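(* There exist a real $\epsilon>0$, a positive integer $c$ and a $c$-size binary test $P$ whose time requirement on every machine $N_n$ is at most $c$, such that for every family of unary tests $(Q_n)_{n\ge 1}$ whose size bound and time limit are both the function $g(n)=\epsilon(\log\log n)^{1/2}(\log\log\log n)^{-1}$, the following holds: for infinitely many positive integers $n$ there exists $a\in[0,2^n-1]$ such that the statements (i) ''there exists $x\in[0,2^n-1]$ with $P_n(x,a)=0$'' and (ii) ''$Q_n(a)=0$'' are not equivalent.
   Context: For each positive integer $n$, $N_n$ is a random access machine with word length $n$ (words are integers in $[0,2^n-1]$) and $2^n$ memory cells. All $N_n$ share a common finite instruction set, each instruction named by a fixed natural number independent of $n$ (only $n>10$ is considered). Instructions: arithmetic (addition and multiplication modulo $2^n$; constants $0,1,n,2^n-1$; $x\mapsto\min\{2^x,2^n-1\}$; $\lfloor x/y\rfloor$ with $\lfloor x/0\rfloor=0$; $\max,\min$; componentwise $\wedge,\vee,\neg$ on $n$-bit binary representations), read/write, control transfer, input/output and halt. A program is a finite sequence of instruction names; $N_n$ runs a program of length $k$ starting with the program in the first $k$ cells and all other cells $0$. A program $P$ is a $c$-size $k$-ary test if $\mathrm{length}(P)\le c$, $k\le c$, and for every $n>10$ and all inputs $x_1,\dots,x_k\in[0,2^n-1]$, $P$ on $N_n$ uses only the first $c$ memory cells and produces an output $P_n(x_1,\dots,x_k)\in\{0,1\}$; its time requirement on $N_n$ is the least $t$ such that on all inputs the output is produced within time $t$. For real-valued functions $f,g$ on the natural numbers, a sequence of programs $(Q_n)_{n\ge1}$ is a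 family of unary tests with size bound $f$ and time limit $g$ if for each sufficiently large $n$, $Q_n$ is a program of length at most $f(n)$ and, for each $a\in[0,2^n-1]$, $Q_n$ running on $N_n$ with input $a$ gives an output $Q_n(a)\in\{0,1\}$ in time at most $g(n)$. Logarithms are base 2. *)

(* Defs.v *)
From Stdlib Require Import Reals List Arith.
Import ListNotations.
Open Scope nat_scope.

(* Words of [N_n] are the naturals below [2 ^ n]; every operation below maps
   words to words. *)
Inductive arith : Set :=
  | Zero | One | WordLength | MaxWord
  | Exp2 | Not
  | Add | Mul | Div | Max | Min | And | Or.

(* Stdlib's [x / 0] is [0]; [Nat.lnot x n] complements the [n] low bits of [x]. *)
Definition arith_eval (n : nat) (o : arith) (x y : nat) : nat :=
  match o with
  | Zero => 0
  | One => 1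
  | WordLength => n
  | MaxWord => 2 ^ n - 1
  | Exp2 => Nat.min (2 ^ x) (2 ^ n - 1)
  | Not => Nat.lnot x n
  | Add => (x + y) mod 2 ^ n
  | Mul => (x * y) mod 2 ^ n
  | Div => x / y
  | Max => Nat.max x y
  | Min => Nat.min x y
  | And => Nat.land x y
  | Or => Nat.lor x y
  end.

(* A program consists of instruction names only, so instructions carry no
   operand words: they act on three processor registers, [Acc] (accumulator),
   [Aux] (second operand) and [Adr] (address). *)
Inductive register : Set := Acc | Aux | Adr.

Inductive instr : Set :=
  | Halt
  | Arith (o : arith)          (* Acc := o(Acc, Aux) *)
  | Move (dst src : register)
  | Read                       (* Acc := memory[Adr] *)
  | Write                      (* memory[Adr] := Acc *)
  | Jump                       (* continue at cell Adr *)
  | JumpZero                   (* continue at cell Adr if Acc = 0 *)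
  | Input                      (* Acc := next input word, 0 if there is none *)
  | Output.                    (* emit Acc *)

(* The name of an instruction is its position in this list. *)
Definition instruction_set : list instr :=
  [ Halt;
    Arith Zero; Arith One; Arith WordLength; Arith MaxWord;
    Arith Exp2; Arith Not;
    Arith Add; Arith Mul; Arith Div; Arith Max; Arith Min; Arith And; Arith Or;
    Move Acc Aux; Move Acc Adr; Move Aux Acc; Move Aux Adr;
    Move Adr Acc; Move Adr Aux;
    Read; Write; Jump; JumpZero; Input; Output ].

Definition decode (w : nat) : option instr := nth_error instruction_set w.

Definition program := list nat.

Definition is_program (p : program) : Prop :=
  Forall (fun w => w < length instruction_set) p.

Record state : Type := State {
  pc : nat;
  reg : register -> nat;
  mem : nat -> nat;    (* only cells at addresses below [2 ^ n] are ever accessed *)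
  inputs : list nat;   (* input words not yet consumed *)
  outputs : list nat;  (* words emitted so far, in order of emission *)
  halted : bool }.

Definition register_eqb (r s : register) : bool :=
  match r, s with
  | Acc, Acc | Aux, Aux | Adr, Adr => true
  | _, _ => false
  end.

Definition set_reg (f : register -> nat) (r : register) (v : nat) : register -> nat :=
  fun s => if register_eqb s r then v else f s.

Definition set_mem (m : nat -> nat) (a v : nat) : nat -> nat :=
  fun b => if b =? a then v else m b.

Definition init (p : program) (xs : list nat) : state :=
  State 0 (fun _ => 0) (fun i => nth i p 0) xs [] false.

Definition stop (s : state) : state :=
  State (pc s) (reg s) (mem s) (inputs s) (outputs s) true.

(* One unit of time. A word that names no instruction stops the machine. *)
Definition step (n : nat) (s : state) : state :=
  let next := S (pc s) mod 2 ^ n in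
  let r := reg s in
  if halted s then s else
  match decode (mem s (pc s)) with
  | None | Some Halt => stop s
  | Some (Arith o) =>
      State next (set_reg r Acc (arith_eval n o (r Acc) (r Aux)))
        (mem s) (inputs s) (outputs s) false
  | Some (Move d e) =>
      State next (set_reg r d (r e)) (mem s) (inputs s) (outputs s) false
  | Some Read =>
      State next (set_reg r Acc (mem s (r Adr))) (mem s) (inputs s) (outputs s) false
  | Some Write =>
      State next r (set_mem (mem s) (r Adr) (r Acc)) (inputs s) (outputs s) false
  | Some Jump =>
      State (r Adr) r (mem s) (inputs s) (outputs s) false
  | Some JumpZero =>
      State (if r Acc =? 0 then r Adr else next) r (mem s) (inputs s) (outputs s) false
  | Some Input =>
      State next (set_reg r Acc (hd 0 (inputs s)))
        (mem s) (tl (inputs s)) (outputs s) false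
  | Some Output =>
      State next r (mem s) (inputs s) (outputs s ++ [r Acc]) false
  end.

Definition run (n : nat) (p : program) (xs : list nat) (t : nat) : state :=
  Nat.iter t (step n) (init p xs).

(* Cells used by the step taken from [s], including the instruction fetch. *)
Definition cells_used (s : state) : list nat :=
  if halted s then [] else
  pc s :: match decode (mem s (pc s)) with
          | Some Read | Some Write => [reg s Adr]
          | _ => []
          end.

(* The output of a run is the first word that it emits. *)
Definition outputs_within (n : nat) (p : program) (xs : list nat) (v t : nat) : Prop :=
  hd_error (outputs (run n p xs t)) = Some v.

Definition has_output (n : nat) (p : program) (xs : list nat) (v : nat) : Prop :=
  exists t, outputs_within n p xs v t.

Definition word_inputs (n k : nat) (xs : list nat) : Prop :=
  length xs = k /\ Forall (fun x => x < 2 ^ n) xs.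

(* [P] is a [c]-size [k]-ary test. *)
Definition is_test (c k : nat) (P : program) : Prop :=
  is_program P /\ length P <= c /\ k <= c /\
  forall n xs, 10 < n -> word_inputs n k xs ->
    (forall t, Forall (fun a => a < c) (cells_used (run n P xs t))) /\
    (exists v, (v = 0 \/ v = 1) /\ has_output n P xs v).

Definition time_bound (n k : nat) (P : program) (t : nat) : Prop :=
  forall xs, word_inputs n k xs -> exists v, outputs_within n P xs v t.

Definition is_time_requirement (n k : nat) (P : program) (t : nat) : Prop :=
  time_bound n k P t /\ forall t', time_bound n k P t' -> t <= t'.

Definition unary_test_family (Q : nat -> program) (f g : nat -> R) : Prop :=
  exists n0, forall n, n0 <= n ->
    is_program (Q n) /\ (INR (length (Q n)) <= f n)%R /\
    forall a, a < 2 ^ n ->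
      exists v t, (v = 0 \/ v = 1) /\ outputs_within n (Q n) [a] v t /\ (INR t <= g n)%R.

Definition lg (x : R) : R := (ln x / ln 2)%R.

Definition growth (eps : R) (n : nat) : R :=
  (eps * sqrt (lg (lg (INR n))) * / lg (lg (lg (INR n))))%R.

(* Main.v *)
Require Import Defs.
From Stdlib Require Import Reals List Arith Lia FunctionalExtensionality Bool Classical_Prop ClassicalEpsilon Lra.
Import ListNotations.
Open Scope nat_scope.

(** [P] is universal for one existential quantifier over words: its parameter [a]
    encodes words [v_i] and a table, and [x] guesses further words; [P] evaluates in
    parallel all the relations [v_i + v_j = v_k], [v_i * v_j = v_k], [land v_i v_j = v_k]
    and looks the resulting bit pattern up in the table.  If the sets
    [Win n a := exists x, P_n(x, a) = 0] were decided by programs [Q_n] of size and time [T], then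
    each alternation of quantifiers over short words could be traded for a slightly
    longer word length: the run of [Q_m] is itself an existential formula over words of
    about [2 m] bits.  Hence [O(T^2)] alternations over words of [m0] bits collapse to
    [Win n] with [n] only slightly larger than [m0].  On the other hand, that many
    alternations over words of about [n^(15/16)] bits suffice to define the result of
    a [T]-step computation on [n]-bit words given by their blocks: loops are guessed step
    sequences, products and carries are loops, and division is a geometric series
    whose digits are recovered by a discrete Fourier transform modulo [2^K + 1].  So
    the diagonal predicate "[Q_n] rejects the parameter built from [e]" is of the
    form [Win n], a contradiction.  As [n = 2^(2^E)] with [E = O(T^2)], this allows
    [T] of order [sqrt (lg (lg n))]. *)

(** The triple exponential comes from the tables. A conjunction doubles the number of guessed words,
    so a formula of depth [Lx] needs about [2 ^ Lx] of them; a pattern records three relations on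
    all triples of words, hence about [2 ^ (3 * Lx)] bits; the table has one bit per pattern and
    must fit into an [n]-bit parameter. So [lg (lg n)] is about [3 * Lx], and [Lx] is quadratic in
    [T] because each simulated step searches a log of up to [T] memory writes. The existential
    formulas lack negation: conditions are carried together with their complements, functions by
    their graphs, and only the levels of the collapse, where [Q] decides, can be complemented. Large
    constants and the tables of the previous level enter a formula through one advice word that
    packs thirteen numbers. With [n = q ^ 16] and short words of [8 * q ^ 15] bits, the ratio
    [q / 8] absorbs a growth factor of at most [128 * cube V] per level, while one short word still
    holds [q + 1] loop states of [q ^ 14 + 2] bits. *)

Definition result (n : nat) (Q : program) (a T : nat) : nat :=
  match outputs (run n Q [a] T) with
  | [] => 1
  | v :: _ => if v =? 0 then 0 else 1
  end.

(** * Symbolic execution of a run of [T] steps *)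

Section SymbolicRun.

Variable B : Type.
Variable n : nat.
(** [Dv d f] ([f] is expressible with depth [d]) is kept abstract because runs are unfolded in two
    settings: over words that fit into one variable, and over long words known only by their
    blocks. *)
Variable Dv : nat -> (B -> nat) -> Prop.
Hypothesis n_big : 5 <= n.
Hypothesis Dv_mono : forall d d' f, d <= d' -> Dv d f -> Dv d' f.
Hypothesis Dv_arith : forall o d f g, Dv d f -> Dv d g ->
  Dv (S d) (fun e => arith_eval n o (f e) (g e)).
Hypothesis Dv_ifeq : forall d f g h k, Dv d f -> Dv d g -> Dv d h -> Dv d k ->
  Dv (S d) (fun e => if f e =? g e then h e else k e).

(** Counting up from 0 makes the depth linear in [c], which is affordable: the constants that occur
    are instruction names, flags and program addresses. [f] supplies the operands of [Zero] and
    [One]. *)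
Lemma Dv_const : forall d f c, Dv d f -> c < 2 ^ n -> Dv (d + c + 1) (fun _ => c).
Proof.
  intros d f c Hf Hc.
  assert (P5 : 2 ^ 1 <= 2 ^ n) by (apply Nat.pow_le_mono_r; lia).
  change (2 ^ 1) with 2 in P5.
  induction c as [|c IH].
  - replace (fun _ : B => 0) with (fun e => arith_eval n Zero (f e) (f e)) by reflexivity.
    eapply Dv_mono; [|apply Dv_arith; exact Hf]. lia.
  - replace (fun _ : B => S c)
      with (fun e => arith_eval n Defs.Add ((fun _ : B => c) e) ((fun e => arith_eval n One (f e) (f e)) e)).
    + eapply Dv_mono; [|apply Dv_arith; [apply IH; lia|]].
      * lia.
      * eapply Dv_mono; [|apply Dv_arith; exact Hf]. lia.
    + extensionality e. cbn [arith_eval]. rewrite Nat.mod_small; lia.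
Qed.

Definition sel (i : B -> nat) (tbl : list (nat * (B -> nat))) (dflt : B -> nat) : B -> nat :=
  fold_right (fun cf (k : B -> nat) => fun e => if i e =? fst cf then snd cf e else k e) dflt tbl.

Lemma Dv_sel : forall i tbl dflt d m, Dv d i -> m <= 2 ^ n -> Dv (d + m + 1) dflt ->
  Forall (fun cf => fst cf < m /\ Dv (d + m + 1) (snd cf)) tbl ->
  Dv (d + m + 1 + length tbl) (sel i tbl dflt).
Proof.
  intros i tbl dflt d m Hi Hm Hdf Ht. induction Ht as [|[c f] tbl (Hc & Hf) Ht IH]; cbn.
  - now rewrite Nat.add_0_r.
  - rewrite Nat.add_succ_r. cbn in Hc, Hf.
    apply (Dv_ifeq (d + m + 1 + length tbl) i (fun _ => c) f (sel i tbl dflt)); auto.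
    + eapply Dv_mono; [|exact Hi]; lia.
    + eapply Dv_mono; [|apply (Dv_const d i c Hi)]; lia.
    + eapply Dv_mono; [|exact Hf]; lia.
Qed.

(* A write record is (flag, address, value); the flag is 1 when the step did write. *)
Local Notation wrec := ((B -> nat) * (B -> nat) * (B -> nat))%type.

Definition rom (Q : program) (al : B -> nat) : B -> nat :=
  sel al (combine (seq 0 (length Q)) (map (fun q (_ : B) => q) Q)) (fun _ => 0).

(** Memory is the program as a constant table below a log of writes, latest first, so a read after
    [t] steps compares with at most [t] addresses. *)
Fixpoint lookup (Q : program) (ws : list wrec) (al : B -> nat) : B -> nat :=
  match ws with
  | [] => rom Q al
  | (fl, ad, va) :: ws' => fun e =>
      if fl e =? 1 then (if ad e =? al e then va e else lookup Q ws' al e)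
      else lookup Q ws' al e
  end.

Lemma rom_ok_aux : forall (Q : program) (al : B -> nat) (e : B) k,
  sel al (combine (seq k (length Q)) (map (fun q (_ : B) => q) Q)) (fun _ => 0) e
  = if k <=? al e then nth (al e - k) Q 0 else 0.
Proof.
  induction Q as [|q Q IH]; intros al e k; cbn [length seq map combine sel fold_right fst snd].
  - destruct (k <=? al e); [now destruct (al e - k)|reflexivity].
  - change (fold_right _ _ _ e) with
      (sel al (combine (seq (S k) (length Q)) (map (fun q (_ : B) => q) Q)) (fun _ => 0) e).
    rewrite IH. destruct (Nat.eqb_spec (al e) k) as [E|E].
    + rewrite E, Nat.leb_refl, Nat.sub_diag. reflexivity.
    + destruct (Nat.leb_spec k (al e)); destruct (Nat.leb_spec (S k) (al e)); try lia.
      replace (al e - k) with (S (al e - S k)) by lia. reflexivity.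
Qed.

Lemma rom_ok : forall Q al e, rom Q al e = nth (al e) Q 0.
Proof. intros. unfold rom. rewrite rom_ok_aux. cbn. now rewrite Nat.sub_0_r. Qed.

Variable Q : program.
Variable T : nat.
Hypothesis Q_prog : is_program Q.
Hypothesis Q_len : length Q <= T.
Hypothesis T_small : T + 32 <= 2 ^ n.

Lemma Dv_rom : forall d al, Dv d al -> Dv (d + 2 * (T + 32) + 1) (rom Q al).
Proof.
  intros d al H. unfold rom.
  eapply Dv_mono; [|apply (Dv_sel al _ _ d (T + 32) H)].
  - rewrite length_combine, length_seq, length_map. lia.
  - exact T_small.
  - eapply Dv_mono; [|apply (Dv_const d al 0 H)]; lia.
  - apply Forall_forall. intros [c f] Hin.
    pose proof (in_combine_l _ _ _ _ Hin) as H1. pose proof (in_combine_r _ _ _ _ Hin) as H2.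
    apply in_seq in H1. apply in_map_iff in H2. destruct H2 as (q & <- & Hq).
    assert (q < 26).
    { pose proof (proj1 (Forall_forall _ _) Q_prog q Hq) as Hqq. cbn in Hqq. exact Hqq. }
    cbn. split; [lia|].
    eapply Dv_mono; [|apply (Dv_const d al q H)]; lia.
Qed.

Lemma Dv_lookup : forall ws al d,
  Dv d al -> Forall (fun w => Dv d (fst (fst w)) /\ Dv d (snd (fst w)) /\ Dv d (snd w)) ws ->
  Dv (d + 2 * (T + 32) + 1 + 2 * length ws) (lookup Q ws al).
Proof.
  intros ws al d Ha Hw. induction Hw as [|[[fl ad] va] ws (H1 & H2 & H3) Hw IH].
  - cbn [lookup length]. rewrite Nat.mul_0_r, Nat.add_0_r. now apply Dv_rom.
  - cbn [lookup length] in *. cbn in H1, H2, H3.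
    set (D := d + 2 * (T + 32) + 1 + 2 * length ws) in *.
    replace (d + 2 * (T + 32) + 1 + 2 * S (length ws)) with (S (S D)) by lia.
    apply (Dv_ifeq (S D) fl (fun _ => 1)
             (fun e => if ad e =? al e then va e else lookup Q ws al e) (lookup Q ws al)).
    + eapply Dv_mono; [|exact H1]; lia.
    + eapply Dv_mono; [|apply (Dv_const d al 1 Ha)]; lia.
    + apply (Dv_ifeq D ad al va (lookup Q ws al)); auto;
        (eapply Dv_mono; [|eassumption]; lia).
    + eapply Dv_mono; [|exact IH]; lia.
Qed.

Record sym := Sym {
  spc : B -> nat; sacc : B -> nat; saux : B -> nat; sadr : B -> nat;
  sinp : B -> nat; shalt : B -> nat; sout : B -> nat; sws : list wrec }.

(** Only the first output counts: 0 means none yet, and a nonzero code is never changed by later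
    outputs. *)
Definition outcode (l : list nat) : nat :=
  match l with [] => 0 | v :: _ => if v =? 0 then 1 else 2 end.

Definition rel (e : B) (y : sym) (s : state) : Prop :=
  pc s = spc y e /\ reg s Acc = sacc y e /\ reg s Aux = saux y e /\ reg s Adr = sadr y e /\
  (inputs s = [sinp y e] \/ inputs s = [] /\ sinp y e = 0) /\
  shalt y e = (if halted s then 1 else 0) /\
  sout y e = outcode (outputs s) /\
  forall al, mem s al = lookup Q (sws y) (fun _ => al) e.

Lemma lookup_pt : forall ws al e, lookup Q ws al e = lookup Q ws (fun _ => al e) e.
Proof.
  induction ws as [|[[fl ad] va] ws IH]; intros; cbn.
  - now rewrite !rom_ok.
  - rewrite IH. reflexivity.
Qed.

Definition ins (y : sym) : B -> nat := lookup Q (sws y) (spc y).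
Definition nxt (y : sym) : B -> nat := fun e => arith_eval n Defs.Add (spc y e) 1.
Definition ar (y : sym) (o : arith) : B -> nat := fun e => arith_eval n o (sacc y e) (saux y e).
Definition zr : B -> nat := fun _ => 0.
Definition on : B -> nat := fun _ => 1.

Definition guard (y : sym) (old new : B -> nat) : B -> nat :=
  fun e => if shalt y e =? 1 then old e else new e.

Definition jz (y : sym) : B -> nat := fun e => if sacc y e =? 0 then sadr y e else nxt y e.
Definition newout (y : sym) : B -> nat := fun e =>
  if sout y e =? 0 then (if sacc y e =? 0 then 1 else 2) else sout y e.

(** The selectors are instruction names, that is, positions in [instruction_set]. Every step logs a
    record, flagged 0 if nothing was written, so the length of the log equals the time for every
    [e]. *)
Definition sstep (y : sym) : sym :=
  let i := ins y in
  let g := guard y in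
  Sym
    (g (spc y) (sel i (map (fun c => (c, nxt y)) (seq 1 21)
       ++ [(22, sadr y); (23, jz y); (24, nxt y); (25, nxt y)]) (spc y)))
    (g (sacc y) (sel i
       [(1, ar y Zero); (2, ar y One); (3, ar y WordLength); (4, ar y MaxWord);
        (5, ar y Exp2); (6, ar y Not); (7, ar y Defs.Add); (8, ar y Mul); (9, ar y Div);
        (10, ar y Max); (11, ar y Min); (12, ar y And); (13, ar y Or);
        (14, saux y); (15, sadr y); (20, lookup Q (sws y) (sadr y)); (24, sinp y)] (sacc y)))
    (g (saux y) (sel i [(16, sacc y); (17, sadr y)] (saux y)))
    (g (sadr y) (sel i [(18, sacc y); (19, saux y)] (sadr y)))
    (g (sinp y) (sel i [(24, zr)] (sinp y)))
    (* Names 1 to 25 keep the machine running; [Halt] and words that name nothing take the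
       default. *)
    (g on (sel i (map (fun c => (c, zr)) (seq 1 25)) on))
    (g (sout y) (sel i [(25, newout y)] (sout y)))
    ((g zr (sel i [(21, on)] zr), sadr y, sacc y) :: sws y).

Lemma outcode_app : forall l v, outcode (l ++ [v]) =
  if outcode l =? 0 then (if v =? 0 then 1 else 2) else outcode l.
Proof. intros [|w l] v; cbn; [reflexivity|]. now destruct (w =? 0). Qed.

Lemma sstep_ok : forall e y s, rel e y s -> rel e (sstep y) (step n s).
Proof.
  intros e y s (Hpc & Hacc & Haux & Hadr & Hinp & Hhalt & Hout & Hmem).
  unfold step. destruct (halted s) eqn:Eh.
  - unfold rel, sstep, guard; cbn [spc sacc saux sadr sinp shalt sout sws lookup].
    rewrite Hhalt. cbn [Nat.eqb]. unfold zr, on. cbn [Nat.eqb].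
    rewrite Eh. repeat split; auto.
  - assert (Hi : mem s (pc s) = ins y e).
    { unfold ins. rewrite lookup_pt, <- Hpc. apply Hmem. }
    rewrite Hi.
    assert (Hn : S (pc s) mod 2 ^ n = nxt y e).
    { unfold nxt. cbn [arith_eval]. rewrite <- Hpc. f_equal. lia. }
    assert (Hrd : mem s (reg s Adr) = lookup Q (sws y) (sadr y) e).
    { rewrite Hmem, Hadr. symmetry. apply lookup_pt. }
    rewrite Hn, Hrd.
    unfold rel, sstep, guard; cbn [spc sacc saux sadr sinp shalt sout sws].
    rewrite Hhalt. cbn [Nat.eqb].
    destruct (le_lt_dec 26 (ins y e)) as [Hge|Hlt].
    + assert (Hd : decode (ins y e) = None).
      { unfold decode. apply nth_error_None. exact Hge. }
      rewrite Hd.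
      assert (Hne : forall c, c < 26 -> (ins y e =? c) = false).
      { intros c Hc. apply Nat.eqb_neq. lia. }
      unfold sel; cbn [fold_right map seq app fst snd]. rewrite !Hne by lia.
      unfold stop; cbn [pc reg mem inputs outputs halted lookup].
      repeat split; auto.
      intros al. unfold on, zr; cbn [Nat.eqb]. rewrite Hhalt. cbn. rewrite Hne by lia. cbn. apply Hmem.
    + cbn [lookup]. rewrite Hhalt. cbn [Nat.eqb].
      unfold sel; cbn [fold_right map seq app fst snd].
      assert (Hinp' : tl (inputs s) = [] /\ hd 0 (inputs s) = sinp y e).
      { destruct Hinp as [-> | [-> E]]; cbn; auto. }
      destruct Hinp' as [Htl Hhd].
      remember (ins y e) as w eqn:Ew. clear Hi.
      do 26 (destruct w as [|w];
        [cbn -[Nat.modulo Nat.pow Nat.add];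
         unfold on, zr, ar, jz, newout, set_mem; rewrite ?Htl, ?Hhd, ?Hacc, ?Haux, ?Hadr;
         cbn [Nat.eqb];
         repeat split; auto; try (now right; auto);
         try (rewrite outcode_app, <- Hout; reflexivity);
         try (intros al; rewrite (Nat.eqb_sym _ al); destruct (al =? sadr y e); auto; fail)
        |]).
      lia.
Qed.

Definition symD (d : nat) (y : sym) : Prop :=
  Dv d (spc y) /\ Dv d (sacc y) /\ Dv d (saux y) /\ Dv d (sadr y) /\ Dv d (sinp y) /\
  Dv d (shalt y) /\ Dv d (sout y) /\
  Forall (fun w => Dv d (fst (fst w)) /\ Dv d (snd (fst w)) /\ Dv d (snd w)) (sws y).

(** The program table costs about [2 * T] and the log at most another [2 * T]; over [T] steps this
    becomes the quadratic depth of a run. *)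
Lemma symD_step : forall d y, symD d y -> length (sws y) <= T ->
  symD (d + 4 * T + 160) (sstep y).
Proof.
  intros d y (H1 & H2 & H3 & H4 & H5 & H6 & H7 & H8) Hk.
  remember (d + 2 * (T + 32) + 1 + 2 * T) as d1 eqn:Ed1.
  assert (HL : forall al, Dv d al -> Dv d1 (lookup Q (sws y) al)).
  { intros al Ha. eapply Dv_mono; [|apply (Dv_lookup (sws y) al d Ha H8)]. lia. }
  assert (Hi : Dv d1 (ins y)) by (apply HL; exact H1).
  assert (HC : forall c, c < 4 -> Dv (d + 5) (fun _ => c)).
  { intros c Hc. eapply Dv_mono; [|apply (Dv_const d (spc y) c H1)]; lia. }
  assert (Hmono : forall f, Dv (d + 10) f -> Dv (d1 + 26 + 1) f).
  { intros f Hf. eapply Dv_mono; [|exact Hf]. lia. }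
  assert (Hm : forall f, Dv d f -> Dv (d + 5) f).
  { intros f Hf. eapply Dv_mono; [|exact Hf]. lia. }
  assert (Hm' : forall f, Dv (d + 5) f -> Dv (d + 6) f).
  { intros f Hf. eapply Dv_mono; [|exact Hf]. lia. }
  assert (Hm2 : forall f, Dv (d + 5) f -> Dv (d + 10) f).
  { intros f Hf. eapply Dv_mono; [|exact Hf]. lia. }
  assert (Hnx : Dv (d + 6) (nxt y)).
  { replace (d + 6) with (S (d + 5)) by lia.
    apply (Dv_arith Defs.Add (d + 5) (spc y) (fun _ => 1)); auto with arith. }
  assert (Har : forall o, Dv (d + 10) (ar y o)).
  { intros o. apply Hm2. eapply Dv_mono; [|apply (Dv_arith o d _ _ H2 H3)]. lia. }
  assert (Hjz : Dv (d + 10) (jz y)).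
  { eapply Dv_mono; [|apply (Dv_ifeq (d + 6) (sacc y) (fun _ => 0) (sadr y) (nxt y))]; auto with arith.
    - lia. }
  assert (Hno : Dv (d + 10) (newout y)).
  { eapply Dv_mono; [|apply (Dv_ifeq (d + 6) (sout y) (fun _ => 0)
       (fun e => if sacc y e =? 0 then 1 else 2) (sout y))]; auto with arith.
    - lia.
    - replace (d + 6) with (S (d + 5)) by lia.
      apply (Dv_ifeq (d + 5) (sacc y) (fun _ => 0) (fun _ => 1) (fun _ => 2)); auto with arith. }
  assert (HS : forall tbl dflt, length tbl <= 26 -> Dv d dflt \/ Dv (d + 5) dflt ->
     Forall (fun cf => fst cf < 26 /\ Dv (d1 + 26 + 1) (snd cf)) tbl ->
     Dv (d1 + 60) (sel (ins y) tbl dflt)).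
  { intros tbl dflt Hlen Hd Ht. eapply Dv_mono; [|apply (Dv_sel (ins y) tbl dflt d1 26 Hi)]; auto.
    - lia.
    - pose proof T_small. lia.
    - destruct Hd; auto. }
  assert (HG : forall old new, Dv (d + 5) old -> Dv (d1 + 60) new ->
     Dv (d + 4 * T + 160) (guard y old new)).
  { intros old new Ho Hn. eapply Dv_mono;
      [|apply (Dv_ifeq (d1 + 60) (shalt y) (fun _ => 1) old new)]; auto.
    - lia.
    - eapply Dv_mono; [|exact H6]; lia.
    - eapply Dv_mono; [|apply (HC 1)]; lia.
    - eapply Dv_mono; [|exact Ho]; lia. }
  assert (Hz : Dv (d + 5) zr) by (apply (HC 0); lia).
  assert (Ho : Dv (d + 5) on) by (apply (HC 1); lia).
  assert (Hnx' : Dv (d1 + 26 + 1) (nxt y)).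
  { apply Hmono. eapply Dv_mono; [|exact Hnx]; lia. }
  assert (Hlast : forall f, Dv d f -> Dv (d + 4 * T + 160) f).
  { intros f Hf. eapply Dv_mono; [|exact Hf]. lia. }
  unfold symD, sstep; cbn [spc sacc saux sadr sinp shalt sout sws].
  assert (HLa : Dv (d1 + 26 + 1) (lookup Q (sws y) (sadr y))).
  { eapply Dv_mono; [|apply (HL (sadr y) H4)]. lia. }
  assert (Har' : forall o, Dv (d1 + 26 + 1) (ar y o)) by auto.
  assert (Hold : forall f, Dv d f -> Dv (d1 + 26 + 1) f) by auto.
  assert (Hcst : Dv (d1 + 26 + 1) zr /\ Dv (d1 + 26 + 1) on) by auto.
  destruct Hcst as [Hz' Ho'].
  pose proof (Hmono _ Hjz) as Hjz'. pose proof (Hmono _ Hno) as Hno'.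
  repeat split; try (apply HG; [auto|apply HS; [cbn; lia|auto|
    cbn [map seq app]; repeat apply Forall_cons; try apply Forall_nil;
    (split; [cbn [fst]; lia | cbn [snd]; auto])]]).
  constructor.
  - cbn [fst snd]. repeat split; auto.
    apply HG; [auto|apply HS; [cbn; lia|auto|]].
    apply Forall_cons; [split; [cbn [fst]; lia | cbn [snd]; auto]|apply Forall_nil].
  - eapply Forall_impl; [|exact H8]. intros w (Hw1 & Hw2 & Hw3). auto.
Qed.

Variable inp : B -> nat.

Definition sinit : sym := Sym zr zr zr zr inp zr zr [].

Lemma sinit_ok : forall e, rel e sinit (init Q [inp e]).
Proof.
  intros e. unfold rel, sinit, init; cbn. repeat split; auto.
  intros al. now rewrite rom_ok.
Qed.

Lemma iter_ok : forall t e, rel e (Nat.iter t sstep sinit) (run n Q [inp e] t).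
Proof.
  intros t e. induction t as [|t IH]; [apply sinit_ok|].
  cbn [Nat.iter]. unfold run. cbn [Nat.iter nat_rect]. apply sstep_ok. exact IH.
Qed.

Lemma iter_len : forall t, length (sws (Nat.iter t sstep sinit)) = t.
Proof. induction t as [|t IH]; [reflexivity|]. cbn [Nat.iter nat_rect sstep sws length]. f_equal. exact IH. Qed.

Lemma iter_D : forall d t, Dv d inp -> t <= T -> symD (d + 1 + t * (4 * T + 160)) (Nat.iter t sstep sinit).
Proof.
  intros d t Hi Ht. induction t as [|t IH].
  - cbn [Nat.iter nat_rect]. rewrite Nat.mul_0_l, Nat.add_0_r.
    assert (Hz : Dv (d + 1) zr).
    { eapply Dv_mono; [|apply (Dv_const d inp 0 Hi)]; lia. }
    unfold symD, sinit; cbn. repeat split; auto. eapply Dv_mono; [|exact Hi]; lia.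
  - replace (d + 1 + S t * (4 * T + 160)) with (d + 1 + t * (4 * T + 160) + 4 * T + 160) by lia.
    change (Nat.iter (S t) sstep sinit) with (sstep (Nat.iter t sstep sinit)).
    apply symD_step; [apply IH; lia|]. rewrite iter_len. lia.
Qed.

Lemma Dv_result : forall d, Dv d inp ->
  Dv (d + T * (4 * T + 160) + 5) (fun e => result n Q (inp e) T).
Proof.
  intros d Hi. destruct (iter_D d T Hi (le_n T)) as (H1 & _ & _ & _ & _ & _ & H7 & _).
  set (y := Nat.iter T sstep sinit) in *. remember (d + 1 + T * (4 * T + 160)) as D eqn:ED.
  replace (fun e => result n Q (inp e) T)
    with (fun e => if sout y e =? 1 then (fun _ => 0) e else (fun _ : B => 1) e).
  - eapply Dv_mono; [|apply (Dv_ifeq (D + 2) (sout y) (fun _ => 1) (fun _ => 0) (fun _ => 1))].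
    + lia.
    + eapply Dv_mono; [|exact H7]; lia.
    + eapply Dv_mono; [|apply (Dv_const D (spc y) 1 H1)]; lia.
    + eapply Dv_mono; [|apply (Dv_const D (spc y) 0 H1)]; lia.
    + eapply Dv_mono; [|apply (Dv_const D (spc y) 1 H1)]; lia.
  - extensionality e. destruct (iter_ok T e) as (_ & _ & _ & _ & _ & _ & Ho & _).
    fold y in Ho. rewrite Ho. unfold result. destruct (outputs (run n Q [inp e] T)) as [|v l]; cbn; [reflexivity|].
    now destruct (v =? 0).
Qed.

End SymbolicRun.

(** * Abstract definability over bounded words *)

Definition env := nat -> nat.
Definition scons (y : nat) (e : env) : env :=
  fun i => match i with 0 => y | S j => e j end.
Notation "y .: e" := (scons y e) (at level 55, right associativity).
Definition sh (k : nat) (e : env) : env := fun i => e (k + i).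
Definition bde (Bd : nat) (e : env) : Prop := forall i, e i < Bd.

Inductive kind := KAdd | KMul | KAnd.

Definition atom (c : kind) (x y z : nat) : Prop :=
  match c with
  | KAdd => x + y = z
  | KMul => x * y = z
  | KAnd => Nat.land x y = z
  end.

(** Closure properties shared by the existential formulas at one word length and by the levels of
    the collapse. The former have no negation, hence [d_natom] next to [d_atom]. A renaming costs
    [k] levels because a formula of level [l] sees only an initial segment of the variables, whose
    length grows with [l]. *)
Record definability (Bd : nat) (E : nat -> (env -> Prop) -> Prop)
    (Cst : nat -> Prop) (S0 : nat) : Prop := {
  d_ext : forall l (P P' : env -> Prop),
    (forall e, bde Bd e -> (P e <-> P' e)) -> E l P -> E l P';
  d_mono : forall l l' P, l <= l' -> E l P -> E l' P;
  d_atom : forall c i j k, i < S0 -> j < S0 -> k < S0 ->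
    E 0 (fun e => atom c (e i) (e j) (e k));
  d_natom : forall c i j k, i < S0 -> j < S0 -> k < S0 ->
    E 0 (fun e => ~ atom c (e i) (e j) (e k));
  d_and : forall l P P', E l P -> E l P' -> E (S l) (fun e => P e /\ P' e);
  d_or : forall l P P', E l P -> E l P' -> E (S l) (fun e => P e \/ P' e);
  d_ex : forall l P, E l P -> E (S l) (fun e => exists y, y < Bd /\ P (y .: e));
  d_ren : forall l k (r : nat -> nat) P, (forall i, r i <= i + k) ->
    E l P -> E (l + k) (fun e => P (fun i => e (r i)));
  d_const : forall c, Cst c -> c < Bd -> E 0 (fun e => e 0 = c) }.

Lemma bde_scons : forall Bd y e, y < Bd -> bde Bd e -> bde Bd (y .: e).
Proof. intros Bd y e Hy He [|i]; cbn; auto. Qed.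

Lemma bde_sh : forall Bd k e, bde Bd e -> bde Bd (sh k e).
Proof. intros Bd k e He i. apply He. Qed.

Record dclass : Type := DClass {
  bd : nat;
  cls : nat -> (env -> Prop) -> Prop;
  csts : nat -> Prop;
  arity : nat;
  d_prf : definability bd cls csts arity;
  arity_ge : 8 <= arity;
  bd_ge : 2 <= bd }.

Section Definability.

Variable D : dclass.
Local Notation Bd := (bd D).
Local Notation E := (cls D).
Local Notation Cst := (csts D).
Let HE := d_prf D.
Let HS0 := arity_ge D.
Let HBd := bd_ge D.

Let ext := d_ext _ _ _ _ (d_prf D).
Let mono := d_mono _ _ _ _ (d_prf D).
Let e_and := d_and _ _ _ _ (d_prf D).
Let e_or := d_or _ _ _ _ (d_prf D).
Let e_ex := d_ex _ _ _ _ (d_prf D).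
Let ren := d_ren _ _ _ _ (d_prf D).

Lemma e_atom : forall l c i j k, i < 8 -> j < 8 -> k < 8 ->
  E l (fun e => atom c (e i) (e j) (e k)).
Proof.
  intros. apply (mono 0); [lia|]. apply (d_atom _ _ _ _ HE); clear - H H0 H1 HS0; lia.
Qed.

Lemma e_natom : forall l c i j k, i < 8 -> j < 8 -> k < 8 ->
  E l (fun e => ~ atom c (e i) (e j) (e k)).
Proof.
  intros. apply (mono 0); [lia|]. apply (d_natom _ _ _ _ HE); clear - H H0 H1 HS0; lia.
Qed.

(** Without negation, a condition that governs a case distinction must come with its complement. *)
Definition Dp (l : nat) (P : env -> Prop) : Prop := E l P /\ E l (fun e => ~ P e).

(** The graph alone suffices: [P (f e)] and its negation both become a guess of [y = f e] followed
    by [P] or by its complement. *)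
Definition Df (l : nat) (f : env -> nat) : Prop :=
  (forall e, bde Bd e -> f e < Bd) /\ E l (fun e => e 0 = f (sh 1 e)).

Lemma Df_mono : forall l l' f, l <= l' -> Df l f -> Df l' f.
Proof. intros l l' f H [H1 H2]. split; auto. eapply mono; eauto. Qed.

Lemma Df_ext : forall l f g, (forall e, bde Bd e -> f e = g e) -> Df l f -> Df l g.
Proof.
  intros l f g H [H1 H2]. split.
  - intros e He. rewrite <- H by auto. auto.
  - eapply ext; [|exact H2]. intros e He; cbn. rewrite H; [tauto|now apply bde_sh].
Qed.

Lemma Df_lt : forall l f e, Df l f -> bde Bd e -> f e < Bd.
Proof. intros l f e [H _]. auto. Qed.

Lemma Dp_mono : forall l l' P, l <= l' -> Dp l P -> Dp l' P.
Proof. intros l l' P H [H1 H2]. split; eapply mono; eauto. Qed.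

Lemma Dp_ext : forall l P Q, (forall e, bde Bd e -> (P e <-> Q e)) -> Dp l P -> Dp l Q.
Proof.
  intros l P Q H [H1 H2]. split; eapply ext; try eassumption; intros e He; cbn; auto.
  rewrite H; tauto.
Qed.

Lemma e_app : forall l P f, E l P -> Df l f -> E (l + 2) (fun e => P (f e .: e)).
Proof.
  intros l P f HP [Hb Hf].
  eapply ext; [|eapply mono; [|apply e_ex; apply e_and; [exact Hf|exact HP]]]; [|lia].
  intros e He; cbn. change (sh 1 (scons ?y e)) with e. split.
  - intros (y & Hy & E1 & E2). cbn in E1. change (sh 1 (y .: e)) with e in E1. now subst y.
  - intros H. exists (f e). repeat split; auto.
Qed.

Lemma Df_sh : forall l k f, Df l f -> Df (l + k) (fun e => f (sh k e)).
Proof.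
  intros l k f [Hb Hf]. split.
  - intros e He. apply Hb. now apply bde_sh.
  - pose proof (ren l k (fun i => match i with 0 => 0 | S j => S (k + j) end) _
      ltac:(intros [|i]; lia) Hf) as H1.
    eapply ext; [|exact H1].
    + intros e He. cbn.
      replace (sh k (sh 1 e)) with (sh 1 (fun i => e match i with 0 => 0 | S j => S (k + j) end)).
      * tauto.
      * extensionality i. unfold sh. cbn. f_equal.
Qed.

Lemma e_app2 : forall l P f g, E l P -> Df l f -> Df l g ->
  E (l + 5) (fun e => P (f e .: g e .: e)).
Proof.
  intros l P f g HP Hf Hg.
  pose proof (e_app (l + 1) P _ (mono l (l + 1) _ ltac:(lia) HP) (Df_sh l 1 f Hf)) as H1.
  pose proof (e_app (l + 1 + 2) _ g H1 (Df_mono l (l + 1 + 2) _ ltac:(lia) Hg)) as H2.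
  eapply mono; [|exact H2]. lia.
Qed.

Lemma Df_op2 : forall l (op : nat -> nat -> nat) f g,
  E l (fun e => e 2 = op (e 0) (e 1)) -> Df l f -> Df l g ->
  (forall e, bde Bd e -> op (f e) (g e) < Bd) ->
  Df (l + 6) (fun e => op (f e) (g e)).
Proof.
  intros l op f g HP Hf Hg Hb. split; auto.
  pose proof (e_app2 (l + 1) _ _ _ (mono l (l + 1) _ ltac:(lia) HP) (Df_sh l 1 f Hf) (Df_sh l 1 g Hg)) as H.
  eapply mono; [|exact H]. lia.
Qed.

(** In the graph of [h] the value has index 0 and the argument index 1; they are swapped so that [f]
    can be substituted at index 0. *)
Lemma Df_comp1 : forall l (h : nat -> env -> nat) f,
  Df l (fun e => h (e 0) (sh 1 e)) -> Df l f -> Df (l + 4) (fun e => h (f e) e).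
Proof.
  intros l h f [Hb Hh] Hf. split.
  - intros e He. apply (Hb (f e .: e)). apply bde_scons; auto. eapply Df_lt; eauto.
  - pose proof (ren l 1 (fun i => match i with 0 => 1 | 1 => 0 | _ => i end) _
      ltac:(intros [|[|i]]; lia) Hh) as H1.
    pose proof (e_app (l + 1) _ _ H1 (Df_sh l 1 f Hf)) as H2.
    eapply mono; [|eapply ext; [|exact H2]]; [lia|].
    intros e He. cbn.
    match goal with |- context [h _ ?a] => replace a with (sh 1 e) by (extensionality i; reflexivity) end.
    tauto.
Qed.

Lemma Df_comp2 : forall l (h : nat -> nat -> env -> nat) f g,
  Df l (fun e => h (e 0) (e 1) (sh 2 e)) -> Df l f -> Df l g ->
  Df (l + 8) (fun e => h (f e) (g e) e).
Proof.
  intros l h f g [Hb Hh] Hf Hg. split.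
  - intros e He. apply (Hb (f e .: g e .: e)).
    apply bde_scons; [|apply bde_scons]; auto; eapply Df_lt; eauto.
  - pose proof (ren l 2 (fun i => match i with 0 => 2 | 1 => 0 | 2 => 1 | _ => i end) _
      ltac:(intros [|[|[|i]]]; lia) Hh) as H1.
    pose proof (e_app2 (l + 2) _ _ _ H1 (Df_mono (l + 1) (l + 2) _ ltac:(lia) (Df_sh l 1 f Hf))
       (Df_mono (l + 1) (l + 2) _ ltac:(lia) (Df_sh l 1 g Hg))) as H2.
    eapply mono; [|eapply ext; [|exact H2]]; [lia|].
    intros e He. cbn.
    match goal with |- context [h _ _ ?a] => replace a with (sh 1 e) by (extensionality i; reflexivity) end.
    tauto.
Qed.

(** For functions of an outer environment that are called under [k] further binders. *)
Lemma Df_orc : forall l k (X : nat -> env -> nat) f,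
  Df l (fun e => X (e 0) (sh 1 e)) -> Df l f -> Df (l + k + 4) (fun e => X (f e) (sh k e)).
Proof.
  intros l k X f [Hb HX] Hf.
  apply (Df_comp1 (l + k) (fun y e => X y (sh k e)) f); [|eapply Df_mono; [|exact Hf]; lia].
  split.
  - intros e He. apply (Hb (e 0 .: sh k (sh 1 e))).
    apply bde_scons; [apply He|]. now apply bde_sh, bde_sh.
  - pose proof (ren l k (fun i => match i with 0 => 0 | 1 => 1 | S (S j) => S (S (k + j)) end) _
      ltac:(intros [|[|i]]; lia) HX) as H1.
    eapply ext; [|exact H1].
    + intros e He. cbn.
      match goal with |- _ = X _ ?a <-> _ = X _ ?b => replace a with b; [tauto|] end.
      extensionality i. unfold sh. cbn. f_equal.
Qed.

Lemma Df_guess : forall l (P : env -> Prop) f,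
  E l P -> (forall e, bde Bd e -> f e < Bd) ->
  (forall e y, bde Bd e -> y < Bd -> (P (y .: e) <-> y = f e)) -> Df l f.
Proof.
  intros l P f HP Hb Hu. split; auto.
  eapply ext; [|exact HP]. intros e He.
  rewrite <- (Hu (sh 1 e) (e 0)); [|now apply bde_sh|apply He].
  replace (e 0 .: sh 1 e) with e; [tauto|]. extensionality i. now destruct i.
Qed.

Lemma Df_zero : Df 0 (fun _ => 0).
Proof.
  split; [intros; lia|]. eapply ext; [|apply (e_atom 0 KAdd 0 0 0)]; try lia.
  intros e _; cbn. lia.
Qed.

(** 1 is the idempotent that is not its own double. *)
Lemma Df_one : Df 1 (fun _ => 1).
Proof.
  split; [intros; lia|].
  eapply ext; [|apply e_and; [apply (e_atom 0 KMul 0 0 0)|apply (e_natom 0 KAdd 0 0 0)]]; try lia.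
  intros e _; cbn. nia.
Qed.

Lemma e_eq01 : E 2 (fun e => e 0 = e 1).
Proof.
  eapply ext; [|apply e_ex; apply e_and; [apply (e_atom 0 KAdd 0 0 0)|apply (e_atom 0 KAdd 0 1 2)]]; try lia.
  intros e He; cbn. split.
  - intros (z & _ & H1 & H2). lia.
  - intros H. exists 0. lia.
Qed.

Lemma e_neq01 : E 2 (fun e => e 0 <> e 1).
Proof.
  eapply ext; [|apply e_ex; apply e_and; [apply (e_atom 0 KAdd 0 0 0)|apply (e_natom 0 KAdd 0 1 2)]]; try lia.
  intros e He; cbn. split.
  - intros (z & _ & H1 & H2). lia.
  - intros H. exists 0. lia.
Qed.

Lemma Df_var : forall i, Df (i + 2) (fun e => e i).
Proof.
  intros i. split; [intros e He; apply He|].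
  pose proof (ren 2 i (fun j => match j with 0 => 0 | S _ => S i end) _
      ltac:(intros [|j]; lia) e_eq01) as H1.
  eapply mono; [|exact H1]. lia.
Qed.

Lemma Df_cst : forall c, Cst c -> c < Bd -> Df 0 (fun _ => c).
Proof. intros c Hc Hl. split; auto. apply (d_const _ _ _ _ HE); auto. Qed.

Lemma Df_add : forall l f g, Df l f -> Df l g -> (forall e, bde Bd e -> f e + g e < Bd) ->
  Df (l + 6) (fun e => f e + g e).
Proof.
  intros l f g Hf Hg Hb. apply (Df_op2 l Nat.add); auto.
  eapply ext; [|apply (e_atom l KAdd 0 1 2)]; try lia. intros e _; cbn. split; auto.
Qed.

Lemma Df_mul : forall l f g, Df l f -> Df l g -> (forall e, bde Bd e -> f e * g e < Bd) ->
  Df (l + 6) (fun e => f e * g e).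
Proof.
  intros l f g Hf Hg Hb. apply (Df_op2 l Nat.mul); auto.
  eapply ext; [|apply (e_atom l KMul 0 1 2)]; try lia. intros e _; cbn. split; auto.
Qed.

Lemma land_le_l : forall x y, Nat.land x y <= x.
Proof.
  intros x y. apply Nat.ldiff_le. apply Nat.bits_inj_0. intros k.
  rewrite Nat.ldiff_spec, Nat.land_spec. destruct (Nat.testbit x k), (Nat.testbit y k); reflexivity.
Qed.

Lemma Df_land : forall l f g, Df l f -> Df l g -> Df (l + 6) (fun e => Nat.land (f e) (g e)).
Proof.
  intros l f g Hf Hg. apply (Df_op2 l Nat.land); auto.
  - eapply ext; [|apply (e_atom l KAnd 0 1 2)]; try lia. intros e _; cbn. split; auto.
  - intros e He. pose proof (land_le_l (f e) (g e)). pose proof (Df_lt _ _ _ Hf He). lia.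
Qed.

Lemma Df_num : forall k, k < Bd -> Df (6 * k + 1) (fun _ => k).
Proof.
  induction k as [|k IH]; intros H.
  - eapply Df_mono; [|apply Df_zero]. lia.
  - eapply Df_mono; [|eapply Df_ext; [|apply (Df_add (6 * k + 1) (fun _ => k) (fun _ => 1))]].
    + lia.
    + intros; cbv beta; lia.
    + apply IH. lia.
    + eapply Df_mono; [|apply Df_one]. lia.
    + intros; cbv beta; lia.
Qed.

Lemma Dp_not : forall l P, Dp l P -> Dp l (fun e => ~ P e).
Proof.
  intros l P [H1 H2]. split; auto. eapply ext; [|exact H1].
  intros e He. split; [tauto|]. apply Classical_Prop.NNPP.
Qed.

Lemma Dp_and : forall l P Q, Dp l P -> Dp l Q -> Dp (S l) (fun e => P e /\ Q e).
Proof.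
  intros l P Q [H1 H2] [H3 H4]. split; [now apply e_and|].
  eapply ext; [|apply e_or; [exact H2|exact H4]]. intros e He; cbn.
  destruct (Classical_Prop.classic (P e)); tauto.
Qed.

Lemma Dp_or : forall l P Q, Dp l P -> Dp l Q -> Dp (S l) (fun e => P e \/ Q e).
Proof.
  intros l P Q [H1 H2] [H3 H4]. split; [now apply e_or|].
  eapply ext; [|apply e_and; [exact H2|exact H4]]. intros e He; cbn. tauto.
Qed.

Lemma Dp_app2 : forall l P f g, Dp l P -> Df l f -> Df l g ->
  Dp (l + 5) (fun e => P (f e .: g e .: e)).
Proof.
  intros l P f g [H1 H2] Hf Hg. split.
  - now apply e_app2.
  - apply (e_app2 l (fun e => ~ P e)); auto.
Qed.

Lemma Dp_eq : forall l f g, 2 <= l -> Df l f -> Df l g -> Dp (l + 5) (fun e => f e = g e).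
Proof.
  intros l f g Hl Hf Hg.
  apply (Dp_app2 l (fun e => e 0 = e 1) f g); auto.
  split; (eapply mono; [|first [apply e_eq01|apply e_neq01]]); lia.
Qed.

(** Both sides are existential: a nonzero difference in one direction, an arbitrary difference in
    the other. *)
Lemma Dp_lt01 : Dp 2 (fun e => e 0 < e 1).
Proof.
  split.
  - eapply ext; [|apply e_ex; apply e_and; [apply (e_atom 0 KAdd 1 0 2)|apply (e_natom 0 KAdd 0 0 0)]]; try lia.
    intros e He; cbn. split.
    + intros (z & _ & H1 & H2). lia.
    + intros H. exists (e 1 - e 0). pose proof (He 1). lia.
  - eapply ext; [|apply e_ex; apply (e_atom 1 KAdd 2 0 1)]; try lia.
    intros e He; cbn. split.
    + intros (z & _ & H1). lia.
    + intros H. exists (e 0 - e 1). pose proof (He 0). lia.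
Qed.

Lemma Dp_lt : forall l f g, 2 <= l -> Df l f -> Df l g -> Dp (l + 5) (fun e => f e < g e).
Proof.
  intros l f g Hl Hf Hg.
  apply (Dp_app2 l (fun e => e 0 < e 1) f g); auto.
  eapply Dp_mono; [|apply Dp_lt01]. lia.
Qed.

Lemma Dp_sh : forall l k P, Dp l P -> Dp (l + k) (fun e => P (sh k e)).
Proof.
  intros l k P [H1 H2].
  assert (H : forall i, k + i <= i + k) by (intros; lia).
  split; [exact (ren l k (fun i => k + i) P H H1)|exact (ren l k (fun i => k + i) _ H H2)].
Qed.

Lemma Df_ite : forall l (t : env -> bool) f g,
  Dp l (fun e => t e = true) -> Df l f -> Df l g ->
  Df (l + 3) (fun e => if t e then f e else g e).
Proof.
  intros l t f g Ht [Hbf Hf] [Hbg Hg]. split.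
  - intros e He. destruct (t e); auto.
  - destruct (Dp_sh l 1 _ Ht) as [H1 H2].
    eapply mono; [|eapply ext; [|apply e_or;
      [apply e_and; [exact H1|eapply mono; [|exact Hf]]
      |apply e_and; [exact H2|eapply mono; [|exact Hg]]]]]; try lia.
    intros e He; cbn. destruct (t (sh 1 e)); intuition congruence.
Qed.

Lemma Df_sub : forall l f g, 3 <= l -> Df l f -> Df l g -> Df (l + 6) (fun e => f e - g e).
Proof.
  intros l f g Hl Hf Hg. apply (Df_op2 l Nat.sub); auto.
  - eapply ext; [|eapply mono; [|apply e_or; [apply (e_atom 2 KAdd 2 1 0)|
      apply e_and; [apply e_ex; apply (e_atom 0 KAdd 1 0 2)|apply (e_atom 1 KAdd 2 2 2)]]]]; try lia.
    + intros e He; cbn. split.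
      * intros [H|[(z & _ & H) H2]]; lia.
      * intros H. destruct (le_lt_dec (e 1) (e 0)); [left; lia|right].
        split; [|lia]. exists (e 1 - e 0). pose proof (He 1). lia.
  - intros e He. pose proof (Df_lt _ _ _ Hf He). lia.
Qed.

Lemma Df_div : forall l f g, 7 <= l -> Df l f -> Df l g -> Df (l + 6) (fun e => f e / g e).
Proof.
  intros l f g Hl Hf Hg. apply (Df_op2 l Nat.div); auto.
  - (* [p = y * z], [p + r = x], [r + d = y] with [d <> 0] *)
    eapply ext; [|eapply mono; [|apply e_or;
      [apply e_and; [apply (e_atom 5 KAdd 1 1 1)|apply (e_atom 5 KAdd 2 2 2)]
      |apply e_ex; apply e_ex; apply e_ex; apply e_and;
        [apply (e_atom 2 KMul 4 5 2)|
         apply e_and; [apply (e_atom 1 KAdd 2 1 3)|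
           apply e_and; [apply (e_atom 0 KAdd 1 0 4)|apply (e_natom 0 KAdd 0 0 0)]]]]]]; try lia.
    intros e He; cbn. split.
    + intros [[H1 H2]|(p & _ & r & _ & d & _ & H1 & H2 & H3 & H4)].
      * replace (e 1) with 0 by lia. cbn. lia.
      * apply (Nat.div_unique (e 0) (e 1) (e 2) r); lia.
    + intros H. destruct (Nat.eq_dec (e 1) 0) as [Z|Z].
      * left. rewrite Z in H. cbn in H. lia.
      * right. pose proof (Nat.div_mod (e 0) (e 1) Z) as Dm.
        pose proof (Nat.mod_upper_bound (e 0) (e 1) Z) as M.
        rewrite <- H in Dm. pose proof (He 0). pose proof (He 1).
        exists (e 1 * e 2). split; [lia|].
        exists (e 0 mod e 1). split; [lia|].
        exists (e 1 - e 0 mod e 1). repeat split; lia.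
  - intros e He. pose proof (Df_lt _ _ _ Hf He).
    destruct (Nat.eq_dec (g e) 0) as [Z|Z]; [rewrite Z; cbn; lia|].
    pose proof (Nat.Div0.div_le_mono (f e) (f e) 1). 
    assert (f e / g e <= f e) by (apply Nat.Div0.div_le_upper_bound; nia). lia.
Qed.

Lemma Df_mod : forall l f g, 7 <= l -> Df l f -> Df l g -> Df (l + 18) (fun e => f e mod g e).
Proof.
  intros l f g Hl Hf Hg.
  assert (H0 : forall e, g e * (f e / g e) <= f e) by (intros e; apply Nat.Div0.mul_div_le).
  eapply Df_ext with (f := fun e => f e - g e * (f e / g e)).
  - intros e He. symmetry. apply Nat.Div0.mod_eq.
  - replace (l + 18) with (l + 12 + 6) by lia.
    apply (Df_sub (l + 12) f (fun e => g e * (f e / g e)));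
      [lia|eapply Df_mono; [|exact Hf]; lia|].
    replace (l + 12) with (l + 6 + 6) by lia.
    apply (Df_mul (l + 6) g (fun e => f e / g e)).
    + eapply Df_mono; [|exact Hg]; lia.
    + now apply Df_div.
    + intros e He. pose proof (H0 e). pose proof (Df_lt _ _ _ Hf He). lia.
Qed.

Ltac up H := eapply Df_mono; [|exact H]; lia.
Ltac upp H := eapply Dp_mono; [|exact H]; lia.

(** Levels are counted in units of 30, enough for one basic operation; [k] is then the nesting depth
    of an expression and [l] the level of its leaves. *)
Definition lv (k l : nat) : nat := 30 * k + l.

Lemma dadd : forall k l f g, Df (lv k l) f -> Df (lv k l) g ->
  (forall e, bde Bd e -> f e + g e < Bd) -> Df (lv (S k) l) (fun e => f e + g e).
Proof.
  intros k l f g Hf Hg Hb. eapply Df_mono; [|apply (Df_add (lv k l) f g); auto]. unfold lv; lia.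
Qed.

Lemma dmul : forall k l f g, Df (lv k l) f -> Df (lv k l) g ->
  (forall e, bde Bd e -> f e * g e < Bd) -> Df (lv (S k) l) (fun e => f e * g e).
Proof.
  intros k l f g Hf Hg Hb. eapply Df_mono; [|apply (Df_mul (lv k l) f g); auto]. unfold lv; lia.
Qed.

Lemma dland : forall k l f g, Df (lv k l) f -> Df (lv k l) g ->
  Df (lv (S k) l) (fun e => Nat.land (f e) (g e)).
Proof.
  intros k l f g Hf Hg. eapply Df_mono; [|apply (Df_land (lv k l) f g); auto]. unfold lv; lia.
Qed.

Lemma dsub : forall k l f g, Df (lv k l) f -> Df (lv k l) g ->
  Df (lv (S k) l) (fun e => f e - g e).
Proof.
  intros k l f g Hf Hg. eapply Df_mono;
    [|apply (Df_sub (lv k l + 7) f g); [lia|up Hf|up Hg]]. unfold lv; lia.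
Qed.

Lemma ddiv : forall k l f g, Df (lv k l) f -> Df (lv k l) g ->
  Df (lv (S k) l) (fun e => f e / g e).
Proof.
  intros k l f g Hf Hg. eapply Df_mono;
    [|apply (Df_div (lv k l + 7) f g); [lia|up Hf|up Hg]]. unfold lv; lia.
Qed.

Lemma dmod : forall k l f g, Df (lv k l) f -> Df (lv k l) g ->
  Df (lv (S k) l) (fun e => f e mod g e).
Proof.
  intros k l f g Hf Hg. eapply Df_mono;
    [|apply (Df_mod (lv k l + 7) f g); [lia|up Hf|up Hg]]. unfold lv; lia.
Qed.

Lemma deq : forall k l f g, Df (lv k l) f -> Df (lv k l) g ->
  Dp (lv (S k) l) (fun e => (f e =? g e) = true).
Proof.
  intros k l f g Hf Hg. eapply Dp_mono;
    [|eapply Dp_ext; [|apply (Dp_eq (lv k l + 7) f g); [lia|up Hf|up Hg]]]; [unfold lv; lia|].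
  intros e _. cbv beta. rewrite Nat.eqb_eq. tauto.
Qed.

Lemma dlt : forall k l f g, Df (lv k l) f -> Df (lv k l) g ->
  Dp (lv (S k) l) (fun e => (f e <? g e) = true).
Proof.
  intros k l f g Hf Hg. eapply Dp_mono;
    [|eapply Dp_ext; [|apply (Dp_lt (lv k l + 7) f g); [lia|up Hf|up Hg]]]; [unfold lv; lia|].
  intros e _. cbv beta. rewrite Nat.ltb_lt. tauto.
Qed.

Lemma dandb : forall k l t u, Dp (lv k l) (fun e => t e = true) -> Dp (lv k l) (fun e => u e = true) ->
  Dp (lv (S k) l) (fun e => t e && u e = true).
Proof.
  intros k l t u Ht Hu. eapply Dp_mono;
    [|eapply Dp_ext; [|apply (Dp_and _ _ _ Ht Hu)]]; [unfold lv; lia|].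
  intros e _. cbv beta. rewrite andb_true_iff. tauto.
Qed.

Lemma dite : forall k l (t : env -> bool) f g,
  Dp (lv k l) (fun e => t e = true) -> Df (lv k l) f -> Df (lv k l) g ->
  Df (lv (S k) l) (fun e => if t e then f e else g e).
Proof.
  intros k l t f g Ht Hf Hg. eapply Df_mono; [|apply (Df_ite (lv k l) t f g); auto]. unfold lv; lia.
Qed.

Lemma dorc : forall k l j (X : nat -> env -> nat) f, j <= 20 ->
  Df (lv k l) (fun e => X (e 0) (sh 1 e)) -> Df (lv k l) f ->
  Df (lv (S k) l) (fun e => X (f e) (sh j e)).
Proof.
  intros k l j X f Hj HX Hf. eapply Df_mono; [|apply (Df_orc (lv k l) j X f); auto]. unfold lv; lia.
Qed.

Lemma dleaf : forall k l l0 f, Df l0 f -> l0 <= l -> Df (lv k l) f.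
Proof. intros k l l0 f Hf H. eapply Df_mono; [|exact Hf]. unfold lv; lia. Qed.

Lemma dleafp : forall k l l0 P, Dp l0 P -> l0 <= l -> Dp (lv k l) P.
Proof. intros k l l0 P Hf H. eapply Dp_mono; [|exact Hf]. unfold lv; lia. Qed.

Lemma dnum : forall k l i, i < Bd -> 6 * i + 1 <= 30 * k -> Df (lv k l) (fun _ => i).
Proof. intros k l i Hi H. eapply Df_mono; [|apply Df_num; auto]. unfold lv; lia. Qed.

Lemma dvar : forall k l i, i + 2 <= 30 * k -> Df (lv k l) (fun e => e i).
Proof. intros k l i H. eapply Df_mono; [|apply Df_var]. unfold lv; lia. Qed.

(** Overflow yields 0. The operations are thus total, and expressions below a quantifier need no
    bounds on the words that occur in them. *)
Definition tadd (x y : nat) : nat := if x + y <? Bd then x + y else 0.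
Definition tmul (x y : nat) : nat := if x * y <? Bd then x * y else 0.

Lemma tadd_small : forall x y, x + y < Bd -> tadd x y = x + y.
Proof. intros x y H. unfold tadd. apply Nat.ltb_lt in H. now rewrite H. Qed.

Lemma tmul_small : forall x y, x * y < Bd -> tmul x y = x * y.
Proof. intros x y H. unfold tmul. apply Nat.ltb_lt in H. now rewrite H. Qed.

Lemma dtadd : forall k l f g, Df l (fun _ => Bd - 1) -> Df (lv k l) f -> Df (lv k l) g ->
  Df (lv (4 + k) l) (fun e => tadd (f e) (g e)).
Proof.
  intros k l f g Hm Hf Hg.
  apply (Df_mono (lv k l + 100 + 6)); [unfold lv; lia|].
  apply (Df_op2 (lv k l + 100) tadd f g); [|up Hf|up Hg|].
  (* Overflow is tested as [y > (Bd - 1) - x], which stays inside the word range. *)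
  - assert (H0 : Dp (lv 3 l) (fun e => ((Bd - 1) - e 0 <? e 1) = true)).
    { apply dlt; [apply dsub; [eapply dleaf; [exact Hm|lia]|apply dvar; lia]|apply dvar; lia]. }
    destruct H0 as [H1 _].
    apply (mono (S (S (lv 3 l)))); [unfold lv; lia|].
    eapply ext; [|apply e_or; [apply (e_atom _ KAdd 0 1 2)|
      apply e_and; [exact H1|apply (e_atom _ KAdd 2 2 2)]]]; try lia.
    intros e He; cbn [atom]. rewrite Nat.ltb_lt. unfold tadd.
    pose proof (He 0); pose proof (He 1); pose proof (He 2).
    destruct (Nat.ltb_spec (e 0 + e 1) Bd); lia.
  - intros e He. unfold tadd. destruct (Nat.ltb_spec (f e + g e) Bd); lia.
Qed.

Lemma dtmul : forall k l f g, Df l (fun _ => Bd - 1) -> Df (lv k l) f -> Df (lv k l) g ->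
  Df (lv (5 + k) l) (fun e => tmul (f e) (g e)).
Proof.
  intros k l f g Hm Hf Hg.
  apply (Df_mono (lv k l + 130 + 6)); [unfold lv; lia|].
  apply (Df_op2 (lv k l + 130) tmul f g); [|up Hf|up Hg|].
  (* Overflow is tested by a quotient, again inside the word range; a zero factor is excluded first
     because [x / 0] is 0. *)
  - assert (H0 : Dp (lv 4 l) (fun e => negb (e 1 =? 0) && ((Bd - 1) / e 1 <? e 0) = true)).
    { apply dandb.
      - eapply Dp_ext; [|apply Dp_not; apply (deq 2 l (fun e => e 1) (fun _ => 0)); [apply dvar|apply dnum]; lia].
        intros e _. cbv beta. destruct (e 1 =? 0); cbn; intuition congruence.
      - apply dlt; [apply ddiv; [eapply dleaf; [exact Hm|lia]|apply dvar; lia]|apply dvar; lia]. }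
    destruct H0 as [H3 _].
    apply (mono (S (S (lv 4 l)))); [unfold lv; lia|].
    eapply ext; [|apply e_or; [apply (e_atom _ KMul 0 1 2)|
      apply e_and; [exact H3|apply (e_atom _ KAdd 2 2 2)]]]; try lia.
    intros e He; cbn [atom]. rewrite andb_true_iff, negb_true_iff, Nat.ltb_lt. unfold tmul.
    pose proof (He 0); pose proof (He 1); pose proof (He 2).
    rewrite Nat.eqb_neq.
    destruct (Nat.eq_dec (e 1) 0) as [Z|Z].
    + rewrite Z, Nat.mul_0_r. destruct (Nat.ltb_spec 0 Bd); lia.
    + pose proof (Nat.div_mod (Bd - 1) (e 1) Z). pose proof (Nat.mod_upper_bound (Bd - 1) (e 1) Z).
      destruct (Nat.ltb_spec (e 0 * e 1) Bd).
      * split; [|lia]. intros [H8|[[H8 H10] H9]]; [lia|]. exfalso. nia.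
      * split; [lia|]. intros H8. right. repeat split; try lia. nia.
  - intros e He. unfold tmul. destruct (Nat.ltb_spec (f e * g e) Bd); lia.
Qed.

End Definability.

Lemma dnegb : forall D l (t : env -> bool), Dp D l (fun e => t e = true) ->
  Dp D l (fun e => negb (t e) = true).
Proof.
  intros D l t H. eapply Dp_ext; [|apply Dp_not; exact H].
  intros e _. cbv beta. destruct (t e); cbn; intuition congruence.
Qed.

Lemma dorb : forall D k l (t u : env -> bool),
  Dp D (lv k l) (fun e => t e = true) -> Dp D (lv k l) (fun e => u e = true) ->
  Dp D (lv (S k) l) (fun e => t e || u e = true).
Proof.
  intros D k l t u Ht Hu.
  eapply Dp_ext; [|apply dnegb; apply dandb; apply dnegb; [exact Ht|exact Hu]].
  intros e _. cbv beta. rewrite <- negb_orb, negb_involutive. tauto.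
Qed.

(** Extension point of [dgo]: later sections redefine it for their own operations. *)
Ltac dhook := fail.

Ltac dleaf_tac :=
  match goal with
  | H : Df ?D _ ?F |- Df ?D _ ?F => first [exact H | eapply dleaf; [exact H|lia]]
  | H : Dp ?D _ ?F |- Dp ?D _ ?F => first [exact H | eapply dleafp; [exact H|lia]]
  end.

(* Goals have the form [Df D (lv k l) F] with a literal [k], which bounds the nesting depth of [F]. *)
Ltac dgo :=
  first [ dleaf_tac |
  lazymatch goal with
  | |- Df _ _ (fun e => @?f e + @?g e) => apply dadd; [dgo|dgo|]
  | |- Df _ _ (fun e => @?f e * @?g e) => apply dmul; [dgo|dgo|]
  | |- Df _ _ (fun e => @?f e - @?g e) => apply dsub; dgo
  | |- Df _ _ (fun e => @?f e / @?g e) => apply ddiv; dgo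
  | |- Df _ _ (fun e => @?f e mod @?g e) => apply dmod; dgo
  | |- Df _ _ (fun e => Nat.land (@?f e) (@?g e)) => apply dland; dgo
  | |- Df _ _ (fun e => tadd _ (@?f e) (@?g e)) => apply dtadd; [eassumption|dgo|dgo]
  | |- Df _ _ (fun e => tmul _ (@?f e) (@?g e)) => apply dtmul; [eassumption|dgo|dgo]
  | |- Df _ _ (fun e => if @?t e then @?f e else @?g e) => apply dite; [dgo|dgo|dgo]
  | |- Df _ _ (fun e => e _) => apply dvar; lia
  | |- Dp _ _ (fun e => (@?f e =? @?g e) = true) => apply deq; dgo
  | |- Dp _ _ (fun e => (@?f e <? @?g e) = true) => apply dlt; dgo
  | |- Dp _ _ (fun e => @?f e && @?g e = true) => apply dandb; dgo
  | |- Dp _ _ (fun e => @?f e || @?g e = true) => apply dorb; dgo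
  | |- Dp _ _ (fun e => negb (@?f e) = true) => apply dnegb; dgo
  end
  | dhook
  | apply dnum; [|lia] ].

(** * An existential definition of exponentiation *)

Definition pow2b (y : nat) : bool := negb (y =? 0) && (Nat.land y (y - 1) =? 0).

Lemma pow2b_spec : forall y, pow2b y = true <-> exists z, y = 2 ^ z.
Proof.
  intros y. unfold pow2b. rewrite andb_true_iff, negb_true_iff, Nat.eqb_neq, Nat.eqb_eq. split.
  - intros [H0 H1]. exists (Nat.log2 y).
    pose proof (Nat.log2_spec y ltac:(lia)) as [L U].
    destruct (Nat.eq_dec y (2 ^ Nat.log2 y)) as [E|NE]; auto. exfalso.
    (* A number that is not a power of two shares its leading bit with its predecessor, so the
       conjunction would not vanish. *)
    assert (T1 : Nat.testbit y (Nat.log2 y) = true) by (apply Nat.bit_log2; lia).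
    assert (T2 : Nat.testbit (y - 1) (Nat.log2 y) = true).
    { replace (Nat.log2 y) with (Nat.log2 (y - 1)) at 1.
      - apply Nat.bit_log2. pose proof (Nat.pow_nonzero 2 (Nat.log2 y)). lia.
      - apply Nat.log2_unique; lia. }
    pose proof (Nat.land_spec y (y - 1) (Nat.log2 y)) as E. rewrite H1, T1, T2, Nat.bits_0 in E. discriminate.
  - intros [z ->]. pose proof (Nat.pow_nonzero 2 z ltac:(lia)). split; auto.
    replace (2 ^ z - 1) with (Nat.ones z).
    + rewrite Nat.land_ones, Nat.Div0.mod_same. reflexivity.
    + rewrite Nat.ones_equiv. lia.
Qed.

(** The binomial theorem modulo [v * v]. *)
Lemma upow : forall v a, exists k, (v + 1) ^ a = 1 + a * v + k * (v * v).
Proof.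
  intros v a. induction a as [|a [k IH]].
  - exists 0. cbn. lia.
  - exists (a + k * v + k). rewrite Nat.pow_succ_r', IH. ring.
Qed.

Lemma mod_eq_ex : forall a b m, m <> 0 -> a mod m = b mod m -> exists k1 k2, a + k1 * m = b + k2 * m.
Proof.
  intros a b m Hm H. exists (b / m), (a / m).
  pose proof (Nat.div_mod a m Hm). pose proof (Nat.div_mod b m Hm). nia.
Qed.

Lemma small_cong : forall a h v K1 K2, a < v -> h < v -> a + K1 * v = h + K2 * v -> a = h.
Proof.
  intros a h v K1 K2 Ha Hh E.
  rewrite <- (Nat.mod_small a v Ha), <- (Nat.mod_small h v Hh).
  rewrite <- (Nat.Div0.mod_add a K1 v), <- (Nat.Div0.mod_add h K2 v). now rewrite E.
Qed.

(** Since [2 ^ w] is 1 plus the base of the modulus, exponentiation modulo the square becomes linear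
    in [a]; this is what lets an exponent be read off from a residue. *)
Lemma exp_mod : forall w a c, exists k,
  2 ^ (w * a + c) = 2 ^ c * (1 + a * (2 ^ w - 1)) + k * ((2 ^ w - 1) * (2 ^ w - 1)).
Proof.
  intros w a c. destruct (upow (2 ^ w - 1) a) as [k E].
  pose proof (Nat.pow_nonzero 2 w ltac:(lia)).
  replace (2 ^ w - 1 + 1) with (2 ^ w) in E by lia.
  exists (2 ^ c * k). rewrite Nat.pow_add_r, Nat.pow_mul_r, E. ring.
Qed.

(** With [v = 2 ^ w - 1], the residue modulo [v] is [2 ^ c] and fixes [c]; once the factor [2 ^ c]
    is completed to [2 ^ w], the coefficient of [v] fixes [a] modulo [v]. *)
Lemma exp_cancel : forall w a h c c', 3 <= w -> c < w -> c' < w ->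
  a < 2 ^ w - 1 -> h < 2 ^ w - 1 ->
  2 ^ (w * a + c) mod ((2 ^ w - 1) * (2 ^ w - 1))
  = (2 ^ c' * (1 + h * (2 ^ w - 1))) mod ((2 ^ w - 1) * (2 ^ w - 1)) ->
  a = h /\ c = c'.
Proof.
  intros w a h c c' Hw Hc Hc' Ha Hh E.
  assert (H8 : 2 ^ 3 <= 2 ^ w) by (apply Nat.pow_le_mono_r; lia). change (2 ^ 3) with 8 in H8.
  destruct (exp_mod w a c) as [k Ek].
  remember (2 ^ w - 1) as v eqn:Ev. assert (Hv : 7 <= v) by lia.
  assert (Hvv : v * v <> 0) by nia.
  destruct (mod_eq_ex _ _ _ Hvv E) as (k1 & k2 & E1). rewrite Ek in E1.
  assert (Hb : forall d, d < w -> 2 ^ d < v).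
  { intros d Hd. assert (2 * 2 ^ d <= 2 ^ w).
    { rewrite <- Nat.pow_succ_r'. apply Nat.pow_le_mono_r; lia. }
    pose proof (Nat.pow_nonzero 2 d ltac:(lia)). lia. }
  assert (Ecc : 2 ^ c = 2 ^ c').
  { apply (small_cong _ _ v (2 ^ c * a + (k + k1) * v) (2 ^ c' * h + k2 * v)); auto.
    rewrite !Nat.mul_add_distr_r. nia. }
  assert (c = c') by (apply (Nat.pow_inj_r 2); lia). subst c'. split; auto.
  (* multiply by [2 ^ (w - c)] and use [2 ^ w = v + 1] *)
  assert (E2 : (v + 1) * (1 + a * v) + 2 ^ (w - c) * (k + k1) * (v * v)
             = (v + 1) * (1 + h * v) + 2 ^ (w - c) * k2 * (v * v)).
  { replace (v + 1) with (2 ^ (w - c) * 2 ^ c).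
    - apply (f_equal (fun t => 2 ^ (w - c) * t)) in E1. nia.
    - rewrite <- Nat.pow_add_r. replace (w - c + c) with w by lia. lia. }
  apply (small_cong a h v (a + 2 ^ (w - c) * (k + k1)) (h + 2 ^ (w - c) * k2)); auto.
  nia.
Qed.

Lemma pow_mod_sub2 : forall u l, 2 <= u -> exists k, u ^ l = 2 ^ l + k * (u - 2).
Proof.
  intros u l Hu. induction l as [|l [k IH]].
  - exists 0. cbn. lia.
  - rewrite !Nat.pow_succ_r', IH. exists (2 ^ l + k * u). 
    replace u with (2 + (u - 2)) at 1 by lia. replace (k * u) with (k * (2 + (u - 2))) by nia. ring.
Qed.

(** Write [x = w * h + l]. A power of two below [Bd] is determined by its residue modulo
    [(u - 1) * (u - 1)], so it suffices to express [2 ^ l * (1 + h * (u - 1))]. The factor [2 ^ l]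
    comes from a second power of two [Y = u ^ l], itself recognised by its residue, because [u] is 2
    modulo [u - 2]. *)
Lemma exp_char : forall w Bd x y, 3 <= w -> Bd <= 2 ^ (w * (2 ^ w - 1)) -> 2 ^ (w * w) <= Bd ->
  y < Bd ->
  let u := 2 ^ w in
  y = 2 ^ x <->
  pow2b y = true /\ x / w < u - 1 /\
  exists Y, Y < Bd /\ pow2b Y = true /\
    Y mod ((u - 1) * (u - 1)) = 1 + (x mod w) * (u - 1) /\
    y mod ((u - 1) * (u - 1)) = ((Y mod (u - 2)) * (1 + (x / w) * (u - 1))) mod ((u - 1) * (u - 1)).
Proof.
  intros w Bd x y Hw HB HB2 Hy u.
  assert (H8 : 2 ^ 3 <= 2 ^ w) by (apply Nat.pow_le_mono_r; lia). change (2 ^ 3) with 8 in H8.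
  fold u in H8, HB.
  assert (Hwu : w < u) by (apply Nat.pow_gt_lin_r; lia).
  pose proof (Nat.div_mod x w ltac:(lia)) as Dx. pose proof (Nat.mod_upper_bound x w ltac:(lia)) as Mx.
  set (h := x / w) in *. set (l := x mod w) in *.
  assert (Hlog : forall z, 2 ^ z < Bd -> z / w < u - 1).
  { intros z Hz. assert (z < w * (u - 1)).
    { apply (Nat.pow_lt_mono_r_iff 2); lia. }
    apply Nat.Div0.div_lt_upper_bound. lia. }
  assert (HL : forall d, d < w -> 2 ^ d < u - 2).
  { intros d Hd. assert (2 * 2 ^ d <= 2 ^ w).
    { rewrite <- Nat.pow_succ_r'. apply Nat.pow_le_mono_r; lia. }
    fold u in H. lia. }
  assert (HYl : 2 ^ (w * l) mod (u - 2) = 2 ^ l).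
  { rewrite Nat.pow_mul_r. fold u. destruct (pow_mod_sub2 u l ltac:(lia)) as [k ->].
    rewrite Nat.Div0.mod_add. apply Nat.mod_small. auto. }
  assert (HY1 : 2 ^ (w * l) mod ((u - 1) * (u - 1)) = 1 + l * (u - 1)).
  { destruct (exp_mod w l 0) as [k E]. fold u in E. rewrite Nat.add_0_r in E. rewrite E.
    rewrite Nat.Div0.mod_add. rewrite Nat.mod_small; cbn [Nat.pow]; [lia|].
    assert (l <= u - 2) by lia. nia. }
  assert (HX : 2 ^ x mod ((u - 1) * (u - 1)) = (2 ^ l * (1 + h * (u - 1))) mod ((u - 1) * (u - 1))).
  { rewrite Dx. destruct (exp_mod w h l) as [k E]. fold u in E. rewrite E. apply Nat.Div0.mod_add. }
  split.
  - intros ->. split; [apply pow2b_spec; eauto|]. split; [apply Hlog; auto|].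
    exists (2 ^ (w * l)). repeat split; auto.
    + apply Nat.lt_le_trans with (2 ^ (w * w)); auto. apply Nat.pow_lt_mono_r; nia.
    + apply pow2b_spec; eauto.
    + rewrite HYl. exact HX.
  - intros (Hp & Hh & Y & HYb & HYp & E1 & E2).
    apply pow2b_spec in Hp, HYp. destruct Hp as [z ->]. destruct HYp as [t ->].
    pose proof (Nat.div_mod t w ltac:(lia)) as Dt. pose proof (Nat.mod_upper_bound t w ltac:(lia)) as Mt.
    pose proof (Nat.div_mod z w ltac:(lia)) as Dz. pose proof (Nat.mod_upper_bound z w ltac:(lia)) as Mz.
    assert (Ht : t = w * l).
    { assert (Hll : l < u - 1) by lia.
      destruct (exp_cancel w (t / w) l (t mod w) 0 Hw Mt ltac:(lia) (Hlog _ HYb) Hll) as [Q1 Q2].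
      - rewrite <- Dt. fold u. rewrite E1. symmetry. cbn [Nat.pow]. rewrite Nat.mul_1_l. apply Nat.mod_small.
        assert (l <= u - 2) by lia. nia.
      - nia. }
    rewrite Ht, HYl in E2. rewrite Dz in E2.
    destruct (exp_cancel w (z / w) h (z mod w) l Hw Mz Mx (Hlog _ Hy) Hh E2) as [Q1 Q2].
    f_equal. nia.
Qed.

Section DefinableExp.

Variable D : dclass.
Local Notation Bd := (bd D).
Local Notation E := (cls D).
Variable w : nat.
Hypothesis Hw : 3 <= w.
Hypothesis HB1 : Bd <= 2 ^ (w * (2 ^ w - 1)).
Hypothesis HB2 : 2 ^ (w * w + 4 * w) <= Bd.
Variable lw : nat.
Hypothesis Dw : Df D lw (fun _ => w).
Hypothesis Du : Df D lw (fun _ => 2 ^ w).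

(** [h] is replaced by 0 when it is too large, so that all products stay below the word bound
    whatever [x] is. *)
Definition expb (x y Y : nat) : bool :=
  let u := 2 ^ w in
  let h := if x / w <? u - 1 then x / w else 0 in
  pow2b y && (x / w <? u - 1) && pow2b Y &&
  (Y mod ((u - 1) * (u - 1)) =? 1 + (x mod w) * (u - 1)) &&
  (y mod ((u - 1) * (u - 1)) =? ((Y mod (u - 2)) * (1 + h * (u - 1))) mod ((u - 1) * (u - 1))).

Lemma e_exp : E (lv 13 lw) (fun e => e 1 = 2 ^ e 0).
Proof.
  assert (HB4 : 2 ^ (4 * w) < Bd).
  { eapply Nat.lt_le_trans; [|exact HB2]. apply Nat.pow_lt_mono_r; nia. }
  assert (HU : 2 ^ (4 * w) = 2 ^ w * 2 ^ w * (2 ^ w * 2 ^ w)).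
  { rewrite <- !Nat.pow_add_r. f_equal. lia. }
  assert (Hwu : w < 2 ^ w) by (apply Nat.pow_gt_lin_r; lia).
  remember (2 ^ w) as u eqn:Eu.
  assert (H8 : 2 ^ 3 <= u) by (subst u; apply Nat.pow_le_mono_r; lia). change (2 ^ 3) with 8 in H8.
  assert (Hx : Dp D (lv 12 lw) (fun e => expb (e 1) (e 2) (e 0) = true)).
  { unfold expb, pow2b. cbv zeta. rewrite <- Eu. dgo; try lia; intros e He; cbv beta.
    all: clear HB1 HB2 Dw Du.
    all: destruct (Nat.ltb_spec (e 1 / w) (u - 1)).
    all: pose proof (Nat.mod_upper_bound (e 1) w ltac:(lia)).
    all: pose proof (Nat.mod_upper_bound (e 0) (u - 2) ltac:(lia)).
    all: assert (U2 : u * u < Bd) by nia.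
    all: assert (U3 : u * (u * u) < Bd) by nia.
    all: remember (e 1 mod w) as r1; remember (e 0 mod (u - 2)) as r2; remember (e 1 / w) as r3.
    all: clear - H8 Hwu U2 U3 H H0 H1.
    13: apply Nat.le_lt_trans with (u * (u * u)); [apply Nat.mul_le_mono; [lia|]|lia].
    all: nia. }
  pose proof (d_ex _ _ _ _ (d_prf D) _ _ (proj1 Hx)) as Hx'.
  eapply d_mono; [apply (d_prf D)| |eapply d_ext; [apply (d_prf D)| |exact Hx']].
  - unfold lv; lia.
  - intros e He. cbv beta. 
    assert (HB1' : Bd <= 2 ^ (w * (2 ^ w - 1))) by (rewrite <- Eu; exact HB1).
    assert (HB2' : 2 ^ (w * w) <= Bd).
    { eapply Nat.le_trans; [|exact HB2]. apply Nat.pow_le_mono_r; lia. }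
    rewrite (exp_char w Bd (e 0) (e 1) Hw HB1' HB2' (He 1)).
    rewrite <- Eu. cbv zeta. unfold expb. cbv zeta. cbn [scons]. rewrite <- Eu.
    split.
    + intros (Y & HY & HH). rewrite !andb_true_iff, !Nat.eqb_eq, Nat.ltb_lt in HH.
      destruct HH as ((((A1 & A2) & A3) & A4) & A5).
      destruct (Nat.ltb_spec (e 0 / w) (u - 1)); [|lia]. eauto 10.
    + intros (A1 & A2 & Y & HY & A3 & A4 & A5). exists Y. split; auto.
      rewrite !andb_true_iff, !Nat.eqb_eq, Nat.ltb_lt.
      destruct (Nat.ltb_spec (e 0 / w) (u - 1)); [|lia]. auto 10.
Qed.

Lemma dexp : forall k l f, lw <= l -> Df D (lv k l) f -> (forall e, bde Bd e -> 2 ^ f e < Bd) ->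
  Df D (lv (14 + k) l) (fun e => 2 ^ f e).
Proof.
  intros k l f Hl Hf Hb. split; auto.
  assert (H0 : E (lv k l + lv 13 0) (fun e => e 1 = 2 ^ e 0)).
  { eapply d_mono; [apply (d_prf D)| |exact e_exp]. unfold lv; lia. }
  pose proof (e_app D (lv k l + lv 13 0) _ (fun e => f (sh 1 e)) H0
    (Df_mono D (lv k l + 1) (lv k l + lv 13 0) _ ltac:(unfold lv; lia) (Df_sh D _ 1 f Hf))) as H.
  eapply d_mono; [apply (d_prf D)| |exact H]. unfold lv; lia.
Qed.

Definition texp (x : nat) : nat := if 2 ^ x <? Bd then 2 ^ x else 0.

Lemma texp_small : forall x, 2 ^ x < Bd -> texp x = 2 ^ x.
Proof. intros x H. unfold texp. apply Nat.ltb_lt in H. now rewrite H. Qed.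

Lemma dtexp : forall k l K f, Bd = 2 ^ K -> Df D l (fun _ => K) -> lw <= l -> Df D (lv k l) f ->
  Df D (lv (17 + k) l) (fun e => texp (f e)).
Proof.
  intros k l K f Ek Hk Hl Hf. pose proof (bd_ge D).
  assert (Hkb : forall x, 2 ^ x < Bd <-> x < K).
  { intros x. rewrite Ek. rewrite <- Nat.pow_lt_mono_r_iff by lia. tauto. }
  assert (0 < K).
  { destruct K; [rewrite Ek in H; cbn in H; lia|lia]. }
  (* The exponent is clamped inside the power as well, because [dexp] requires the power to be in
     range for every environment. *)
  eapply Df_ext with (f := fun e => if f e <? K then 2 ^ (if f e <? K then f e else 0) else 0).
  - intros e He. unfold texp.
    destruct (Nat.ltb_spec (f e) K) as [L|L]; destruct (Nat.ltb_spec (2 ^ f e) Bd) as [L2|L2]; auto.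
    + apply Hkb in L. lia.
    + apply Hkb in L2. lia.
  - assert (Hf1 : forall j, Df D (lv (j + k) l) f) by (intros j; eapply Df_mono; [|exact Hf]; unfold lv; lia).
    assert (H00 : Df D (lv (2 + k) l) (fun e => if f e <? K then f e else 0)).
    { apply dite; [apply dlt; [exact Hf|dgo]|exact (Hf1 1)|apply dnum; lia]. }
    apply (dite D (16 + k)).
    + apply (dlt D (15 + k)); [exact (Hf1 15)|dgo].
    + apply (dexp (2 + k)); auto. intros e He. apply Hkb. destruct (Nat.ltb_spec (f e) K); lia.
    + apply dnum; lia.
Qed.

End DefinableExp.

(** * Existential formulas as tables over guessed words *)

Definition atomb (c : kind) (x y z : nat) : bool :=
  match c with
  | KAdd => x + y =? z
  | KMul => x * y =? z
  | KAnd => Nat.land x y =? z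
  end.

Lemma atomb_spec : forall c x y z, atomb c x y z = true <-> atom c x y z.
Proof. intros [] x y z; cbn; apply Nat.eqb_eq. Qed.

Definition table : Type := kind -> nat -> nat -> nat -> bool.

(** The pattern of a vector of words: all that a formula may learn about it. Entries outside [ok]
    are false, so a pattern depends on the visible words only. *)
Definition atoms (ok : nat -> bool) (v : nat -> nat) : table :=
  fun c i j k => ok i && ok j && ok k && atomb c (v i) (v j) (v k).

Definition remap (ok : nat -> bool) (s : nat -> nat) (t : table) : table :=
  fun c i j k => ok i && ok j && ok k && t c (s i) (s j) (s k).

Lemma remap_atoms : forall ok ok' s v v',
  (forall i, ok i = true -> ok' (s i) = true /\ v (s i) = v' i) ->
  remap ok s (atoms ok' v) = atoms ok v'.
Proof.
  intros ok ok' s v v' H. extensionality c. extensionality i. extensionality j. extensionality k.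
  unfold remap, atoms.
  destruct (ok i) eqn:Ei; [|reflexivity]. destruct (ok j) eqn:Ej; [|reflexivity].
  destruct (ok k) eqn:Ek; [|reflexivity]. cbn.
  destruct (H i Ei) as [-> ->]. destruct (H j Ej) as [-> ->]. destruct (H k Ek) as [-> ->]. reflexivity.
Qed.

Definition layout (V : nat) (inp u : nat -> nat) (i : nat) : nat :=
  if i <? V then inp i else u (i - V).

Section ExistentialClass.

Variable Bd : nat.
Variable cs : list nat.
Variable A : nat.
Variable S0 : nat.
Hypothesis HBd : 2 <= Bd.
Hypothesis HS0 : 8 <= S0.

Local Notation NC := (length cs).

Definition inputs_of (e : env) (i : nat) : nat :=
  if i <? NC then nth i cs 0 else if i <? NC + A then e (i - NC) else 0.

Definition mk (e u : env) (i : nat) : nat :=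
  if i <? NC + A then inputs_of e i else u (i - (NC + A)).

(** Visible at level [l] are the constants, [S0 + l] variables, and [2 ^ l] guessed words, which are
    stored behind all [A] slots for variables. *)
Definition okx (l i : nat) : bool :=
  (i <? NC + (S0 + l)) || ((NC + A <=? i) && (i <? NC + A + 2 ^ l)).

Lemma okx_spec : forall l i, okx l i = true <->
  i < NC + (S0 + l) \/ NC + A <= i < NC + A + 2 ^ l.
Proof.
  intros l i. unfold okx.
  rewrite orb_true_iff, andb_true_iff, !Nat.ltb_lt, Nat.leb_le. tauto.
Qed.

(** [L] is an arbitrary predicate: the Boolean structure is left to the table and only the guessed
    words are counted. The premise restricts attention to levels whose variables fit into the [A]
    slots. *)
Definition EX (l : nat) (P : env -> Prop) : Prop :=
  S0 + l <= A ->
  exists L : table -> Prop, forall e, bde Bd e ->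
    (P e <-> exists u, bde Bd u /\ L (atoms (okx l) (mk e u))).

Ltac mkc :=
  unfold mk, inputs_of;
  repeat match goal with
  | |- context [?a <? ?b] => destruct (Nat.ltb_spec a b); try lia
  end.

Lemma pow2_pos : forall l, 0 < 2 ^ l.
Proof. intros l. pose proof (Nat.pow_nonzero 2 l). lia. Qed.

Lemma EX_mono : forall l l' P, l <= l' -> EX l P -> EX l' P.
Proof.
  intros l l' P Hl HP HA. destruct (HP ltac:(lia)) as [L HL].
  exists (fun t => L (remap (okx l) (fun i => i) t)). intros e He. rewrite HL by auto.
  assert (Hp : 2 ^ l <= 2 ^ l') by (apply Nat.pow_le_mono_r; lia).
  assert (Heq : forall u, remap (okx l) (fun i => i) (atoms (okx l') (mk e u)) = atoms (okx l) (mk e u)).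
  { intros u. apply remap_atoms. intros i. rewrite !okx_spec. intros H. split; [lia|reflexivity]. }
  split; intros (u & Hu & H); exists u; split; auto; [rewrite Heq|rewrite Heq in H]; auto.
Qed.

(** The quantified word becomes the guessed word of index [2 ^ l], the first one that level [l] does
    not use. *)
Lemma EX_ex : forall l P, EX l P -> EX (S l) (fun e => exists y, y < Bd /\ P (y .: e)).
Proof.
  intros l P HP HA. destruct (HP ltac:(lia)) as [L HL]. pose proof (pow2_pos l).
  set (s := fun i => if i =? NC then NC + A + 2 ^ l
                     else if (NC <? i) && (i <? NC + A) then i - 1 else i).
  exists (fun t => L (remap (okx l) s t)). intros e He.
  assert (Heq : forall u y, u (2 ^ l) = y ->
     remap (okx l) s (atoms (okx (S l)) (mk e u)) = atoms (okx l) (mk (y .: e) u)).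
  { intros u y Hy. apply remap_atoms. intros i. rewrite !okx_spec. cbn [Nat.pow]. intros Hi. unfold s.
    destruct (Nat.eqb_spec i NC) as [E|E].
    - split; [lia|]. mkc. replace (NC + A + 2 ^ l - (NC + A)) with (2 ^ l) by lia.
      rewrite Hy. subst i. rewrite Nat.sub_diag. reflexivity.
    - destruct (Nat.ltb_spec NC i); destruct (Nat.ltb_spec i (NC + A)); cbn [andb].
      + split; [lia|]. mkc; replace (i - NC) with (S (i - 1 - NC)) by lia; reflexivity.
      + split; [lia|]. mkc; reflexivity.
      + split; [lia|]. mkc; reflexivity.
      + lia. }
  split.
  - intros (y & Hy & H1). apply HL in H1; [|now apply bde_scons]. destruct H1 as (u & Hu & HH).
    set (u' := fun i => if i =? 2 ^ l then y else u i).
    exists u'. split.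
    + intros i. unfold u'. destruct (i =? 2 ^ l); auto.
    + rewrite (Heq u' y); [|unfold u'; now rewrite Nat.eqb_refl].
      replace (atoms (okx l) (mk (y .: e) u')) with (atoms (okx l) (mk (y .: e) u)); auto.
      extensionality c. extensionality i. extensionality j. extensionality k. unfold atoms.
      assert (Hv : forall i, okx l i = true -> mk (y .: e) u i = mk (y .: e) u' i).
      { intros i0 Hi0. apply okx_spec in Hi0. mkc; auto. unfold u'.
        destruct (Nat.eqb_spec (i0 - (NC + A)) (2 ^ l)); [lia|reflexivity]. }
      destruct (okx l i) eqn:Ei; [|reflexivity]. destruct (okx l j) eqn:Ej; [|reflexivity].
      destruct (okx l k) eqn:Ek; [|reflexivity]. now rewrite !Hv by auto.
  - intros (u & Hu & HH). exists (u (2 ^ l)). split; [apply Hu|].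
    apply HL; [now apply bde_scons|]. exists u. split; auto. rewrite <- (Heq u (u (2 ^ l)) eq_refl). exact HH.
Qed.

(** The two witnesses are independent and occupy separate halves of the guessed words. This doubling
    makes their number exponential in the level. *)
Lemma EX_and : forall l P P', EX l P -> EX l P' -> EX (S l) (fun e => P e /\ P' e).
Proof.
  intros l P P' HP HP' HA. destruct (HP ltac:(lia)) as [L HL]. destruct (HP' ltac:(lia)) as [L' HL'].
  pose proof (pow2_pos l).
  set (s := fun i => if i <? NC + A then i else i + 2 ^ l).
  exists (fun t => L (remap (okx l) (fun i => i) t) /\ L' (remap (okx l) s t)). intros e He.
  assert (E1 : forall u u1, (forall i, i < 2 ^ l -> u i = u1 i) ->
     remap (okx l) (fun i => i) (atoms (okx (S l)) (mk e u)) = atoms (okx l) (mk e u1)).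
  { intros u u1 Hu. apply remap_atoms. intros i. rewrite !okx_spec. cbn [Nat.pow]. intros Hi. split; [lia|].
    mkc; auto. apply Hu. lia. }
  assert (E2 : forall u u1, (forall i, i < 2 ^ l -> u (i + 2 ^ l) = u1 i) ->
     remap (okx l) s (atoms (okx (S l)) (mk e u)) = atoms (okx l) (mk e u1)).
  { intros u u1 Hu. apply remap_atoms. intros i. rewrite !okx_spec. cbn [Nat.pow]. intros Hi. unfold s.
    mkc; (split; [lia|]); try reflexivity. rewrite <- Hu by lia. f_equal. lia. }
  rewrite HL, HL' by auto. split.
  - intros [(u1 & Hu1 & H1) (u2 & Hu2 & H2)].
    exists (fun i => if i <? 2 ^ l then u1 i else u2 (i - 2 ^ l)). split.
    + intros i. destruct (i <? 2 ^ l); auto.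
    + rewrite (E1 _ u1), (E2 _ u2); auto.
      * intros i Hi. destruct (Nat.ltb_spec (i + 2 ^ l) (2 ^ l)); [lia|]. f_equal. lia.
      * intros i Hi. destruct (Nat.ltb_spec i (2 ^ l)); [reflexivity|lia].
  - intros (u & Hu & H1 & H2). rewrite (E1 u u) in H1 by auto.
    rewrite (E2 u (fun i => u (i + 2 ^ l))) in H2 by auto. split; [eauto|].
    eexists; split; [|exact H2]. intros i. apply Hu.
Qed.

Lemma EX_or : forall l P P', EX l P -> EX l P' -> EX (S l) (fun e => P e \/ P' e).
Proof.
  intros l P P' HP HP'. apply (EX_mono l); [lia|]. intros HA.
  destruct (HP HA) as [L HL]. destruct (HP' HA) as [L' HL'].
  exists (fun t => L t \/ L' t). intros e He. rewrite HL, HL' by auto.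
  split.
  - intros [(u & Hu & H)|(u & Hu & H)]; eauto.
  - intros (u & Hu & [H|H]); eauto.
Qed.

(** Only the addressing of the pattern changes; the [k] additional levels make the renamed variables
    visible. *)
Lemma EX_ren : forall l k (r : nat -> nat) P, (forall i, r i <= i + k) ->
  EX l P -> EX (l + k) (fun e => P (fun i => e (r i))).
Proof.
  intros l k r P Hr HP HA. destruct (HP ltac:(lia)) as [L HL].
  assert (Hp : 2 ^ l <= 2 ^ (l + k)) by (apply Nat.pow_le_mono_r; lia).
  set (s := fun i => if (NC <=? i) && (i <? NC + A) then NC + r (i - NC) else i).
  exists (fun t => L (remap (okx l) s t)). intros e He.
  rewrite HL by (intros i; apply He).
  assert (Heq : forall u, remap (okx l) s (atoms (okx (l + k)) (mk e u))
                          = atoms (okx l) (mk (fun i => e (r i)) u)).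
  { intros u. apply remap_atoms. intros i. rewrite !okx_spec. intros Hi. unfold s.
    destruct (Nat.leb_spec NC i); destruct (Nat.ltb_spec i (NC + A)); cbn [andb].
    - pose proof (Hr (i - NC)). split; [lia|]. mkc; f_equal; lia.
    - split; [lia|]. mkc; reflexivity.
    - split; [lia|]. mkc; reflexivity.
    - lia. }
  split; intros (u & Hu & H); exists u; split; auto; [rewrite Heq|rewrite Heq in H]; auto.
Qed.

Lemma EX_atom_gen : forall c i j k (b : bool), i < S0 -> j < S0 -> k < S0 ->
  EX 0 (fun e => atomb c (e i) (e j) (e k) = b).
Proof.
  intros c i j k b Hi Hj Hk HA.
  exists (fun t => t c (NC + i) (NC + j) (NC + k) = b). intros e He.
  assert (Heq : forall u, atoms (okx 0) (mk e u) c (NC + i) (NC + j) (NC + k) = atomb c (e i) (e j) (e k)).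
  { intros u. unfold atoms.
    assert (Hok : forall x, x < S0 -> okx 0 (NC + x) = true) by (intros x Hx; apply okx_spec; lia).
    assert (Hv : forall x, x < S0 -> mk e u (NC + x) = e x) by (intros x Hx; mkc; f_equal; lia).
    rewrite !Hok, !Hv by auto. reflexivity. }
  split.
  - intros H. exists e. split; auto. now rewrite Heq.
  - intros (u & Hu & H). now rewrite Heq in H.
Qed.

Lemma EX_definable : definability Bd EX (fun c => In c cs) S0.
Proof.
  split.
  - intros l P P' H HP HA. destruct (HP HA) as [L HL]. exists L. intros e He.
    rewrite <- H by auto. auto.
  - apply EX_mono.
  - intros c i j k Hi Hj Hk HA.
    destruct (EX_atom_gen c i j k true Hi Hj Hk HA) as [L HL]. exists L. intros e He.
    rewrite <- HL by auto. symmetry. apply atomb_spec.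
  - intros c i j k Hi Hj Hk HA.
    destruct (EX_atom_gen c i j k false Hi Hj Hk HA) as [L HL]. exists L. intros e He.
    rewrite <- HL by auto. rewrite <- atomb_spec. destruct (atomb c (e i) (e j) (e k)); intuition congruence.
  - apply EX_and.
  - apply EX_or.
  - apply EX_ex.
  - apply EX_ren.
  - intros c Hc Hl HA. destruct (In_nth cs c 0 Hc) as (n & Hn & En).
    (* Equality with the constant stored at position [n] is read off from two conjunction atoms:
       each of the words contains the bits of the other. *)
    exists (fun t => t KAnd NC n NC = true /\ t KAnd NC n n = true). intros e He.
    assert (Heq : forall u x, atoms (okx 0) (mk e u) KAnd NC n x = okx 0 x && (Nat.land (e 0) c =? mk e u x)).
    { intros u x. unfold atoms.
      assert (H1 : okx 0 NC = true) by (apply okx_spec; lia).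
      assert (H2 : okx 0 n = true) by (apply okx_spec; lia).
      rewrite H1, H2. cbn [andb atomb]. 
      assert (H3 : mk e u NC = e 0) by (mkc; f_equal; lia).
      assert (H4 : mk e u n = c) by (mkc; auto).
      now rewrite H3, H4. }
    assert (H1 : okx 0 NC = true) by (apply okx_spec; lia).
    assert (H2 : okx 0 n = true) by (apply okx_spec; lia).
    assert (H3 : forall u, mk e u NC = e 0) by (intros; mkc; f_equal; lia).
    assert (H4 : forall u, mk e u n = c) by (intros; mkc; auto).
    split.
    + intros E. exists e. split; auto. rewrite !Heq, H1, H2, H3, H4, E, Nat.land_diag, Nat.eqb_refl. auto.
    + intros (u & Hu & E1 & E2). rewrite Heq, H1, H3 in E1. rewrite Heq, H2, H4 in E2.
      cbn in E1, E2. apply Nat.eqb_eq in E1, E2. congruence.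
Qed.

Definition EXclass : dclass := DClass Bd EX (fun c => In c cs) S0 EX_definable HS0 HBd.

(** Brings every formula into the one shape that the test evaluates: [V] given words followed by [V]
    guessed ones. *)
Lemma EX_layout : forall l P V, EX l P -> S0 + l <= A -> NC + A <= V -> 2 ^ l <= V ->
  exists L : table -> Prop, forall e, bde Bd e ->
    (P e <-> exists u, bde Bd u /\
       L (atoms (fun i => i <? 2 * V) (layout V (inputs_of e) u))).
Proof.
  intros l P V HP HA HV Hl. destruct (HP HA) as [L HL].
  set (s := fun i => if i <? NC + A then i else i - (NC + A) + V).
  exists (fun t => L (remap (okx l) s t)). intros e He. rewrite HL by auto.
  assert (Heq : forall u, remap (okx l) s (atoms (fun i => i <? 2 * V) (layout V (inputs_of e) u))
                          = atoms (okx l) (mk e u)).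
  { intros u. apply remap_atoms. intros i. rewrite okx_spec, Nat.ltb_lt. intros Hi. unfold s, layout, mk.
    destruct (Nat.ltb_spec i (NC + A)).
    - destruct (Nat.ltb_spec i V); [|lia]. split; [lia|reflexivity].
    - destruct (Nat.ltb_spec (i - (NC + A) + V) V); [lia|]. split; [lia|]. f_equal. lia. }
  split; intros (u & Hu & H); exists u; split; auto; [rewrite Heq|rewrite Heq in H]; auto.
Qed.

End ExistentialClass.

(** * Compiling straight-line code for the machine *)

Definition iname (i : instr) : nat :=
  match i with
  | Halt => 0
  | Arith Zero => 1 | Arith One => 2 | Arith WordLength => 3 | Arith MaxWord => 4
  | Arith Exp2 => 5 | Arith Not => 6 | Arith Defs.Add => 7 | Arith Mul => 8 | Arith Div => 9
  | Arith Max => 10 | Arith Min => 11 | Arith And => 12 | Arith Or => 13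
  | Move Acc Aux => 14 | Move Acc Adr => 15 | Move Aux Acc => 16 | Move Aux Adr => 17
  | Move Adr Acc => 18 | Move Adr Aux => 19
  | Read => 20 | Write => 21 | Jump => 22 | JumpZero => 23 | Input => 24 | Output => 25
  | Move _ _ => 0
  end.

Definition named (i : instr) : Prop := decode (iname i) = Some i.

(** The state without program counter and halting flag, which is what straight-line code acts on. *)
Record cfg := Cfg { ca : nat; cx : nat; cd : nat; cm : nat -> nat; ci : list nat; co : list nat }.

Definition simple (i : instr) : bool :=
  match i with Halt | Jump | JumpZero => false | _ => true end.

Definition creg (c : cfg) (r : register) : nat :=
  match r with Acc => ca c | Aux => cx c | Adr => cd c end.

Definition cset (c : cfg) (r : register) (v : nat) : cfg :=
  match r with
  | Acc => Cfg v (cx c) (cd c) (cm c) (ci c) (co c)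
  | Aux => Cfg (ca c) v (cd c) (cm c) (ci c) (co c)
  | Adr => Cfg (ca c) (cx c) v (cm c) (ci c) (co c)
  end.

Definition ceff (n : nat) (i : instr) (c : cfg) : cfg :=
  match i with
  | Arith o => cset c Acc (arith_eval n o (ca c) (cx c))
  | Move d e => cset c d (creg c e)
  | Read => cset c Acc (cm c (cd c))
  | Write => Cfg (ca c) (cx c) (cd c) (set_mem (cm c) (cd c) (ca c)) (ci c) (co c)
  | Input => Cfg (hd 0 (ci c)) (cx c) (cd c) (cm c) (tl (ci c)) (co c)
  | Output => Cfg (ca c) (cx c) (cd c) (cm c) (ci c) (co c ++ [ca c])
  | _ => c
  end.

Definition ceffs (n : nat) (code : list instr) (c : cfg) : cfg :=
  fold_left (fun c i => ceff n i c) code c.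

Definition touches (i : instr) : bool := match i with Read | Write => true | _ => false end.

Fixpoint okc (n D : nat) (code : list instr) (c : cfg) : Prop :=
  match code with
  | [] => True
  | i :: code' => (touches i = true -> cd c < D) /\ okc n D code' (ceff n i c)
  end.

Definition codeok (code : list instr) : Prop := Forall (fun i => simple i = true /\ named i) code.

Definition sim (p : nat) (s : state) (c : cfg) : Prop :=
  pc s = p /\ halted s = false /\ reg s Acc = ca c /\ reg s Aux = cx c /\ reg s Adr = cd c /\
  mem s = cm c /\ inputs s = ci c /\ outputs s = co c.

Lemma sim_step : forall n p s c i, sim p s c -> simple i = true -> named i ->
  mem s p = iname i -> S p < 2 ^ n -> sim (S p) (step n s) (ceff n i c).
Proof.
  intros n p s c i (Hp & Hh & Ha & Hx & Hd & Hm & Hi & Ho) Hs Hn Hf Hb.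
  unfold step. rewrite Hh, Hp, Hf, Hn. rewrite (Nat.mod_small _ _ Hb).
  unfold sim. destruct i as [|o|d e| | | | | |]; try discriminate; cbn [pc halted reg mem inputs outputs];
    rewrite ?Hi, ?Ho, ?Hm; try (cbn; rewrite ?Ha, ?Hx, ?Hd; auto 10; fail).
  destruct d, e; cbn; rewrite ?Ha, ?Hx, ?Hd; auto 10.
Qed.

Lemma ceff_mem : forall n D i c, (touches i = true -> cd c < D) ->
  forall a, D <= a -> cm (ceff n i c) a = cm c a.
Proof.
  intros n D i c H a Ha. destruct i as [|o|d e| | | | | |]; cbn; auto.
  - now destruct d.
  - specialize (H eq_refl). unfold set_mem. destruct (Nat.eqb_spec a (cd c)); [lia|reflexivity].
Qed.

Lemma sim_cells : forall D lim p s c i, sim p s c -> mem s p = iname i -> named i ->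
  (touches i = true -> cd c < D) -> D <= lim -> p < lim ->
  Forall (fun a => a < lim) (cells_used s).
Proof.
  intros D lim p s c i (Hp & Hh & Ha & Hx & Hd & Hm & Hi & Ho) Hf Hn Ht HD Hpl.
  unfold cells_used. rewrite Hh, Hp, Hf, Hn. constructor; auto.
  destruct i; auto; constructor; auto; rewrite Hd; specialize (Ht eq_refl); lia.
Qed.

(** Code placed at [D] or above accesses only cells below [D], so it cannot overwrite itself and the
    fetched instructions are the original ones. *)
Lemma sim_code : forall n D lim code p s c, sim p s c -> codeok code ->
  (forall j, j < length code -> mem s (p + j) = iname (nth j code Halt)) ->
  D <= p -> p + length code < 2 ^ n -> p + length code <= lim -> okc n D code c ->
  sim (p + length code) (Nat.iter (length code) (step n) s) (ceffs n code c) /\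
  (forall a, D <= a -> cm (ceffs n code c) a = cm c a) /\
  (forall t, t < length code -> Forall (fun a => a < lim) (cells_used (Nat.iter t (step n) s))).
Proof.
  intros n D lim. induction code as [|i code IH]; intros p s c Hsim Hc Hm HD Hb Hl Hok.
  - cbn. rewrite Nat.add_0_r. repeat split; try apply Hsim; auto. intros; lia.
  - inversion Hc as [|? ? [Hs Hn] Hc']; subst. destruct Hok as [Ht Hok].
    cbn [length] in *.
    assert (Hf : mem s p = iname i).
    { specialize (Hm 0 ltac:(lia)). rewrite Nat.add_0_r in Hm. exact Hm. }
    pose proof (sim_step n p s c i Hsim Hs Hn Hf ltac:(lia)) as Hsim1.
    pose proof (ceff_mem n D i c Ht) as Hmem1.
    destruct (IH (S p) (step n s) (ceff n i c) Hsim1 Hc') as (R1 & R2 & R3); try lia; auto.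
    + intros j Hj. replace (S p + j) with (p + S j) by lia.
      destruct Hsim1 as (_ & _ & _ & _ & _ & Em1 & _). destruct Hsim as (_ & _ & _ & _ & _ & Em & _).
      rewrite Em1, Hmem1 by lia. rewrite <- Em. rewrite (Hm (S j)) by lia. reflexivity.
    + repeat split.
      * replace (p + S (length code)) with (S p + length code) by lia.
        rewrite Nat.iter_succ_r. exact (proj1 R1).
      * rewrite Nat.iter_succ_r. apply R1.
      * rewrite Nat.iter_succ_r. apply R1.
      * rewrite Nat.iter_succ_r. apply R1.
      * rewrite Nat.iter_succ_r. apply R1.
      * rewrite Nat.iter_succ_r. apply R1.
      * rewrite Nat.iter_succ_r. apply R1.
      * rewrite Nat.iter_succ_r. apply R1.
      * intros a Ha. cbn. fold (ceffs n code (ceff n i c)). rewrite R2 by auto. auto.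
      * intros [|t] Hlt.
        -- cbn. eapply sim_cells; eauto; lia.
        -- rewrite Nat.iter_succ_r. apply R3. lia.
Qed.

Lemma okc_app : forall n D c1 c2 c, okc n D c1 c -> okc n D c2 (ceffs n c1 c) -> okc n D (c1 ++ c2) c.
Proof. intros n D c1. induction c1 as [|i c1 IH]; cbn; intros c2 c H1 H2; auto. destruct H1; split; auto. Qed.

Lemma ceffs_app : forall n c1 c2 c, ceffs n (c1 ++ c2) c = ceffs n c2 (ceffs n c1 c).
Proof. intros. unfold ceffs. now rewrite fold_left_app. Qed.

(** Instructions carry no operands, so a constant is built by repeatedly adding 1, in about [k]
    instructions. *)
Definition setk (k : nat) : list instr :=
  [Arith One; Move Aux Acc] ++ repeat (Arith Defs.Add) (k - 1).

Lemma setk_rep : forall n D j a d m i o, a + j < 2 ^ n ->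
  ceffs n (repeat (Arith Defs.Add) j) (Cfg a 1 d m i o) = Cfg (a + j) 1 d m i o /\
  okc n D (repeat (Arith Defs.Add) j) (Cfg a 1 d m i o).
Proof.
  intros n D. induction j as [|j IH]; intros a d m i o H.
  - cbn. now rewrite Nat.add_0_r.
  - cbn [repeat]. destruct (IH (a + 1) d m i o ltac:(lia)) as [H1 H2].
    assert (E : ceff n (Arith Defs.Add) (Cfg a 1 d m i o) = Cfg (a + 1) 1 d m i o).
    { cbn [ceff cset ca cx cd cm ci co arith_eval]. rewrite Nat.mod_small by lia. reflexivity. }
    split.
    + change (ceffs n (Arith Defs.Add :: repeat (Arith Defs.Add) j) (Cfg a 1 d m i o))
        with (ceffs n (repeat (Arith Defs.Add) j) (ceff n (Arith Defs.Add) (Cfg a 1 d m i o))).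
      rewrite E, H1. f_equal. lia.
    + split; [discriminate|]. rewrite E. exact H2.
Qed.

Lemma setk_ok : forall n D k a x d m i o, 0 < k -> k < 2 ^ n ->
  ceffs n (setk k) (Cfg a x d m i o) = Cfg k 1 d m i o /\ okc n D (setk k) (Cfg a x d m i o).
Proof.
  intros n D k a x d m i o H0 Hk. unfold setk.
  destruct (setk_rep n D (k - 1) 1 d m i o ltac:(lia)) as [H1 H2]. split.
  - rewrite ceffs_app.
    change (ceffs n [Arith One; Move Aux Acc] (Cfg a x d m i o)) with (Cfg 1 1 d m i o).
    rewrite H1. f_equal. lia.
  - apply okc_app; cbn [okc touches]; [repeat split; discriminate|].
    exact H2.
Qed.

(* The addresses 4 and 16 are reachable by iterating [Exp2] in the accumulator, hence
   without disturbing [Aux]: cells 4 and 16 serve as scratch space. *)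
Definition fix4 : list instr := [Arith One; Arith Exp2; Arith Exp2; Move Adr Acc].
Definition fix16 : list instr := [Arith One; Arith Exp2; Arith Exp2; Arith Exp2; Move Adr Acc].
Definition save4 : list instr := [Move Aux Acc] ++ fix4 ++ [Move Acc Aux; Write].
Definition load (k : nat) : list instr := setk k ++ [Move Adr Acc; Read].
(** The value to be stored waits in cell 4. Building [k] overwrites [Acc] and [Aux], so the address
    is parked in cell 16 while the value is fetched. *)
Definition store4 (k : nat) : list instr :=
  setk k ++ [Move Aux Acc] ++ fix16 ++ [Move Acc Aux; Write] ++ fix4 ++ [Read; Move Aux Acc]
  ++ fix16 ++ [Read; Move Adr Acc; Move Acc Aux; Write].
Definition emit (o : arith) (i j k : nat) : list instr :=
  load i ++ save4 ++ load j ++ [Move Aux Acc] ++ fix4 ++ [Read; Arith o] ++ save4 ++ store4 k.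

Lemma exp_vals : forall n, 6 <= n ->
  Nat.min (2 ^ 1) (2 ^ n - 1) = 2 /\ Nat.min (2 ^ 2) (2 ^ n - 1) = 4 /\ Nat.min (2 ^ 4) (2 ^ n - 1) = 16.
Proof.
  intros n Hn. assert (2 ^ 6 <= 2 ^ n) by (apply Nat.pow_le_mono_r; lia).
  change (2 ^ 6) with 64 in H. change (2 ^ 1) with 2. change (2 ^ 2) with 4. change (2 ^ 4) with 16. lia.
Qed.

Section Emit.

Variable n : nat.
Hypothesis Hn : 9 <= n.

Lemma n256 : 512 <= 2 ^ n.
Proof. change 512 with (2 ^ 9). apply Nat.pow_le_mono_r; lia. Qed.

Ltac crun := cbn [ceffs fold_left app ceff cset creg ca cx cd cm ci co arith_eval fix4 fix16 save4];
  destruct (exp_vals n ltac:(lia)) as (V1 & V2 & V4); rewrite ?V1, ?V2, ?V4.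
Ltac cok := cbn [okc touches app ceff cset creg ca cx cd cm ci co arith_eval fix4 fix16 save4];
  destruct (exp_vals n ltac:(lia)) as (V1 & V2 & V4); rewrite ?V1, ?V2, ?V4; repeat split; try discriminate; try lia.

Lemma save4_ok : forall a x d m i o,
  ceffs n save4 (Cfg a x d m i o) = Cfg a a 4 (set_mem m 4 a) i o /\ okc n 256 save4 (Cfg a x d m i o).
Proof. intros. split; [crun; reflexivity|cok]. Qed.

Lemma load_ok : forall k a x d m i o, 0 < k -> k < 256 ->
  ceffs n (load k) (Cfg a x d m i o) = Cfg (m k) 1 k m i o /\ okc n 256 (load k) (Cfg a x d m i o).
Proof.
  intros k a x d m i o H0 H1. pose proof n256. unfold load.
  destruct (setk_ok n 256 k a x d m i o H0 ltac:(lia)) as [E1 E2]. split.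
  - rewrite ceffs_app, E1. crun. reflexivity.
  - apply okc_app; auto. rewrite E1. cok.
Qed.

Lemma store4_ok : forall k a x d m i o, 16 < k -> k < 256 ->
  exists a' x' d', ceffs n (store4 k) (Cfg a x d m i o)
    = Cfg a' x' d' (set_mem (set_mem m 16 k) k (m 4)) i o /\ okc n 256 (store4 k) (Cfg a x d m i o).
Proof.
  intros k a x d m i o H0 H1. pose proof n256. unfold store4.
  destruct (setk_ok n 256 k a x d m i o ltac:(lia) ltac:(lia)) as [E1 E2].
  assert (S1 : set_mem m 16 k 4 = m 4) by reflexivity.
  assert (S2 : set_mem m 16 k 16 = k) by reflexivity.
  do 3 eexists. split.
  - rewrite ceffs_app, E1. crun. rewrite S1, S2. reflexivity.
  - apply okc_app; auto. rewrite E1. cok; rewrite ?S2; lia.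
Qed.

Lemma emit_ok : forall op i j k a x d m inp o, 16 < i < 256 -> 16 < j < 256 -> 16 < k < 256 ->
  exists a' x' d' m', ceffs n (emit op i j k) (Cfg a x d m inp o) = Cfg a' x' d' m' inp o /\
    okc n 256 (emit op i j k) (Cfg a x d m inp o) /\
    m' k = arith_eval n op (m i) (m j) /\
    forall q, 16 < q -> q <> k -> m' q = m q.
Proof.
  intros op i j k a x d m inp o Hi Hj Hk. unfold emit.
  destruct (load_ok i a x d m inp o ltac:(lia) ltac:(lia)) as [E1 O1].
  destruct (save4_ok (m i) 1 i m inp o) as [E2 O2].
  set (m1 := set_mem m 4 (m i)) in *.
  destruct (load_ok j (m i) (m i) 4 m1 inp o ltac:(lia) ltac:(lia)) as [E3 O3].
  assert (Hmj : m1 j = m j).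
  { unfold m1, set_mem. destruct (Nat.eqb_spec j 4); [lia|reflexivity]. }
  set (mid := [Move Aux Acc] ++ fix4 ++ [Read; Arith op]).
  assert (E4 : ceffs n mid (Cfg (m1 j) 1 j m1 inp o) = Cfg (arith_eval n op (m i) (m1 j)) (m1 j) 4 m1 inp o).
  { unfold mid. crun. reflexivity. }
  assert (O4 : okc n 256 mid (Cfg (m1 j) 1 j m1 inp o)) by (unfold mid; cok).
  set (r := arith_eval n op (m i) (m1 j)) in *.
  destruct (save4_ok r (m1 j) 4 m1 inp o) as [E5 O5].
  set (m2 := set_mem m1 4 r) in *.
  destruct (store4_ok k r r 4 m2 inp o ltac:(lia) ltac:(lia)) as (a' & x' & d' & E6 & O6).
  replace (load i ++ save4 ++ load j ++ [Move Aux Acc] ++ fix4 ++ [Read; Arith op] ++ save4 ++ store4 k)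
    with (load i ++ save4 ++ load j ++ mid ++ save4 ++ store4 k) by (unfold mid; now rewrite <- !app_assoc).
  exists a', x', d', (set_mem (set_mem m2 16 k) k (m2 4)). split; [|split; [|split]].
  - rewrite !ceffs_app, E1, E2, E3, E4, E5. exact E6.
  - apply okc_app; [exact O1|]. rewrite E1. apply okc_app; [exact O2|]. rewrite E2.
    apply okc_app; [exact O3|]. rewrite E3. apply okc_app; [exact O4|]. rewrite E4.
    apply okc_app; [exact O5|]. rewrite E5. exact O6.
  - unfold set_mem at 1. rewrite Nat.eqb_refl. unfold m2, set_mem. cbn [Nat.eqb]. unfold r. now rewrite Hmj.
  - intros q Hq Hqk. unfold m2, m1, set_mem.
    destruct (Nat.eqb_spec q k); [lia|]. destruct (Nat.eqb_spec q 16); [lia|].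
    destruct (Nat.eqb_spec q 4); [lia|reflexivity].
Qed.

End Emit.

Definition slp : Type := list (arith * nat * nat).

Definition vals (n : nat) (p : slp) (l : list nat) : list nat :=
  fold_left (fun vs q => vs ++ [arith_eval n (fst (fst q)) (nth (snd (fst q)) vs 0) (nth (snd q) vs 0)]) p l.

Fixpoint emits (k : nat) (p : slp) : list instr :=
  match p with
  | [] => []
  | (o, i, j) :: p' => emit o (20 + i) (20 + j) (20 + k) ++ emits (S k) p'
  end.

(** Value [k] lives in cell [20 + k], above the scratch cells; the bound 200 keeps all of them below
    256, the region of data. *)
Fixpoint wf (k : nat) (p : slp) : bool :=
  match p with
  | [] => true
  | (o, i, j) :: p' => (i <? k) && (j <? k) && (k <? 200) && wf (S k) p'
  end.

Lemma emits_ok : forall n p l a x d m inp o, 9 <= n -> wf (length l) p = true ->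
  (forall q, q < length l -> m (20 + q) = nth q l 0) ->
  exists a' x' d' m', ceffs n (emits (length l) p) (Cfg a x d m inp o) = Cfg a' x' d' m' inp o /\
    okc n 256 (emits (length l) p) (Cfg a x d m inp o) /\
    (forall q, q < length l + length p -> m' (20 + q) = nth q (vals n p l) 0).
Proof.
  intros n p. induction p as [|[[op i] j] p IH]; intros l a x d m inp o Hn Hwf Hm.
  - cbn. exists a, x, d, m. repeat split; auto. intros q Hq. apply Hm. lia.
  - cbn [wf] in Hwf. rewrite !andb_true_iff, !Nat.ltb_lt in Hwf. destruct Hwf as (((H1 & H2) & H3) & H4).
    cbn [emits].
    destruct (emit_ok n Hn op (20 + i) (20 + j) (20 + length l) a x d m inp o ltac:(lia) ltac:(lia) ltac:(lia))
      as (a1 & x1 & d1 & m1 & E1 & O1 & V1 & K1).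
    set (v := arith_eval n op (nth i l 0) (nth j l 0)).
    assert (Hlen : length (l ++ [v]) = S (length l)) by (rewrite length_app; cbn; lia).
    destruct (IH (l ++ [v]) a1 x1 d1 m1 inp o Hn) as (a2 & x2 & d2 & m2 & E2 & O2 & V2).
    + rewrite Hlen. exact H4.
    + intros q Hq. rewrite Hlen in Hq. destruct (Nat.eq_dec q (length l)) as [->|Hne].
      * rewrite V1, nth_middle, !Hm by auto. reflexivity.
      * rewrite app_nth1 by lia. rewrite K1 by lia. apply Hm. lia.
    + rewrite Hlen in E2, O2, V2. exists a2, x2, d2, m2. split; [|split].
      * rewrite ceffs_app, E1. exact E2.
      * apply okc_app; auto. rewrite E1. exact O2.
      * intros q Hq. cbn [length] in Hq. rewrite V2 by lia. reflexivity.
Qed.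

Lemma vals_app : forall n p1 p2 l, vals n (p1 ++ p2) l = vals n p2 (vals n p1 l).
Proof. intros. unfold vals. now rewrite fold_left_app. Qed.

Lemma vals_length : forall n p l, length (vals n p l) = length l + length p.
Proof.
  intros n. induction p as [|q p IH]; intros l; cbn; [lia|].
  change (fold_left _ p ?z) with (vals n p z). rewrite IH, length_app. cbn. lia.
Qed.

Lemma vals_prefix : forall n p l q, q < length l -> nth q (vals n p l) 0 = nth q l 0.
Proof.
  intros n. induction p as [|r p IH]; intros l q Hq; cbn; [reflexivity|].
  change (fold_left _ p ?z) with (vals n p z). rewrite IH by (rewrite length_app; lia).
  now rewrite app_nth1.
Qed.

(** Values are never overwritten, so each instruction is an equation between entries of the final
    list. The verifier is analysed through these equations alone. *)
Lemma vals_eq : forall n p l s o i j, nth_error p s = Some (o, i, j) ->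
  i < length l + s -> j < length l + s ->
  nth (length l + s) (vals n p l) 0 = arith_eval n o (nth i (vals n p l) 0) (nth j (vals n p l) 0).
Proof.
  intros n p l s o i j Hs Hi Hj.
  destruct (nth_error_split p s Hs) as (p1 & p2 & -> & Hlen).
  rewrite vals_app. change ((o, i, j) :: p2) with ([(o, i, j)] ++ p2). rewrite vals_app.
  pose proof (vals_length n p1 l) as L1.
  assert (L2 : length (vals n [(o, i, j)] (vals n p1 l)) = S (length l + s)).
  { rewrite vals_length, L1, Hlen. cbn. lia. }
  rewrite !(vals_prefix n p2) by lia.
  cbn [vals fold_left fst snd]. rewrite !(app_nth1 _ _ _ (n := i)), !(app_nth1 _ _ _ (n := j)) by lia.
  replace (length l + s) with (length (vals n p1 l)) by lia. apply nth_middle.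
Qed.

Lemma step_halted : forall n s, halted s = true -> step n s = s.
Proof. intros n s H. unfold step. now rewrite H. Qed.

Lemma iter_halted : forall n s t, halted s = true -> Nat.iter t (step n) s = s.
Proof. intros n s t H. induction t as [|t IH]; [reflexivity|]. rewrite Nat.iter_succ, IH. now apply step_halted. Qed.

Lemma outputs_step : forall n s, exists l, outputs (step n s) = outputs s ++ l.
Proof.
  intros n s. unfold step. destruct (halted s); [exists []; now rewrite app_nil_r|].
  destruct (decode (mem s (pc s))) as [[]|]; cbn; try (exists []; now rewrite app_nil_r).
  eauto.
Qed.

Lemma outputs_iter : forall n s t t', t <= t' ->
  exists l, outputs (Nat.iter t' (step n) s) = outputs (Nat.iter t (step n) s) ++ l.
Proof.
  intros n s t t' H. induction H as [|t' H [l IH]]; [exists []; now rewrite app_nil_r|].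
  rewrite Nat.iter_succ. destruct (outputs_step n (Nat.iter t' (step n) s)) as [l' E].
  exists (l ++ l'). rewrite E, IH. now rewrite app_assoc.
Qed.

Lemma outputs_within_mono : forall n p xs v t t', t <= t' ->
  outputs_within n p xs v t -> outputs_within n p xs v t'.
Proof.
  intros n p xs v t t' H. unfold outputs_within, run.
  destruct (outputs_iter n (init p xs) t t' H) as [l ->].
  destruct (outputs (Nat.iter t (step n) (init p xs))); cbn; auto. discriminate.
Qed.

Lemma outputs_within_fun : forall n p xs v v' t t',
  outputs_within n p xs v t -> outputs_within n p xs v' t' -> v = v'.
Proof.
  intros n p xs v v' t t' H H'.
  apply (outputs_within_mono n p xs v t (Nat.max t t')) in H; [|lia].
  apply (outputs_within_mono n p xs v' t' (Nat.max t t')) in H'; [|lia].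
  unfold outputs_within in *. congruence.
Qed.

Lemma okc_notouch : forall n D code c, forallb (fun i => negb (touches i)) code = true -> okc n D code c.
Proof.
  intros n D code. induction code as [|i code IH]; intros c H; cbn; auto.
  cbn in H. apply andb_true_iff in H. destruct H as [H1 H2]. split; auto.
  intros E. now rewrite E in H1.
Qed.

(** Leaves [40 / n] in [Acc] and [256 = 16 * 16] in [Adr], so the conditional jump that follows is
    taken exactly when [n > 40]. Shorter words may not be able to address the whole program and get
    the answer 0. *)
Definition pre1 : list instr :=
  [Arith WordLength; Move Adr Acc] ++ setk 40 ++ [Move Aux Adr; Arith Div; Move Adr Acc]
  ++ setk 16 ++ [Move Aux Acc; Arith Mul] ++ [Move Aux Acc; Move Acc Adr; Move Adr Aux].

Definition pre : list instr := pre1 ++ [JumpZero; Arith Zero; Output; Halt].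

(** The data cells lie below 256, so the main code starts there; the preamble may be overwritten
    once it has jumped. *)
Definition padded : list instr := pre ++ repeat Halt (256 - length pre).

Definition mainseg (p : slp) : list instr :=
  [Input] ++ save4 ++ store4 20 ++ [Input] ++ save4 ++ store4 21
  ++ emits 2 p ++ load (20 + (1 + length p)) ++ [Output].

Definition code_of (p : slp) : list instr := padded ++ mainseg p ++ [Halt].

Definition prog (p : slp) : program := map iname (code_of p).

Lemma pre1_ok : forall n m i, 11 <= n ->
  ceffs n pre1 (Cfg 0 0 0 m i []) = Cfg (40 / n) 256 256 m i [].
Proof.
  intros n m i Hn. assert (H : 2 ^ 9 <= 2 ^ n) by (apply Nat.pow_le_mono_r; lia).
  change (2 ^ 9) with 512 in H.
  unfold pre1. rewrite !ceffs_app.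
  change (ceffs n [Arith WordLength; Move Adr Acc] (Cfg 0 0 0 m i [])) with (Cfg n 0 n m i []).
  rewrite (proj1 (setk_ok n 0 40 n 0 n m i [] ltac:(lia) ltac:(lia))).
  change (ceffs n [Move Aux Adr; Arith Div; Move Adr Acc] (Cfg 40 1 n m i []))
    with (Cfg (40 / n) n (40 / n) m i []).
  rewrite (proj1 (setk_ok n 0 16 (40 / n) n (40 / n) m i [] ltac:(lia) ltac:(lia))).
  cbn [ceffs fold_left ceff cset creg ca cx cd cm ci co arith_eval].
  change (16 * 16) with 256. rewrite Nat.mod_small by lia. reflexivity.
Qed.

Lemma codeok_app : forall c1 c2, codeok c1 -> codeok c2 -> codeok (c1 ++ c2).
Proof. intros. now apply Forall_app. Qed.

Ltac ck := repeat (apply Forall_cons; [split; [reflexivity|reflexivity]|]); apply Forall_nil.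

Lemma codeok_setk : forall k, codeok (setk k).
Proof.
  intros k. apply codeok_app; [ck|]. apply Forall_forall. intros i Hi.
  apply repeat_spec in Hi. subst i. split; reflexivity.
Qed.

Lemma codeok_store4 : forall k, codeok (store4 k).
Proof. intros k. apply codeok_app; [apply codeok_setk|]. ck. Qed.

Lemma codeok_load : forall k, codeok (load k).
Proof. intros k. apply codeok_app; [apply codeok_setk|]. ck. Qed.

Lemma codeok_emit : forall o i j k, codeok (emit o i j k).
Proof.
  intros o i j k. unfold emit.
  do 5 (apply codeok_app; [first [apply codeok_load|ck]|]).
  apply codeok_app; [|apply codeok_app; [ck|apply codeok_store4]].
  constructor; [split; reflexivity|]. constructor; [|constructor]. split; [reflexivity|].
  destruct o; reflexivity.
Qed.

Lemma codeok_emits : forall p k, codeok (emits k p).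
Proof.
  induction p as [|[[o i] j] p IH]; intros k; [constructor|]. cbn [emits].
  apply codeok_app; [apply codeok_emit|apply IH].
Qed.

Lemma codeok_main : forall p, codeok (mainseg p).
Proof.
  intros p. unfold mainseg.
  repeat (apply codeok_app; [first [apply codeok_load|apply codeok_store4|apply codeok_emits|ck]|]). ck.
Qed.

Lemma codeok_pre1 : codeok pre1.
Proof. unfold pre1. repeat (apply codeok_app; [first [apply codeok_setk|ck]|]). ck. Qed.

Lemma length_setk : forall k, length (setk k) <= k + 2.
Proof. intros k. unfold setk. rewrite length_app, repeat_length. cbn. lia. Qed.

Lemma length_store4 : forall k, length (store4 k) <= k + 40.
Proof. intros k. unfold store4. rewrite length_app. pose proof (length_setk k). cbn [length app fix16 fix4]. lia. Qed.

Lemma length_load : forall k, length (load k) <= k + 4.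
Proof. intros k. unfold load. rewrite length_app. pose proof (length_setk k). cbn [length]. lia. Qed.

Lemma length_emits : forall p k, wf k p = true -> length (emits k p) <= 900 * length p.
Proof.
  induction p as [|[[o i] j] p IH]; intros k H; [cbn; lia|].
  cbn [wf] in H. rewrite !andb_true_iff, !Nat.ltb_lt in H. destruct H as (((H1 & H2) & H3) & H4).
  cbn [emits]. rewrite length_app. specialize (IH _ H4). unfold emit. rewrite !length_app.
  pose proof (length_load (20 + i)). pose proof (length_load (20 + j)). pose proof (length_store4 (20 + k)).
  cbn [length]. change (length save4) with 7. change (length fix4) with 4. lia.
Qed.

Lemma length_padded : length padded = 256.
Proof. reflexivity. Qed.

Section Program.

Variable p : slp.
Hypothesis p_wf : wf 2 p = true.
Hypothesis p_len : length p <= 190.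

Definition lim : nat := length (code_of p).

Lemma lim_eq : lim = 256 + (length (mainseg p) + 1).
Proof. unfold lim, code_of. rewrite !length_app, length_padded. reflexivity. Qed.

Lemma lim_bound : forall n, 41 <= n -> lim < 2 ^ n.
Proof.
  intros n Hn. rewrite lim_eq. unfold mainseg. rewrite !length_app.
  pose proof (length_emits p 2 p_wf). pose proof (length_load (20 + (1 + length p))).
  pose proof (length_store4 20). pose proof (length_store4 21).
  change (length save4) with 7. cbn [length].
  assert (2 ^ 9 * 2 ^ 9 <= 2 ^ n).
  { rewrite <- Nat.pow_add_r. apply Nat.pow_le_mono_r; lia. }
  change (2 ^ 9) with 512 in H3. lia.
Qed.

Lemma mem_init : forall xs j, mem (init (prog p) xs) j = iname (nth j (code_of p) Halt).
Proof. intros xs j. exact (map_nth iname (code_of p) Halt j). Qed.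

Definition pval (n : nat) (xs : list nat) : nat :=
  if n <=? 40 then 0 else nth (1 + length p) (vals n p [hd 0 xs; hd 0 (tl xs)]) 0.

Lemma pre_run : forall n xs, 10 < n -> exists s1,
  sim 68 s1 (Cfg (40 / n) 256 256 (mem s1) xs []) /\
  (forall j, mem s1 j = iname (nth j (code_of p) Halt)) /\
  (forall j, run n (prog p) xs (j + 68) = Nat.iter j (step n) s1) /\
  (forall t, t <= 68 -> Forall (fun a => a < lim) (cells_used (run n (prog p) xs t))).
Proof.
  intros n xs Hn. pose proof lim_eq as HL.
  assert (S0 : sim 0 (init (prog p) xs) (Cfg 0 0 0 (mem (init (prog p) xs)) xs [])) by (repeat split).
  assert (Hp1 : length pre1 = 68) by reflexivity.
  assert (P9 : 2 ^ 9 <= 2 ^ n) by (apply Nat.pow_le_mono_r; lia). change (2 ^ 9) with 512 in P9.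
  destruct (sim_code n 0 lim pre1 0 (init (prog p) xs) _ S0 codeok_pre1) as (R1 & R2 & R3); try lia.
  { intros j Hj. rewrite Nat.add_0_l, mem_init. f_equal. unfold code_of, padded, pre.
    rewrite <- !app_assoc. now rewrite app_nth1. }
  { now apply okc_notouch. }
  rewrite pre1_ok in R1 by lia. rewrite Hp1 in R1, R3. rewrite Nat.add_0_l in R1.
  destruct R1 as (Rpc & Rh & Ra & Rx & Rd & Rm & Ri & Ro). cbn [ca cx cd cm ci co] in Ra, Rx, Rd, Rm, Ri, Ro.
  exists (Nat.iter 68 (step n) (init (prog p) xs)).
  assert (Hc : forall j, mem (Nat.iter 68 (step n) (init (prog p) xs)) j = iname (nth j (code_of p) Halt)).
  { intros j. rewrite Rm. apply mem_init. }
  split; [exact (conj Rpc (conj Rh (conj Ra (conj Rx (conj Rd (conj eq_refl (conj Ri Ro)))))))|].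
  split; [exact Hc|]. split.
  - intros j. unfold run. now rewrite Nat.iter_add.
  - intros t Ht. destruct (Nat.eq_dec t 68) as [->|]; [|apply R3; lia].
    unfold cells_used, run. rewrite Rh, Rpc. constructor; [lia|]. rewrite Hc.
    replace (nth 68 (code_of p) Halt) with JumpZero; [cbn; constructor|].
    unfold code_of, padded, pre. rewrite <- !app_assoc. rewrite app_nth2 by lia. rewrite Hp1. reflexivity.
Qed.

Lemma code_exit : forall j, j < 4 ->
  nth (68 + j) (code_of p) Halt = nth j [JumpZero; Arith Zero; Output; Halt] Halt.
Proof.
  intros j Hj. unfold code_of, padded, pre. rewrite <- !app_assoc.
  assert (Hp1 : length pre1 = 68) by reflexivity.
  rewrite app_nth2 by lia. rewrite Hp1. replace (68 + j - 68) with j by lia.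
  rewrite app_nth1; [reflexivity|]. cbn. lia.
Qed.

Lemma code_main : forall j, nth (256 + j) (code_of p) Halt = nth j (mainseg p ++ [Halt]) Halt.
Proof.
  intros j. unfold code_of. rewrite app_nth2 by (rewrite length_padded; lia).
  rewrite length_padded. replace (256 + j - 256) with j by lia. reflexivity.
Qed.

(** A finite initial part of the run settles all times, since the state no longer changes after a
    halt. *)
Definition run_ok (n : nat) (xs : list nat) (v : nat) : Prop := exists t, t <= lim /\
  outputs (run n (prog p) xs t) = [v] /\
  halted (run n (prog p) xs (S t)) = true /\
  forall t', t' <= t -> Forall (fun a => a < lim) (cells_used (run n (prog p) xs t')).

(* [pc] reaches [target] by the conditional jump at cell 68, then [code] runs up to a [Halt]. *)
Lemma finish : forall n xs target code c D s1 c0, 10 < n -> D <= target ->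
  target + length code < lim -> target + length code < 2 ^ n -> 69 + length code <= lim ->
  (forall j, run n (prog p) xs (j + 68) = Nat.iter j (step n) s1) ->
  (forall t, t <= 68 -> Forall (fun a => a < lim) (cells_used (run n (prog p) xs t))) ->
  sim target (step n s1) c0 -> codeok code ->
  (forall j, j <= length code -> cm c0 (target + j) = iname (nth j (code ++ [Halt]) Halt)) ->
  okc n D code c0 -> ceffs n code c0 = c ->
  forall v, co c = [v] -> run_ok n xs v.
Proof.
  intros n xs target code c D s1 c0 Hn HD H1 H2 H3 Hrun Hcells S2 Hc Hm Hok Ec v Hv.
  assert (Em : mem (step n s1) = cm c0) by (destruct S2 as (_ & _ & _ & _ & _ & E & _); exact E).
  destruct (sim_code n D lim code target _ _ S2 Hc) as (Q1 & Q2 & Q3); try lia; auto.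
  { intros j Hj. rewrite Em, Hm by lia. now rewrite app_nth1. }
  rewrite Ec in Q1, Q2.
  assert (Er : forall j, run n (prog p) xs (69 + j) = Nat.iter j (step n) (step n s1)).
  { intros j. replace (69 + j) with (S j + 68) by lia. rewrite Hrun, Nat.iter_succ_r. reflexivity. }
  assert (Hsucc : forall t, run n (prog p) xs (S t) = step n (run n (prog p) xs t)).
  { intros t. unfold run. apply Nat.iter_succ. }
  destruct Q1 as (Qpc & Qh & Qa & Qx & Qd & Qm & Qi & Qo).
  rewrite <- Er in Qpc, Qh, Qm, Qo.
  assert (HH : mem (run n (prog p) xs (69 + length code)) (target + length code) = iname Halt).
  { rewrite Qm, Q2 by lia. rewrite Hm by lia. rewrite app_nth2 by lia. now rewrite Nat.sub_diag. }
  exists (69 + length code). split; [lia|]. split; [|split].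
  - rewrite Qo. exact Hv.
  - rewrite Hsucc. unfold step. rewrite Qh, Qpc, HH. reflexivity.
  - intros t' Ht'. destruct (Nat.le_gt_cases t' 68) as [L|L]; [auto|].
    destruct (Nat.eq_dec t' (69 + length code)) as [->|].
    + unfold cells_used. rewrite Qh, Qpc, HH. constructor; [lia|]. cbn. constructor.
    + replace t' with (69 + (t' - 69)) by lia. rewrite Er. apply Q3. lia.
Qed.

Lemma main_ok : forall n xs m0, 41 <= n ->
  co (ceffs n (mainseg p) (Cfg 0 256 256 m0 xs []))
    = [nth (1 + length p) (vals n p [hd 0 xs; hd 0 (tl xs)]) 0] /\
  okc n 256 (mainseg p) (Cfg 0 256 256 m0 xs []).
Proof.
  intros n xs m0 Hn. unfold mainseg. assert (Hn9 : 9 <= n) by lia.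
  remember (hd 0 xs) as x eqn:Ex. remember (hd 0 (tl xs)) as a eqn:Ea.
  assert (I1 : ceffs n [Input] (Cfg 0 256 256 m0 xs []) = Cfg x 256 256 m0 (tl xs) []) by (subst x; reflexivity).
  destruct (save4_ok n Hn9 x 256 256 m0 (tl xs) []) as [E1 O1].
  destruct (store4_ok n Hn9 20 x x 4 (set_mem m0 4 x) (tl xs) [] ltac:(lia) ltac:(lia))
    as (a2 & x2 & d2 & E2 & O2).
  remember (set_mem (set_mem (set_mem m0 4 x) 16 20) 20 (set_mem m0 4 x 4)) as m2 eqn:Em2.
  assert (I2 : ceffs n [Input] (Cfg a2 x2 d2 m2 (tl xs) []) = Cfg a x2 d2 m2 (tl (tl xs)) []) by (subst a; reflexivity).
  destruct (save4_ok n Hn9 a x2 d2 m2 (tl (tl xs)) []) as [E3 O3].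
  destruct (store4_ok n Hn9 21 a a 4 (set_mem m2 4 a) (tl (tl xs)) [] ltac:(lia) ltac:(lia))
    as (a4 & x4 & d4 & E4 & O4).
  remember (set_mem (set_mem (set_mem m2 4 a) 16 21) 21 (set_mem m2 4 a 4)) as m4 eqn:Em4.
  destruct (emits_ok n p [x; a] a4 x4 d4 m4 (tl (tl xs)) [] Hn9 p_wf) as (a5 & x5 & d5 & m5 & E5 & O5 & V5).
  { intros q Hq9. cbn [length] in Hq9. subst m4 m2. destruct q as [|[|q]]; [reflexivity|reflexivity|lia]. }
  destruct (load_ok n Hn9 (20 + (1 + length p)) a5 x5 d5 m5 (tl (tl xs)) [] ltac:(lia) ltac:(lia)) as [E6 O6].
  change (length [x; a]) with 2 in E5, O5, V5.
  assert (V : m5 (20 + (1 + length p)) = nth (1 + length p) (vals n p [x; a]) 0) by (apply V5; lia).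
  split.
  - rewrite !ceffs_app, I1, E1, E2, I2, E3, E4, E5, E6.
    cbn [ceffs fold_left ceff cset creg ca cx cd cm ci co app]. now rewrite V.
  - apply okc_app; [apply okc_notouch; reflexivity|]. rewrite I1.
    apply okc_app; [exact O1|]. rewrite E1. apply okc_app; [exact O2|]. rewrite E2.
    apply okc_app; [apply okc_notouch; reflexivity|]. rewrite I2.
    apply okc_app; [exact O3|]. rewrite E3. apply okc_app; [exact O4|]. rewrite E4.
    apply okc_app; [exact O5|]. rewrite E5. apply okc_app; [exact O6|]. apply okc_notouch; reflexivity.
Qed.

Lemma prog_run : forall n xs, 10 < n -> run_ok n xs (pval n xs).
Proof.
  intros n xs Hn. pose proof lim_eq as HL.
  destruct (pre_run n xs Hn) as (s1 & (Rpc & Rh & Ra & Rx & Rd & Rm & Ri & Ro) & Hcode & Hrun & Hcells).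
  cbn [ca cx cd cm ci co] in Ra, Rx, Rd, Rm, Ri, Ro.
  assert (P9 : 2 ^ 9 <= 2 ^ n) by (apply Nat.pow_le_mono_r; lia). change (2 ^ 9) with 512 in P9.
  assert (HJ0 : mem s1 68 = 23).
  { rewrite Hcode. pose proof (code_exit 0 ltac:(lia)) as E. rewrite Nat.add_0_r in E. rewrite E. reflexivity. }
  unfold pval. destruct (Nat.leb_spec n 40) as [Hs|Hs].
  - assert (Hq : 40 / n <> 0).
    { intros E. apply Nat.div_small_iff in E; lia. }
    apply (finish n xs 69 [Arith Zero; Output] (ceffs n [Arith Zero; Output] (Cfg (40 / n) 256 256 (mem s1) xs []))
      0 s1 (Cfg (40 / n) 256 256 (mem s1) xs [])); auto; try (cbn [length]; lia).
    + unfold step. rewrite Rh, Rpc, HJ0.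
      change (decode 23) with (Some JumpZero). cbv iota.
      rewrite Ra. apply Nat.eqb_neq in Hq. rewrite Hq.
      rewrite Nat.mod_small by lia. repeat split; auto.
    + ck.
    + intros j Hj. cbn [length cm] in *. rewrite Hcode.
      replace (69 + j) with (68 + S j) by lia. rewrite code_exit by lia.
      destruct j as [|[|[|j]]]; [reflexivity|reflexivity|reflexivity|lia].
    + apply okc_notouch; reflexivity.
  - pose proof (lim_bound n ltac:(lia)) as HLb.
    assert (Hq : 40 / n = 0) by (apply Nat.div_small; lia).
    destruct (main_ok n xs (mem s1) ltac:(lia)) as [Ho Hok].
    apply (finish n xs 256 (mainseg p) (ceffs n (mainseg p) (Cfg 0 256 256 (mem s1) xs []))
      256 s1 (Cfg 0 256 256 (mem s1) xs [])); auto; try lia.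
    + unfold step. rewrite Rh, Rpc, HJ0.
      change (decode 23) with (Some JumpZero). cbv iota.
      rewrite Ra, Hq. rewrite Rd. cbn [Nat.eqb]. repeat split; auto. cbn [reg ca]. now rewrite Ra, Hq.
    + apply codeok_main.
    + intros j Hj. cbn [cm]. now rewrite Hcode, code_main.
Qed.

Lemma prog_cells : forall n xs t, 10 < n ->
  Forall (fun a => a < lim) (cells_used (run n (prog p) xs t)).
Proof.
  intros n xs t Hn. destruct (prog_run n xs Hn) as (T & HT & _ & Hh & Hc).
  destruct (Nat.le_gt_cases t T) as [L|L]; [auto|].
  replace t with ((t - S T) + S T) by lia. unfold run. rewrite Nat.iter_add.
  rewrite iter_halted by exact Hh. unfold cells_used. unfold run in Hh. now rewrite Hh.
Qed.

Lemma prog_within : forall n xs, 10 < n -> outputs_within n (prog p) xs (pval n xs) lim.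
Proof.
  intros n xs Hn. destruct (prog_run n xs Hn) as (T & HT & Ho & _ & _).
  apply (outputs_within_mono _ _ _ _ T); auto. unfold outputs_within. now rewrite Ho.
Qed.

Lemma prog_output : forall n xs v, 10 < n -> (has_output n (prog p) xs v <-> pval n xs = v).
Proof.
  intros n xs v Hn. pose proof (prog_within n xs Hn) as H. split.
  - intros [t Ht]. eapply outputs_within_fun; eauto.
  - intros <-. now exists lim.
Qed.

Lemma prog_is_program : is_program (prog p).
Proof.
  unfold is_program, prog. apply Forall_forall. intros w Hw. apply in_map_iff in Hw.
  destruct Hw as (i & <- & _). destruct i as [|[]|[] []| | | | | |]; cbn; lia.
Qed.

Lemma least_time : forall (Q : nat -> Prop) t, Q t -> exists m, m <= t /\ Q m /\ forall t', Q t' -> m <= t'.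
Proof.
  intros Q t. induction t as [t IH] using (well_founded_induction Nat.lt_wf_0). intros Ht.
  destruct (classic (exists t', t' < t /\ Q t')) as [(t' & L & H')|H].
  - destruct (IH t' L H') as (m & Hm & H1 & H2). exists m. split; [lia|]. split; assumption.
  - exists t. repeat split; auto. intros t' H'. destruct (Nat.le_gt_cases t t'); auto. exfalso. eauto.
Qed.

Lemma prog_time : forall n, 10 < n -> exists t, is_time_requirement n 2 (prog p) t /\ t <= lim.
Proof.
  intros n Hn. destruct (least_time (time_bound n 2 (prog p)) lim) as (m & H1 & H2 & H3).
  - intros xs _. eexists. now apply prog_within.
  - exists m. repeat split; auto.
Qed.

Lemma prog_is_test : (forall n xs, pval n xs <= 1) -> is_test lim 2 (prog p).
Proof.
  intros Hv. split; [apply prog_is_program|]. split.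
  - unfold prog, lim. now rewrite length_map.
  - split; [pose proof lim_eq; lia|]. intros n xs Hn _. split; [intros t; now apply prog_cells|].
    exists (pval n xs). split; [specialize (Hv n xs); lia|]. now apply prog_output.
Qed.

End Program.

(** * Numbers as digit vectors *)

Fixpoint dig (B n : nat) (d : nat -> nat) : nat :=
  match n with
  | 0 => 0
  | S k => dig B k d + d k * B ^ k
  end.

Lemma dig_ext : forall B n d d', (forall p, p < n -> d p = d' p) -> dig B n d = dig B n d'.
Proof.
  intros B n d d'. induction n as [|n IH]; intros H; cbn; [reflexivity|].
  rewrite IH, H; auto.
Qed.

Lemma dig_bound : forall B n d, (forall p, p < n -> d p < B) -> dig B n d < B ^ n.
Proof.
  intros B n d. induction n as [|n IH]; intros H; cbn; [lia|].
  specialize (IH ltac:(auto)). specialize (H n ltac:(lia)). nia.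
Qed.

Lemma dig_bound_small : forall B n d m, 0 < m -> m <= B -> (forall p, p <= n -> d p < m) ->
  dig B (S n) d < m * B ^ n.
Proof.
  intros B n d m Hm HB H. cbn.
  assert (dig B n d < B ^ n) by (apply dig_bound; intros p Hp; specialize (H p ltac:(lia)); lia).
  specialize (H n ltac:(lia)). nia.
Qed.

Lemma dig_add : forall B n d d', dig B n d + dig B n d' = dig B n (fun p => d p + d' p).
Proof. intros B n d d'. induction n as [|n IH]; cbn; [reflexivity|]. rewrite <- IH. ring. Qed.

Lemma dig_scale : forall B n c d, c * dig B n d = dig B n (fun p => c * d p).
Proof. intros B n c d. induction n as [|n IH]; cbn; [lia|]. rewrite <- IH. ring. Qed.

Lemma dig_le : forall B n d d', (forall p, p < n -> d p <= d' p) -> dig B n d <= dig B n d'.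
Proof.
  intros B n d d'. induction n as [|n IH]; intros H; cbn; [lia|].
  specialize (IH ltac:(auto)). specialize (H n ltac:(lia)). nia.
Qed.

Lemma dig_sub : forall B n d d', (forall p, p < n -> d' p <= d p) ->
  dig B n d - dig B n d' = dig B n (fun p => d p - d' p).
Proof.
  intros B n d d'. induction n as [|n IH]; intros H; cbn; [reflexivity|].
  rewrite <- IH by auto. pose proof (dig_le B n d' d ltac:(auto)). specialize (H n ltac:(lia)). 
  rewrite Nat.mul_sub_distr_r. nia.
Qed.

Lemma dig_split : forall B n m d, dig B (n + m) d = dig B n d + B ^ n * dig B m (fun p => d (n + p)).
Proof.
  intros B n m d. induction m as [|m IH]; cbn.
  - replace (n + 0) with n by lia. rewrite Nat.mul_0_r. lia.
  - rewrite Nat.add_succ_r. cbn. rewrite IH, Nat.pow_add_r. ring.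
Qed.

(* An outer product of digit vectors involves no carries. *)
Lemma dig_mul : forall B N Q x y, 0 < N ->
  dig B N x * dig (B ^ N) Q y = dig B (N * Q) (fun p => x (p mod N) * y (p / N)).
Proof.
  intros B N Q x y HN. induction Q as [|Q IH].
  - cbn [dig]. rewrite !Nat.mul_0_r. reflexivity.
  - rewrite Nat.mul_succ_r, dig_split, <- IH. cbn [dig].
    rewrite <- Nat.pow_mul_r, Nat.mul_add_distr_l. f_equal.
    replace (dig B N (fun p => x ((N * Q + p) mod N) * y ((N * Q + p) / N)))
      with (dig B N (fun p => y Q * x p)).
    + rewrite <- dig_scale. ring.
    + apply dig_ext. intros p Hp.
      replace (N * Q + p) with (p + Q * N) by lia.
      rewrite Nat.Div0.mod_add, Nat.div_add, Nat.mod_small, Nat.div_small by lia. cbn. lia.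
Qed.

(** The repunit. Multiplying by it copies a digit vector, and one division computes it. *)
Definition rep (B n : nat) : nat := dig B n (fun _ => 1).

Lemma rep_spec : forall B n, 2 <= B -> (B ^ n - 1) / (B - 1) = rep B n.
Proof.
  intros B n HB. symmetry. apply Nat.div_unique_exact; [lia|].
  induction n as [|n IH]; [cbn; lia|].
  unfold rep in *. cbn [dig]. rewrite Nat.mul_1_l, Nat.mul_add_distr_l, <- IH. cbn [Nat.pow].
  pose proof (Nat.pow_nonzero B n ltac:(lia)). nia.
Qed.

Lemma land_split : forall k a b c d, a < 2 ^ k -> c < 2 ^ k ->
  Nat.land (a + b * 2 ^ k) (c + d * 2 ^ k) = Nat.land a c + Nat.land b d * 2 ^ k.
Proof.
  intros k a b c d Ha Hc.
  assert (Hl : Nat.land a c < 2 ^ k).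
  { apply Nat.le_lt_trans with a; auto.
    apply Nat.ldiff_le. apply Nat.bits_inj_0. intros i.
    rewrite Nat.ldiff_spec, Nat.land_spec. destruct (Nat.testbit a i), (Nat.testbit c i); reflexivity. }
  assert (Hb : forall x y i, x < 2 ^ k -> Nat.testbit (x + y * 2 ^ k) i =
     if i <? k then Nat.testbit x i else Nat.testbit y (i - k)).
  { intros x y i Hx. destruct (Nat.ltb_spec i k) as [L|L].
    - rewrite <- (Nat.mod_pow2_bits_low (x + y * 2 ^ k) k i L).
      rewrite Nat.Div0.mod_add, Nat.mod_small by auto. reflexivity.
    - replace i with ((i - k) + k) at 1 by lia. rewrite <- Nat.div_pow2_bits.
      rewrite Nat.div_add by (apply Nat.pow_nonzero; lia). rewrite Nat.div_small by auto. reflexivity. }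
  apply Nat.bits_inj. intros i. rewrite Nat.land_spec, !Hb by auto.
  destruct (i <? k); now rewrite Nat.land_spec.
Qed.

Lemma dig_land : forall b n x y, (forall p, p < n -> x p < 2 ^ b) -> (forall p, p < n -> y p < 2 ^ b) ->
  Nat.land (dig (2 ^ b) n x) (dig (2 ^ b) n y) = dig (2 ^ b) n (fun p => Nat.land (x p) (y p)).
Proof.
  intros b n x y Hx Hy. induction n as [|n IH]; [reflexivity|]. cbn [dig].
  rewrite <- IH by auto. rewrite <- Nat.pow_mul_r. apply land_split.
  - rewrite Nat.pow_mul_r. apply dig_bound. auto.
  - rewrite Nat.pow_mul_r. apply dig_bound. auto.
Qed.

Lemma pow_cong : forall c d p, d <= c -> exists k, c ^ p = d ^ p + k * (c - d).
Proof.
  intros c d p H. induction p as [|p [k IH]]; [exists 0; cbn; lia|].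
  exists (d ^ p + k * c). rewrite !Nat.pow_succ_r', IH.
  replace c with (d + (c - d)) at 1 by lia. replace (k * c) with (k * (d + (c - d))) by (f_equal; lia). ring.
Qed.

Lemma dig_cong : forall c d n v, d <= c -> exists k, dig c n v = dig d n v + k * (c - d).
Proof.
  intros c d n v H. induction n as [|n [k IH]]; [exists 0; reflexivity|].
  cbn. destruct (pow_cong c d n H) as [k' E]. exists (k + v n * k'). rewrite IH, E. ring.
Qed.

(** [c] equals [d] modulo [c - d], so a single remainder changes the base of a digit vector. *)
Lemma dig_rebase : forall c d n v, d <= c -> dig d n v < c - d -> dig c n v mod (c - d) = dig d n v.
Proof.
  intros c d n v H H1. destruct (dig_cong c d n v H) as [k ->].
  rewrite Nat.Div0.mod_add. now apply Nat.mod_small.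
Qed.

Lemma land_top : forall b x, 0 < b -> x < 2 ^ b ->
  Nat.land x (2 ^ (b - 1)) = 2 ^ (b - 1) * (if 2 ^ (b - 1) <=? x then 1 else 0).
Proof.
  intros b x Hb Hx. set (k := b - 1).
  assert (E : 2 ^ b = 2 * 2 ^ k) by (unfold k; rewrite <- Nat.pow_succ_r'; f_equal; lia).
  pose proof (Nat.pow_nonzero 2 k ltac:(lia)) as Hk.
  destruct (Nat.leb_spec (2 ^ k) x) as [L|L].
  - replace x with ((x - 2 ^ k) + 1 * 2 ^ k) at 1 by lia.
    replace (2 ^ k) with (0 + 1 * 2 ^ k) at 3 by lia. rewrite land_split by lia.
    rewrite Nat.land_0_r. cbn. lia.
  - replace x with (x + 0 * 2 ^ k) at 1 by lia.
    replace (2 ^ k) with (0 + 1 * 2 ^ k) at 2 by lia. rewrite land_split by lia.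
    rewrite Nat.land_0_r. cbn. lia.
Qed.

Definition b2n (b : bool) : nat := if b then 1 else 0.

Lemma land_land_mask : forall d1 d2 g, Nat.land (Nat.land d1 d2) g = Nat.land (Nat.land d1 g) (Nat.land d2 g).
Proof.
  intros. apply Nat.bits_inj. intros i. rewrite !Nat.land_spec.
  destruct (Nat.testbit d1 i), (Nat.testbit d2 i), (Nat.testbit g i); reflexivity.
Qed.

(* The guard bit of a field survives the two subtractions exactly when the fields agree. *)
Lemma packed_eq : forall b n s t, 2 <= b -> (forall p, p < n -> s p < 2 ^ (b - 1)) ->
  (forall p, p < n -> t p < 2 ^ (b - 1)) ->
  let B := 2 ^ b in let G := 2 ^ (b - 1) * rep B n in
  Nat.land (Nat.land (dig B n s + G - dig B n t) (dig B n t + G - dig B n s)) G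
  = 2 ^ (b - 1) * dig B n (fun p => b2n (s p =? t p)).
Proof.
  intros b n s t Hb Hs Ht B G.
  assert (E : 2 ^ b = 2 * 2 ^ (b - 1)) by (rewrite <- Nat.pow_succ_r'; f_equal; lia).
  pose proof (Nat.pow_nonzero 2 (b - 1) ltac:(lia)) as Hk.
  assert (EG : G = dig B n (fun _ => 2 ^ (b - 1))).
  { unfold G, rep. rewrite dig_scale. apply dig_ext. intros; lia. }
  assert (H1 : forall x y, (forall p, p < n -> x p < 2 ^ (b - 1)) -> (forall p, p < n -> y p < 2 ^ (b - 1)) ->
    Nat.land (dig B n x + G - dig B n y) G = dig B n (fun p => 2 ^ (b - 1) * b2n (y p <=? x p))).
  { intros x y Hx Hy. rewrite EG, dig_add, dig_sub.
    - unfold B. rewrite dig_land.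
      + apply dig_ext. intros p Hp. rewrite land_top; [| lia |].
        * specialize (Hx p Hp). specialize (Hy p Hp).
          destruct (Nat.leb_spec (2 ^ (b - 1)) (x p + 2 ^ (b - 1) - y p));
          destruct (Nat.leb_spec (y p) (x p)); unfold b2n; lia.
        * specialize (Hx p Hp). specialize (Hy p Hp). lia.
      + intros p Hp. specialize (Hx p Hp). specialize (Hy p Hp). lia.
      + intros p Hp. lia.
    - intros p Hp. specialize (Hy p Hp). lia. }
  rewrite land_land_mask, (H1 s t), (H1 t s) by auto. unfold B. rewrite dig_land.
  - rewrite dig_scale. apply dig_ext. intros p Hp.
    destruct (Nat.leb_spec (t p) (s p)); destruct (Nat.leb_spec (s p) (t p)); destruct (Nat.eqb_spec (s p) (t p));
      cbn [b2n]; rewrite ?Nat.mul_0_r, ?Nat.mul_1_r, ?Nat.land_0_r, ?Nat.land_0_l, ?Nat.land_diag; lia.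
  - intros p Hp. unfold b2n. destruct (t p <=? s p); lia.
  - intros p Hp. unfold b2n. destruct (s p <=? t p); lia.
Qed.

Lemma dig_testbit : forall n (t : nat -> bool) i,
  Nat.testbit (dig 2 n (fun p => b2n (t p))) i = (i <? n) && t i.
Proof.
  intros n t. induction n as [|n IH]; intros i; cbn [dig].
  - rewrite Nat.bits_0. reflexivity.
  - assert (Hlt : dig 2 n (fun p => b2n (t p)) < 2 ^ n).
    { apply dig_bound. intros p _. unfold b2n. destruct (t p); lia. }
    destruct (Nat.lt_trichotomy i n) as [L|[L|L]].
    + rewrite <- (Nat.mod_pow2_bits_low _ n i L).
      rewrite Nat.Div0.mod_add, Nat.mod_small, IH by auto.
      destruct (Nat.ltb_spec i n); destruct (Nat.ltb_spec i (S n)); try lia; reflexivity.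
    + subst i.
      pose proof (Nat.div_pow2_bits (dig 2 n (fun p => b2n (t p)) + b2n (t n) * 2 ^ n) n 0) as E.
      rewrite Nat.add_0_l in E. rewrite <- E.
      rewrite Nat.div_add by (apply Nat.pow_nonzero; lia). rewrite Nat.div_small by auto.
      destruct (Nat.ltb_spec n (S n)); [|lia]. cbn. unfold b2n. now destruct (t n).
    + assert (dig 2 n (fun p => b2n (t p)) + b2n (t n) * 2 ^ n < 2 ^ i).
      { assert (2 ^ S n <= 2 ^ i) by (apply Nat.pow_le_mono_r; lia). cbn in H.
        unfold b2n at 2. destruct (t n); lia. }
      destruct (Nat.ltb_spec i (S n)); [lia|]. cbn [andb].
      rewrite <- (Nat.mod_small _ _ H). rewrite Nat.mod_pow2_bits_high; auto.
Qed.

(** * The verifying straight-line program *)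

(** Values 0 and 1 are [x] and the parameter; instruction [s] yields value [2 + s]. Subtraction is
    compiled into [Not], [Add] and an addition of 1. Values up to 23 unpack the parameter, up to 62
    give widths, bases and repunits, up to 82 the vector of words in three bases, up to 94 the cubes
    of operands and the guard bits, up to 140 the comparison bits; the rest indexes the table. The
    final [Min] makes the output a bit on all inputs. *)
Definition verifier : slp :=
  [ (One, 0, 0); (Defs.Add, 2, 2); (Defs.Add, 3, 3); (Defs.Add, 4, 4); (WordLength, 0, 0);
    (Div, 6, 5); (Exp2, 7, 7); (Div, 1, 8); (Mul, 9, 8); (Not, 10, 10); (Defs.Add, 1, 11);
    (Defs.Add, 12, 2); (Div, 9, 8); (Mul, 14, 8); (Not, 15, 15); (Defs.Add, 9, 16);
    (Defs.Add, 17, 2); (Div, 14, 8); (Mul, 19, 8); (Not, 20, 20); (Defs.Add, 14, 21);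
    (Defs.Add, 22, 2); (Defs.Add, 18, 18); (Defs.Add, 13, 13); (Defs.Add, 25, 3);
    (Defs.Add, 25, 2); (Mul, 26, 24); (Mul, 28, 24); (Mul, 29, 24); (Exp2, 26, 26);
    (Exp2, 28, 28); (Exp2, 29, 29); (Exp2, 30, 30); (Mul, 29, 18); (Exp2, 35, 35);
    (Exp2, 13, 13); (Exp2, 27, 27); (Not, 2, 2); (Defs.Add, 31, 39); (Defs.Add, 40, 2);
    (Not, 2, 2); (Defs.Add, 32, 42); (Defs.Add, 43, 2); (Not, 2, 2); (Defs.Add, 33, 45);
    (Defs.Add, 46, 2); (Not, 2, 2); (Defs.Add, 34, 48); (Defs.Add, 49, 2); (Not, 2, 2);
    (Defs.Add, 36, 51); (Defs.Add, 52, 2); (Not, 2, 2); (Defs.Add, 37, 54); (Defs.Add, 55, 2);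
    (Div, 50, 44); (Div, 44, 41); (Div, 50, 47); (Div, 47, 41); (Div, 53, 47); (Div, 50, 41);
    (Mul, 56, 61); (And, 0, 63); (Mul, 36, 64); (Defs.Add, 19, 65); (Not, 31, 31);
    (Defs.Add, 33, 67); (Defs.Add, 68, 2); (Div, 66, 69); (Mul, 70, 69); (Not, 71, 71);
    (Defs.Add, 66, 72); (Defs.Add, 73, 2); (Not, 32, 32); (Defs.Add, 33, 75);
    (Defs.Add, 76, 2); (Div, 66, 77); (Mul, 78, 77); (Not, 79, 79); (Defs.Add, 66, 80);
    (Defs.Add, 81, 2); (Mul, 74, 57); (Mul, 82, 58); (Mul, 84, 59); (Mul, 66, 60);
    (Mul, 74, 82); (Mul, 87, 59); (Defs.Add, 83, 85); (And, 83, 85); (Mul, 38, 62);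
    (Not, 2, 2); (Defs.Add, 41, 92); (Defs.Add, 93, 2); (Defs.Add, 86, 91); (Defs.Add, 89, 91);
    (Not, 86, 86); (Defs.Add, 96, 97); (Defs.Add, 98, 2); (Not, 89, 89); (Defs.Add, 95, 100);
    (Defs.Add, 101, 2); (And, 99, 102); (And, 103, 91); (Div, 104, 38); (Div, 105, 94);
    (Mul, 106, 94); (Not, 107, 107); (Defs.Add, 105, 108); (Defs.Add, 109, 2);
    (Defs.Add, 88, 91); (Not, 86, 86); (Defs.Add, 111, 112); (Defs.Add, 113, 2); (Not, 88, 88);
    (Defs.Add, 95, 115); (Defs.Add, 116, 2); (And, 114, 117); (And, 118, 91); (Div, 119, 38);
    (Div, 120, 94); (Mul, 121, 94); (Not, 122, 122); (Defs.Add, 120, 123); (Defs.Add, 124, 2);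
    (Defs.Add, 90, 91); (Not, 86, 86); (Defs.Add, 126, 127); (Defs.Add, 128, 2); (Not, 90, 90);
    (Defs.Add, 95, 130); (Defs.Add, 131, 2); (And, 129, 132); (And, 133, 91); (Div, 134, 38);
    (Div, 135, 94); (Mul, 136, 94); (Not, 137, 137); (Defs.Add, 135, 138); (Defs.Add, 139, 2);
    (Mul, 24, 24); (Mul, 141, 24); (Exp2, 142, 142); (Mul, 140, 143); (Defs.Add, 125, 144);
    (Mul, 145, 143); (Defs.Add, 110, 146); (Exp2, 147, 147); (Div, 23, 148); (Div, 149, 3);
    (Mul, 150, 3); (Not, 151, 151); (Defs.Add, 149, 152); (Defs.Add, 153, 2); (Not, 154, 154);
    (Defs.Add, 2, 155); (Defs.Add, 156, 2); (Min, 157, 2) ].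

Lemma lnot_low : forall n y, y < 2 ^ n -> Nat.lnot y n = 2 ^ n - 1 - y.
Proof.
  intros n y H. pose proof (Nat.pow_nonzero 2 n ltac:(lia)).
  assert (E : y + Nat.lnot y n = Nat.ones n).
  { destruct (Nat.eq_dec y 0) as [->|Hy].
    - rewrite Nat.lnot_0_l. reflexivity.
    - apply Nat.add_lnot_diag_low. apply Nat.log2_lt_pow2; lia. }
  rewrite Nat.ones_equiv in E. lia.
Qed.

(** Subtraction in two's complement. *)
Lemma sub_via_not : forall n x y, y <= x -> x < 2 ^ n ->
  ((x + Nat.lnot y n) mod 2 ^ n + 1) mod 2 ^ n = x - y.
Proof.
  intros n x y H Hx. rewrite lnot_low by lia.
  pose proof (Nat.pow_nonzero 2 n ltac:(lia)).
  rewrite Nat.Div0.add_mod_idemp_l.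
  replace (x + (2 ^ n - 1 - y) + 1) with ((x - y) + 1 * 2 ^ n) by lia.
  rewrite Nat.Div0.mod_add. apply Nat.mod_small. lia.
Qed.

(** Fields at multiples of [M / 8], a distance that the program can compute itself: [F] is [Exp2] of
    a quotient of the word length. *)
Definition encode (M beta V Tb I : nat) : nat :=
  let F := 2 ^ (M / 8) in beta + F * (V + F * (Tb + F * I)).

Definition fields (beta V : nat) : nat := (2 * beta + 2) * (2 * V) * (2 * V).

(** The pattern as a number: one block of [N ^ 3] bits per relation, in which the triple [(i, j, k)]
    has position [i + N * j + N * N * k]. *)
Definition patidx (N : nat) (w : nat -> nat) : nat :=
  let K := N * N * N in
  let t c := dig 2 K (fun p => b2n (atomb c (w (p mod N)) (w (p mod (N * N) / N)) (w (p / (N * N))))) in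
  t KAdd + (t KMul + t KAnd * 2 ^ K) * 2 ^ K.

Section Verifier.

Variables n beta V Tb x : nat.
Variable ins : nat -> nat.
Let N := V + V.
(** A field has room for a product of two words below a guard bit. Words are stored at distance [W],
    the spacing of the third coordinate in the cube of triples; the spacings [b] and [b * N] of the
    other two are obtained by changes of base. *)
Let b := beta + beta + 2.
Let W := b * N * N.
Let Q := b * N * N * N.
Hypothesis HV : 1 <= V.
Hypothesis Hb : N * N * N + 2 <= b.
Hypothesis HQ : Q <= n / 8.
Hypothesis HT : 2 ^ (3 * (N * N * N)) <= n / 8.
Hypothesis HTb : Tb < 2 ^ (2 ^ (3 * (N * N * N))).
Hypothesis Hins : forall i, ins i < 2 ^ beta.
Hypothesis Hx : x < 2 ^ n.

Let a := encode n beta V Tb (dig (2 ^ W) V ins).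
Variable v : nat -> nat.
Hypothesis v_x : v 0 = x.
Hypothesis v_a : v 1 = a.
Hypothesis v_eq : forall s o i j, nth_error verifier s = Some (o, i, j) -> i < 2 + s -> j < 2 + s ->
  v (2 + s) = arith_eval n o (v i) (v j).
Let u (i : nat) := (x / (2 ^ W) ^ i) mod 2 ^ beta.
Let w := layout V ins u.

(** [st K] rewrites with the equation of instruction [K]; [sb K] below treats the instructions [K],
    [K + 1], [K + 2] as one subtraction. *)
Ltac st K := let E := fresh "E" in
  pose proof (v_eq K _ _ _ eq_refl ltac:(lia) ltac:(lia)) as E; cbn [Nat.add arith_eval] in E; rewrite E; clear E.

Lemma HN2 : 2 <= N. Proof. unfold N. lia. Qed.
Lemma HNb : N < b. Proof. pose proof HN2. nia. Qed.
Lemma Hn8 : 8 * (n / 8) <= n. Proof. apply Nat.Div0.mul_div_le. Qed.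
Lemma HQb : 4 * b <= Q. Proof. pose proof HN2. unfold Q. assert (4 <= N * N * N) by nia. nia. Qed.
Lemma HWQ : 2 * W <= Q. Proof. pose proof HN2. unfold Q, W. nia. Qed.
Lemma HWVQ : W * V <= Q. Proof. unfold Q, W, N. nia. Qed.
Lemma HbNW : b * N <= W. Proof. pose proof HN2. unfold W. nia. Qed.

Lemma pw_lt : forall z e, z <= 2 ^ e -> e <= 7 * (n / 8) -> z < 2 ^ n.
Proof.
  intros z e H He. pose proof Hn8. pose proof HQb. pose proof HNb.
  apply Nat.le_lt_trans with (2 ^ e); auto. apply Nat.pow_lt_mono_r; lia.
Qed.

Lemma sm_lt : forall z, z <= Q -> z < 2 ^ n.
Proof.
  intros z H. apply (pw_lt z Q); [|lia].
  pose proof (Nat.pow_gt_lin_r 2 Q ltac:(lia)). lia.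
Qed.

Lemma s_sub : forall X Y K, v 2 = 1 ->
  v (2 + K) = arith_eval n Not (v Y) (v Y) ->
  v (2 + S K) = arith_eval n Defs.Add (v X) (v (2 + K)) ->
  v (2 + S (S K)) = arith_eval n Defs.Add (v (2 + S K)) (v 2) ->
  v Y <= v X -> v X < 2 ^ n -> v (2 + S (S K)) = v X - v Y.
Proof.
  intros X Y K H1 E1 E2 E3 H Hl. rewrite E3, E2, E1, H1. cbn [arith_eval]. now apply sub_via_not.
Qed.

Lemma s_one : v 2 = 1.
Proof. st 0. reflexivity. Qed.

Ltac sb K := let E := fresh "E" in
  pose proof (s_sub _ _ K s_one (v_eq K _ _ _ eq_refl ltac:(lia) ltac:(lia))
  (v_eq (S K) _ _ _ eq_refl ltac:(lia) ltac:(lia)) (v_eq (S (S K)) _ _ _ eq_refl ltac:(lia) ltac:(lia))) as E;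
  cbn [Nat.add] in E; rewrite E; clear E.

Lemma c8 : 64 < 2 ^ n.
Proof. change 64 with (2 ^ 6). apply Nat.pow_lt_mono_r; pose proof Hn8; pose proof HQb; pose proof HNb; pose proof HN2; lia. Qed.

Lemma s_two : v 3 = 2.
Proof. st 1. rewrite s_one. pose proof c8. apply Nat.mod_small; lia. Qed.

Lemma s_four : v 4 = 4.
Proof. st 2. rewrite s_two. pose proof c8. apply Nat.mod_small; lia. Qed.

Lemma s_eight : v 5 = 8.
Proof. st 3. rewrite s_four. pose proof c8. apply Nat.mod_small; lia. Qed.

Lemma s_n : v 6 = n.
Proof. st 4. reflexivity. Qed.

Lemma s_f : v 7 = n / 8.
Proof. st 5. now rewrite s_n, s_eight. Qed.

Lemma exp_ok : forall e, e < n -> Nat.min (2 ^ e) (2 ^ n - 1) = 2 ^ e.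
Proof. intros e H. assert (2 ^ e < 2 ^ n) by (apply Nat.pow_lt_mono_r; lia). lia. Qed.

Let F := 2 ^ (n / 8).
Let I := dig (2 ^ W) V ins.

Lemma I_lt : I < 2 ^ (W * V).
Proof.
  unfold I. rewrite Nat.pow_mul_r. apply dig_bound. intros p _.
  eapply Nat.lt_le_trans; [apply Hins|]. apply Nat.pow_le_mono_r; [lia|].
  pose proof HN2. unfold W. assert (beta <= b) by (unfold b; lia). assert (1 <= N * N) by nia. nia.
Qed.

Lemma F_gt : forall z, z <= Q -> z < F.
Proof.
  intros z H. unfold F. pose proof (Nat.pow_gt_lin_r 2 (n / 8) ltac:(lia)). lia.
Qed.

Lemma I_F : I < F.
Proof. eapply Nat.lt_le_trans; [apply I_lt|]. apply Nat.pow_le_mono_r; [lia|]. pose proof HWVQ. lia. Qed.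

Lemma Tb_F : Tb < F.
Proof. eapply Nat.lt_le_trans; [apply HTb|]. apply Nat.pow_le_mono_r; lia. Qed.

Lemma a_eq : v 1 = beta + F * (V + F * (Tb + F * I)).
Proof. rewrite v_a. reflexivity. Qed.

Lemma Fpow : F * F * F * F < 2 ^ n.
Proof.
  unfold F. rewrite <- !Nat.pow_add_r. apply (pw_lt _ (n / 8 + n / 8 + n / 8 + n / 8)); lia.
Qed.

Lemma a2_lt : Tb + F * I < F * F.
Proof. pose proof I_F. pose proof Tb_F. nia. Qed.

Lemma a1_lt : V + F * (Tb + F * I) < F * F * F.
Proof. pose proof a2_lt. assert (V < F) by (apply F_gt; pose proof HWVQ; pose proof HbNW; pose proof HNb; unfold N in *; nia). nia. Qed.

Lemma a_lt : beta + F * (V + F * (Tb + F * I)) < 2 ^ n.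
Proof.
  pose proof a1_lt. pose proof Fpow. assert (beta < F) by (apply F_gt; pose proof HQb; unfold b in *; lia). nia.
Qed.

Lemma divF : forall y z, y < F -> (y + F * z) / F = z.
Proof.
  intros y z H. replace (y + F * z) with (y + z * F) by lia. rewrite Nat.div_add by lia.
  now rewrite Nat.div_small.
Qed.

Lemma s_F : v 8 = F.
Proof. st 6. rewrite s_f. apply exp_ok. pose proof Hn8. pose proof HQb. pose proof HNb. lia. Qed.

Lemma s_a1 : v 9 = V + F * (Tb + F * I).
Proof. st 7. rewrite s_F, a_eq. apply divF. apply F_gt. pose proof HQb. unfold b in *. lia. Qed.

Lemma s_a1F : v 10 = F * (V + F * (Tb + F * I)).
Proof. st 8. rewrite s_a1, s_F, Nat.mul_comm. apply Nat.mod_small. pose proof a_lt. lia. Qed.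

Lemma s_beta : v 13 = beta.
Proof. sb 9 ; rewrite ?s_a1F, ?a_eq; pose proof a_lt; lia. Qed.

Lemma s_a2 : v 14 = Tb + F * I.
Proof. st 12. rewrite s_a1, s_F. apply divF. apply F_gt. pose proof HWVQ; pose proof HbNW; pose proof HNb; unfold N in *; nia. Qed.

Lemma s_a2F : v 15 = F * (Tb + F * I).
Proof. st 13. rewrite s_a2, s_F, Nat.mul_comm. apply Nat.mod_small. pose proof a1_lt. pose proof Fpow. nia. Qed.

Lemma a1_lt' : V + F * (Tb + F * I) < 2 ^ n.
Proof. pose proof a1_lt. pose proof Fpow. nia. Qed.

Lemma a2_lt' : Tb + F * I < 2 ^ n.
Proof. pose proof a2_lt. pose proof Fpow. assert (1 <= F * F) by lia. nia. Qed.

Lemma s_V : v 18 = V.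
Proof. sb 14 ; rewrite ?s_a2F, ?s_a1; pose proof a1_lt'; lia. Qed.

Lemma s_I : v 19 = I.
Proof. st 17. rewrite s_a2, s_F. apply divF. apply Tb_F. Qed.

Lemma s_IF : v 20 = F * I.
Proof. st 18. rewrite s_I, s_F, Nat.mul_comm. apply Nat.mod_small. pose proof a2_lt'. lia. Qed.

Lemma s_Tb : v 23 = Tb.
Proof. sb 19 ; rewrite ?s_IF, ?s_a2; pose proof a2_lt'; lia. Qed.

Lemma s_N : v 24 = N.
Proof. st 22. rewrite s_V. apply Nat.mod_small. fold N. apply sm_lt. pose proof HQb; pose proof HNb; pose proof HbNW; pose proof HWQ; pose proof HN2; lia. Qed.

Lemma s_b0 : v 25 = beta + beta.
Proof. st 23. rewrite s_beta. apply Nat.mod_small. apply sm_lt. pose proof HQb; pose proof HNb; pose proof HbNW; pose proof HWQ; pose proof HN2; unfold b in *; lia. Qed.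

Lemma s_b : v 26 = b.
Proof. st 24. rewrite s_b0, s_two. apply Nat.mod_small. apply sm_lt. pose proof HQb; pose proof HNb; pose proof HbNW; pose proof HWQ; pose proof HN2; unfold b in *; lia. Qed.

Lemma s_bm : v 27 = b - 1.
Proof. st 25. rewrite s_b0, s_one. rewrite Nat.mod_small; [unfold b; lia|]. apply sm_lt. pose proof HQb; pose proof HNb; pose proof HbNW; pose proof HWQ; pose proof HN2; unfold b in *; lia. Qed.

Lemma s_bN : v 28 = b * N.
Proof. st 26. rewrite s_b, s_N. apply Nat.mod_small. apply sm_lt. pose proof HQb; pose proof HNb; pose proof HbNW; pose proof HWQ; pose proof HN2; lia. Qed.

Lemma s_W : v 29 = W.
Proof. st 27. rewrite s_bN, s_N. apply Nat.mod_small. apply sm_lt. fold W. pose proof HQb; pose proof HNb; pose proof HbNW; pose proof HWQ; pose proof HN2; lia. Qed.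

Lemma s_Q : v 30 = Q.
Proof. st 28. rewrite s_W, s_N. apply Nat.mod_small. apply sm_lt. unfold W, Q. lia. Qed.

Lemma Qn : Q < n.
Proof. pose proof Hn8. pose proof HQb. pose proof HNb. lia. Qed.

Lemma s_B : v 31 = 2 ^ b.
Proof. st 29. rewrite s_b. apply exp_ok. pose proof Qn. pose proof HQb; pose proof HNb; pose proof HbNW; pose proof HWQ; pose proof HN2; lia. Qed.

Lemma s_BN : v 32 = 2 ^ (b * N).
Proof. st 30. rewrite s_bN. apply exp_ok. pose proof Qn. pose proof HQb; pose proof HNb; pose proof HbNW; pose proof HWQ; pose proof HN2; lia. Qed.

Lemma s_BN2 : v 33 = 2 ^ W.
Proof. st 31. rewrite s_W. apply exp_ok. pose proof Qn. pose proof HQb; pose proof HNb; pose proof HbNW; pose proof HWQ; pose proof HN2; lia. Qed.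

Lemma s_BN3 : v 34 = 2 ^ Q.
Proof. st 32. rewrite s_Q. apply exp_ok. pose proof Qn. pose proof HQb; pose proof HNb; pose proof HbNW; pose proof HWQ; pose proof HN2; lia. Qed.

Lemma s_WV : v 35 = W * V.
Proof. st 33. rewrite s_W, s_V. apply Nat.mod_small. apply sm_lt. apply HWVQ. Qed.

Lemma s_BH : v 36 = 2 ^ (W * V).
Proof. st 34. rewrite s_WV. apply exp_ok. pose proof Qn. pose proof HWVQ. lia. Qed.

Lemma s_eb : v 37 = 2 ^ beta.
Proof. st 35. rewrite s_beta. apply exp_ok. pose proof Qn. pose proof HQb; pose proof HNb; pose proof HbNW; pose proof HWQ; pose proof HN2; unfold b in *; lia. Qed.

Lemma s_Gb : v 38 = 2 ^ (b - 1).
Proof. st 36. rewrite s_bm. apply exp_ok. pose proof Qn. pose proof HQb; pose proof HNb; pose proof HbNW; pose proof HWQ; pose proof HN2; lia. Qed.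

Lemma p1 : forall e, 1 <= 2 ^ e.
Proof. intros e. pose proof (Nat.pow_nonzero 2 e). lia. Qed.

Lemma plt : forall e, e <= Q -> 2 ^ e < 2 ^ n.
Proof. intros e H. apply Nat.pow_lt_mono_r; pose proof Qn; lia. Qed.

Lemma s_Bm : v 41 = 2 ^ b - 1.
Proof. sb 37 ; rewrite ?s_B, ?s_one; [reflexivity|apply p1|apply plt; pose proof HWVQ; pose proof HQb; pose proof HNb; pose proof HbNW; pose proof HWQ; pose proof HN2; unfold b in *; lia]. Qed.

Lemma s_BNm : v 44 = 2 ^ (b * N) - 1.
Proof. sb 40 ; rewrite ?s_BN, ?s_one; [reflexivity|apply p1|apply plt; pose proof HWVQ; pose proof HQb; pose proof HNb; pose proof HbNW; pose proof HWQ; pose proof HN2; unfold b in *; lia]. Qed.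

Lemma s_BN2m : v 47 = 2 ^ W - 1.
Proof. sb 43 ; rewrite ?s_BN2, ?s_one; [reflexivity|apply p1|apply plt; pose proof HWVQ; pose proof HQb; pose proof HNb; pose proof HbNW; pose proof HWQ; pose proof HN2; unfold b in *; lia]. Qed.

Lemma s_BN3m : v 50 = 2 ^ Q - 1.
Proof. sb 46 ; rewrite ?s_BN3, ?s_one; [reflexivity|apply p1|apply plt; pose proof HWVQ; pose proof HQb; pose proof HNb; pose proof HbNW; pose proof HWQ; pose proof HN2; unfold b in *; lia]. Qed.

Lemma s_BHm : v 53 = 2 ^ (W * V) - 1.
Proof. sb 49 ; rewrite ?s_BH, ?s_one; [reflexivity|apply p1|apply plt; pose proof HWVQ; pose proof HQb; pose proof HNb; pose proof HbNW; pose proof HWQ; pose proof HN2; unfold b in *; lia]. Qed.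

Lemma s_ebm : v 56 = 2 ^ beta - 1.
Proof. sb 52 ; rewrite ?s_eb, ?s_one; [reflexivity|apply p1|apply plt; pose proof HWVQ; pose proof HQb; pose proof HNb; pose proof HbNW; pose proof HWQ; pose proof HN2; unfold b in *; lia]. Qed.

Let B := 2 ^ b.

Lemma EBN : 2 ^ (b * N) = B ^ N. Proof. unfold B. now rewrite Nat.pow_mul_r. Qed.
Lemma EBW : 2 ^ W = B ^ (N * N).
Proof. unfold B, W. rewrite <- Nat.mul_assoc. now rewrite Nat.pow_mul_r. Qed.
Lemma EBQ : 2 ^ Q = B ^ (N * N * N).
Proof. unfold B, Q. rewrite <- !Nat.mul_assoc. now rewrite Nat.pow_mul_r. Qed.
Lemma B2 : 2 <= B.
Proof. unfold B. change 2 with (2 ^ 1) at 1. apply Nat.pow_le_mono_r; pose proof HNb; pose proof HN2; lia. Qed.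
Lemma B2p : forall k, 0 < k -> 2 <= B ^ k.
Proof.
  intros k Hk. pose proof B2. replace k with (S (k - 1)) by lia. cbn.
  pose proof (Nat.pow_nonzero B (k - 1) ltac:(lia)). nia.
Qed.
Lemma NN : 0 < N * N. Proof. pose proof HN2. nia. Qed.

Lemma s_R1 : v 57 = rep (B ^ N) (N * N).
Proof. st 55. rewrite s_BN3m, s_BNm, EBQ, EBN. replace (B ^ (N * N * N)) with ((B ^ N) ^ (N * N)) by (rewrite <- Nat.pow_mul_r; f_equal; lia). apply rep_spec. apply B2p. pose proof HN2; lia. Qed.

Lemma s_R2 : v 58 = rep B N.
Proof. st 56. rewrite s_BNm, s_Bm, EBN. apply rep_spec. apply B2. Qed.

Lemma s_R3 : v 59 = rep (B ^ (N * N)) N.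
Proof. st 57. rewrite s_BN3m, s_BN2m, EBQ, EBW. rewrite (Nat.pow_mul_r B (N * N) N). apply rep_spec. apply B2p, NN. Qed.

Lemma s_R4 : v 60 = rep B (N * N).
Proof. st 58. rewrite s_BN2m, s_Bm, EBW. apply rep_spec. apply B2. Qed.

Lemma s_R5 : v 61 = rep (2 ^ W) V.
Proof. st 59. rewrite s_BHm, s_BN2m. rewrite (Nat.pow_mul_r 2 W V). apply rep_spec. rewrite EBW. apply B2p, NN. Qed.

Lemma s_R6 : v 62 = rep B (N * N * N).
Proof. st 60. rewrite s_BN3m, s_Bm, EBQ. apply rep_spec. apply B2. Qed.

Lemma beta_W : beta <= W. Proof. pose proof HN2. unfold W. assert (beta <= b) by (unfold b; lia). nia. Qed.

Lemma w_lt : forall i, w i < 2 ^ beta.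
Proof.
  intros i. unfold w, layout. destruct (i <? V); [apply Hins|]. unfold u.
  apply Nat.mod_upper_bound. apply Nat.pow_nonzero. lia.
Qed.

Lemma mask_lt : dig (2 ^ W) V (fun _ => 2 ^ beta - 1) < 2 ^ (W * V).
Proof.
  rewrite Nat.pow_mul_r. apply dig_bound. intros p _.
  assert (2 ^ beta <= 2 ^ W) by (apply Nat.pow_le_mono_r; [lia|apply beta_W]). pose proof (p1 beta). lia.
Qed.

Lemma s_Mask : v 63 = dig (2 ^ W) V (fun _ => 2 ^ beta - 1).
Proof. st 61. rewrite s_ebm, s_R5. unfold rep. rewrite dig_scale.
  replace (dig (2 ^ W) V (fun p => (2 ^ beta - 1) * 1)) with (dig (2 ^ W) V (fun _ => 2 ^ beta - 1))
    by (apply dig_ext; intros; lia).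
  apply Nat.mod_small. apply (pw_lt _ (W * V)); [pose proof mask_lt; lia|pose proof HWVQ; lia]. Qed.

Lemma x_digits : forall k, x mod (2 ^ W) ^ k = dig (2 ^ W) k (fun i => (x / (2 ^ W) ^ i) mod 2 ^ W).
Proof.
  induction k as [|k IH]; [apply Nat.mod_1_r|].
  cbn [dig]. rewrite <- IH.
  replace ((2 ^ W) ^ S k) with ((2 ^ W) ^ k * 2 ^ W) by (cbn [Nat.pow]; apply Nat.mul_comm).
  rewrite Nat.Div0.mod_mul_r. ring.
Qed.

(** The mask keeps the low [beta] bits of each field, so every [x] encodes a legitimate vector of
    guessed words. *)
Lemma s_xm : v 64 = dig (2 ^ W) V u.
Proof. st 62. rewrite s_Mask, v_x.
  transitivity (Nat.land (x mod (2 ^ W) ^ V) (dig (2 ^ W) V (fun _ => 2 ^ beta - 1))).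
  - rewrite <- Nat.pow_mul_r. pose proof mask_lt as ML.
    pose proof (Nat.div_mod x (2 ^ (W * V)) ltac:(apply Nat.pow_nonzero; lia)) as D.
    rewrite D at 1. rewrite (Nat.add_comm (2 ^ (W * V) * _)), (Nat.mul_comm (2 ^ (W * V))).
    replace (dig (2 ^ W) V (fun _ => 2 ^ beta - 1)) with (dig (2 ^ W) V (fun _ => 2 ^ beta - 1) + 0 * 2 ^ (W * V)) at 1 by lia.
    rewrite land_split; [rewrite Nat.land_0_r; lia| |exact ML].
    apply Nat.mod_upper_bound. apply Nat.pow_nonzero; lia.
  - assert (BW : 2 ^ beta <= 2 ^ W) by (apply Nat.pow_le_mono_r; [lia|apply beta_W]).
    rewrite x_digits. rewrite dig_land.
    + apply dig_ext. intros p Hp. replace (2 ^ beta - 1) with (Nat.ones beta) by (rewrite Nat.ones_equiv; lia).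
      rewrite Nat.land_ones. unfold u.
      replace (2 ^ W) with (2 ^ beta * 2 ^ (W - beta)) at 2.
      * rewrite Nat.Div0.mod_mul_r. rewrite Nat.mul_comm. rewrite Nat.Div0.mod_add. apply Nat.Div0.mod_mod.
      * rewrite <- Nat.pow_add_r. f_equal. pose proof beta_W. lia.
    + intros p _. apply Nat.mod_upper_bound. apply Nat.pow_nonzero; lia.
    + intros p _. pose proof (p1 beta). lia. Qed.

Lemma A3_eq : I + 2 ^ (W * V) * dig (2 ^ W) V u = dig (2 ^ W) N w.
Proof.
  unfold N. rewrite dig_split. unfold I. rewrite <- Nat.pow_mul_r. f_equal; [|f_equal]; apply dig_ext; intros p Hp; unfold w, layout.
  - destruct (Nat.ltb_spec p V); [reflexivity|lia].
  - destruct (Nat.ltb_spec (V + p) V); [lia|]. f_equal. lia.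
Qed.

Lemma dig_lt : forall C k, 2 ^ beta <= C -> dig C k w < C ^ k.
Proof. intros C k H. apply dig_bound. intros p _. pose proof (w_lt p). lia. Qed.

Lemma A3_lt : dig (2 ^ W) N w < 2 ^ Q.
Proof.
  replace (2 ^ Q) with ((2 ^ W) ^ N) by (rewrite <- Nat.pow_mul_r; reflexivity). apply dig_lt.
  apply Nat.pow_le_mono_r; [lia|apply beta_W].
Qed.

Lemma s_xs : v 65 = 2 ^ (W * V) * dig (2 ^ W) V u.
Proof. st 63. rewrite s_BH, s_xm. apply Nat.mod_small. pose proof A3_eq. pose proof A3_lt. pose proof (plt Q ltac:(lia)). lia. Qed.

Lemma s_A3 : v 66 = dig (2 ^ W) N w.
Proof. st 64. rewrite s_I, s_xs, A3_eq. apply Nat.mod_small. pose proof A3_lt. pose proof (plt Q ltac:(lia)). lia. Qed.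

Lemma beta_B : 4 * 2 ^ beta <= B.
Proof.
  unfold B. change 4 with (2 ^ 2). rewrite <- Nat.pow_add_r. apply Nat.pow_le_mono_r; [lia|].
  unfold b. lia.
Qed.

(** Every digit is at most a quarter of the base, which leaves the margin that a change of base by
    remainder requires. *)
Lemma room : forall C k, B <= C -> 2 <= k -> dig C k w < C ^ k - C.
Proof.
  intros C k HC Hk. replace k with (S (k - 1)) by lia.
  pose proof beta_B. pose proof (p1 beta).
  pose proof (dig_bound_small C (k - 1) w (2 ^ beta) ltac:(lia) ltac:(lia) (fun p _ => w_lt p)) as H1.
  assert (C <= C ^ (k - 1)).
  { replace (k - 1) with (S (k - 2)) by lia. cbn. pose proof (Nat.pow_nonzero C (k - 2) ltac:(lia)). nia. }
  cbn [Nat.pow]. nia.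
Qed.

Lemma BleBN : B <= B ^ N.
Proof. rewrite <- (Nat.pow_1_r B) at 1. apply Nat.pow_le_mono_r; pose proof B2; pose proof HN2; lia. Qed.

Lemma BNle : B ^ N * B ^ N <= 2 ^ W.
Proof.
  rewrite EBW, <- Nat.pow_add_r. apply Nat.pow_le_mono_r; [pose proof B2; lia|]. pose proof HN2. nia.
Qed.

Lemma roomA : dig B N w < 2 ^ W - B.
Proof.
  pose proof (room B N ltac:(lia) HN2). pose proof BNle. pose proof BleBN. pose proof B2. nia.
Qed.

Lemma roomA2 : dig (B ^ N) N w < 2 ^ W - B ^ N.
Proof.
  pose proof (room (B ^ N) N BleBN HN2) as H. rewrite <- Nat.pow_mul_r, <- EBW in H. exact H.
Qed.

Lemma mod_sub : forall y z, y - z * (y / z) = y mod z.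
Proof. intros. symmetry. apply Nat.Div0.mod_eq. Qed.

Lemma A3_n : dig (2 ^ W) N w < 2 ^ n.
Proof. pose proof A3_lt. pose proof (plt Q ltac:(lia)). lia. Qed.

Lemma s_m1 : v 69 = 2 ^ W - B.
Proof. sb 65 ; rewrite ?s_BN2, ?s_B; [reflexivity|pose proof BNle; pose proof BleBN; pose proof B2; fold B; nia|apply plt; pose proof HQb; pose proof HNb; pose proof HbNW; pose proof HWQ; pose proof HN2; lia]. Qed.

Lemma s_q1 : v 70 = dig (2 ^ W) N w / (2 ^ W - B).
Proof. st 68. now rewrite s_A3, s_m1. Qed.

Lemma s_t1 : v 71 = (2 ^ W - B) * (dig (2 ^ W) N w / (2 ^ W - B)).
Proof. st 69. rewrite s_q1, s_m1, Nat.mul_comm. apply Nat.mod_small. eapply Nat.le_lt_trans; [apply Nat.Div0.mul_div_le|apply A3_n]. Qed.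

(** The words at distance [b], obtained from those at distance [W] by a remainder; [s_A2] does the
    same for distance [b * N]. *)
Lemma s_A : v 74 = dig B N w.
Proof. sb 70 ; rewrite ?s_t1, ?s_A3; [|apply Nat.Div0.mul_div_le|apply A3_n]. rewrite mod_sub. apply dig_rebase; [pose proof BNle; pose proof BleBN; pose proof B2; nia|apply roomA]. Qed.

Lemma s_m2 : v 77 = 2 ^ W - B ^ N.
Proof. sb 73 ; rewrite ?s_BN2, ?s_BN, ?EBN; [reflexivity|pose proof BNle; pose proof BleBN; pose proof B2; nia|apply plt; pose proof HQb; pose proof HNb; pose proof HbNW; pose proof HWQ; pose proof HN2; lia]. Qed.

Lemma s_q2 : v 78 = dig (2 ^ W) N w / (2 ^ W - B ^ N).
Proof. st 76. now rewrite s_A3, s_m2. Qed.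

Lemma s_t2 : v 79 = (2 ^ W - B ^ N) * (dig (2 ^ W) N w / (2 ^ W - B ^ N)).
Proof. st 77. rewrite s_q2, s_m2, Nat.mul_comm. apply Nat.mod_small. eapply Nat.le_lt_trans; [apply Nat.Div0.mul_div_le|apply A3_n]. Qed.

Lemma s_A2 : v 82 = dig (B ^ N) N w.
Proof. sb 78 ; rewrite ?s_t2, ?s_A3; [|apply Nat.Div0.mul_div_le|apply A3_n]. rewrite mod_sub. apply dig_rebase; [pose proof BNle; pose proof BleBN; pose proof B2; nia|apply roomA2]. Qed.

Let K := N * N * N.
Let dX (p : nat) := w (p mod N).
Let dY (p : nat) := w (p mod (N * N) / N).
Let dZ (p : nat) := w (p / (N * N)).

Lemma sq_lt : forall p q, w p * w q < 2 ^ (b - 1).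
Proof.
  intros p q. pose proof (w_lt p). pose proof (w_lt q).
  replace (b - 1) with (S (beta + beta)) by (unfold b; lia).
  rewrite Nat.pow_succ_r', Nat.pow_add_r. nia.
Qed.

Lemma sum_lt : forall p q, w p + w q < 2 ^ (b - 1).
Proof.
  intros p q. pose proof (w_lt p). pose proof (w_lt q).
  assert (2 ^ S beta <= 2 ^ (b - 1)) by (apply Nat.pow_le_mono_r; unfold b; lia). cbn in H1. lia.
Qed.

Lemma one_lt : forall p, w p < 2 ^ (b - 1).
Proof. intros p. pose proof (sum_lt p p). lia. Qed.

Lemma half_B : 2 ^ (b - 1) + 2 ^ (b - 1) = B.
Proof. unfold B. replace b with (S (b - 1)) at 3 by (pose proof HNb; lia). cbn. lia. Qed.

Lemma digK : forall d, (forall p, d p < 2 ^ (b - 1)) -> dig B K d < 2 ^ n.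
Proof.
  intros d H. apply (pw_lt _ Q); [|lia]. apply Nat.lt_le_incl. rewrite EBQ. apply dig_bound.
  intros p _. specialize (H p). pose proof half_B. lia.
Qed.

Lemma digK' : forall k d, k <= K -> (forall p, d p < 2 ^ (b - 1)) -> dig B k d < 2 ^ n.
Proof.
  intros k d Hk H. apply (pw_lt _ Q); [|lia]. apply Nat.lt_le_incl. rewrite EBQ.
  eapply Nat.lt_le_trans; [apply dig_bound|apply Nat.pow_le_mono_r; [pose proof B2; lia|exact Hk]].
  intros p _. specialize (H p). pose proof half_B. lia.
Qed.

Lemma NNK : N * N <= K. Proof. pose proof HN2. unfold K. nia. Qed.

(** A repunit repeats the vector along the other coordinates of the cube of triples, whose three
    coordinate functions are [dX], [dY] and [dZ]. *)
Lemma s_X : v 83 = dig B K dX.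
Proof. st 81. rewrite s_A, s_R1. unfold rep. rewrite dig_mul by (pose proof HN2; lia).
  replace (N * (N * N)) with K by (unfold K; lia).
  replace (dig B K (fun p => w (p mod N) * 1)) with (dig B K dX) by (apply dig_ext; intros; unfold dX; lia).
  apply Nat.mod_small. apply digK. intros; apply one_lt. Qed.

Lemma s_Y0 : v 84 = dig B (N * N) (fun p => w (p / N)).
Proof. st 82. rewrite s_A2, s_R2, Nat.mul_comm. unfold rep. rewrite dig_mul by (pose proof HN2; lia).
  replace (dig B (N * N) (fun p => 1 * w (p / N))) with (dig B (N * N) (fun p => w (p / N))) by (apply dig_ext; intros; lia).
  apply Nat.mod_small. apply digK'; [apply NNK|]. intros; apply one_lt. Qed.

Lemma s_Y : v 85 = dig B K dY.
Proof. st 83. rewrite s_Y0, s_R3. unfold rep. rewrite dig_mul by apply NN. fold K.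
  replace (dig B K (fun p => w (p mod (N * N) / N) * 1)) with (dig B K dY) by (apply dig_ext; intros; unfold dY; lia).
  apply Nat.mod_small. apply digK. intros; apply one_lt. Qed.

Lemma s_Z : v 86 = dig B K dZ.
Proof. st 84. rewrite s_A3, s_R4, Nat.mul_comm, EBW. unfold rep. rewrite dig_mul by apply NN. fold K.
  replace (dig B K (fun p => 1 * w (p / (N * N)))) with (dig B K dZ) by (apply dig_ext; intros; unfold dZ; lia).
  apply Nat.mod_small. apply digK. intros; apply one_lt. Qed.

(** The product of the vectors at distances [b] and [b * N] contains all pairwise products, one per
    field. *)
Lemma s_M0 : v 87 = dig B (N * N) (fun p => w (p mod N) * w (p / N)).
Proof. st 85. rewrite s_A, s_A2. rewrite dig_mul by (pose proof HN2; lia).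
  apply Nat.mod_small. apply digK'; [apply NNK|]. intros; apply sq_lt. Qed.

Lemma modmod : forall p, p mod (N * N) mod N = p mod N.
Proof. intros p. rewrite Nat.Div0.mod_mul_r. rewrite Nat.mul_comm, Nat.Div0.mod_add. apply Nat.Div0.mod_mod. Qed.

Lemma s_XY : v 88 = dig B K (fun p => dX p * dY p).
Proof. st 86. rewrite s_M0, s_R3. unfold rep. rewrite dig_mul by apply NN. fold K.
  replace (dig B K (fun p => w (p mod (N * N) mod N) * w (p mod (N * N) / N) * 1)) with (dig B K (fun p => dX p * dY p))
    by (apply dig_ext; intros; unfold dX, dY; rewrite modmod; lia).
  apply Nat.mod_small. apply digK. intros; apply sq_lt. Qed.

Lemma s_XA : v 89 = dig B K (fun p => dX p + dY p).
Proof. st 87. rewrite s_X, s_Y, dig_add. apply Nat.mod_small. apply digK. intros; apply sum_lt. Qed.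

Lemma s_XL : v 90 = dig B K (fun p => Nat.land (dX p) (dY p)).
Proof. st 88. rewrite s_X, s_Y. unfold B. apply dig_land; intros p _; fold B; pose proof half_B.
  - pose proof (one_lt (p mod N)). unfold dX. lia.
  - pose proof (one_lt (p mod (N * N) / N)). unfold dY. lia. Qed.

Lemma s_G : v 91 = 2 ^ (b - 1) * rep B K.
Proof. st 89. rewrite s_Gb, s_R6. fold K. apply Nat.mod_small. unfold rep. rewrite dig_scale.
  apply (pw_lt _ Q); [|lia]. apply Nat.lt_le_incl. rewrite EBQ. apply dig_bound. intros p _. pose proof half_B. pose proof (p1 (b - 1)). lia. Qed.

Lemma s_Bmm : v 94 = B - 2.
Proof. sb 90 ; rewrite ?s_Bm, ?s_one; fold B; pose proof B2; pose proof (plt b ltac:(pose proof HQb; pose proof HNb; pose proof HbNW; pose proof HWQ; pose proof HN2; lia)); fold B in H0; lia. Qed.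

Lemma sumG : forall d, (forall p, d p < 2 ^ (b - 1)) -> dig B K d + 2 ^ (b - 1) * rep B K < 2 ^ n.
Proof.
  intros d H. unfold rep. rewrite dig_scale, dig_add. apply (pw_lt _ Q); [|lia]. apply Nat.lt_le_incl. rewrite EBQ.
  apply dig_bound. intros p _. specialize (H p). pose proof half_B. lia.
Qed.

Lemma Gge : forall d, (forall p, d p < 2 ^ (b - 1)) -> dig B K d <= 2 ^ (b - 1) * rep B K.
Proof.
  intros d H. unfold rep. rewrite dig_scale. apply dig_le. intros p _. specialize (H p). lia.
Qed.

Lemma zb : forall p, dZ p < 2 ^ (b - 1). Proof. intros p. apply one_lt. Qed.
Lemma ab : forall p, dX p + dY p < 2 ^ (b - 1). Proof. intros p. apply sum_lt. Qed.
Lemma mb : forall p, dX p * dY p < 2 ^ (b - 1). Proof. intros p. apply sq_lt. Qed.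
Lemma lb : forall p, Nat.land (dX p) (dY p) < 2 ^ (b - 1).
Proof. intros p. eapply Nat.le_lt_trans; [apply land_le_l|apply one_lt]. Qed.

Definition bits (d : nat -> nat) : nat -> nat := fun p => b2n (d p =? dZ p).

Lemma b2 : 2 <= b. Proof. pose proof HNb. pose proof HN2. lia. Qed.

Lemma bits_n : forall d, 2 ^ (b - 1) * dig B K (bits d) < 2 ^ n.
Proof.
  intros d. rewrite dig_scale. apply (pw_lt _ Q); [|lia]. apply Nat.lt_le_incl. rewrite EBQ.
  apply dig_bound. intros p _. pose proof half_B. unfold bits, b2n. pose proof (p1 (b - 1)). destruct (d p =? dZ p); lia.
Qed.

(** This is where fields of at least [N * N * N + 2] bits are required: the comparison bits, read in
    base 2, must lie below the modulus [B - 2]. *)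
Lemma idx_lt : forall d, dig 2 K (bits d) < B - 2.
Proof.
  intros d. assert (H : dig 2 K (bits d) < 2 ^ K).
  { apply dig_bound. intros p _. unfold bits, b2n. destruct (d p =? dZ p); lia. }
  assert (2 ^ (K + 2) <= B) by (apply Nat.pow_le_mono_r; [lia|exact Hb]).
  rewrite Nat.pow_add_r in H0. change (2 ^ 2) with 4 in H0. pose proof (p1 K). lia.
Qed.

Lemma s_ZG : v 95 = dig B K dZ + 2 ^ (b - 1) * rep B K.
Proof. st 93. rewrite s_Z, s_G. apply Nat.mod_small. apply sumG, zb. Qed.

Lemma s_TGA : v 96 = dig B K (fun p => dX p + dY p) + 2 ^ (b - 1) * rep B K.
Proof. st 94. rewrite s_XA, s_G. apply Nat.mod_small. apply sumG, ab. Qed.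

Lemma s_dA : v 99 = dig B K (fun p => dX p + dY p) + 2 ^ (b - 1) * rep B K - dig B K dZ.
Proof. sb 95 ; rewrite ?s_TGA, ?s_Z; [reflexivity|pose proof (Gge _ zb); lia|apply sumG, ab]. Qed.

Lemma s_cA : v 102 = dig B K dZ + 2 ^ (b - 1) * rep B K - dig B K (fun p => dX p + dY p).
Proof. sb 98 ; rewrite ?s_ZG, ?s_XA; [reflexivity|pose proof (Gge _ ab); lia|apply sumG, zb]. Qed.

Lemma s_eA : v 103 = Nat.land (dig B K (fun p => dX p + dY p) + 2 ^ (b - 1) * rep B K - dig B K dZ) (dig B K dZ + 2 ^ (b - 1) * rep B K - dig B K (fun p => dX p + dY p)).
Proof. st 101. now rewrite s_dA, s_cA. Qed.

Lemma s_gA : v 104 = 2 ^ (b - 1) * dig B K (bits (fun p => dX p + dY p)).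
Proof. st 102. rewrite s_eA, s_G. apply (packed_eq b K); [apply b2|intros; apply ab|intros; apply zb]. Qed.

Lemma s_hA : v 105 = dig B K (bits (fun p => dX p + dY p)).
Proof. st 103. rewrite s_gA, s_Gb, Nat.mul_comm. apply Nat.div_mul. pose proof (p1 (b - 1)); lia. Qed.

Lemma s_qA : v 106 = dig B K (bits (fun p => dX p + dY p)) / (B - 2).
Proof. st 104. now rewrite s_hA, s_Bmm. Qed.

Lemma s_tA : v 107 = (B - 2) * (dig B K (bits (fun p => dX p + dY p)) / (B - 2)).
Proof. st 105. rewrite s_qA, s_Bmm, Nat.mul_comm. apply Nat.mod_small. eapply Nat.le_lt_trans; [apply Nat.Div0.mul_div_le|]. pose proof (bits_n (fun p => dX p + dY p)). pose proof (p1 (b - 1)). nia. Qed.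

(** A change of base from [B] to 2 compresses the comparison bits, one per field, into consecutive
    bits. *)
Lemma s_iA : v 110 = dig 2 K (bits (fun p => dX p + dY p)).
Proof. sb 106 ; rewrite ?s_tA, ?s_hA; [|apply Nat.Div0.mul_div_le|pose proof (bits_n (fun p => dX p + dY p)); pose proof (p1 (b - 1)); nia]. rewrite mod_sub. apply dig_rebase; [apply B2|apply idx_lt]. Qed.

Lemma s_TGM : v 111 = dig B K (fun p => dX p * dY p) + 2 ^ (b - 1) * rep B K.
Proof. st 109. rewrite s_XY, s_G. apply Nat.mod_small. apply sumG, mb. Qed.

Lemma s_dM : v 114 = dig B K (fun p => dX p * dY p) + 2 ^ (b - 1) * rep B K - dig B K dZ.
Proof. sb 110 ; rewrite ?s_TGM, ?s_Z; [reflexivity|pose proof (Gge _ zb); lia|apply sumG, mb]. Qed.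

Lemma s_cM : v 117 = dig B K dZ + 2 ^ (b - 1) * rep B K - dig B K (fun p => dX p * dY p).
Proof. sb 113 ; rewrite ?s_ZG, ?s_XY; [reflexivity|pose proof (Gge _ mb); lia|apply sumG, zb]. Qed.

Lemma s_eM : v 118 = Nat.land (dig B K (fun p => dX p * dY p) + 2 ^ (b - 1) * rep B K - dig B K dZ) (dig B K dZ + 2 ^ (b - 1) * rep B K - dig B K (fun p => dX p * dY p)).
Proof. st 116. now rewrite s_dM, s_cM. Qed.

Lemma s_gM : v 119 = 2 ^ (b - 1) * dig B K (bits (fun p => dX p * dY p)).
Proof. st 117. rewrite s_eM, s_G. apply (packed_eq b K); [apply b2|intros; apply mb|intros; apply zb]. Qed.

Lemma s_hM : v 120 = dig B K (bits (fun p => dX p * dY p)).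
Proof. st 118. rewrite s_gM, s_Gb, Nat.mul_comm. apply Nat.div_mul. pose proof (p1 (b - 1)); lia. Qed.

Lemma s_qM : v 121 = dig B K (bits (fun p => dX p * dY p)) / (B - 2).
Proof. st 119. now rewrite s_hM, s_Bmm. Qed.

Lemma s_tM : v 122 = (B - 2) * (dig B K (bits (fun p => dX p * dY p)) / (B - 2)).
Proof. st 120. rewrite s_qM, s_Bmm, Nat.mul_comm. apply Nat.mod_small. eapply Nat.le_lt_trans; [apply Nat.Div0.mul_div_le|]. pose proof (bits_n (fun p => dX p * dY p)). pose proof (p1 (b - 1)). nia. Qed.

Lemma s_iM : v 125 = dig 2 K (bits (fun p => dX p * dY p)).
Proof. sb 121 ; rewrite ?s_tM, ?s_hM; [|apply Nat.Div0.mul_div_le|pose proof (bits_n (fun p => dX p * dY p)); pose proof (p1 (b - 1)); nia]. rewrite mod_sub. apply dig_rebase; [apply B2|apply idx_lt]. Qed.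

Lemma s_TGL : v 126 = dig B K (fun p => Nat.land (dX p) (dY p)) + 2 ^ (b - 1) * rep B K.
Proof. st 124. rewrite s_XL, s_G. apply Nat.mod_small. apply sumG, lb. Qed.

Lemma s_dL : v 129 = dig B K (fun p => Nat.land (dX p) (dY p)) + 2 ^ (b - 1) * rep B K - dig B K dZ.
Proof. sb 125 ; rewrite ?s_TGL, ?s_Z; [reflexivity|pose proof (Gge _ zb); lia|apply sumG, lb]. Qed.

Lemma s_cL : v 132 = dig B K dZ + 2 ^ (b - 1) * rep B K - dig B K (fun p => Nat.land (dX p) (dY p)).
Proof. sb 128 ; rewrite ?s_ZG, ?s_XL; [reflexivity|pose proof (Gge _ lb); lia|apply sumG, zb]. Qed.

Lemma s_eL : v 133 = Nat.land (dig B K (fun p => Nat.land (dX p) (dY p)) + 2 ^ (b - 1) * rep B K - dig B K dZ) (dig B K dZ + 2 ^ (b - 1) * rep B K - dig B K (fun p => Nat.land (dX p) (dY p))).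
Proof. st 131. now rewrite s_dL, s_cL. Qed.

Lemma s_gL : v 134 = 2 ^ (b - 1) * dig B K (bits (fun p => Nat.land (dX p) (dY p))).
Proof. st 132. rewrite s_eL, s_G. apply (packed_eq b K); [apply b2|intros; apply lb|intros; apply zb]. Qed.

Lemma s_hL : v 135 = dig B K (bits (fun p => Nat.land (dX p) (dY p))).
Proof. st 133. rewrite s_gL, s_Gb, Nat.mul_comm. apply Nat.div_mul. pose proof (p1 (b - 1)); lia. Qed.

Lemma s_qL : v 136 = dig B K (bits (fun p => Nat.land (dX p) (dY p))) / (B - 2).
Proof. st 134. now rewrite s_hL, s_Bmm. Qed.

Lemma s_tL : v 137 = (B - 2) * (dig B K (bits (fun p => Nat.land (dX p) (dY p))) / (B - 2)).
Proof. st 135. rewrite s_qL, s_Bmm, Nat.mul_comm. apply Nat.mod_small. eapply Nat.le_lt_trans; [apply Nat.Div0.mul_div_le|]. pose proof (bits_n (fun p => Nat.land (dX p) (dY p))). pose proof (p1 (b - 1)). nia. Qed.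

Lemma s_iL : v 140 = dig 2 K (bits (fun p => Nat.land (dX p) (dY p))).
Proof. sb 136 ; rewrite ?s_tL, ?s_hL; [|apply Nat.Div0.mul_div_le|pose proof (bits_n (fun p => Nat.land (dX p) (dY p))); pose proof (p1 (b - 1)); nia]. rewrite mod_sub. apply dig_rebase; [apply B2|apply idx_lt]. Qed.

Lemma kb : forall d, dig 2 K (bits d) < 2 ^ K.
Proof. intros d. apply dig_bound. intros p _. unfold bits, b2n. destruct (d p =? dZ p); lia. Qed.

Lemma K3 : 2 ^ K * 2 ^ K * 2 ^ K = 2 ^ (3 * K).
Proof. rewrite <- !Nat.pow_add_r. f_equal. lia. Qed.

Lemma K3n : 2 ^ (3 * K) < n.
Proof. pose proof HT. pose proof Hn8. fold K in H. pose proof (p1 (3 * K)). lia. Qed.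

Lemma nlt : n < 2 ^ n. Proof. apply Nat.pow_gt_lin_r; lia. Qed.

Lemma s_N2 : v 141 = N * N.
Proof. st 139. rewrite s_N. apply Nat.mod_small. apply sm_lt. pose proof NNK. unfold Q, K in *. pose proof HNb. nia. Qed.

Lemma s_N3 : v 142 = K.
Proof. st 140. rewrite s_N2, s_N. apply Nat.mod_small. apply sm_lt. unfold Q, K in *. pose proof HNb. nia. Qed.

Lemma s_E3 : v 143 = 2 ^ K.
Proof. st 141. rewrite s_N3. apply exp_ok. pose proof Qn. unfold Q, K in *. pose proof HNb. nia. Qed.

Let iA := dig 2 K (bits (fun p => dX p + dY p)).
Let iM := dig 2 K (bits (fun p => dX p * dY p)).
Let iL := dig 2 K (bits (fun p => Nat.land (dX p) (dY p))).

Lemma j_lt : iA + (iM + iL * 2 ^ K) * 2 ^ K < 2 ^ (3 * K).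
Proof.
  rewrite <- K3. assert (iA < 2 ^ K) by apply kb. assert (iM < 2 ^ K) by apply kb. assert (iL < 2 ^ K) by apply kb. nia.
Qed.

Lemma j2_lt : iM + iL * 2 ^ K < 2 ^ n.
Proof. pose proof j_lt. pose proof K3n. pose proof nlt. pose proof (p1 K). nia. Qed.

Lemma s_j1 : v 144 = iL * 2 ^ K.
Proof. st 142. rewrite s_iL, s_E3. apply Nat.mod_small. pose proof j2_lt. fold iL. lia. Qed.

Lemma s_j2 : v 145 = iM + iL * 2 ^ K.
Proof. st 143. rewrite s_j1, s_iM. apply Nat.mod_small. apply j2_lt. Qed.

Lemma s_j3 : v 146 = (iM + iL * 2 ^ K) * 2 ^ K.
Proof. st 144. rewrite s_j2, s_E3. apply Nat.mod_small. pose proof j_lt. pose proof K3n. pose proof nlt. lia. Qed.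

Lemma s_idx : v 147 = iA + (iM + iL * 2 ^ K) * 2 ^ K.
Proof. st 145. rewrite s_j3, s_iA. apply Nat.mod_small. fold iA. pose proof j_lt. pose proof K3n. pose proof nlt. lia. Qed.

Let J := iA + (iM + iL * 2 ^ K) * 2 ^ K.

(** The index is below [n / 8], so [Exp2] does not saturate and a division by its value shifts the
    table. *)
Lemma s_pw : v 148 = 2 ^ J.
Proof. st 146. rewrite s_idx. apply exp_ok. pose proof j_lt. pose proof K3n. unfold J. lia. Qed.

Lemma s_tq : v 149 = Tb / 2 ^ J.
Proof. st 147. now rewrite s_Tb, s_pw. Qed.

Lemma s_th : v 150 = Tb / 2 ^ J / 2.
Proof. st 148. now rewrite s_tq, s_two. Qed.

Lemma tq_lt : Tb / 2 ^ J < 2 ^ n.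
Proof.
  eapply Nat.le_lt_trans; [apply Nat.Div0.div_le_upper_bound with (q := Tb); pose proof (p1 J); nia|].
  apply (pw_lt _ (n / 8)); [pose proof Tb_F; unfold F in *; lia|lia].
Qed.

Lemma s_t3 : v 151 = 2 * (Tb / 2 ^ J / 2).
Proof. st 149. rewrite s_th, s_two, Nat.mul_comm. apply Nat.mod_small. eapply Nat.le_lt_trans; [apply Nat.Div0.mul_div_le|apply tq_lt]. Qed.

Lemma s_bit : v 154 = (Tb / 2 ^ J) mod 2.
Proof. sb 150 ; rewrite ?s_t3, ?s_tq; [|apply Nat.Div0.mul_div_le|apply tq_lt]. apply mod_sub. Qed.

Lemma s_o : v 157 = 1 - (Tb / 2 ^ J) mod 2.
Proof. sb 153 ; rewrite ?s_bit, ?s_one; pose proof (Nat.mod_upper_bound (Tb / 2 ^ J) 2 ltac:(lia)); pose proof c8; lia. Qed.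

Lemma verifier_out_aux : v 158 = 0 <-> Nat.testbit Tb (patidx (2 * V) w) = true.
Proof.
  st 156. rewrite s_o, s_one.
  assert (EJ : patidx (2 * V) w = J).
  { unfold patidx. replace (2 * V) with N by (unfold N; lia). fold K. unfold J, iA, iM, iL.
    unfold bits. cbn [atomb]. reflexivity. }
  rewrite EJ, Nat.testbit_eqb, Nat.eqb_eq.
  pose proof (Nat.mod_upper_bound (Tb / 2 ^ J) 2 ltac:(lia)). lia.
Qed.

End Verifier.

Lemma verifier_out : forall n beta V Tb x ins,
  let K := (V + V) * (V + V) * (V + V) in
  1 <= V -> K + 2 <= beta + beta + 2 ->
  (beta + beta + 2) * (V + V) * (V + V) * (V + V) <= n / 8 ->
  2 ^ (3 * K) <= n / 8 -> Tb < 2 ^ (2 ^ (3 * K)) -> (forall i, ins i < 2 ^ beta) -> x < 2 ^ n ->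
  let W := (beta + beta + 2) * (V + V) * (V + V) in
  (nth 158 (vals n verifier [x; encode n beta V Tb (dig (2 ^ W) V ins)]) 0 = 0 <->
   Nat.testbit Tb (patidx (2 * V) (layout V ins (fun i => (x / (2 ^ W) ^ i) mod 2 ^ beta))) = true).
Proof.
  intros n beta V Tb x ins K HV Hb HQ HT HTb Hins Hx W.
  apply (verifier_out_aux n beta V Tb x ins HV Hb HQ HT HTb Hins Hx
    (fun k => nth k (vals n verifier [x; encode n beta V Tb (dig (2 ^ W) V ins)]) 0)).
  - rewrite vals_prefix by (cbn; lia). reflexivity.
  - rewrite vals_prefix by (cbn; lia). reflexivity.
  - intros s o i j H Hi Hj.
    apply (vals_eq n verifier [x; encode n beta V Tb (dig (2 ^ W) V ins)] s o i j H Hi Hj).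
Qed.

(** * The test as an evaluator of tables *)

Definition P : program := prog verifier.

Lemma verifier_wf : wf 2 verifier = true. Proof. reflexivity. Qed.
Lemma verifier_len : length verifier <= 190. Proof. cbn. lia. Qed.

Lemma pval_le : forall n xs, pval verifier n xs <= 1.
Proof.
  intros n xs. unfold pval. destruct (n <=? 40); [lia|].
  pose proof (vals_eq n verifier [hd 0 xs; hd 0 (tl xs)] 156 Min 157 2 eq_refl) as E.
  cbn [length Nat.add] in E. specialize (E ltac:(lia) ltac:(lia)).
  replace (1 + length verifier) with 158 by reflexivity. rewrite E. clear E.
  pose proof (vals_eq n verifier [hd 0 xs; hd 0 (tl xs)] 0 One 0 0 eq_refl) as E.
  cbn [length Nat.add] in E. specialize (E ltac:(lia) ltac:(lia)). rewrite E.
  cbn [arith_eval]. lia.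
Qed.

Definition Win (n a : nat) : Prop := exists x, x < 2 ^ n /\ has_output n P [x; a] 0.

Lemma Win_vals : forall n a, 41 <= n ->
  (Win n a <-> exists x, x < 2 ^ n /\ nth 158 (vals n verifier [x; a]) 0 = 0).
Proof.
  intros n a Hn. unfold Win.
  assert (H : forall x, has_output n P [x; a] 0 <-> nth 158 (vals n verifier [x; a]) 0 = 0).
  { intros x. unfold P. rewrite (prog_output verifier verifier_wf verifier_len n [x; a] 0) by lia.
    unfold pval. destruct (Nat.leb_spec n 40); [lia|]. reflexivity. }
  split; intros (x & Hx & Ho); exists x; (split; [exact Hx|]); apply H; exact Ho.
Qed.

Definition cube (V : nat) : nat := (V + V) * (V + V) * (V + V).
Definition stride (beta V : nat) : nat := (beta + beta + 2) * (V + V) * (V + V).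

(** [ad_b] allows the comparison bits to be compressed, [ad_n] lets the cube of fields fit into
    [n / 8] bits, and [ad_t] lets the table fit into its field of the parameter. *)
Record admissible (n beta V : nat) : Prop := {
  ad_V : 1 <= V;
  ad_b : cube V <= beta + beta;
  ad_n : (beta + beta + 2) * (V + V) * (V + V) * (V + V) <= n / 8;
  ad_t : 2 ^ (3 * cube V) <= n / 8;
  ad_41 : 41 <= n }.

Lemma patidx_ext : forall N w w', (forall i, i < N -> w i = w' i) -> patidx N w = patidx N w'.
Proof.
  intros N w w' H. unfold patidx.
  assert (Ht : forall c p, p < N * N * N ->
    b2n (atomb c (w (p mod N)) (w (p mod (N * N) / N)) (w (p / (N * N))))
    = b2n (atomb c (w' (p mod N)) (w' (p mod (N * N) / N)) (w' (p / (N * N))))).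
  { intros c p Hp. destruct (Nat.eq_dec N 0) as [->|HN]; [lia|].
    pose proof (Nat.mod_upper_bound p N HN).
    assert (p mod (N * N) / N < N).
    { apply Nat.Div0.div_lt_upper_bound. apply Nat.mod_upper_bound. nia. }
    assert (p / (N * N) < N) by (apply Nat.Div0.div_lt_upper_bound; nia).
    rewrite !H by auto. reflexivity. }
  f_equal; [apply dig_ext; apply Ht|].
  f_equal. f_equal; [apply dig_ext; apply Ht|]. f_equal. apply dig_ext; apply Ht.
Qed.

Lemma dig_digit : forall k V u i m, (forall p, u p < 2 ^ m) -> m <= k -> i < V ->
  (dig (2 ^ k) V u / (2 ^ k) ^ i) mod 2 ^ m = u i.
Proof.
  intros k V u i m Hu Hm Hi.
  assert (Hk : forall p, u p < 2 ^ k).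
  { intros p. eapply Nat.lt_le_trans; [apply Hu|]. apply Nat.pow_le_mono_r; lia. }
  replace V with (i + S (V - i - 1)) by lia. rewrite dig_split.
  rewrite Nat.mul_comm. pose proof (Nat.pow_nonzero 2 k ltac:(lia)) as Hp.
  rewrite Nat.div_add by (apply Nat.pow_nonzero; lia).
  rewrite Nat.div_small by (apply dig_bound; auto). rewrite Nat.add_0_l.
  change (S (V - i - 1)) with (1 + (V - i - 1)). rewrite dig_split. cbn [dig Nat.pow].
  rewrite Nat.add_0_r, Nat.mul_1_r, Nat.add_0_l, Nat.mul_1_r.
  replace (2 ^ k) with (2 ^ m * 2 ^ (k - m)) at 1 by (rewrite <- Nat.pow_add_r; f_equal; lia).
  replace (u i + 2 ^ m * 2 ^ (k - m) * dig (2 ^ k) (V - i - 1) (fun p => u (i + (1 + p))))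
    with (u i + (2 ^ (k - m) * dig (2 ^ k) (V - i - 1) (fun p => u (i + (1 + p)))) * 2 ^ m) by ring.
  rewrite Nat.Div0.mod_add. apply Nat.mod_small. auto.
Qed.

(** Universality of the test: any existential statement given by a table over patterns of [beta]-bit
    words is an instance of the single predicate [Win n]. *)
Lemma Win_encode : forall n beta V Tb ins, admissible n beta V ->
  Tb < 2 ^ (2 ^ (3 * cube V)) -> (forall i, ins i < 2 ^ beta) ->
  (Win n (encode n beta V Tb (dig (2 ^ stride beta V) V ins)) <->
   exists u, bde (2 ^ beta) u /\ Nat.testbit Tb (patidx (2 * V) (layout V ins u)) = true).
Proof.
  intros n beta V Tb ins [HV Hb HQ HT H41] HTb Hins. rewrite Win_vals by auto.
  assert (HK : cube V + 2 <= beta + beta + 2) by lia.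
  pose proof (Nat.pow_nonzero 2 beta ltac:(lia)) as Hnz.
  assert (HbW : beta <= stride beta V) by (unfold stride; nia).
  split.
  - intros (x & Hx & E). apply (verifier_out n beta V Tb x ins HV HK HQ HT HTb Hins Hx) in E.
    eexists. split; [|exact E]. intros i. apply Nat.mod_upper_bound. exact Hnz.
  - intros (u & Hu & E). exists (dig (2 ^ stride beta V) V u).
    assert (Hx : dig (2 ^ stride beta V) V u < 2 ^ n).
    { eapply Nat.lt_le_trans; [apply dig_bound; intros p _; eapply Nat.lt_le_trans; [apply Hu|]|].
      - apply Nat.pow_le_mono_r; [lia|exact HbW].
      - rewrite <- Nat.pow_mul_r. apply Nat.pow_le_mono_r; [lia|].
        pose proof (Nat.Div0.mul_div_le n 8). unfold stride in *. nia. }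
    split; [exact Hx|].
    apply (verifier_out n beta V Tb _ ins HV HK HQ HT HTb Hins Hx).
    rewrite <- E. f_equal. apply patidx_ext. intros i Hi. unfold layout.
    destruct (Nat.ltb_spec i V); [reflexivity|].
    apply dig_digit; auto. lia.
Qed.

Lemma testbit_split : forall k a h i, a < 2 ^ k ->
  Nat.testbit (a + h * 2 ^ k) i = if i <? k then Nat.testbit a i else Nat.testbit h (i - k).
Proof.
  intros k a h i Ha. destruct (Nat.ltb_spec i k) as [L|L].
  - rewrite <- (Nat.mod_pow2_bits_low (a + h * 2 ^ k) k i L).
    rewrite Nat.Div0.mod_add, Nat.mod_small by auto. reflexivity.
  - replace i with ((i - k) + k) at 1 by lia. rewrite <- Nat.div_pow2_bits.
    rewrite Nat.div_add by (apply Nat.pow_nonzero; lia). rewrite Nat.div_small by auto. reflexivity.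
Qed.

Definition offset (K : nat) (c : kind) : nat := match c with KAdd => 0 | KMul => K | KAnd => 2 * K end.

Definition decode_pat (N p : nat) : table := fun c i j k =>
  (i <? N) && (j <? N) && (k <? N) && Nat.testbit p (offset (N * N * N) c + (i + N * j + N * N * k)).

Lemma dig2_lt : forall K (t : nat -> bool), dig 2 K (fun p => b2n (t p)) < 2 ^ K.
Proof. intros K t. apply dig_bound. intros p _. destruct (t p); cbn; lia. Qed.

Lemma patidx_lt : forall N w, patidx N w < 2 ^ (3 * (N * N * N)).
Proof.
  intros N w. unfold patidx. set (K := N * N * N).
  replace (2 ^ (3 * K)) with (2 ^ K * 2 ^ K * 2 ^ K) by (rewrite <- !Nat.pow_add_r; f_equal; lia).
  pose proof (fun c => dig2_lt K (fun p => atomb c (w (p mod N)) (w (p mod (N * N) / N)) (w (p / (N * N))))) as H.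
  pose proof (H KAdd). pose proof (H KMul). pose proof (H KAnd).
  nia.
Qed.

Lemma decode_patidx : forall N w, decode_pat N (patidx N w) = atoms (fun i => i <? N) w.
Proof.
  intros N w. extensionality c. extensionality i. extensionality j. extensionality k.
  unfold decode_pat, atoms.
  destruct (Nat.ltb_spec i N) as [Hi|]; [|reflexivity].
  destruct (Nat.ltb_spec j N) as [Hj|]; [|reflexivity].
  destruct (Nat.ltb_spec k N) as [Hk|]; [|reflexivity]. cbn [andb].
  set (p := i + N * j + N * N * k).
  assert (Hp : p < N * N * N).
  { unfold p. assert (i + N * j < N * N) by nia. nia. }
  assert (E1 : p mod N = i).
  { unfold p. replace (i + N * j + N * N * k) with (i + (j + N * k) * N) by ring.
    rewrite Nat.Div0.mod_add. now apply Nat.mod_small. }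
  assert (E2 : p mod (N * N) / N = j).
  { unfold p. replace (i + N * j + N * N * k) with ((i + N * j) + k * (N * N)) by ring.
    rewrite Nat.Div0.mod_add. rewrite Nat.mod_small by nia.
    replace (i + N * j) with (i + j * N) by ring. rewrite Nat.div_add by lia. rewrite Nat.div_small; lia. }
  assert (E3 : p / (N * N) = k).
  { unfold p. replace (i + N * j + N * N * k) with ((i + N * j) + k * (N * N)) by ring.
    rewrite Nat.div_add by nia. rewrite Nat.div_small by nia. lia. }
  unfold patidx. set (K := N * N * N) in *.
  set (t := fun c p => atomb c (w (p mod N)) (w (p mod (N * N) / N)) (w (p / (N * N)))).
  change (Nat.testbit (dig 2 K (fun p => b2n (t KAdd p)) + (dig 2 K (fun p => b2n (t KMul p))
    + dig 2 K (fun p => b2n (t KAnd p)) * 2 ^ K) * 2 ^ K) (offset K c + p) = atomb c (w i) (w j) (w k)).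
  assert (Et : forall c, t c p = atomb c (w i) (w j) (w k)) by (intros c'; unfold t; now rewrite E1, E2, E3).
  rewrite testbit_split by apply dig2_lt.
  destruct c; cbn [offset].
  - destruct (Nat.ltb_spec (0 + p) K); [|lia]. rewrite dig_testbit. cbn [Nat.add].
    destruct (Nat.ltb_spec p K); [|lia]. exact (Et KAdd).
  - destruct (Nat.ltb_spec (K + p) K); [lia|]. replace (K + p - K) with p by lia.
    rewrite testbit_split by apply dig2_lt. destruct (Nat.ltb_spec p K); [|lia].
    rewrite dig_testbit. destruct (Nat.ltb_spec p K); [|lia]. exact (Et KMul).
  - destruct (Nat.ltb_spec (2 * K + p) K); [lia|]. replace (2 * K + p - K) with (K + p) by lia.
    rewrite testbit_split by apply dig2_lt. destruct (Nat.ltb_spec (K + p) K); [lia|].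
    replace (K + p - K) with p by lia.
    rewrite dig_testbit. destruct (Nat.ltb_spec p K); [|lia]. exact (Et KAnd).
Qed.

(** There are finitely many patterns, so the table can list the answers of [L]; nothing about [L]
    has to be computable. *)
Lemma table_exists : forall N (L : table -> Prop), exists Tb, Tb < 2 ^ (2 ^ (3 * (N * N * N))) /\
  forall w, Nat.testbit Tb (patidx N w) = true <-> L (atoms (fun i => i <? N) w).
Proof.
  intros N L.
  set (t := fun p => if excluded_middle_informative (L (decode_pat N p)) then true else false).
  exists (dig 2 (2 ^ (3 * (N * N * N))) (fun p => b2n (t p))). split; [apply dig2_lt|].
  intros w. rewrite dig_testbit. pose proof (patidx_lt N w) as H. apply Nat.ltb_lt in H. rewrite H. cbn [andb].
  unfold t. rewrite decode_patidx. destruct excluded_middle_informative; intuition congruence.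
Qed.

Lemma inputs_of_lt : forall cs A e Bd i, 0 < Bd -> Forall (fun c => c < Bd) cs -> bde Bd e -> inputs_of cs A e i < Bd.
Proof.
  intros cs A e Bd i H0 Hc He. unfold inputs_of. destruct (Nat.ltb_spec i (length cs)).
  - rewrite Forall_forall in Hc. apply Hc. now apply nth_In.
  - destruct (i <? length cs + A); auto.
Qed.

(** * Machine operations on words that fit into one variable *)

Lemma pow_div_lt : forall n x y, x < 2 ^ n -> x / y < 2 ^ n.
Proof.
  intros n x y H. destruct y as [|y]; [cbn; pose proof (Nat.pow_nonzero 2 n); lia|].
  apply Nat.Div0.div_lt_upper_bound. nia.
Qed.

Lemma log2_low : forall n x, 0 < n -> x < 2 ^ n -> Nat.log2 x < n.
Proof.
  intros n x Hn H. destruct (Nat.eq_dec x 0) as [->|]; [cbn; lia|]. apply Nat.log2_lt_pow2; lia.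
Qed.

(** De Morgan, since bitwise conjunction is the only bitwise atom. *)
Lemma lor_low : forall n x y, 0 < n -> x < 2 ^ n -> y < 2 ^ n ->
  Nat.lor x y = 2 ^ n - 1 - Nat.land (2 ^ n - 1 - x) (2 ^ n - 1 - y).
Proof.
  intros n x y Hn Hx Hy. rewrite <- (lnot_low n x), <- (lnot_low n y) by auto.
  rewrite <- Nat.lnot_lor_low by (apply log2_low; auto).
  assert (H : Nat.lnot (Nat.lor x y) n < 2 ^ n).
  { rewrite Nat.lnot_lor_low by (apply log2_low; auto).
    eapply Nat.le_lt_trans; [apply land_le_l|]. rewrite lnot_low by auto. lia. }
  rewrite <- (lnot_low n (Nat.lnot (Nat.lor x y) n)) by auto. now rewrite Nat.lnot_involutive.
Qed.

Lemma arith_lt : forall n o x y, 0 < n -> x < 2 ^ n -> y < 2 ^ n -> arith_eval n o x y < 2 ^ n.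
Proof.
  intros n o x y Hn Hx Hy. pose proof (Nat.pow_nonzero 2 n ltac:(lia)) as Hz.
  assert (H1 : 2 ^ 1 <= 2 ^ n) by (apply Nat.pow_le_mono_r; lia). change (2 ^ 1) with 2 in H1.
  destruct o; cbn [arith_eval]; try lia.
  - apply Nat.pow_gt_lin_r; lia.
  - rewrite lnot_low by auto. lia.
  - apply Nat.mod_upper_bound; auto.
  - apply Nat.mod_upper_bound; auto.
  - now apply pow_div_lt.
  - eapply Nat.le_lt_trans; [apply land_le_l|]. auto.
  - rewrite (lor_low n) by auto. lia.
Qed.

Section WordOps.

Variable D : dclass.
Variable w beta m l1 : nat.
Hypothesis Hm : 0 < m.
Hypothesis Hbd : bd D = 2 ^ beta.
Hypothesis Hbeta : m + m + 2 <= beta.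
Hypothesis Hw : 3 <= w.
Hypothesis HB1 : bd D <= 2 ^ (w * (2 ^ w - 1)).
Hypothesis HB2 : 2 ^ (w * w + 4 * w) <= bd D.
Hypothesis Dw : Df D l1 (fun _ => w).
Hypothesis Du : Df D l1 (fun _ => 2 ^ w).
Hypothesis Dm : Df D l1 (fun _ => m).
Hypothesis Dpm : Df D l1 (fun _ => 2 ^ m).

Lemma bd_sq : 2 ^ m * 2 ^ m * 4 <= bd D.
Proof.
  rewrite Hbd. change 4 with (2 ^ 2). rewrite <- !Nat.pow_add_r. apply Nat.pow_le_mono_r; lia.
Qed.

(** Words of the class are more than twice as long as machine words, so sums and products exist
    before they are reduced. 22 exceeds the nesting depth of every case; exponentiation is the
    deepest. *)
Lemma darith : forall o k f g, Df D (lv k l1) f -> Df D (lv k l1) g ->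
  (forall e, bde (bd D) e -> f e < 2 ^ m) -> (forall e, bde (bd D) e -> g e < 2 ^ m) ->
  Df D (lv (22 + k) l1) (fun e => arith_eval m o (f e) (g e)).
Proof.
  intros o k f g Hf Hg Bf Bg. pose proof bd_sq as HS. pose proof (Nat.pow_nonzero 2 m ltac:(lia)) as Hz.
  assert (Hf' : forall j, Df D (lv (j + k) l1) f) by (intros j; eapply Df_mono; [|exact Hf]; unfold lv; lia).
  assert (Hg' : forall j, Df D (lv (j + k) l1) g) by (intros j; eapply Df_mono; [|exact Hg]; unfold lv; lia).
  assert (Hp : 2 <= 2 ^ m).
  { change 2 with (2 ^ 1) at 1. apply Nat.pow_le_mono_r; lia. }
  assert (Hmx : forall j, Df D (lv (S (S j)) l1) (fun _ => 2 ^ m - 1)).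
  { intros j. apply dsub; [eapply dleaf; [exact Dpm|lia]|apply dnum; [nia|lia]]. }
  assert (Hlift : forall j h, j <= 22 -> Df D (lv (j + k) l1) h -> Df D (lv (22 + k) l1) h).
  { intros j h Hj. apply Df_mono. unfold lv; lia. }
  destruct o; cbn [arith_eval].
  - apply dnum; [nia|lia].
  - apply dnum; [nia|lia].
  - eapply dleaf; [exact Dm|lia].
  - apply (Hlift 2); [lia|]. apply Hmx.
  - apply (Hlift 17); [lia|].
    eapply Df_ext with (f := fun e => if f e <? m then 2 ^ (if f e <? m then f e else 0) else 2 ^ m - 1).
    + intros e He. destruct (Nat.ltb_spec (f e) m) as [L|L].
      * assert (2 ^ f e < 2 ^ m) by (apply Nat.pow_lt_mono_r; lia). lia.
      * assert (2 ^ m <= 2 ^ f e) by (apply Nat.pow_le_mono_r; lia). lia.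
    + apply (dite D (16 + k)).
      * apply (dlt D (15 + k)); [apply (Hf' 15)|eapply dleaf; [exact Dm|lia]].
      * apply (dexp D w Hw HB1 HB2 l1 Dw Du (2 + k)); [lia| |].
        -- apply dite; [apply dlt; [exact Hf|eapply dleaf; [exact Dm|lia]]|apply (Hf' 1)|apply dnum; [nia|lia]].
        -- intros e He. destruct (Nat.ltb_spec (f e) m) as [L|L].
           ++ assert (2 ^ f e < 2 ^ m) by (apply Nat.pow_lt_mono_r; lia). nia.
           ++ cbn. nia.
      * apply Hmx.
  - apply (Hlift 3); [lia|].
    eapply Df_ext with (f := fun e => 2 ^ m - 1 - f e).
    + intros e He. symmetry. apply lnot_low. auto.
    + apply dsub; [apply Hmx|apply (Hf' 2)].
  - apply (Hlift 2); [lia|]. apply dmod; [|eapply dleaf; [exact Dpm|lia]].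
    apply dadd; auto. intros e He. specialize (Bf e He). specialize (Bg e He). nia.
  - apply (Hlift 2); [lia|]. apply dmod; [|eapply dleaf; [exact Dpm|lia]].
    apply dmul; auto. intros e He. specialize (Bf e He). specialize (Bg e He). nia.
  - apply (Hlift 1); [lia|]. apply ddiv; auto.
  - apply (Hlift 2); [lia|].
    eapply Df_ext with (f := fun e => if f e <? g e then g e else f e).
    + intros e He. destruct (Nat.ltb_spec (f e) (g e)); lia.
    + apply dite; [apply dlt; auto|apply (Hg' 1)|apply (Hf' 1)].
  - apply (Hlift 2); [lia|].
    eapply Df_ext with (f := fun e => if f e <? g e then f e else g e).
    + intros e He. destruct (Nat.ltb_spec (f e) (g e)); lia.
    + apply dite; [apply dlt; auto|apply (Hf' 1)|apply (Hg' 1)].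
  - apply (Hlift 1); [lia|]. apply dland; auto.
  - apply (Hlift 6); [lia|].
    eapply Df_ext with (f := fun e => 2 ^ m - 1 - Nat.land (2 ^ m - 1 - f e) (2 ^ m - 1 - g e)).
    + intros e He. symmetry. apply lor_low; auto.
    + apply (dsub D (5 + k)); [apply Hmx|]. apply (dland D (4 + k)).
      * apply (dsub D (3 + k)); [apply Hmx|apply (Hf' 3)].
      * apply (dsub D (3 + k)); [apply Hmx|apply (Hg' 3)].
Qed.

Lemma dresult : forall k Q T inp, Df D (lv (22 * k) l1) inp -> (forall e, bde (bd D) e -> inp e < 2 ^ m) ->
  5 <= m -> is_program Q -> length Q <= T -> T + 32 <= 2 ^ m ->
  Df D (lv (22 * (k + T * (4 * T + 160) + 5)) l1) (fun e => result m Q (inp e) T).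
Proof.
  intros k Q T inp Hi Bi H5 HQ HL HT.
  (* First instance of the symbolic run: one unit of its depth stands for 22 nested operations. *)
  set (Dv := fun d (f : env -> nat) => (forall e, bde (bd D) e -> f e < 2 ^ m) /\ Df D (lv (22 * d) l1) f).
  enough (H : Dv (k + T * (4 * T + 160) + 5) (fun e => result m Q (inp e) T)) by exact (proj2 H).
  apply (Dv_result env m Dv); auto.
  - intros d d' f Hd [H1 H2]. split; auto. eapply Df_mono; [|exact H2]. unfold lv; lia.
  - intros o d f g [Bf Hf] [Bg Hg]. split.
    + intros e He. apply arith_lt; auto.
    + replace (22 * S d) with (22 + 22 * d) by lia. apply darith; auto.
  - intros d f g h j [Bf Hf] [Bg Hg] [Bh Hh] [Bj Hj]. split.
    + intros e He. destruct (f e =? g e); auto.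
    + eapply Df_mono; [|apply (dite D (1 + 22 * d) l1 (fun e => f e =? g e) h j)].
      * unfold lv; lia.
      * apply deq; auto.
      * eapply Df_mono; [|exact Hh]. unfold lv; lia.
      * eapply Df_mono; [|exact Hj]. unfold lv; lia.
  - split; auto.
Qed.

End WordOps.

(** * Trading alternations for longer words *)

Lemma dig_cons : forall B n d, dig B (S n) d = d 0 + B * dig B n (fun i => d (S i)).
Proof. intros B n d. change (S n) with (1 + n). rewrite dig_split. cbn. lia. Qed.

Lemma dig_zero_tail : forall B n k d, n <= k -> (forall i, n <= i -> d i = 0) -> dig B k d = dig B n d.
Proof.
  intros B n k d H Hd. induction H as [|k H IH]; [reflexivity|]. cbn. rewrite IH, Hd by lia. lia.
Qed.

Lemma inputs_dig : forall B V A c d e, 2 + A <= V ->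
  dig B V (inputs_of [c; d] A e) = c + B * (d + B * dig B A e).
Proof.
  intros B V A c d e H. rewrite (dig_zero_tail B (2 + A) V); auto.
  - cbn [Nat.add]. rewrite !dig_cons.
    replace (dig B A (fun i => inputs_of [c; d] A e (S (S i)))) with (dig B A e); [reflexivity|].
    apply dig_ext. intros i Hi. unfold inputs_of. cbn [length].
    destruct (Nat.ltb_spec (S (S i)) 2); [lia|]. destruct (Nat.ltb_spec (S (S i)) (2 + A)); [|lia].
    f_equal. lia.
  - intros i Hi. unfold inputs_of. cbn [length].
    destruct (Nat.ltb_spec i 2); [lia|]. destruct (Nat.ltb_spec i (2 + A)); [lia|reflexivity].
Qed.

Lemma encode_lt : forall n beta V Tb I, admissible n beta V -> Tb < 2 ^ (n / 8) -> I < 2 ^ (n / 8) ->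
  encode n beta V Tb I < 2 ^ n.
Proof.
  intros n beta V Tb I [HV Hb HQ _ H41] HT HI. unfold encode. cbv zeta.
  set (F := 2 ^ (n / 8)) in *.
  assert (HF : n / 8 < F) by (apply Nat.pow_gt_lin_r; lia).
  assert (V < F /\ beta < F).
  { assert (1 <= (V + V) * (V + V)) by nia. split; nia. }
  assert (H4 : F * F * F * F <= 2 ^ n).
  { unfold F. rewrite <- !Nat.pow_add_r. apply Nat.pow_le_mono_r; [lia|].
    pose proof (Nat.Div0.mul_div_le n 8). lia. }
  assert (Tb + F * I < F * F) by nia. assert (V + F * (Tb + F * I) < F * F * F) by nia. nia.
Qed.

(** Large constants reach a formula as the digits of a single advice word, which are read by
    repeated division by the base. *)
Lemma piece_Df : forall D ps Pb adv, length ps <= 13 -> Forall (fun p => p < Pb) ps ->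
  adv = dig Pb 13 (fun i => nth i ps 0) -> csts D adv -> csts D Pb -> adv < bd D -> Pb < bd D ->
  forall i, i < length ps -> Df D (lv 15 0) (fun _ => nth i ps 0).
Proof.
  intros D ps Pb adv Hl HF Ea Ca CP La LP i Hi.
  assert (Hp : forall j, nth j ps 0 < Pb \/ Pb = 0).
  { intros j. destruct (Nat.lt_ge_cases j (length ps)) as [L|L].
    - left. rewrite Forall_forall in HF. apply HF. now apply nth_In.
    - rewrite nth_overflow by auto. lia. }
  assert (HP0 : Pb <> 0).
  { destruct (Hp i) as [H|H]; [lia|]. rewrite Forall_forall in HF.
    specialize (HF (nth i ps 0) (nth_In ps 0 Hi)). lia. }
  assert (Hp' : forall j, nth j ps 0 < Pb) by (intros j; destruct (Hp j); [auto|lia]).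
  assert (Hd : forall j, j <= 13 -> Df D (lv j 0) (fun _ => dig Pb (13 - j) (fun q => nth (j + q) ps 0))).
  { induction j as [|j IH]; intros Hj.
    - cbn [Nat.sub Nat.add]. rewrite <- Ea. eapply dleaf; [apply Df_cst; auto|lia].
    - specialize (IH ltac:(lia)).
      eapply Df_ext; [|apply (ddiv D j 0 (fun _ => dig Pb (13 - j) (fun q => nth (j + q) ps 0)) (fun _ => Pb)); [exact IH|eapply dleaf; [apply Df_cst; auto|lia]]].
      intros e _. cbv beta. replace (13 - j) with (S (13 - S j)) by lia. rewrite dig_cons.
      rewrite (Nat.mul_comm Pb), Nat.div_add by auto. rewrite Nat.div_small by auto. cbn [Nat.add].
      apply dig_ext. intros q _. f_equal. lia. }
  assert (H14 : Df D (lv (S i) 0) (fun _ => nth i ps 0)).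
  { eapply Df_ext; [|apply (dmod D i 0 (fun _ => dig Pb (13 - i) (fun q => nth (i + q) ps 0)) (fun _ => Pb)); [apply (Hd i); lia|eapply dleaf; [apply Df_cst; auto|lia]]].
    intros e _. cbv beta. replace (13 - i) with (S (12 - i)) by lia. rewrite dig_cons.
    rewrite (Nat.mul_comm Pb), Nat.Div0.mod_add. rewrite Nat.add_0_r. now apply Nat.mod_small. }
  eapply Df_mono; [|exact H14]. unfold lv; lia.
Qed.

Lemma grow : forall F x, F <> 0 -> x <= F * x.
Proof. intros F x H. nia. Qed.

(** The number of variables visible at level 0; atoms use only the first 8 of them. *)
Definition S0 : nat := 20.

Section Levels.

Variables T kmax m0 V w s0 : nat.
Variable Q : nat -> program.

(** Level [l] is decided by the machine with word length [M l], for which [ad_n] holds with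
    equality. The next level must compute with words of that machine, hence
    [be (S l) = 2 * M l + 2]. *)
Fixpoint be (l : nat) : nat :=
  match l with
  | 0 => m0
  | S l' => 2 * (8 * ((be l' + be l' + 2) * (V + V) * (V + V) * (V + V))) + 2
  end.

Definition M (l : nat) : nat := 8 * ((be l + be l + 2) * (V + V) * (V + V) * (V + V)).
(** The advice of a level packs thirteen numbers of the size of the previous advice. *)
Definition sz (l : nat) : nat := 13 ^ l * s0.
(** The base in which the advice of level [l] is packed; at level 0 the advice is a single
    constant. *)
Definition Pb (l : nat) : nat := match l with 0 => 0 | S l' => 2 ^ sz l' end.

Definition K1 : nat := 3 * (S0 + kmax) + (S0 + kmax + 10) + 20.
(** [K1] bounds the depth of assembling a query. [Lmax] covers a whole level: the query, the
    symbolic run of [T] steps on it, a connective and a quantifier. *)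
Definition Lmax : nat := lv (22 * (K1 + T * (4 * T + 160) + 5) + 2) (lv 60 0) + 2.

Hypothesis H_V : 2 ^ Lmax + Lmax + 100 <= V.
Hypothesis H_m0 : 2 ^ (3 * cube V) <= m0.
Hypothesis H_w3 : 3 <= w.
Hypothesis H_ww : w * w + 4 * w <= m0.
Hypothesis H_w : forall l, l <= kmax -> be (S l) <= 2 ^ w - 1.
Hypothesis H_s : sz (S kmax) <= m0.
Hypothesis H_s0 : w + 1 <= s0.
Hypothesis H_s1 : 2 ^ (3 * cube V) <= s0.
Hypothesis H_T : T + 32 <= m0.
Hypothesis H_Q : forall l, l <= kmax -> is_program (Q (M l)) /\ length (Q (M l)) <= T /\
  forall a, a < 2 ^ M l -> (Win (M l) a <-> result (M l) (Q (M l)) a T = 0).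

(** The environment has [m0]-bit words on every level and only the guessed words grow, which makes
    the levels comparable. Advice and table may depend on [P] in any way. *)
Definition Def (l : nat) (P : env -> Prop) : Prop := l <= kmax ->
  exists adv (L : table -> Prop), adv < 2 ^ sz l /\ forall e, bde (2 ^ m0) e ->
    (P e <-> exists u, bde (2 ^ be l) u /\
      L (atoms (fun i => i <? 2 * V) (layout V (inputs_of [adv; Pb l] (S0 + l) e) u))).

Definition trunc (k : nat) (e : env) : env := fun i => if i <? k then e i else 0.

Lemma V_pos : 1 <= V. Proof. lia. Qed.

Lemma be_S : forall l, be (S l) = M l + M l + 2.
Proof. intros l. unfold M. cbn [be]. lia. Qed.

Lemma be_m0 : forall l, m0 <= be l.
Proof.
  induction l as [|l IH]; [reflexivity|]. rewrite be_S. unfold M. pose proof V_pos.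
  assert (1 <= (V + V) * (V + V) * (V + V)) by nia. nia.
Qed.

Lemma cube_m0 : cube V <= m0.
Proof. pose proof (Nat.pow_gt_lin_r 2 (3 * cube V) ltac:(lia)). lia. Qed.

Lemma M_adm : forall l, admissible (M l) (be l) V.
Proof.
  intros l. pose proof (be_m0 l). pose proof cube_m0. pose proof V_pos.
  assert (E : M l / 8 = (be l + be l + 2) * (V + V) * (V + V) * (V + V)).
  { unfold M. rewrite Nat.mul_comm. apply Nat.div_mul. lia. }
  assert (HC : 8 <= cube V) by (unfold cube; nia).
  split.
  - lia.
  - lia.
  - rewrite E. lia.
  - rewrite E. assert (1 <= (V + V) * (V + V) * (V + V)) by nia. nia.
  - unfold M. assert (1 <= (V + V) * (V + V) * (V + V)) by nia. nia.
Qed.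

Lemma sz_le : forall l l', l <= l' -> sz l <= sz l'.
Proof. intros l l' H. unfold sz. apply Nat.mul_le_mono_r. apply Nat.pow_le_mono_r; lia. Qed.

Lemma sz_m0 : forall l, l <= S kmax -> sz l <= m0.
Proof. intros l H. pose proof (sz_le l (S kmax) H). lia. Qed.

Lemma Pb_lt : forall l, l <= S kmax -> Pb l < 2 ^ sz l.
Proof.
  intros [|l] H; unfold Pb.
  - pose proof (Nat.pow_nonzero 2 (sz 0)). lia.
  - apply Nat.pow_lt_mono_r; [lia|]. unfold sz. cbn [Nat.pow]. pose proof (Nat.pow_nonzero 13 l ltac:(lia)). nia.
Qed.

Lemma consts_lt : forall l adv, l <= S kmax -> adv < 2 ^ sz l ->
  Forall (fun c => c < 2 ^ be l) [adv; Pb l].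
Proof.
  intros l adv Hl Ha. pose proof (Pb_lt l Hl). pose proof (sz_m0 l Hl). pose proof (be_m0 l).
  assert (2 ^ sz l <= 2 ^ be l) by (apply Nat.pow_le_mono_r; lia).
  repeat constructor; lia.
Qed.

Lemma bde_m0 : forall l e, bde (2 ^ m0) e -> bde (2 ^ be l) e.
Proof.
  intros l e He i. eapply Nat.lt_le_trans; [apply He|]. apply Nat.pow_le_mono_r; [lia|apply be_m0].
Qed.

Lemma bd2 : forall l, 2 <= 2 ^ be l.
Proof.
  intros l. change 2 with (2 ^ 1) at 1. apply Nat.pow_le_mono_r; [lia|]. pose proof (be_m0 l). lia.
Qed.

Definition Cl (l adv : nat) : dclass :=
  EXclass (2 ^ be l) [adv; Pb l] (V - 2) 8 (bd2 l) ltac:(lia).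

Lemma Lmax_V : 8 + Lmax <= V - 2 /\ 2 ^ Lmax <= V.
Proof. lia. Qed.

Lemma Def_of_EX : forall l adv (P Phi : env -> Prop), l <= kmax -> adv < 2 ^ sz l ->
  cls (Cl l adv) Lmax Phi ->
  (forall e, bde (2 ^ m0) e -> (P e <-> Phi (trunc (S0 + l) e))) -> Def l P.
Proof.
  intros l adv P Phi Hl Ha HP HE _. destruct Lmax_V as [L1 L2].
  destruct (EX_layout (2 ^ be l) [adv; Pb l] (V - 2) 8 (bd2 l) ltac:(lia) Lmax Phi V HP L1 ltac:(cbn; lia) L2) as [L HL].
  exists adv, L. split; auto. intros e He. rewrite HE by auto.
  rewrite HL.
  - replace (inputs_of [adv; Pb l] (V - 2) (trunc (S0 + l) e)) with (inputs_of [adv; Pb l] (S0 + l) e); [reflexivity|].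
    extensionality i. unfold inputs_of, trunc. cbn [length].
    destruct (Nat.ltb_spec i 2); auto.
    assert (S0 + kmax + 10 <= V - 2) by (unfold Lmax, lv, K1 in *; lia).
    destruct (Nat.ltb_spec i (2 + (S0 + l))); destruct (Nat.ltb_spec i (2 + (V - 2)));
      destruct (Nat.ltb_spec (i - 2) (S0 + l)); try lia; reflexivity.
  - apply bde_m0. intros i. unfold trunc. destruct (i <? S0 + l); auto.
    pose proof (Nat.pow_nonzero 2 m0). lia.
Qed.

(** Used twice: with [n = M l] to pass to the next level, and with the full word length in the
    diagonal argument. *)
Lemma Def_Win : forall l P n, Def l P -> l <= kmax -> admissible n (be l) V ->
  exists Tb adv, Tb < 2 ^ (2 ^ (3 * cube V)) /\ adv < 2 ^ sz l /\ forall e, bde (2 ^ m0) e ->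
  (P e <-> Win n (encode n (be l) V Tb (dig (2 ^ stride (be l) V) V (inputs_of [adv; Pb l] (S0 + l) e)))).
Proof.
  intros l P n HP Hl Had. destruct (HP Hl) as (adv & L & Ha & HL).
  destruct (table_exists (2 * V) L) as (Tb & HTb & HT).
  replace (2 * V * (2 * V) * (2 * V)) with (cube V) in HTb by (unfold cube; ring).
  exists Tb, adv. split; [exact HTb|split; [exact Ha|]]. intros e He.
  rewrite (HL e He), (Win_encode n (be l) V Tb _ Had HTb).
  - split; intros (u & Hu & H); exists u; (split; [exact Hu|]); now apply HT.
  - intros i. apply inputs_of_lt; [pose proof (Nat.pow_nonzero 2 (be l)); lia|apply consts_lt; auto|now apply bde_m0].
Qed.

(* The input word handed to [Q (M l)] when a level-[l] instance is evaluated in the environment [e o r]. *)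
Definition query (l Tb adv : nat) (r : nat -> nat) (e : env) : nat :=
  encode (M l) (be l) V Tb
    (adv + 2 ^ stride (be l) V * (Pb l + 2 ^ stride (be l) V *
      dig (2 ^ stride (be l) V) (S0 + l) (fun i => e (r i) mod 2 ^ m0))).

Lemma stride_M : forall l, stride (be l) V * V <= M l / 8 /\ M l / 8 <= M l /\ 2 * stride (be l) V <= M l /\ m0 <= stride (be l) V /\ m0 <= M l /\ be l <= M l /\ V <= M l.
Proof.
  intros l. pose proof V_pos. pose proof (be_m0 l).
  assert (E : M l / 8 = (be l + be l + 2) * (V + V) * (V + V) * (V + V)).
  { unfold M. rewrite Nat.mul_comm. apply Nat.div_mul. lia. }
  rewrite E. unfold M, stride.
  set (X := (be l + be l + 2) * (V + V) * (V + V)).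
  assert (be l <= X) by (unfold X; nia). assert (V <= X) by (unfold X; nia).
  repeat split; nia.
Qed.

Lemma S0V : forall l, l <= kmax -> 2 + (S0 + l) <= V.
Proof. intros l Hl. unfold Lmax, lv, K1 in *. pose proof (Nat.pow_nonzero 2 (30 * (22 * (3 * (S0 + kmax) + (S0 + kmax + 10) + 20 + T * (4 * T + 160) + 5) + 2) + (30 * 60 + 0) + 2)). lia. Qed.

Lemma query_inner_lt : forall l adv (r : nat -> nat) (e : env), l <= kmax -> adv < 2 ^ sz l ->
  adv + 2 ^ stride (be l) V * (Pb l + 2 ^ stride (be l) V *
      dig (2 ^ stride (be l) V) (S0 + l) (fun i => e (r i) mod 2 ^ m0)) < 2 ^ (M l / 8).
Proof.
  intros l adv r e Hl Ha. rewrite <- (inputs_dig _ V); [|now apply S0V].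
  destruct (stride_M l) as (B1 & B2 & B3 & B4 & B5 & B6 & B7).
  eapply Nat.lt_le_trans; [apply dig_bound|rewrite <- Nat.pow_mul_r; apply Nat.pow_le_mono_r; [lia|exact B1]].
  intros p _. assert (2 ^ m0 <= 2 ^ stride (be l) V) by (apply Nat.pow_le_mono_r; lia).
  eapply Nat.lt_le_trans; [|exact H]. apply inputs_of_lt.
  - pose proof (Nat.pow_nonzero 2 m0); lia.
  - pose proof (Pb_lt l ltac:(lia)). pose proof (sz_m0 l ltac:(lia)).
    assert (2 ^ sz l <= 2 ^ m0) by (apply Nat.pow_le_mono_r; lia). repeat constructor; lia.
  - intros i. apply Nat.mod_upper_bound. apply Nat.pow_nonzero; lia.
Qed.

Lemma query_lt : forall l Tb adv r e, l <= kmax -> Tb < 2 ^ (2 ^ (3 * cube V)) -> adv < 2 ^ sz l ->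
  query l Tb adv r e < 2 ^ M l.
Proof.
  intros l Tb adv r e Hl HT Ha. apply encode_lt.
  - apply M_adm.
  - eapply Nat.lt_le_trans; [exact HT|]. apply Nat.pow_le_mono_r; [lia|]. apply (ad_t _ _ _ (M_adm l)).
  - now apply query_inner_lt.
Qed.

(** Connective and signs in one operation, so that conjunction, disjunction, negation and
    quantification share a single level step. *)
Definition comb (ao s1 s2 : bool) (A B : Prop) : Prop :=
  let A' := if s1 then A else ~ A in let B' := if s2 then B else ~ B in
  if ao then A' /\ B' else A' \/ B'.

Lemma Df_query : forall D l Tb adv r, l <= kmax -> Tb < 2 ^ (2 ^ (3 * cube V)) -> adv < 2 ^ sz l ->
  bd D = 2 ^ be (S l) -> (forall i, r i <= i + 2) ->
  Df D (lv 40 0) (fun _ => 2 ^ (M l / 8)) -> Df D (lv 40 0) (fun _ => 2 ^ stride (be l) V) ->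
  Df D (lv 40 0) (fun _ => 2 ^ m0) -> Df D (lv 15 0) (fun _ => Tb) -> Df D (lv 15 0) (fun _ => adv) ->
  Df D (lv 15 0) (fun _ => be l) -> Df D (lv 15 0) (fun _ => V) -> Df D (lv 15 0) (fun _ => Pb l) ->
  Df D (lv K1 (lv 60 0)) (query l Tb adv r).
Proof.
  intros D l Tb adv r Hl HT Ha Hbd Hr DF DW Dm DT Da Db DV DP.
  set (W := stride (be l) V) in *. set (L1 := lv 60 0).
  assert (HL : lv 40 0 <= L1 /\ lv 15 0 <= L1) by (unfold L1, lv; lia). destruct HL as [HLa HLb].
  assert (Leaf : forall k c, Df D (lv 40 0) (fun _ => c) -> Df D (lv k L1) (fun _ => c))
    by (intros k c H; eapply dleaf; [exact H|exact HLa]).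
  assert (Leaf' : forall k c, Df D (lv 15 0) (fun _ => c) -> Df D (lv k L1) (fun _ => c))
    by (intros k c H; eapply dleaf; [exact H|exact HLb]).
  set (R := S0 + kmax + 10).
  assert (HMbd : 2 ^ M l < bd D).
  { rewrite Hbd, be_S. apply Nat.pow_lt_mono_r; lia. }
  destruct (stride_M l) as (B1 & B2 & B3 & B4 & B5 & B6 & B7). fold W in B1, B3, B4.
  assert (Hmod : forall x, x mod 2 ^ m0 < 2 ^ W).
  { intros x. eapply Nat.lt_le_trans; [apply Nat.mod_upper_bound; apply Nat.pow_nonzero; lia|].
    apply Nat.pow_le_mono_r; lia. }
  assert (Hdig : forall cnt (q : nat -> nat), cnt <= V -> (forall i, i < cnt -> q i <= R) ->
    Df D (lv (3 * cnt + R) L1) (fun e => dig (2 ^ W) cnt (fun i => e (q i) mod 2 ^ m0))).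
  { induction cnt as [|cnt IH]; intros q Hc Hq.
    - cbn [dig]. apply dnum; [pose proof (bd_ge D); lia|lia].
    - assert (Hdb : forall e : env, e (q 0) mod 2 ^ m0 + 2 ^ W * dig (2 ^ W) cnt (fun i => e (q (S i)) mod 2 ^ m0) < bd D).
      { intros e. rewrite <- (dig_cons (2 ^ W) cnt (fun i => e (q i) mod 2 ^ m0)).
        eapply Nat.lt_le_trans; [apply dig_bound; intros; apply Hmod|].
        rewrite <- Nat.pow_mul_r. apply Nat.lt_le_incl. eapply Nat.le_lt_trans; [|exact HMbd].
        apply Nat.pow_le_mono_r; nia. }
      eapply Df_mono; [|eapply Df_ext; [intros e _; symmetry; apply dig_cons|]].
      2: { apply (dadd D (2 + (3 * cnt + R)) L1).
           - apply dmod; [apply dvar|apply Leaf; exact Dm]. specialize (Hq 0 ltac:(lia)). unfold R in *. lia.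
           - apply dmul.
             + apply Leaf; exact DW.
             + eapply Df_mono; [|apply (IH (fun i => q (S i)))]; [unfold lv; lia|lia|].
               intros i Hi. apply Hq. lia.
             + intros e _. specialize (Hdb e). lia.
           - intros e _. apply Hdb. }
      unfold lv. lia. }
  pose proof (Hdig (S0 + l) r ltac:(pose proof (S0V l Hl); lia)) as Hh.
  specialize (Hh ltac:(intros i Hi; specialize (Hr i); unfold R; lia)).
  assert (HA : Df D (lv (10 + (3 * (S0 + l) + R)) L1) (query l Tb adv r)).
  { unfold query, encode. cbv zeta. fold W.
    assert (Hq : forall e, query l Tb adv r e < bd D).
    { intros e. pose proof (query_lt l Tb adv r e Hl HT Ha). lia. }
    unfold query, encode in Hq. cbv zeta in Hq. fold W in Hq.
    pose proof (fun e => query_inner_lt l adv r e Hl Ha) as Hi. fold W in Hi.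
    pose proof (Nat.pow_nonzero 2 (M l / 8) ltac:(lia)) as HF0.
    assert (HFI : forall e : env, 2 ^ (M l / 8) * (adv + 2 ^ W * (Pb l + 2 ^ W * dig (2 ^ W) (S0 + l) (fun i => e (r i) mod 2 ^ m0))) < bd D
       /\ Tb + 2 ^ (M l / 8) * (adv + 2 ^ W * (Pb l + 2 ^ W * dig (2 ^ W) (S0 + l) (fun i => e (r i) mod 2 ^ m0))) < bd D).
    { intros e. specialize (Hq e).
      remember (adv + 2 ^ W * (Pb l + 2 ^ W * dig (2 ^ W) (S0 + l) (fun i => e (r i) mod 2 ^ m0))) as I.
      remember (2 ^ (M l / 8)) as F. clear - Hq HF0.
      pose proof (grow F (Tb + F * I) HF0). pose proof (grow F (V + F * (Tb + F * I)) HF0). lia. }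
    pose proof (Nat.pow_nonzero 2 W ltac:(lia)) as HW0.
    assert (HVI : forall e : env, V + 2 ^ (M l / 8) * (Tb + 2 ^ (M l / 8) * (adv + 2 ^ W * (Pb l + 2 ^ W * dig (2 ^ W) (S0 + l) (fun i => e (r i) mod 2 ^ m0)))) < bd D
      /\ 2 ^ (M l / 8) * (Tb + 2 ^ (M l / 8) * (adv + 2 ^ W * (Pb l + 2 ^ W * dig (2 ^ W) (S0 + l) (fun i => e (r i) mod 2 ^ m0)))) < bd D).
    { intros e. specialize (Hq e).
      remember (adv + 2 ^ W * (Pb l + 2 ^ W * dig (2 ^ W) (S0 + l) (fun i => e (r i) mod 2 ^ m0))) as I.
      remember (2 ^ (M l / 8)) as F. clear - Hq HF0.
      pose proof (grow F (V + F * (Tb + F * I)) HF0). lia. }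
    assert (HII : forall e : env, adv + 2 ^ W * (Pb l + 2 ^ W * dig (2 ^ W) (S0 + l) (fun i => e (r i) mod 2 ^ m0)) < bd D).
    { intros e. destruct (HFI e) as [HF1 _].
      remember (adv + 2 ^ W * (Pb l + 2 ^ W * dig (2 ^ W) (S0 + l) (fun i => e (r i) mod 2 ^ m0))) as I.
      pose proof (grow (2 ^ (M l / 8)) I HF0). lia. }
    assert (HIJ : forall e : env, Pb l + 2 ^ W * dig (2 ^ W) (S0 + l) (fun i => e (r i) mod 2 ^ m0) < bd D).
    { intros e. specialize (HII e).
      pose proof (grow (2 ^ W) (Pb l + 2 ^ W * dig (2 ^ W) (S0 + l) (fun i => e (r i) mod 2 ^ m0)) HW0). lia. }
    apply dadd; [apply Leaf'; exact Db| |intros e _; apply Hq].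
    apply dmul; [apply Leaf; exact DF| |intros e _; specialize (Hq e); clear - Hq; lia].
    apply dadd; [apply Leaf'; exact DV| |intros e _; apply HVI].
    apply dmul; [apply Leaf; exact DF| |intros e _; apply HVI].
    apply dadd; [apply Leaf'; exact DT| |intros e _; apply HFI].
    apply dmul; [apply Leaf; exact DF| |intros e _; apply HFI].
    apply (dadd D (S (S (S (3 * (S0 + l) + R)))) L1 (fun _ => adv)); [apply Leaf'; exact Da| |intros e _; apply HII].
    apply dmul; [apply Leaf; exact DW| |intros e _; specialize (HII e); clear - HII; lia].
    apply dadd; [apply Leaf'; exact DP| |intros e _; apply HIJ].
    eapply Df_mono; [|apply (dmul D (3 * (S0 + l) + R) L1 (fun _ => 2 ^ W))]; [unfold lv; lia|apply Leaf; exact DW|exact Hh|].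
    intros e _. specialize (HIJ e). clear - HIJ. lia. }
  eapply Df_mono; [|exact HA]. unfold K1, lv, R. lia.
Qed.

Lemma comb_iff : forall ao s1 s2 A A' B B', (A <-> A') -> (B <-> B') ->
  (comb ao s1 s2 A B <-> comb ao s1 s2 A' B').
Proof. intros [] [] []; unfold comb; tauto. Qed.

Lemma Dp_comb : forall D l ao s1 s2 A B, Dp D l A -> Dp D l B -> Dp D (S l) (fun e => comb ao s1 s2 (A e) (B e)).
Proof.
  intros D l [] [] [] A B HA HB; unfold comb;
    first [apply Dp_and|apply Dp_or]; auto; apply Dp_not; auto.
Qed.

(** On [m0]-bit environments the remainders in [query] change nothing; they bound the query when the
    next formula is read over its longer words. *)
Lemma query_of_inputs : forall l Tb adv r (e : env), l <= kmax -> bde (2 ^ m0) e ->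
  encode (M l) (be l) V Tb (dig (2 ^ stride (be l) V) V (inputs_of [adv; Pb l] (S0 + l) (fun i => e (r i))))
  = query l Tb adv r e.
Proof.
  intros l Tb adv r e Hl He. unfold query. rewrite inputs_dig by (now apply S0V).
  do 5 f_equal. apply dig_ext. intros i _. symmetry. apply Nat.mod_small. apply He.
Qed.

Lemma pow2_lt : forall a b, a < b -> 2 ^ a < 2 ^ b.
Proof. intros a b H. apply Nat.pow_lt_mono_r; lia. Qed.

(** Here an alternation disappears. Both predicates are decided by runs of [Q (M l)] on query words;
    since [result] is a definable function, its being 0 and its being nonzero are equally
    existential over words of [be (S l)] bits, so the signs cost nothing. *)
Lemma Def_step : forall l P1 P2 r1 r2 ao s1 s2, Def l P1 -> Def l P2 ->
  (forall i, r1 i <= i + 2) -> (forall i, r2 i <= i + 2) ->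
  Def (S l) (fun e => exists y, y < 2 ^ m0 /\
    comb ao s1 s2 (P1 (fun i => (y .: e) (r1 i))) (P2 (fun i => (y .: e) (r2 i)))).
Proof.
  intros l P1 P2 r1 r2 ao s1 s2 HP1 HP2 Hr1 Hr2 HSl.
  assert (Hl : l <= kmax) by lia.
  destruct (Def_Win l P1 (M l) HP1 Hl (M_adm l)) as (Tb1 & adv1 & HT1 & Ha1 & E1).
  destruct (Def_Win l P2 (M l) HP2 Hl (M_adm l)) as (Tb2 & adv2 & HT2 & Ha2 & E2).
  destruct (H_Q l Hl) as (HQ1 & HQ2 & HQ3).
  (* The thirteen constants from which the queries and the simulation of [M l]-bit words are built;
     [w] and [2 ^ w] serve the definition of powers. *)
  set (ps := [Tb1; adv1; Tb2; adv2; M l; M l / 8; stride (be l) V; be l; V; Pb l; m0; w; 2 ^ w]).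
  set (adv := dig (2 ^ sz l) 13 (fun i => nth i ps 0)).
  pose proof (H_w l Hl) as Hbw. rewrite be_S in Hbw.
  destruct (stride_M l) as (B1 & B2 & B3 & B4 & B5 & B6 & B7).
  assert (Hs : s0 <= sz l).
  { unfold sz. pose proof (Nat.pow_nonzero 13 l ltac:(lia)). nia. }
  assert (HTs : 2 ^ (2 ^ (3 * cube V)) <= 2 ^ sz l) by (apply Nat.pow_le_mono_r; lia).
  assert (Hws : 2 ^ w < 2 ^ sz l) by (apply pow2_lt; lia).
  assert (Hwlt : w < 2 ^ w) by (apply Nat.pow_gt_lin_r; lia).
  assert (HF : Forall (fun p => p < 2 ^ sz l) ps).
  { pose proof (Pb_lt l ltac:(lia)). repeat constructor; lia. }
  assert (Hadv : adv < 2 ^ sz (S l)).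
  { eapply Nat.lt_le_trans; [apply dig_bound|].
    - intros p Hp. rewrite Forall_forall in HF. apply HF. apply nth_In. exact Hp.
    - rewrite <- Nat.pow_mul_r. apply Nat.pow_le_mono_r; [lia|]. unfold sz. cbn [Nat.pow]. lia. }
  set (D := Cl (S l) adv).
  assert (Hbd : bd D = 2 ^ be (S l)) by reflexivity.
  pose proof (consts_lt (S l) adv ltac:(lia) Hadv) as HC.
  assert (HC1 : adv < bd D /\ 2 ^ sz l < bd D).
  { inversion_clear HC as [|? ? C1 C2]. inversion_clear C2 as [|? ? C3 C4]. split; [exact C1|exact C3]. }
  destruct HC1 as [HC1 HC2].
  assert (HD : forall i, i < 13 -> Df D (lv 15 0) (fun _ => nth i ps 0)).
  { intros i Hi. apply (piece_Df D ps (2 ^ sz l) adv); auto.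
    - left. reflexivity.
    - right. left. reflexivity. }
  pose proof (HD 0 ltac:(lia)) as D0. pose proof (HD 1 ltac:(lia)) as D1.
  pose proof (HD 2 ltac:(lia)) as D2. pose proof (HD 3 ltac:(lia)) as D3.
  pose proof (HD 4 ltac:(lia)) as D4. pose proof (HD 5 ltac:(lia)) as D5.
  pose proof (HD 6 ltac:(lia)) as D6. pose proof (HD 7 ltac:(lia)) as D7.
  pose proof (HD 8 ltac:(lia)) as D8. pose proof (HD 9 ltac:(lia)) as D9.
  pose proof (HD 10 ltac:(lia)) as D10. pose proof (HD 11 ltac:(lia)) as D11.
  pose proof (HD 12 ltac:(lia)) as D12. clear HD.
  cbn [nth ps] in D0, D1, D2, D3, D4, D5, D6, D7, D8, D9, D10, D11, D12.
  pose proof (be_m0 (S l)) as Hbm.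
  assert (HB1 : bd D <= 2 ^ (w * (2 ^ w - 1))).
  { rewrite Hbd. apply Nat.pow_le_mono_r; [lia|]. rewrite be_S. nia. }
  assert (HB2 : 2 ^ (w * w + 4 * w) <= bd D).
  { rewrite Hbd. apply Nat.pow_le_mono_r; lia. }
  (* Numbers such as [2 ^ M l] are too long for a piece of advice, so only their exponents are
     stored. *)
  assert (Hexp : forall c, c <= M l -> Df D (lv 15 0) (fun _ => c) -> Df D (lv 40 0) (fun _ => 2 ^ c)).
  { intros c Hc Dc.
    eapply Df_mono; [|apply (dexp D w H_w3 HB1 HB2 (lv 15 0) D11 D12 0 (lv 15 0) (fun _ => c))].
    - unfold lv; lia.
    - lia.
    - eapply dleaf; [exact Dc|lia].
    - intros e _. rewrite Hbd, be_S. apply pow2_lt. lia. }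
  pose proof (Hexp (M l) ltac:(lia) D4) as X4. pose proof (Hexp (M l / 8) ltac:(lia) D5) as X5.
  pose proof (Hexp (stride (be l) V) ltac:(lia) D6) as X6. pose proof (Hexp m0 ltac:(lia) D10) as X10.
  assert (Hb2 : bd D = 2 ^ be (S l)) by exact Hbd.
  set (l1 := lv 60 0).
  assert (Q1 : Df D (lv K1 l1) (query l Tb1 adv1 r1)) by (apply Df_query; auto).
  assert (Q2 : Df D (lv K1 l1) (query l Tb2 adv2 r2)) by (apply Df_query; auto).
  assert (Up : forall f, Df D (lv 40 0) f -> Df D l1 f) by (intros f H; eapply Df_mono; [|exact H]; unfold l1, lv; lia).
  assert (Up' : forall f, Df D (lv 15 0) f -> Df D l1 f) by (intros f H; eapply Df_mono; [|exact H]; unfold l1, lv; lia).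
  assert (HTm : T + 32 <= 2 ^ M l).
  { pose proof (Nat.pow_gt_lin_r 2 (M l) ltac:(lia)). lia. }
  set (kk := 22 * (K1 + T * (4 * T + 160) + 5)).
  assert (HR : forall inp, Df D (lv K1 l1) inp -> (forall e, bde (bd D) e -> inp e < 2 ^ M l) ->
    Dp D (lv (S kk) l1) (fun e => result (M l) (Q (M l)) (inp e) T = 0)).
  { intros inp Hi Hb. eapply Dp_ext; [|apply (deq D kk l1 (fun e => result (M l) (Q (M l)) (inp e) T) (fun _ => 0)); [|apply dnum; unfold kk; [pose proof (bd_ge D)|]; lia]].
    - intros e _. cbv beta. rewrite Nat.eqb_eq. reflexivity.
    - apply (dresult D w (be (S l)) (M l) l1); auto; try lia.
      + rewrite be_S. lia.
      + eapply Df_mono; [|exact Hi]. unfold lv; lia. }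
  pose proof (HR _ Q1 (fun e _ => query_lt l Tb1 adv1 r1 e Hl HT1 Ha1)) as R1.
  pose proof (HR _ Q2 (fun e _ => query_lt l Tb2 adv2 r2 e Hl HT2 Ha2)) as R2.
  pose proof (Dp_comb D _ ao s1 s2 _ _ R1 R2) as RC.
  (* The guess ranges over words of [be (S l)] bits, so the bound [2 ^ m0] of the quantifier has to
     be part of the formula. *)
  assert (Ry : Dp D (S (lv (S kk) l1)) (fun e => e 0 < 2 ^ m0)).
  { eapply Dp_ext; [|eapply Dp_mono; [|apply (dlt D 1 l1 (fun e => e 0) (fun _ => 2 ^ m0))]].
    - intros e _. cbv beta. apply Nat.ltb_lt.
    - unfold lv; lia.
    - apply dvar. lia.
    - eapply dleaf; [apply Up; exact X10|lia]. }
  pose proof (d_and _ _ _ _ (d_prf D) _ _ _ (proj1 Ry) (proj1 RC)) as RA.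
  pose proof (d_ex _ _ _ _ (d_prf D) _ _ RA) as RX.
  refine (Def_of_EX (S l) adv _ _ HSl Hadv (d_mono _ _ _ _ (d_prf D) _ Lmax _ _ RX) _ HSl).
  { unfold Lmax. fold l1. fold kk. unfold lv. lia. }
  intros e He. cbv beta.
  assert (Hm0bd : 2 ^ m0 <= bd D) by (rewrite Hbd; apply Nat.pow_le_mono_r; lia).
  assert (HE : forall y, y < 2 ^ m0 -> comb ao s1 s2 (P1 (fun i => (y .: e) (r1 i))) (P2 (fun i => (y .: e) (r2 i))) <->
    comb ao s1 s2 (result (M l) (Q (M l)) (query l Tb1 adv1 r1 (y .: trunc (S0 + S l) e)) T = 0)
     (result (M l) (Q (M l)) (query l Tb2 adv2 r2 (y .: trunc (S0 + S l) e)) T = 0)).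
  { intros y Hy.
    assert (Hye : bde (2 ^ m0) (y .: e)) by (apply bde_scons; auto).
    assert (Hq : forall Tb adv r, (forall i, r i <= i + 2) -> query l Tb adv r (y .: trunc (S0 + S l) e) = query l Tb adv r (y .: e)).
    { intros Tb a r Hr. unfold query. do 5 f_equal. apply dig_ext. intros i Hi. f_equal.
      specialize (Hr i). destruct (r i) as [|j]; [reflexivity|]. cbn [scons]. unfold trunc.
      destruct (Nat.ltb_spec j (S0 + S l)); [reflexivity|lia]. }
    rewrite !Hq by auto.
    apply comb_iff.
    - rewrite (E1 (fun i => (y .: e) (r1 i))) by (intros i; apply Hye).
      rewrite query_of_inputs by auto. apply HQ3. apply query_lt; auto.
    - rewrite (E2 (fun i => (y .: e) (r2 i))) by (intros i; apply Hye).
      rewrite query_of_inputs by auto. apply HQ3. apply query_lt; auto. }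
  split.
  - intros (y & Hy & H). exists y. split; [lia|]. split; [exact Hy|]. apply HE; auto.
  - intros (y & _ & Hy & H). cbn in Hy. exists y. split; auto. apply HE; auto.
Qed.

Lemma Def_ext : forall l (P P' : env -> Prop),
  (forall e, bde (2 ^ m0) e -> (P e <-> P' e)) -> Def l P -> Def l P'.
Proof.
  intros l P P' H HP Hl. destruct (HP Hl) as (adv & L & Ha & HL). exists adv, L. split; auto.
  intros e He. rewrite <- H by auto. auto.
Qed.

(** A renaming that does not increase indices is free: the table just reads other positions. *)
Lemma Def_ren0 : forall l (r : nat -> nat) P, (forall i, r i <= i) -> Def l P -> Def l (fun e => P (fun i => e (r i))).
Proof.
  intros l r P Hr HP Hl. destruct (HP Hl) as (adv & L & Ha & HL).
  pose proof (S0V l Hl) as HV2.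
  set (sg := fun i => if i <? 2 then i else if i <? 2 + (S0 + l) then 2 + r (i - 2) else i).
  exists adv, (fun t => L (remap (fun i => i <? 2 * V) sg t)). split; auto.
  intros e He. rewrite (HL (fun i => e (r i))) by (intros i; apply He).
  assert (HR : forall u, remap (fun i => i <? 2 * V) sg (atoms (fun i => i <? 2 * V) (layout V (inputs_of [adv; Pb l] (S0 + l) e) u))
    = atoms (fun i => i <? 2 * V) (layout V (inputs_of [adv; Pb l] (S0 + l) (fun i => e (r i))) u)).
  { intros u. apply remap_atoms. intros i Hi. apply Nat.ltb_lt in Hi. unfold sg, layout, inputs_of. cbn [length].
    specialize (Hr (i - 2)).
    destruct (Nat.ltb_spec i 2).
    - split; [apply Nat.ltb_lt; lia|]. destruct (Nat.ltb_spec i V); [|lia].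
      destruct (Nat.ltb_spec i 2); [reflexivity|lia].
    - destruct (Nat.ltb_spec i (2 + (S0 + l))).
      + split; [apply Nat.ltb_lt; lia|].
        destruct (Nat.ltb_spec (2 + r (i - 2)) V); [|lia]. destruct (Nat.ltb_spec i V); [|lia].
        destruct (Nat.ltb_spec (2 + r (i - 2)) 2); [lia|].
        destruct (Nat.ltb_spec (2 + r (i - 2)) (2 + (S0 + l))); [|lia].
        destruct (Nat.ltb_spec i 2); [lia|].
        destruct (Nat.ltb_spec i (2 + (S0 + l))); [|lia]. f_equal. lia.
      + split; [apply Nat.ltb_lt; lia|].
        destruct (Nat.ltb_spec i V); [|reflexivity].
        destruct (Nat.ltb_spec i 2); [lia|].
        destruct (Nat.ltb_spec i (2 + (S0 + l))); [lia|reflexivity]. }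
  split; intros (u & Hu & H); exists u; (split; [exact Hu|]).
  - now rewrite HR.
  - now rewrite <- HR.
Qed.

Lemma m0_pos : 0 < 2 ^ m0.
Proof. pose proof (Nat.pow_nonzero 2 m0). lia. Qed.

(** A level step with a vacuous quantifier. *)
Lemma Def_shift1 : forall l d P, d <= 1 -> Def l P -> Def (S l) (fun e => P (fun i => e (i + d))).
Proof.
  intros l d P Hd HP.
  eapply Def_ext; [|apply (Def_step l P P (fun i => S (i + d)) (fun i => S (i + d)) true true true HP HP); intros; lia].
  intros e He. unfold comb. cbn [scons]. pose proof m0_pos. split.
  - intros (y & _ & H0 & _). exact H0.
  - intros H0. exists 0. auto.
Qed.

Lemma Def_mono : forall l l' P, l <= l' -> Def l P -> Def l' P.
Proof.
  intros l l' P H HP. induction H as [|l' H IH]; auto.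
  eapply Def_ext; [|apply (Def_shift1 l' 0 P); [lia|exact IH]].
  intros e _. cbv beta. replace (fun i => e (i + 0)) with e; [reflexivity|].
  extensionality i. now rewrite Nat.add_0_r.
Qed.

Lemma Def_shift : forall k l P, Def l P -> Def (l + k) (fun e => P (fun i => e (i + k))).
Proof.
  induction k as [|k IH]; intros l P HP.
  - rewrite Nat.add_0_r. eapply Def_ext; [|exact HP]. intros e _.
    replace (fun i => e (i + 0)) with e; [reflexivity|]. extensionality i. now rewrite Nat.add_0_r.
  - rewrite Nat.add_succ_r.
    eapply Def_ext; [|apply (Def_shift1 (l + k) 1); [lia|apply (IH l P HP)]].
    intros e _. cbv beta. replace (fun i => e (i + k + 1)) with (fun i => e (i + S k)); [reflexivity|].
    extensionality i. f_equal. lia.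
Qed.

Lemma Def_base : forall c (Phi : env -> Prop), c < 2 ^ s0 -> cls (Cl 0 c) 0 Phi ->
  (forall e e' : env, (forall i, i < 8 -> e i = e' i) -> (Phi e <-> Phi e')) -> Def 0 Phi.
Proof.
  intros c Phi Hc HP HI Hl.
  refine (Def_of_EX 0 c Phi Phi Hl _ (d_mono _ _ _ _ (d_prf (Cl 0 c)) 0 Lmax Phi ltac:(lia) HP) _ Hl).
  - unfold sz. cbn [Nat.pow]. now rewrite Nat.mul_1_l.
  - intros e He. apply HI. intros i Hi. unfold trunc, S0. destruct (Nat.ltb_spec i (20 + 0)); [reflexivity|lia].
Qed.

Lemma Def_definable : definability (2 ^ m0) Def (fun c => c < 2 ^ s0) 8.
Proof.
  assert (H0 : 0 < 2 ^ s0) by (pose proof (Nat.pow_nonzero 2 s0); lia).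
  split.
  - apply Def_ext.
  - apply Def_mono.
  - intros c i j k Hi Hj Hk. apply (Def_base 0); auto.
    + now apply (d_atom _ _ _ _ (d_prf (Cl 0 0))).
    + intros e e' H. rewrite !H by auto. reflexivity.
  - intros c i j k Hi Hj Hk. apply (Def_base 0); auto.
    + now apply (d_natom _ _ _ _ (d_prf (Cl 0 0))).
    + intros e e' H. rewrite !H by auto. reflexivity.
  - intros l P P' HP HP'.
    eapply Def_ext; [|apply (Def_step l P P' S S true true true HP HP'); intros; lia].
    intros e _. unfold comb. cbn [scons]. change (fun i => e i) with e. pose proof m0_pos. split.
    + intros (y & _ & H2). exact H2.
    + intros H2. exists 0. auto.
  - intros l P P' HP HP'.
    eapply Def_ext; [|apply (Def_step l P P' S S false true true HP HP'); intros; lia].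
    intros e _. unfold comb. cbn [scons]. change (fun i => e i) with e. pose proof m0_pos. split.
    + intros (y & _ & H2). exact H2.
    + intros H2. exists 0. auto.
  - intros l P HP.
    eapply Def_ext; [|apply (Def_step l P P (fun i => i) (fun i => i) true true true HP HP); intros; lia].
    intros e _. unfold comb. split.
    + intros (y & H1 & H2 & _). exists y. split; [exact H1|exact H2].
    + intros (y & H1 & H2). exists y. repeat split; auto.
  - intros l k r P Hr HP.
    (* The renaming is decomposed into a shift by [k] and a renaming that does not increase
       indices. *)
    eapply Def_ext; [|apply (Def_ren0 (l + k) (fun j => if j <? k then 0 else r (j - k)) (fun e => P (fun i => e (i + k)))); [|apply (Def_shift k l P HP)]].
    + intros e _. cbv beta. replace (fun i => e (if i + k <? k then 0 else r (i + k - k))) with (fun i => e (r i)); [reflexivity|].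
      extensionality i. destruct (Nat.ltb_spec (i + k) k); [lia|]. f_equal. f_equal. lia.
    + intros j. destruct (Nat.ltb_spec j k); [lia|]. specialize (Hr (j - k)). lia.
  - intros c Hc Hb. apply (Def_base c); auto.
    + apply (d_const _ _ _ _ (d_prf (Cl 0 c))).
      * left. reflexivity.
      * cbn. exact Hb.
    + intros e e' H. rewrite !H by lia. reflexivity.
Qed.

(** Negation, absent from the existential class, costs one level here. *)
Lemma Def_not : forall l P, Def l P -> Def (S l) (fun e => ~ P e).
Proof.
  intros l P HP.
  eapply Def_ext; [|apply (Def_step l P P S S true false false HP HP); intros; lia].
  intros e _. unfold comb. cbn [scons]. change (fun i => e i) with e. pose proof m0_pos. split.
  - intros (y & _ & H2 & _). exact H2.
  - intros H2. exists 0. auto.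
Qed.

Lemma two_le_m0 : 2 <= 2 ^ m0.
Proof. apply (bd2 0). Qed.

Definition Level : dclass := DClass (2 ^ m0) Def (fun c => c < 2 ^ s0) 8 Def_definable (le_n 8) two_le_m0.

End Levels.

(** * Loops as guessed step sequences *)

Fixpoint iterf (F : nat -> nat -> nat) (c s : nat) : nat :=
  match c with
  | 0 => s
  | S c' => F c' (iterf F c' s)
  end.

Lemma iterf_inv : forall (I : nat -> nat -> Prop) F c s, I 0 s ->
  (forall i x, i < c -> I i x -> I (S i) (F i x)) -> I c (iterf F c s).
Proof.
  intros I F c s H0 HS. induction c as [|c IH]; auto. cbn. apply HS; auto.
Qed.

Lemma iterf_ext : forall (I : nat -> Prop) F G c s, I s ->
  (forall i x, i < c -> I x -> F i x = G i x /\ I (F i x)) -> iterf F c s = iterf G c s /\ I (iterf F c s).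
Proof.
  intros I F G c s H0 HS. induction c as [|c IH]; auto. cbn.
  destruct IH as [E HI]; [intros; apply HS; auto|]. rewrite <- E. apply HS; auto.
Qed.

Lemma iterf_add : forall F a b s, iterf F (a + b) s = iterf (fun i => F (a + i)) b (iterf F a s).
Proof.
  intros F a b s. induction b as [|b IH]; [now rewrite Nat.add_0_r|].
  rewrite Nat.add_succ_r. cbn. now rewrite IH.
Qed.

Lemma iterf_mul : forall F q p s,
  iterf F (q * p) s = iterf (fun i x => iterf (fun j => F (i * p + j)) p x) q s.
Proof.
  intros F q p s. induction q as [|q IH]; [reflexivity|].
  cbn [iterf]. rewrite <- IH. replace (S q * p) with (q * p + p) by lia. apply iterf_add.
Qed.

Lemma Df_orc2 : forall D l k (X : nat -> nat -> env -> nat) f g,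
  Df D l (fun e => X (e 0) (e 1) (sh 2 e)) -> Df D l f -> Df D l g ->
  Df D (l + k + 8) (fun e => X (f e) (g e) (sh k e)).
Proof.
  intros D l k X f g [Hb HX] Hf Hg.
  apply (Df_comp2 D (l + k) (fun y z e => X y z (sh k e)) f g);
    [|eapply Df_mono; [|exact Hf]; lia|eapply Df_mono; [|exact Hg]; lia].
  split.
  - intros e He. apply (Hb (e 0 .: e 1 .: sh k (sh 2 e))).
    apply bde_scons; [apply He|]. apply bde_scons; [apply He|]. now apply bde_sh, bde_sh.
  - pose proof (d_ren _ _ _ _ (d_prf D) l k
      (fun i => match i with 0 => 0 | 1 => 1 | 2 => 2 | S (S (S j)) => S (S (S (k + j))) end) _
      ltac:(intros [|[|[|i]]]; lia) HX) as H1.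
    eapply (d_ext _ _ _ _ (d_prf D)); [|exact H1].
    intros e He. cbn.
    match goal with |- _ = X _ _ ?a <-> _ = X _ _ ?b => replace a with b; [tauto|] end.
    extensionality i. unfold sh. cbn. f_equal.
Qed.

Lemma dorc2 : forall D k l j (X : nat -> nat -> env -> nat) f g, j <= 20 ->
  Df D (lv k l) (fun e => X (e 0) (e 1) (sh 2 e)) -> Df D (lv k l) f -> Df D (lv k l) g ->
  Df D (lv (S k) l) (fun e => X (f e) (g e) (sh j e)).
Proof.
  intros D k l j X f g Hj HX Hf Hg. eapply Df_mono; [|apply (Df_orc2 D (lv k l) j X f g); auto]. unfold lv; lia.
Qed.

(** What loops need beyond [definability]: negation, to say that a guessed sequence contains no
    wrong step, and the constants behind powers and truncated arithmetic. *)
Record counting (D : dclass) (w m0 l0 : nat) : Prop := {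
  c_neg : forall l P, cls D l P -> cls D (S l) (fun e => ~ P e);
  c_w3 : 3 <= w;
  c_B1 : bd D <= 2 ^ (w * (2 ^ w - 1));
  c_B2 : 2 ^ (w * w + 4 * w) <= bd D;
  c_bd : bd D = 2 ^ m0;
  c_w : Df D l0 (fun _ => w);
  c_u : Df D l0 (fun _ => 2 ^ w);
  c_m : Df D l0 (fun _ => m0);
  c_max : Df D l0 (fun _ => bd D - 1) }.

Section Loops.

Variable D : dclass.
Variables w m0 l0 q K : nat.
Hypothesis HD : counting D w m0 l0.
Hypothesis Dq : Df D l0 (fun _ => q).
Hypothesis DK : Df D l0 (fun _ => K).
Hypothesis Hsize : K * (q + 1) < m0.
Hypothesis HK : 0 < K.

Let Dmax := c_max _ _ _ _ HD.

Lemma dtx : forall k f, Df D (lv k l0) f -> Df D (lv (17 + k) l0) (fun e => texp D (f e)).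
Proof.
  intros k f Hf. destruct HD. eapply (dtexp D w); eauto.
Qed.

Lemma texp_le : forall x, x < m0 -> texp D x = 2 ^ x.
Proof. intros x Hx. apply texp_small. rewrite (c_bd _ _ _ _ HD). apply Nat.pow_lt_mono_r; lia. Qed.

Lemma m0_bd : m0 < bd D.
Proof. rewrite (c_bd _ _ _ _ HD). apply Nat.pow_gt_lin_r. lia. Qed.

Definition fld (h i : nat) : nat := (h / texp D (tmul D K i)) mod texp D K.

Lemma fld_dig : forall u i, (forall p, u p < 2 ^ K) -> i <= q -> fld (dig (2 ^ K) (S q) u) i = u i.
Proof.
  intros u i Hu Hi. unfold fld. pose proof m0_bd.
  assert (Hb : K * i <= K * q) by (apply Nat.mul_le_mono_l; lia).
  rewrite tmul_small by lia. rewrite !texp_le by nia.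
  rewrite Nat.pow_mul_r. apply dig_digit; auto. lia.
Qed.

Ltac dhook ::=
  lazymatch goal with
  | |- Df _ _ (fun e => texp _ (@?f e)) => apply dtx; dgo
  | |- Df _ _ (fun e => fld (@?f e) (@?g e)) => unfold fld; dgo
  | H : Df ?D (lv _ ?l) ?F |- Df ?D (lv _ ?l) ?F => eapply Df_mono; [|exact H]; unfold lv; lia
  end.

(** One guessed word [h] holds all [q + 1] states in fields of [K] bits. That they form a run is the
    absence of an index with an incorrect step, one negated existential. *)
Lemma dl1 : forall k F s, Df D (lv k l0) (fun e => F (sh 2 e) (e 1) (e 0)) ->
  (forall e i x, bde (bd D) e -> F e i x < 2 ^ K) -> Df D (lv k l0) s -> (forall e, bde (bd D) e -> s e < 2 ^ K) ->
  Df D (lv (40 + k) l0) (fun e => iterf (F e) q (s e)).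
Proof.
  intros k F s HF HFb Hs Hsb.
  assert (D1 : Dp D (lv (34 + k) l0) (fun e => (fld (e 0) 0 =? s (sh 2 e)) = true)).
  { apply (deq D (33 + k)); [dgo; pose proof (bd_ge D); lia|].
    apply (Df_mono D (lv k l0 + 2)); [unfold lv; lia|]. now apply Df_sh. }
  assert (D2 : Dp D (lv (34 + k) l0) (fun e => (fld (e 0) q =? e 1) = true)) by dgo.
  assert (DF3 : Df D (lv (33 + k) l0) (fun e => F (sh 3 e) (e 0) (fld (e 1) (e 0)))).
  { apply (dorc2 D (32 + k) l0 3 (fun x i e => F e i x)); [lia| |dgo|dgo].
    eapply Df_mono; [|exact HF]. unfold lv; lia. }
  assert (D3 : Dp D (lv (36 + k) l0) (fun e => (e 0 <? q) && negb (fld (e 1) (tadd D (e 0) 1) =? F (sh 3 e) (e 0) (fld (e 1) (e 0))) = true)).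
  { dgo; pose proof (bd_ge D); lia. }
  pose proof (d_prf D) as HP.
  pose proof (c_neg _ _ _ _ HD _ _ (d_ex _ _ _ _ HP _ _ (proj1 D3))) as D4.
  pose proof (d_and _ _ _ _ HP _ _ _ (d_mono _ _ _ _ HP (lv (34 + k) l0) (S (S (lv (36 + k) l0))) _ ltac:(unfold lv; lia) (proj1 D1))
    (d_mono _ _ _ _ HP (lv (34 + k) l0) (S (S (lv (36 + k) l0))) _ ltac:(unfold lv; lia) (proj1 D2))) as D5.
  pose proof (d_and _ _ _ _ HP _ _ _ D5 (d_mono _ _ _ _ HP (S (S (lv (36 + k) l0))) (S (S (S (lv (36 + k) l0)))) _ (Nat.le_succ_diag_r _) D4)) as D6.
  pose proof (d_ex _ _ _ _ HP _ _ D6) as D7.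
  assert (Hit : forall e c, bde (bd D) e -> iterf (F e) c (s e) < 2 ^ K).
  { intros e [|c] He; cbn; auto. }
  assert (HKb : 2 ^ K <= bd D).
  { rewrite (c_bd _ _ _ _ HD). apply Nat.pow_le_mono_r; nia. }
  pose proof m0_bd as Hm.
  eapply Df_guess.
  - eapply d_mono; [exact HP| |exact D7]. unfold lv; lia.
  - intros e He. specialize (Hit e q He). lia.
  - intros e y He Hy. cbn [scons]. change (sh 2 (?a .: ?b .: e)) with e.
    split.
    + intros (h & Hh & [H1 H2] & H3). apply Nat.eqb_eq in H1, H2.
      assert (HI : forall i, i <= q -> fld h i = iterf (F e) i (s e)).
      { induction i as [|i IH]; intros Hi; [exact H1|].
        cbn. rewrite <- IH by lia.
        destruct (Nat.eq_dec (fld h (S i)) (F e i (fld h i))) as [E|E]; auto.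
        exfalso. apply H3. exists i. split; [nia|].
        rewrite tadd_small by nia. change (sh 3 (i .: h .: y .: e)) with e.
        rewrite Nat.add_1_r. apply Nat.eqb_neq in E. rewrite E.
        destruct (Nat.ltb_spec i q); [reflexivity|lia]. }
      rewrite <- H2. apply HI. lia.
    + intros ->. exists (dig (2 ^ K) (S q) (fun i => iterf (F e) i (s e))).
      assert (Hd : forall i, i <= q -> fld (dig (2 ^ K) (S q) (fun i => iterf (F e) i (s e))) i = iterf (F e) i (s e)).
      { intros i Hi. exact (fld_dig (fun i => iterf (F e) i (s e)) i (fun p => Hit e p He) Hi). }
      split; [|split; [split|]].
      * eapply Nat.lt_le_trans; [apply dig_bound; intros; auto|].
        rewrite <- Nat.pow_mul_r, (c_bd _ _ _ _ HD). apply Nat.pow_le_mono_r; nia.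
      * rewrite Hd by lia. apply Nat.eqb_refl.
      * rewrite Hd by lia. apply Nat.eqb_refl.
      * intros (i & Hi & H). apply andb_true_iff in H as [H1 H2]. apply Nat.ltb_lt in H1.
        change (sh 3 (?a .: ?b .: ?c .: e)) with e in H2.
        rewrite tadd_small in H2 by nia. rewrite !Hd in H2 by lia.
        rewrite Nat.add_1_r in H2. cbn in H2. rewrite Nat.eqb_refl in H2. discriminate.
Qed.

(** One word has room for [q] steps only, so [j] nested loops produce [q ^ j] of them; [a] numbers
    the current batch of [q ^ j] iterations. The remainders keep states in range for arbitrary
    [F]. *)
Fixpoint nl (j : nat) (F : nat -> nat -> nat) (a s : nat) : nat :=
  match j with
  | 0 => F a s mod texp D K
  | S j' => iterf (fun i x => nl j' F (tadd D (tmul D a q) i) x) q (s mod texp D K)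
  end.

Lemma texpK : texp D K = 2 ^ K.
Proof. apply texp_le. nia. Qed.

Lemma nl_lt : forall j F a s, nl j F a s < 2 ^ K.
Proof.
  assert (H0 : forall x, x mod texp D K < 2 ^ K).
  { intros x. rewrite texpK. apply Nat.mod_upper_bound. apply Nat.pow_nonzero. lia. }
  induction j as [|j IH]; intros F a s; cbn [nl]; auto.
  destruct q as [|q']; cbn [iterf]; auto.
Qed.

Lemma dnl : forall j k F, Df D (lv k l0) (fun e => F (sh 2 e) (e 1) (e 0)) ->
  Df D (lv (60 * j + (20 + k)) l0) (fun e => nl j (F (sh 2 e)) (e 1) (e 0)).
Proof.
  induction j as [|j IH]; intros k F HF.
  - change (60 * 0 + (20 + k)) with (20 + k).
    change (fun e => nl 0 (F (sh 2 e)) (e 1) (e 0)) with (fun e => F (sh 2 e) (e 1) (e 0) mod texp D K). dgo.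
  - specialize (IH k F HF). remember (60 * j + (20 + k)) as k'.
    replace (60 * S j + (20 + k)) with (60 + k') by lia.
    eapply Df_mono; [|apply (dl1 (19 + k') (fun e i x => nl j (F (sh 2 e)) (tadd D (tmul D (e 1) q) i) x) (fun e => e 0 mod texp D K))].
    + unfold lv; lia.
    + apply (dorc2 D (18 + k') l0 4 (fun x a e => nl j (F e) a x) (fun e => e 0) (fun e => tadd D (tmul D (e 3) q) (e 1))); [lia| |dgo|dgo].
      eapply Df_mono; [|exact IH]. unfold lv; lia.
    + intros e i x _. apply nl_lt.
    + dgo.
    + intros e _. rewrite texpK. apply Nat.mod_upper_bound. apply Nat.pow_nonzero. lia.
Qed.

Lemma nl_spec : forall j F a s p, s < 2 ^ K -> a * q ^ j + q ^ j <= p -> p < bd D ->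
  (forall i x, i < p -> x < 2 ^ K -> F i x < 2 ^ K) ->
  nl j F a s = iterf (fun i => F (a * q ^ j + i)) (q ^ j) s.
Proof.
  induction j as [|j IH]; intros F a s p Hs Ha Hp HF.
  - cbn [nl Nat.pow iterf] in *. rewrite texpK, Nat.mul_1_r, Nat.add_0_r.
    apply Nat.mod_small. apply HF; lia.
  - cbn [nl]. rewrite texpK, Nat.mod_small by auto. cbn [Nat.pow] in *. rewrite iterf_mul.
    apply (iterf_ext (fun x => x < 2 ^ K)); auto. intros i x Hi Hx. split; [|apply nl_lt].
    assert (Hq : (a * q + i) * q ^ j + q ^ j <= p) by nia.
    assert (1 <= q ^ j \/ q ^ j = 0) as [H1|H1] by lia.
    + rewrite tmul_small by nia. rewrite tadd_small by nia.
      rewrite (IH F _ x p Hx Hq Hp HF).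
      assert (HE : forall c y, iterf (fun i0 => F ((a * q + i) * q ^ j + i0)) c y =
        iterf (fun j0 => F (a * (q * q ^ j) + (i * q ^ j + j0))) c y).
      { induction c as [|c IHc]; intros y; [reflexivity|]. cbn [iterf]. rewrite IHc. f_equal. ring. }
      apply HE.
    + exfalso. apply (Nat.pow_nonzero q j); lia.
Qed.

(** Ten nested loops, because in the final choice of sizes [q ^ 10] is both the loop bound and the
    length of the Fourier transform. *)
Lemma dloop : forall k F s, q ^ 10 < bd D -> Df D (lv k l0) (fun e => F (sh 2 e) (e 1) (e 0)) ->
  Df D (lv k l0) s -> (forall e, bde (bd D) e -> s e < 2 ^ K) ->
  (forall e i x, bde (bd D) e -> i < q ^ 10 -> x < 2 ^ K -> F e i x < 2 ^ K) ->
  Df D (lv (630 + k) l0) (fun e => iterf (F e) (q ^ 10) (s e)).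
Proof.
  intros k F s Hq HF Hs Hsb HFb.
  pose proof (dnl 10 k F HF) as H.
  eapply Df_ext; [|apply (dorc2 D (629 + k) l0 0 (fun x a e => nl 10 (F e) a x) s (fun _ => 0)); [lia| | |]].
  - intros e He. cbv beta. change (sh 0 e) with e.
    rewrite (nl_spec 10 (F e) 0 (s e) (q ^ 10)); auto; lia.
  - eapply Df_mono; [|exact H]. unfold lv; lia.
  - dgo.
  - apply dnum; [pose proof (bd_ge D)|]; lia.
Qed.

End Loops.

(** * Discrete Fourier transform modulo [2 ^ K + 1] *)

Section Congruence.

Variable M : nat.

Definition eqm (a b : nat) : Prop := a mod M = b mod M.

Lemma eqm_add : forall a b c d, eqm a b -> eqm c d -> eqm (a + c) (b + d).
Proof. unfold eqm. intros a b c d H1 H2. rewrite Nat.Div0.add_mod, H1, H2, <- Nat.Div0.add_mod. reflexivity. Qed.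

Lemma eqm_mul : forall a b c d, eqm a b -> eqm c d -> eqm (a * c) (b * d).
Proof. unfold eqm. intros a b c d H1 H2. rewrite Nat.Div0.mul_mod, H1, H2, <- Nat.Div0.mul_mod. reflexivity. Qed.

Lemma eqm_pow : forall a b k, eqm a b -> eqm (a ^ k) (b ^ k).
Proof. intros a b k H. induction k as [|k IH]; [reflexivity|]. cbn [Nat.pow]. now apply eqm_mul. Qed.

Lemma eqm_dig : forall X n c d, (forall i, i < n -> eqm (c i) (d i)) -> eqm (dig X n c) (dig X n d).
Proof.
  intros X n c d H. induction n as [|n IH]; [reflexivity|]. cbn [dig].
  apply eqm_add; [apply IH; intros; apply H; lia|]. apply eqm_mul; [apply H; lia|reflexivity].
Qed.

Lemma eqm_base : forall X Y n c, eqm X Y -> eqm (dig X n c) (dig Y n c).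
Proof.
  intros X Y n c H. induction n as [|n IH]; [reflexivity|]. cbn [dig].
  apply eqm_add; [exact IH|]. apply eqm_mul; [reflexivity|]. now apply eqm_pow.
Qed.

Lemma eqm_mul0_l : forall a b, eqm a 0 -> eqm (a * b) 0.
Proof. intros a b H. exact (eqm_mul a 0 b b H eq_refl). Qed.

Lemma eqm_mul0_r : forall a b, eqm b 0 -> eqm (a * b) 0.
Proof. intros a b H. rewrite Nat.mul_comm. now apply eqm_mul0_l. Qed.

End Congruence.

Lemma rep_double : forall x a, rep x (a + a) = rep x a * (x ^ a + 1).
Proof. intros x a. unfold rep. rewrite dig_split. ring. Qed.

Lemma two_pow_S : forall u, 2 ^ S u = 2 ^ u + 2 ^ u.
Proof. intros u. cbn. lia. Qed.

(** The repunit of length [2 ^ u] is the product of the factors [x ^ (2 ^ s) + 1] with [s < u]. *)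
Lemma rep_eqm0 : forall M x u s, s < u -> eqm M (x ^ (2 ^ s) + 1) 0 -> eqm M (rep x (2 ^ u)) 0.
Proof.
  intros M x u s Hs H. induction u as [|u IH]; [lia|].
  rewrite two_pow_S, rep_double.
  destruct (Nat.eq_dec s u) as [->|E].
  - now apply eqm_mul0_r.
  - apply eqm_mul0_l. apply IH. lia.
Qed.

(** Among the positive numbers below [2 ^ S u], only [2 ^ u] is divisible by [2 ^ u]. *)
Lemma odd_part : forall u d, 0 < d -> d < 2 ^ S u -> d <> 2 ^ u -> exists a h, a < u /\ d = 2 ^ a * (2 * h + 1).
Proof.
  induction u as [|u IH]; intros d H0 H1 H2; [cbn in *; lia|].
  destruct (Nat.Even_or_Odd d) as [[h Hh]|[h Hh]].
  - destruct (IH h) as (a & h' & Ha & E).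
    + lia.
    + cbn [Nat.pow] in *. lia.
    + cbn [Nat.pow] in *. lia.
    + exists (S a), h'. split; [lia|]. subst d h. cbn [Nat.pow]. ring.
  - exists 0, h. split; [lia|]. cbn. lia.
Qed.

Lemma dig_one : forall m, dig 1 m (fun _ => 1) = m.
Proof. induction m as [|m IH]; [reflexivity|]. cbn [dig]. rewrite IH, Nat.pow_1_l. lia. Qed.

Section DFT.

Variables K u g : nat.
Hypothesis Hg : g * 2 ^ u = K.

Local Notation N := (2 ^ S u).
Local Notation M := (2 ^ K + 1).

Lemma minus_one_sq : eqm M (2 ^ K * 2 ^ K) 1.
Proof.
  unfold eqm. replace (2 ^ K * 2 ^ K) with (1 + (2 ^ K - 1) * M).
  - apply Nat.Div0.mod_add.
  - pose proof (Nat.pow_nonzero 2 K). remember (2 ^ K) as x. destruct x; [lia|]. cbn [Nat.sub]. nia.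
Qed.

Lemma omega_N : eqm M (2 ^ (g * N)) 1.
Proof.
  replace (g * N) with (K + K) by (rewrite two_pow_S; lia).
  rewrite Nat.pow_add_r. apply minus_one_sq.
Qed.

Lemma omega_mod : forall x, eqm M (2 ^ (g * (x mod N))) (2 ^ (g * x)).
Proof.
  intros x. pose proof (eqm_pow M _ _ (x / N) omega_N) as H1. rewrite Nat.pow_1_l in H1.
  pose proof (eqm_mul M _ _ _ _ H1 (eq_refl : eqm M (2 ^ (g * (x mod N))) _)) as H2.
  rewrite Nat.mul_1_l, <- Nat.pow_mul_r, <- Nat.pow_add_r in H2. symmetry. unfold eqm in H2. rewrite <- H2.
  f_equal. f_equal. rewrite (Nat.div_mod_eq x N) at 1. ring.
Qed.

(** [2 ^ g] is an [N]-th root of unity. If [d] has 2-adic valuation [a], then raising [2 ^ (g * d)]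
    to the power [2 ^ (u - a)] gives an odd power of [2 ^ K], that is -1, so one factor of the
    repunit vanishes. *)
Lemma omega_orth : forall d, 0 < d -> d < 2 * N -> d <> N -> eqm M (rep (2 ^ (g * d)) N) 0.
Proof.
  intros d H0 H1 H2. destruct (odd_part (S u) d H0) as (a & h & Ha & E); auto.
  apply (rep_eqm0 M _ (S u) (u - a)); [lia|].
  rewrite <- Nat.pow_mul_r.
  replace (g * d * 2 ^ (u - a)) with (K * (2 * h + 1)).
  - rewrite Nat.pow_mul_r.
    assert (Hh : eqm M ((2 ^ K) ^ (2 * h + 1)) (2 ^ K)).
    { rewrite Nat.pow_add_r, Nat.pow_1_r, Nat.pow_mul_r.
      assert (H3 : eqm M ((2 ^ K) ^ 2) 1) by (rewrite Nat.pow_2_r; apply minus_one_sq).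
      pose proof (eqm_pow M _ _ h H3) as H4. rewrite Nat.pow_1_l in H4.
      pose proof (eqm_mul M _ _ _ _ H4 (eq_refl : eqm M (2 ^ K) (2 ^ K))) as H5.
      rewrite Nat.mul_1_l in H5. exact H5. }
    unfold eqm. transitivity (M mod M); [|rewrite Nat.Div0.mod_same, Nat.Div0.mod_0_l; reflexivity].
    apply eqm_add; [exact Hh|reflexivity].
  - rewrite E, <- Hg. replace (2 ^ u) with (2 ^ a * 2 ^ (u - a)); [ring|].
    rewrite <- Nat.pow_add_r. f_equal. lia.
Qed.

(** Orthogonality, one coefficient at a time. Negative exponents are avoided by writing [N - k] for
    [- k], so the frequencies lie strictly between 0 and [2 * N]. *)
Lemma dft_sum : forall n c k, n <= N -> k < N ->
  eqm M (dig 1 N (fun j => dig (2 ^ (g * j)) n c * 2 ^ (g * (j * (N - k)))))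
    (if k <? n then N * c k else 0).
Proof.
  induction n as [|n IH]; intros c k Hn Hk.
  - cbn [dig Nat.ltb Nat.leb]. unfold eqm. f_equal.
    transitivity (0 * dig 1 N (fun j => 2 ^ (g * (j * (N - k))))); [|lia].
    now rewrite dig_scale.
  - assert (E : dig 1 N (fun j => dig (2 ^ (g * j)) (S n) c * 2 ^ (g * (j * (N - k)))) =
      dig 1 N (fun j => dig (2 ^ (g * j)) n c * 2 ^ (g * (j * (N - k)))) + c n * rep (2 ^ (g * (n + (N - k)))) N).
    { assert (Er : forall d m, rep (2 ^ (g * d)) m = dig 1 m (fun j => 2 ^ (g * (j * d)))).
      { intros d m. unfold rep. induction m as [|m IHm]; [reflexivity|].
        cbn [dig]. rewrite IHm, Nat.pow_1_l, Nat.mul_1_r, Nat.mul_1_l, <- Nat.pow_mul_r.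
        do 2 f_equal. ring. }
      rewrite Er, dig_scale, dig_add. apply dig_ext. intros j _. cbn [dig].
      rewrite <- Nat.pow_mul_r. rewrite Nat.mul_add_distr_r. f_equal.
      rewrite <- Nat.mul_assoc, <- Nat.pow_add_r. do 2 f_equal. ring. }
    rewrite E. specialize (IH c k ltac:(lia) Hk).
    destruct (Nat.eq_dec n k) as [->|Hne].
    + rewrite Nat.ltb_irrefl in IH. destruct (Nat.ltb_spec k (S k)); [|lia].
      replace (N * c k) with (0 + c k * N) by lia. apply eqm_add; [exact IH|].
      apply eqm_mul; [reflexivity|].
      replace (k + (N - k)) with N by lia.
      unfold eqm, rep. rewrite (eqm_base M (2 ^ (g * N)) 1 N (fun _ => 1) omega_N). f_equal.
      apply dig_one.
    + replace (if k <? S n then N * c k else 0) with ((if k <? n then N * c k else 0) + c n * 0).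
      * apply eqm_add; [exact IH|]. apply eqm_mul; [reflexivity|]. apply omega_orth; lia.
      * rewrite Nat.mul_0_r, Nat.add_0_r.
        destruct (Nat.ltb_spec k n); destruct (Nat.ltb_spec k (S n)); try lia; reflexivity.
Qed.

(** [2 ^ (2 * K)] is 1, so division by [N = 2 ^ S u] is multiplication by a power of two.
    Coefficients below the modulus are recovered exactly. *)
Lemma dft_inverse : forall n c k (V : nat -> nat), n <= N -> k < N -> S u <= 2 * K -> (forall i, c i < M) ->
  (forall j, j < N -> eqm M (V j) (dig (2 ^ (g * j)) n c)) ->
  (2 ^ (2 * K - S u) * (dig 1 N (fun j => V j * 2 ^ (g * ((j * (N - k)) mod N))) mod M)) mod M
    = if k <? n then c k else 0.
Proof.
  intros n c k V Hn Hk Hu Hc HV.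
  assert (E : eqm M (2 ^ (2 * K - S u) * (dig 1 N (fun j => V j * 2 ^ (g * ((j * (N - k)) mod N))) mod M))
    (2 ^ (2 * K - S u) * (if k <? n then N * c k else 0))).
  { apply eqm_mul; [reflexivity|]. unfold eqm. rewrite Nat.Div0.mod_mod.
    rewrite <- (dft_sum n c k Hn Hk). apply eqm_dig. intros j Hj. apply eqm_mul; [now apply HV|apply omega_mod]. }
  unfold eqm in E. rewrite E.
  destruct (k <? n); [|rewrite Nat.mul_0_r; apply Nat.Div0.mod_0_l].
  rewrite Nat.mul_assoc, <- Nat.pow_add_r. replace (2 * K - S u + S u) with (K + K) by lia.
  rewrite Nat.pow_add_r. transitivity ((1 * c k) mod M).
  - apply eqm_mul; [apply minus_one_sq|reflexivity].
  - rewrite Nat.mul_1_l. now apply Nat.mod_small.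
Qed.

End DFT.

(** * Integer division by a geometric series *)

(** Coefficients are natural numbers, so the value at 1 bounds each of them ([coef_le]); this is how
    coefficients are shown to lie below the modulus of the transform. *)
Definition poly (p : nat -> nat) (n : nat) : Prop := exists c, forall X, p X = dig X n c.

Lemma poly_ext : forall p p' n, (forall X, p X = p' X) -> poly p n -> poly p' n.
Proof. intros p p' n H [c Hc]. exists c. intros X. now rewrite <- H. Qed.

Lemma poly_mono : forall p n n', n <= n' -> poly p n -> poly p n'.
Proof.
  intros p n n' H [c Hc]. exists (fun i => if i <? n then c i else 0). intros X. rewrite Hc.
  replace n' with (n + (n' - n)) by lia. rewrite dig_split.
  assert (E : forall m d, (forall i, i < m -> d i = 0) -> dig X m d = 0).
  { induction m as [|m IHm]; intros d Hd; [reflexivity|]. cbn [dig]. rewrite IHm by (intros; apply Hd; lia). rewrite Hd by lia. lia. }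
  rewrite (E (n' - n)).
  - rewrite Nat.mul_0_r, Nat.add_0_r. apply dig_ext. intros i Hi. destruct (Nat.ltb_spec i n); [reflexivity|lia].
  - intros i _. destruct (Nat.ltb_spec (n + i) n); [lia|reflexivity].
Qed.

Lemma poly_add : forall p p' n, poly p n -> poly p' n -> poly (fun X => p X + p' X) n.
Proof. intros p p' n [c Hc] [d Hd]. exists (fun i => c i + d i). intros X. now rewrite Hc, Hd, dig_add. Qed.

Lemma poly_scale : forall a p n, poly p n -> poly (fun X => a * p X) n.
Proof. intros a p n [c Hc]. exists (fun i => a * c i). intros X. now rewrite Hc, dig_scale. Qed.

Lemma poly_shift : forall m p n, poly p n -> poly (fun X => X ^ m * p X) (m + n).
Proof.
  intros m p n [c Hc]. exists (fun i => if i <? m then 0 else c (i - m)). intros X. rewrite Hc, dig_split.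
  replace (dig X m (fun i => if i <? m then 0 else c (i - m))) with 0.
  - cbn [Nat.add]. f_equal. apply dig_ext. intros i Hi. destruct (Nat.ltb_spec (m + i) m); [lia|]. f_equal. lia.
  - symmetry. transitivity (dig X m (fun _ => 0 * 0)).
    + apply dig_ext. intros i Hi. destruct (Nat.ltb_spec i m); [reflexivity|lia].
    + rewrite <- (dig_scale X m 0 (fun _ => 0)). lia.
Qed.

Lemma poly_mul : forall p p' n n', poly p n -> poly p' n' -> poly (fun X => p X * p' X) (n + n').
Proof.
  intros p p' n n' Hp [d Hd].
  apply (poly_ext (fun X => p X * dig X n' d)); [intros X; now rewrite Hd|]. clear p' Hd.
  induction n' as [|n' IH].
  - exists (fun _ => 0). intros X. cbn [dig]. rewrite Nat.mul_0_r.
    pose proof (dig_scale X (n + 0) 0 (fun _ => 0)). cbn in H. exact H.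
  - apply (poly_ext (fun X => p X * dig X n' d + d n' * (X ^ n' * p X))).
    + intros X. cbn [dig]. ring.
    + apply poly_add.
      * eapply poly_mono; [|exact IH]. lia.
      * apply poly_scale. eapply poly_mono; [|apply poly_shift; exact Hp]. lia.
Qed.

Lemma poly_dig : forall n c, poly (fun X => dig X n c) n.
Proof. intros n c. exists c. reflexivity. Qed.

Lemma poly_mono_term : forall m, poly (fun X => X ^ m) (m + 1).
Proof.
  intros m. apply (poly_ext (fun X => X ^ m * dig X 1 (fun _ => 1))).
  - intros X. cbn. lia.
  - apply poly_shift. apply poly_dig.
Qed.

Lemma coef_le : forall n c i, i < n -> c i <= dig 1 n c.
Proof.
  induction n as [|n IH]; intros c i Hi; [lia|]. cbn [dig]. rewrite Nat.pow_1_l, Nat.mul_1_r.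
  destruct (Nat.eq_dec i n) as [->|E]; [lia|]. specialize (IH c i ltac:(lia)). lia.
Qed.

(** Horner's rule for [(Z ^ r - f ^ r) / (Z - f)]. *)
Fixpoint geom (f Z : nat) (r : nat) : nat :=
  match r with
  | 0 => 0
  | S r' => f * geom f Z r' + Z ^ r'
  end.

Lemma geom_spec : forall f v r, geom f (v + f) r * v + f ^ r = (v + f) ^ r.
Proof.
  intros f v r. induction r as [|r IH]; [reflexivity|]. cbn [geom Nat.pow].
  transitivity (f * (geom f (v + f) r * v + f ^ r) + (v + f) ^ r * v); [ring|]. rewrite IH. ring.
Qed.

Lemma poly_geom : forall p a n r, poly p n -> poly (fun X => geom (p X) (X ^ a) r) (r * (n + a) + 1).
Proof.
  intros p a n r Hp. induction r as [|r IH].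
  - exists (fun _ => 0). intros X. cbn. lia.
  - cbn [geom]. apply poly_add.
    + eapply poly_mono; [|apply poly_mul; [exact Hp|exact IH]]. lia.
    + apply (poly_ext (fun X => X ^ (a * r))); [intros X; apply Nat.pow_mul_r|].
      eapply poly_mono; [|apply poly_mono_term]. nia.
Qed.

Lemma geom_le : forall f H r, f <= H -> 1 <= H -> geom f 1 r <= r * H ^ r.
Proof.
  intros f H r Hf H1. induction r as [|r IH]; [cbn; lia|]. cbn [geom]. rewrite Nat.pow_1_l. cbn [Nat.pow].
  assert (1 <= H ^ r) by (pose proof (Nat.pow_nonzero H r); lia).
  assert (f * geom f 1 r <= H * (r * H ^ r)) by (apply Nat.mul_le_mono; lia). nia.
Qed.

Lemma geom_eqm : forall M f f' Z Z' r, eqm M f f' -> eqm M Z Z' -> eqm M (geom f Z r) (geom f' Z' r).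
Proof.
  intros M f f' Z Z' r Hf HZ. induction r as [|r IH]; [reflexivity|]. cbn [geom].
  apply eqm_add; [now apply eqm_mul|now apply eqm_pow].
Qed.

Section Division.

Variables beta D t y : nat.
Hypothesis Hb : 2 <= beta.
Hypothesis HD : 2 <= D.
Hypothesis Ht : 1 <= t.
Hypothesis Hy1 : beta ^ (t - 1) <= y.
Hypothesis Hy2 : y < beta ^ t.

Let yt := y * beta ^ D / beta ^ t.
Let u := beta ^ (2 * D) / (yt + 1).

(** [yt] consists of the leading [D] digits of [y]. Dividing by [yt + 1] rounds down, so [u]
    approximates [beta ^ (D + t) / y] from below, with relative error less than
    [beta ^ 2 / beta ^ D]. *)
Lemma reciprocal_spec : exists f, u * y + f = beta ^ (D + t) /\ f < beta ^ (t + 2) /\ u < beta ^ (D + 1) + 1 /\ yt < beta ^ D.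
Proof.
  assert (Hp : forall k, 1 <= beta ^ k) by (intros k; pose proof (Nat.pow_nonzero beta k); lia).
  pose proof (Nat.div_mod_eq (y * beta ^ D) (beta ^ t)) as E1. fold yt in E1.
  pose proof (Nat.mod_upper_bound (y * beta ^ D) (beta ^ t) ltac:(specialize (Hp t); lia)) as E2.
  pose proof (Nat.div_mod_eq (beta ^ (2 * D)) (yt + 1)) as E3. fold u in E3.
  pose proof (Nat.mod_upper_bound (beta ^ (2 * D)) (yt + 1) ltac:(lia)) as E4.
  remember ((y * beta ^ D) mod beta ^ t) as r1. remember (beta ^ (2 * D) mod (yt + 1)) as r2.
  replace (2 * D) with (D + D) in E3 by lia. rewrite Nat.pow_add_r in E3.
  assert (Ebt : beta ^ t = beta * beta ^ (t - 1)) by (rewrite <- Nat.pow_succ_r'; f_equal; lia).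
  assert (EbD : beta ^ D = beta * beta ^ (D - 1)) by (rewrite <- Nat.pow_succ_r'; f_equal; lia).
  replace (D + 1) with (S D) by lia. replace (t + 2) with (S (S t)) by lia.
  rewrite Nat.pow_add_r. cbn [Nat.pow].
  pose proof (Hp D) as PD. pose proof (Hp t) as Pt. pose proof (Hp (D - 1)) as PD1. pose proof (Hp (t - 1)) as Pt1.
  set (BD := beta ^ D) in *. set (Bt := beta ^ t) in *. set (BD1 := beta ^ (D - 1)) in *. set (Bt1 := beta ^ (t - 1)) in *.
  clearbody BD Bt BD1 Bt1 yt u. clear Heqr1 Heqr2 Hp.
  assert (Hyt : yt < BD).
  { assert (yt * Bt < BD * Bt) by nia. nia. }
  assert (Hyl : BD1 <= yt).
  { assert (BD1 * Bt <= y * BD) by (rewrite Ebt, EbD; nia).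
    assert (BD1 * Bt < (yt + 1) * Bt) by nia. nia. }
  assert (Hu : u <= beta * BD).
  { apply (Nat.mul_le_mono_pos_r _ _ BD1); [lia|]. transitivity (u * yt); [now apply Nat.mul_le_mono_l|].
    replace (beta * BD * BD1) with (BD * BD) by (rewrite EbD at 2; ring). clear - E3. nia. }
  assert (H1 : u * y <= BD * Bt).
  { apply (Nat.mul_le_mono_pos_r _ _ BD); [lia|].
    replace (u * y * BD) with (u * (y * BD)) by ring. transitivity (u * ((yt + 1) * Bt)).
    - apply Nat.mul_le_mono_l. lia.
    - replace (u * ((yt + 1) * Bt)) with ((yt + 1) * u * Bt) by ring.
      replace (BD * Bt * BD) with (BD * BD * Bt) by ring. apply Nat.mul_le_mono_r. lia. }
  exists (BD * Bt - u * y).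
  assert (H2 : (BD * Bt - u * y) * BD <= Bt * (yt + 1 + u)).
  { rewrite Nat.mul_sub_distr_r. assert (BD * Bt * BD <= Bt * (yt + 1 + u) + u * y * BD); [|lia].
    replace (u * y * BD) with (u * (Bt * yt + r1)) by (rewrite <- E1; ring).
    assert (H3 : BD * BD <= yt + 1 + u + u * yt) by lia.
    apply (Nat.mul_le_mono_l _ _ Bt) in H3. clear - H3. lia. }
  assert (H3 : (BD * Bt - u * y) * BD < beta * (beta * Bt) * BD).
  { eapply Nat.le_lt_trans; [exact H2|]. assert (H4 : yt + 1 + u <= (1 + beta) * BD) by lia.
    apply (Nat.mul_le_mono_l _ _ Bt) in H4. eapply Nat.le_lt_trans; [exact H4|].
    assert (H5 : 1 + beta < beta * beta) by (clear - Hb; nia).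
    replace (beta * (beta * Bt) * BD) with (Bt * (beta * beta * BD)) by ring.
    apply Nat.mul_lt_mono_pos_l; [lia|]. apply Nat.mul_lt_mono_pos_r; lia. }
  repeat split; try lia. apply (Nat.mul_lt_mono_pos_r BD); [lia|exact H3].
Qed.

(** With [Z = beta ^ (D + t)], [1 / y] equals [u / (Z - f)], and stopping its series after [r] terms
    loses the fraction [(f / Z) ^ r], at most [1 / (2 * x + 1)]. One half is added to [x], so the
    exact quotient lies at least [1 / (2 * y)] above an integer and the loss cannot cross it. The
    factor [beta] makes the half an integer. *)
Lemma division_spec : forall f x r, u * y + f = beta ^ (D + t) -> f < beta ^ (t + 2) ->
  2 * x + 1 <= beta ^ ((D - 2) * r) -> Nat.Even beta ->
  (beta * x + beta / 2) * u * geom f (beta ^ (D + t)) r / beta ^ (1 + (D + t) * r) = x / y.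
Proof.
  intros f x r Ef Hf Hx [h Hh].
  replace (beta / 2) with h by (rewrite Hh, Nat.mul_comm, Nat.div_mul; lia).
  replace (beta ^ (1 + (D + t) * r)) with (beta * (beta ^ (D + t)) ^ r) by (rewrite <- Nat.pow_mul_r; reflexivity).
  rewrite <- Ef. pose proof (geom_spec f (u * y) r) as Hg.
  set (G := geom f (u * y + f) r) in *. set (Zr := (u * y + f) ^ r) in *.
  assert (Hy0 : 0 < y) by (pose proof (Nat.pow_nonzero beta (t - 1)); lia).
  assert (Hfr : f ^ r * (2 * x + 1) <= Zr).
  { transitivity (f ^ r * beta ^ ((D - 2) * r)); [nia|].
    rewrite Nat.pow_mul_r, <- Nat.pow_mul_l. apply Nat.pow_le_mono_l. rewrite Ef.
    replace (D + t) with ((t + 2) + (D - 2)) by lia. rewrite Nat.pow_add_r. apply Nat.mul_le_mono_r. lia. }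
  assert (HZ : 0 < Zr).
  { unfold Zr. rewrite Ef. pose proof (Nat.pow_nonzero (beta ^ (D + t)) r (Nat.pow_nonzero beta (D + t) ltac:(lia))). lia. }
  replace ((beta * x + h) * u * G) with (h * ((2 * x + 1) * (u * G))) by (rewrite Hh; ring).
  replace (beta * Zr) with (h * (2 * Zr)) by (rewrite Hh; ring).
  rewrite Nat.Div0.div_mul_cancel_l by lia.
  symmetry. pose proof (Nat.div_mod_eq x y) as Ex. pose proof (Nat.mod_upper_bound x y ltac:(lia)) as Mx.
  set (z := x / y) in *. remember (x mod y) as rho.
  assert (A1 : 2 * Zr * z <= (2 * x + 1) * (u * G)).
  { assert (2 * Zr * z * y <= (2 * x + 1) * (u * G) * y); [|nia].
    replace ((2 * x + 1) * (u * G) * y) with ((2 * x + 1) * (G * (u * y))) by ring.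
    assert ((2 * x + 1) * (G * (u * y)) + (2 * x + 1) * f ^ r = (2 * x + 1) * Zr) by nia.
    assert (2 * Zr * z * y + Zr <= (2 * x + 1) * Zr) by nia. nia. }
  assert (A2 : (2 * x + 1) * (u * G) < 2 * Zr * (z + 1)).
  { assert ((2 * x + 1) * (u * G) * y < 2 * Zr * (z + 1) * y); [|nia].
    replace ((2 * x + 1) * (u * G) * y) with ((2 * x + 1) * (G * (u * y))) by ring.
    assert ((2 * x + 1) * (G * (u * y)) <= (2 * x + 1) * Zr) by nia.
    assert (2 * x + 1 < 2 * (z + 1) * y) by nia. nia. }
  apply (Nat.div_unique _ _ z ((2 * x + 1) * (u * G) - 2 * Zr * z)); lia.
Qed.

(** Computes [f = beta ^ (D + t) - u * y] without borrows: modulo [beta ^ (t + 2)], [- y] is the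
    digitwise complement of [y] plus 1. *)
Lemma complement_spec : forall f L yc, u * y + f = beta ^ (D + t) -> f < beta ^ (t + 2) -> t + 2 <= L ->
  y + yc + 1 = beta ^ L -> (u * yc + u) mod beta ^ (t + 2) = f.
Proof.
  intros f L yc Ef Hf HL Hc.
  assert (E : (u * yc + u) + beta ^ (D + t) = u * beta ^ L + f) by (rewrite <- Ef, <- Hc; ring).
  replace (D + t) with ((D - 2) + (t + 2)) in E by lia.
  replace L with ((L - (t + 2)) + (t + 2)) in E by lia. rewrite !Nat.pow_add_r in E.
  assert (E2 : ((u * yc + u) + beta ^ (D - 2) * beta ^ (t + 2)) mod beta ^ (t + 2)
    = (f + (u * beta ^ (L - (t + 2))) * beta ^ (t + 2)) mod beta ^ (t + 2)).
  { f_equal. rewrite Nat.pow_add_r. lia. }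
  rewrite !Nat.Div0.mod_add in E2. rewrite E2. now apply Nat.mod_small.
Qed.

End Division.

(** * Arithmetic on long words given by their blocks *)

Section Blocks.

Variable D : dclass.
(** Long words have [L] blocks of [b] bits. [N] is the loop bound and the length of the transform
    modulo [2 ^ K + 1], with root of unity [2 ^ g0]; [Dd] is the precision of the reciprocal and [r]
    the number of terms of the series. *)
Variables w m0 l1 q K N L b Dd r g0 u0 : nat.
Hypothesis HD : counting D w m0 l1.

Let beta := 2 ^ b.
Let Mo := 2 ^ K + 1.
Let KK := K + 2.
Let B2D := beta ^ (2 * Dd).
Let cinv := 2 ^ (2 * K - S u0).

Hypothesis Cq : Df D l1 (fun _ => q).
Hypothesis CN : Df D l1 (fun _ => N).
Hypothesis CL : Df D l1 (fun _ => L).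
Hypothesis CL2 : Df D l1 (fun _ => L + 2).
Hypothesis Cb : Df D l1 (fun _ => b).
Hypothesis Cbeta : Df D l1 (fun _ => beta).
Hypothesis CMo : Df D l1 (fun _ => Mo).
Hypothesis CKK : Df D l1 (fun _ => KK).
Hypothesis CDd : Df D l1 (fun _ => Dd).
Hypothesis Cr : Df D l1 (fun _ => r).
Hypothesis Cg : Df D l1 (fun _ => g0).
Hypothesis CB2D : Df D l1 (fun _ => B2D).
Hypothesis Ccinv : Df D l1 (fun _ => cinv).

Hypothesis H_N : N = q ^ 10.
Hypothesis H_N2 : N = 2 ^ S u0.
Hypothesis H_g : g0 * 2 ^ u0 = K.
Hypothesis H_s1 : KK * (q + 1) < m0.
Hypothesis H_s2 : 4 * K + 20 <= m0.
Hypothesis H_b : 3 <= b.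
Hypothesis H_L : 1 <= L.
Hypothesis H_deg : L + (r * ((L + 2) + (Dd + L)) + 1) + 2 <= N.
Hypothesis H_Lb : 2 * L + 4 <= beta.
Hypothesis H_rb : r <= beta.
Hypothesis H_K : b * (Dd + Dd + 2 * r + 8) <= K.
Hypothesis H_D : 3 <= Dd.
Hypothesis H_r : L + 1 <= (Dd - 2) * r.

Let Cmax := c_max _ _ _ _ HD.

Lemma K_pos : 8 <= K.
Proof. transitivity (b * (Dd + Dd + 2 * r + 8)); [|exact H_K]. transitivity (1 * 8); [lia|]. apply Nat.mul_le_mono; lia. Qed.

Lemma r_pos : 1 <= r.
Proof. destruct r; [|lia]. rewrite Nat.mul_0_r in H_r. lia. Qed.

Lemma g0_pos : 1 <= g0.
Proof. pose proof K_pos. destruct g0; cbn in *; lia. Qed.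

Lemma u0_K : S u0 <= K.
Proof. pose proof g0_pos. pose proof (Nat.pow_gt_lin_r 2 u0 ltac:(lia)). rewrite <- H_g. pose proof (Nat.mul_le_mono_r 1 g0 (2 ^ u0) H). lia. Qed.

Lemma pw : forall a c, a <= c -> 2 ^ a <= 2 ^ c.
Proof. intros a c H. apply Nat.pow_le_mono_r; lia. Qed.

Lemma N_K : N <= 2 ^ K.
Proof. rewrite H_N2. apply pw. apply u0_K. Qed.

Lemma bd_pw : forall a c, a <= m0 -> c < 2 ^ a -> c < bd D.
Proof. intros a c Ha Hc. rewrite (c_bd _ _ _ _ HD). pose proof (pw a m0 Ha). lia. Qed.

Lemma lt_mul_pw : forall x y a c, x <= 2 ^ a -> y < 2 ^ c -> x * y < 2 ^ (a + c).
Proof. intros x y a c H1 H2. rewrite Nat.pow_add_r. pose proof (Nat.pow_nonzero 2 a ltac:(lia)). clear - H1 H2 H. nia. Qed.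

Lemma beta_pos : 8 <= beta.
Proof. unfold beta. change 8 with (2 ^ 3). now apply pw. Qed.

Lemma beta_pow : forall k, beta ^ k = 2 ^ (b * k).
Proof. intros k. unfold beta. now rewrite <- Nat.pow_mul_r. Qed.

Lemma beta_pow_K : forall k, k <= Dd + Dd + 2 * r + 8 -> beta ^ k <= 2 ^ K.
Proof. intros k Hk. rewrite beta_pow. apply pw. transitivity (b * (Dd + Dd + 2 * r + 8)); [now apply Nat.mul_le_mono_l|exact H_K]. Qed.

Lemma pK2 : 2 ^ KK = 4 * 2 ^ K.
Proof. unfold KK. rewrite Nat.pow_add_r. cbn. lia. Qed.

Lemma texpKK : texp D KK = 2 ^ KK.
Proof. apply texp_small. apply (bd_pw (S KK)); [unfold KK; lia|apply Nat.pow_lt_mono_r; lia]. Qed.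

Lemma q_bd : q ^ 10 < bd D.
Proof. rewrite <- H_N. pose proof N_K. apply (bd_pw (S K)); [lia|]. cbn. pose proof (Nat.pow_nonzero 2 K). lia. Qed.

(** A long word does not fit into a variable, so it is represented by the definable function from an
    index to the block there. *)
Definition Do (k : nat) (g : env -> nat -> nat) : Prop := Df D (lv k l1) (fun e => g (sh 1 e) (e 0)).

Lemma Do_mono : forall k k' g, k <= k' -> Do k g -> Do k' g.
Proof. intros k k' g H Hg. eapply Df_mono; [|exact Hg]. unfold lv; lia. Qed.

Lemma dsh : forall k j f, j <= 20 -> Df D (lv k l1) f -> Df D (lv (S k) l1) (fun e => f (sh j e)).
Proof. intros k j f Hj Hf. eapply Df_mono; [|apply Df_sh; exact Hf]. unfold lv; lia. Qed.

Lemma duse : forall k k' j g idx, k <= k' -> j <= 20 -> Do k g -> Df D (lv k' l1) idx ->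
  Df D (lv (S k') l1) (fun e => g (sh j e) (idx e)).
Proof.
  intros k k' j g idx Hk Hj Hg Hi. apply (dorc D k' l1 j (fun i e => g e i) idx Hj); [|exact Hi].
  eapply Df_mono; [|exact Hg]. unfold lv; lia.
Qed.

Lemma dtx1 : forall k f, Df D (lv k l1) f -> Df D (lv (17 + k) l1) (fun e => texp D (f e)).
Proof. apply (dtx D w m0 l1 HD). Qed.

Ltac dhook ::=
  lazymatch goal with
  | |- Df _ _ (fun e => texp _ (@?f e)) => apply dtx1; dgo
  | H : Do _ ?g |- Df _ _ (fun e => ?g (sh ?j e) (@?f e)) => eapply duse; [|lia|exact H|dgo]; [lia|..]
  | H : Df ?D (lv _ ?l) ?S |- Df ?D _ (fun e => ?S (sh _ e)) => apply dsh; [lia|]; eapply Df_mono; [|exact H]; unfold lv; lia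
  | H : Df ?D (lv _ ?l) ?F |- Df ?D (lv _ ?l) ?F => eapply Df_mono; [|exact H]; unfold lv; lia
  end.

Ltac dnums := try (pose proof (bd_ge D); lia); try (apply (bd_pw 4); [lia|cbn; lia]).

(** The common form of all computations below: exactly [N] rounds from state 0. Shorter loops leave
    the state as it is after their bound. *)
Definition lp (F : nat -> nat -> nat) : nat := iterf (fun i x => F i x mod texp D KK) N 0.

Lemma dlp : forall k F, Df D (lv k l1) (fun e => F (sh 2 e) (e 1) (e 0)) ->
  Df D (lv (650 + k) l1) (fun e => lp (F e)).
Proof.
  intros k F HF. unfold lp. rewrite H_N.
  assert (H0 : 0 < 2 ^ KK) by (pose proof (Nat.pow_nonzero 2 KK); lia).
  assert (H1 : forall x, x mod texp D KK < 2 ^ KK) by (intros x; rewrite texpKK; apply Nat.mod_upper_bound; lia).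
  apply (dloop D w m0 l1 q KK HD Cq CKK H_s1 ltac:(unfold KK; lia) (20 + k) (fun e i x => F e i x mod texp D KK) (fun _ => 0)).
  - apply q_bd.
  - dgo.
  - apply dnum; [pose proof (bd_ge D)|]; lia.
  - auto.
  - intros. apply H1.
Qed.

Lemma dlp1 : forall k F, Df D (lv k l1) (fun e => F (sh 3 e) (e 2) (e 1) (e 0)) ->
  Do (650 + k) (fun e j => lp (F e j)).
Proof. intros k F HF. apply (dlp k (fun e => F (sh 1 e) (e 0))). exact HF. Qed.

Lemma lp_inv : forall (I : nat -> nat -> Prop) F, I 0 0 ->
  (forall i x, i < N -> I i x -> F i x < 2 ^ KK /\ I (S i) (F i x)) -> I N (lp F).
Proof.
  intros I F H0 HS. unfold lp. apply iterf_inv; auto.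
  intros i x Hi Hx. destruct (HS i x Hi Hx) as [H1 H2]. rewrite texpKK, Nat.mod_small; auto.
Qed.

Definition blk (x i : nat) : nat := (x / beta ^ i) mod beta.

Lemma bpos : forall i, beta ^ i <> 0.
Proof. intros i. apply Nat.pow_nonzero. pose proof beta_pos. lia. Qed.

Lemma blk_lt : forall x i, blk x i < beta.
Proof. intros x i. apply Nat.mod_upper_bound. pose proof beta_pos. lia. Qed.

Lemma mod_step : forall x i, x mod beta ^ S i = x mod beta ^ i + beta ^ i * blk x i.
Proof.
  intros x i. replace (beta ^ S i) with (beta ^ i * beta) by (cbn; lia). apply Nat.Div0.mod_mul_r.
Qed.

Lemma dig_blk : forall x c, dig beta c (blk x) = x mod beta ^ c.
Proof.
  intros x c. induction c as [|c IH]; [symmetry; apply Nat.mod_1_r|]. rewrite mod_step, <- IH. cbn [dig]. lia.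
Qed.

Lemma blk_high : forall x c i, x < beta ^ c -> c <= i -> blk x i = 0.
Proof.
  intros x c i Hx Hi. unfold blk. rewrite Nat.div_small; [apply Nat.Div0.mod_0_l|].
  eapply Nat.lt_le_trans; [exact Hx|]. apply Nat.pow_le_mono_r; [pose proof beta_pos|]; lia.
Qed.

Lemma blk_mod : forall x c i, i < c -> blk (x mod beta ^ c) i = blk x i.
Proof.
  intros x c i Hi. unfold blk. replace c with (i + S (c - i - 1)) by lia.
  rewrite Nat.pow_add_r. rewrite Nat.Div0.mod_mul_r.
  rewrite (Nat.mul_comm (beta ^ i)), Nat.div_add by apply bpos.
  rewrite Nat.div_small by (apply Nat.mod_upper_bound, bpos). cbn [Nat.add Nat.pow].
  rewrite Nat.Div0.mod_mul_r. rewrite (Nat.mul_comm beta), Nat.Div0.mod_add. apply Nat.Div0.mod_mod.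
Qed.

Definition osum (c : nat) (g : nat -> nat) : nat :=
  lp (fun i x => tadd D x (if i <? c then g i else 0) mod Mo).

Lemma d_osum : forall k c g, Df D l1 (fun _ => c) -> Do k g -> Df D (lv (670 + k) l1) (fun e => osum c (g e)).
Proof.
  intros k c g Hc Hg. apply (dlp (20 + k) (fun e i x => tadd D x (if i <? c then g e i else 0) mod Mo)).
  dgo; dnums.
Qed.

Lemma Mo_lt : forall x, x mod Mo < 2 ^ KK /\ x mod Mo <= 2 ^ K.
Proof.
  intros x. pose proof (Nat.mod_upper_bound x Mo ltac:(unfold Mo; lia)). rewrite pK2. pose proof (Nat.pow_nonzero 2 K ltac:(lia)). unfold Mo in *. lia.
Qed.

Lemma osum_spec : forall c g, c <= N -> (forall i, i < c -> g i < 2 ^ (4 * K + 16)) -> osum c g = dig 1 c g mod Mo.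
Proof.
  intros c g Hc Hg. unfold osum.
  assert (H : (c <= N -> lp (fun i x => tadd D x (if i <? c then g i else 0) mod Mo) = dig 1 c g mod Mo) /\
    (N <= c -> lp (fun i x => tadd D x (if i <? c then g i else 0) mod Mo) = dig 1 N g mod Mo)).
  { apply (lp_inv (fun i x => (c <= i -> x = dig 1 c g mod Mo) /\ (i <= c -> x = dig 1 i g mod Mo))).
    - split; intros H; [|symmetry; apply Nat.Div0.mod_0_l]. replace c with 0 by lia. symmetry; apply Nat.Div0.mod_0_l.
    - intros i x Hi [H1 H2]. split; [apply Mo_lt|].
      assert (Hx : x <= 2 ^ K).
      { destruct (Nat.le_gt_cases c i); [rewrite H1 by lia|rewrite H2 by lia]; apply Mo_lt. }
      assert (E : tadd D x (if i <? c then g i else 0) = x + (if i <? c then g i else 0)).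
      { apply tadd_small. apply (bd_pw (S (4 * K + 16))); [lia|]. rewrite two_pow_S.
        pose proof (pw K (4 * K + 16) ltac:(lia)). pose proof (Nat.pow_nonzero 2 (4 * K + 16)).
        destruct (Nat.ltb_spec i c); [specialize (Hg i ltac:(lia))|]; lia. }
      rewrite E. destruct (Nat.ltb_spec i c) as [Hic|Hic].
      + split; intros H3.
        * replace c with (S i) by lia. cbn [dig]. rewrite Nat.pow_1_l, Nat.mul_1_r, H2 by lia.
          apply Nat.Div0.add_mod_idemp_l.
        * cbn [dig]. rewrite Nat.pow_1_l, Nat.mul_1_r, H2 by lia. apply Nat.Div0.add_mod_idemp_l.
      + split; intros H3; [|lia]. rewrite Nat.add_0_r, H1 by lia. apply Nat.Div0.mod_mod. }
  apply H. exact Hc.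
Qed.

(** The power [j * i] of the root of unity. Reducing the exponent modulo [N] keeps the value at most
    [2 ^ (K + K)], hence inside a word. *)
Definition owr (j i : nat) : nat := texp D (tmul D g0 (tmul D j i mod N)).

Lemma N_pos : N <> 0.
Proof. rewrite H_N2. apply Nat.pow_nonzero. lia. Qed.

Lemma owr_val : forall j i, j * i < bd D -> owr j i = 2 ^ (g0 * ((j * i) mod N)) /\ owr j i <= 2 ^ (K + K).
Proof.
  intros j i H. unfold owr. rewrite (tmul_small D j i) by auto.
  pose proof (Nat.mod_upper_bound (j * i) N N_pos) as Hm.
  assert (HgN : g0 * N = K + K) by (rewrite H_N2, two_pow_S; lia).
  assert (Hl : g0 * ((j * i) mod N) <= K + K) by (rewrite <- HgN; apply Nat.mul_le_mono_l; lia).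
  rewrite tmul_small.
  - rewrite texp_small; [split; [reflexivity|now apply pw]|].
    apply (bd_pw (S (K + K))); [lia|]. apply Nat.pow_lt_mono_r; lia.
  - apply (bd_pw (K + K)); [lia|]. pose proof (Nat.pow_gt_lin_r 2 (K + K) ltac:(lia)). lia.
Qed.

Lemma owr_eqm : forall j i, j * i < bd D -> eqm Mo (owr j i) (2 ^ (g0 * (j * i))).
Proof.
  intros j i H. destruct (owr_val j i H) as [-> _]. unfold Mo. rewrite H_N2.
  apply (omega_mod K u0 g0 H_g).
Qed.

Lemma NN_bd : forall j i, j < N -> i <= N -> j * i < bd D.
Proof.
  intros j i Hj Hi. pose proof N_K. apply (bd_pw (K + K)); [lia|]. rewrite Nat.mul_comm. apply lt_mul_pw; lia.
Qed.

(** The polynomial with coefficients [cf], evaluated at the [j]-th power of the root of unity. *)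
Definition oev (c : nat) (cf : nat -> nat) (j : nat) : nat := osum c (fun i => tmul D (cf i) (owr j i)).

Lemma d_oev : forall k c cf, Df D l1 (fun _ => c) -> Do k cf -> Do (720 + k) (fun e j => oev c (cf e) j).
Proof.
  intros k c cf Hc Hcf.
  apply (d_osum (50 + k) c (fun e i => tmul D (cf (sh 1 e) i) (owr (e 0) i)) Hc).
  unfold Do, owr.
  change (Df D (lv (50 + k) l1) (fun e => tmul D (cf (sh 2 e) (e 0)) (texp D (tmul D g0 (tmul D (e 1) (e 0) mod N))))).
  dgo.
Qed.

Lemma oev_spec : forall c cf j, c <= N -> j < N -> (forall i, i < c -> cf i < 2 ^ (K + K)) ->
  eqm Mo (oev c cf j) (dig (2 ^ (g0 * j)) c cf).
Proof.
  intros c cf j Hc Hj Hcf. unfold oev.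
  assert (Hb : forall i, i < c -> tmul D (cf i) (owr j i) = cf i * owr j i /\ cf i * owr j i < 2 ^ (4 * K + 16)).
  { intros i Hi. specialize (Hcf i Hi). destruct (owr_val j i (NN_bd j i Hj ltac:(lia))) as [_ Ho].
    assert (cf i * owr j i < 2 ^ (K + K + (K + K))) by (rewrite Nat.mul_comm; apply lt_mul_pw; lia).
    split; [apply tmul_small; apply (bd_pw (K + K + (K + K))); lia|].
    pose proof (pw (K + K + (K + K)) (4 * K + 16) ltac:(lia)). lia. }
  rewrite osum_spec; auto.
  2: { intros i Hi. destruct (Hb i Hi) as [-> H]. exact H. }
  unfold eqm. rewrite Nat.Div0.mod_mod.
  transitivity (dig 1 c (fun i => cf i * 2 ^ (g0 * (j * i))) mod Mo).
  - apply eqm_dig. intros i Hi. destruct (Hb i Hi) as [-> _]. apply eqm_mul; [reflexivity|].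
    apply owr_eqm. apply NN_bd; lia.
  - f_equal. clear. induction c as [|c IH]; [reflexivity|]. cbn [dig].
    rewrite IH, Nat.pow_1_l, Nat.mul_1_r, <- Nat.pow_mul_r. do 3 f_equal. ring.
Qed.

(** The entries of [cf] may exceed [beta]: [ocar] is the carry into position [k], [ocb] the block
    left there after carrying. *)
Definition ocar (cf : nat -> nat) (k : nat) : nat := lp (fun i x => if i <? k then tadd D x (cf i) / beta else x).
Definition ocb (cf : nat -> nat) (k : nat) : nat := tadd D (ocar cf k) (cf k) mod beta.

Lemma d_ocb : forall k cf, Do k cf -> Do (680 + k) (fun e j => ocb (cf e) j).
Proof.
  intros k cf Hcf.
  assert (H : Do (660 + k) (fun e j => ocar (cf e) j)).
  { apply (dlp1 (10 + k) (fun e j i x => if i <? j then tadd D x (cf e i) / beta else x)). dgo. }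
  unfold Do, ocb.
  remember (fun e j => ocar (cf e) j) as oc.
  apply (Df_ext D _ (fun e => tadd D (oc (sh 1 e) (e 0)) (cf (sh 1 e) (e 0)) mod beta)); [intros e _; now rewrite Heqoc|].
  dgo.
Qed.

Lemma ocar_spec : forall cf k, k <= N -> (forall i, i < k -> cf i <= 2 ^ K) ->
  ocar cf k = dig beta k cf / beta ^ k /\ ocar cf k <= 2 ^ K.
Proof.
  intros cf k Hk Hcf. unfold ocar.
  pose proof beta_pos as Hbp.
  assert (H : (k <= N -> lp (fun i x => if i <? k then tadd D x (cf i) / beta else x) = dig beta k cf / beta ^ k) /\
    (N <= k -> lp (fun i x => if i <? k then tadd D x (cf i) / beta else x) = dig beta N cf / beta ^ N) /\
    lp (fun i x => if i <? k then tadd D x (cf i) / beta else x) <= 2 ^ K).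
  { apply (lp_inv (fun i x => (k <= i -> x = dig beta k cf / beta ^ k) /\ (i <= k -> x = dig beta i cf / beta ^ i) /\ x <= 2 ^ K)).
    - split; [|split]; intros; try lia; [replace k with 0 by lia|]; reflexivity.
    - intros i x Hi (H1 & H2 & Hx). pose proof pK2 as HpK. pose proof (Nat.pow_nonzero 2 K ltac:(lia)) as HKz.
      destruct (Nat.ltb_spec i k) as [Hik|Hik].
      + specialize (Hcf i Hik). rewrite tadd_small by (apply (bd_pw KK); [unfold KK; lia|lia]).
        assert (Hle : (x + cf i) / beta <= 2 ^ K) by (apply Nat.Div0.div_le_upper_bound; clear - Hcf Hx Hbp; nia).
        assert (E : (x + cf i) / beta = dig beta (S i) cf / beta ^ S i).
        { rewrite H2 by lia. replace (beta ^ S i) with (beta ^ i * beta) by (cbn; lia).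
          cbn [dig]. rewrite <- Nat.Div0.div_div, Nat.div_add by apply bpos. reflexivity. }
        split; [lia|]. split; [|split; auto]. intros H3. replace k with (S i) by lia. exact E.
      + split; [lia|]. split; [auto|split; [lia|auto]]. }
  split; apply H; auto.
Qed.

Lemma ocb_spec : forall cf k n, k < n -> n <= N -> (forall i, i < n -> cf i <= 2 ^ K) ->
  ocb cf k = blk (dig beta n cf) k.
Proof.
  intros cf k n Hk Hn Hcf. unfold ocb, blk.
  destruct (ocar_spec cf k ltac:(lia)) as [E Hle]; [intros; apply Hcf; lia|].
  specialize (Hcf k Hk). pose proof pK2 as HpK. pose proof (Nat.pow_nonzero 2 K ltac:(lia)) as HKz.
  rewrite tadd_small by (apply (bd_pw KK); [unfold KK; lia|lia]).
  rewrite E. replace n with (k + S (n - k - 1)) by lia. rewrite dig_split, dig_cons, Nat.add_0_r.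
  rewrite (Nat.mul_comm (beta ^ k)), Nat.div_add by apply bpos.
  rewrite (Nat.mul_comm beta), Nat.add_assoc, Nat.Div0.mod_add. reflexivity.
Qed.

Definition cmp (x y : nat) : nat := if x <? y then 1 else if y <? x then 2 else 0.
(** The scan goes upwards, so the last difference it meets is the most significant one. *)
Definition ocmp (X Y : nat -> nat) : nat := lp (fun i x => if X i <? Y i then 1 else if Y i <? X i then 2 else x).

Lemma d_ocmp : forall k X Y, Do k X -> Do k Y -> Df D (lv (660 + k) l1) (fun e => ocmp (X e) (Y e)).
Proof.
  intros k X Y HX HY.
  apply (dlp (10 + k) (fun e i x => if X e i <? Y e i then 1 else if Y e i <? X e i then 2 else x)).
  dgo; dnums.
Qed.

Lemma LN : L + 2 <= N.
Proof. lia. Qed.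

Lemma top_mod : forall x, x < beta ^ L -> x mod beta ^ N = x.
Proof.
  intros x Hx. apply Nat.mod_small. eapply Nat.lt_le_trans; [exact Hx|].
  pose proof LN. pose proof beta_pos. apply Nat.pow_le_mono_r; lia.
Qed.

Lemma KK4 : 4 <= 2 ^ KK.
Proof. rewrite pK2. pose proof (Nat.pow_nonzero 2 K). lia. Qed.

Lemma ocmp_spec : forall x y, x < beta ^ L -> y < beta ^ L -> ocmp (blk x) (blk y) = cmp x y.
Proof.
  intros x y Hx Hy. rewrite <- (top_mod x Hx) at 2. rewrite <- (top_mod y Hy) at 2.
  unfold ocmp. apply (lp_inv (fun i s => s = cmp (x mod beta ^ i) (y mod beta ^ i))).
  - cbn [Nat.pow]. now rewrite !Nat.mod_1_r.
  - intros i s Hi ->. rewrite !mod_step.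
    pose proof (Nat.mod_upper_bound x (beta ^ i) (bpos i)). pose proof (Nat.mod_upper_bound y (beta ^ i) (bpos i)).
    pose proof KK4.
    remember (x mod beta ^ i) as x'. remember (y mod beta ^ i) as y'. remember (beta ^ i) as B.
    unfold cmp.
    destruct (Nat.ltb_spec (blk x i) (blk y i)) as [H3|H3].
    + assert (B * blk x i + B <= B * blk y i) by (clear - H3; nia).
      destruct (Nat.ltb_spec (x' + B * blk x i) (y' + B * blk y i)); [split; lia|lia].
    + destruct (Nat.ltb_spec (blk y i) (blk x i)) as [H4|H4].
      * assert (B * blk y i + B <= B * blk x i) by (clear - H4; nia).
        destruct (Nat.ltb_spec (x' + B * blk x i) (y' + B * blk y i)); [lia|].
        destruct (Nat.ltb_spec (y' + B * blk y i) (x' + B * blk x i)); [split; lia|lia].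
      * replace (blk y i) with (blk x i) by lia.
        destruct (Nat.ltb_spec x' y'); destruct (Nat.ltb_spec y' x');
        destruct (Nat.ltb_spec (x' + B * blk x i) (y' + B * blk x i));
        destruct (Nat.ltb_spec (y' + B * blk x i) (x' + B * blk x i)); split; lia.
Qed.

Definition olen (Y : nat -> nat) : nat := lp (fun i x => if Y i =? 0 then x else tadd D i 1).

Lemma d_olen : forall k Y, Do k Y -> Df D (lv (660 + k) l1) (fun e => olen (Y e)).
Proof.
  intros k Y HY. apply (dlp (10 + k) (fun e i x => if Y e i =? 0 then x else tadd D i 1)). dgo; dnums.
Qed.

Lemma olen_spec : forall y, y < beta ^ L ->
  (olen (blk y) = 0 /\ y = 0) \/ (1 <= olen (blk y) <= L /\ beta ^ (olen (blk y) - 1) <= y < beta ^ olen (blk y)).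
Proof.
  intros y Hy. pose proof beta_pos as Hbp.
  assert (H : (olen (blk y) = 0 /\ y mod beta ^ N = 0) \/
    (1 <= olen (blk y) <= N /\ beta ^ (olen (blk y) - 1) <= y mod beta ^ N < beta ^ olen (blk y))).
  { unfold olen. apply (lp_inv (fun i s => (s = 0 /\ y mod beta ^ i = 0) \/ (1 <= s <= i /\ beta ^ (s - 1) <= y mod beta ^ i < beta ^ s))).
    - left. split; [reflexivity|]. apply Nat.mod_1_r.
    - intros i s Hi HI. rewrite mod_step. pose proof N_K as HNK. pose proof pK2 as HpK. pose proof (Nat.pow_nonzero 2 K ltac:(lia)) as HKz.
      destruct (Nat.eqb_spec (blk y i) 0) as [E|E].
      + rewrite E, Nat.mul_0_r, Nat.add_0_r. split; [destruct HI as [HI|HI]; lia|].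
        destruct HI as [HI|HI]; [left; exact HI|right; split; [lia|apply HI]].
      + rewrite tadd_small by (apply (bd_pw KK); [unfold KK; lia|lia]).
        split; [lia|]. right. split; [lia|]. rewrite Nat.add_1_r. replace (S i - 1) with i by lia.
        pose proof (Nat.mod_upper_bound y (beta ^ i) (bpos i)). pose proof (blk_lt y i). cbn [Nat.pow].
        remember (beta ^ i) as B. clear - E H H0. split; nia. }
  rewrite top_mod in H by auto. destruct H as [H|[H1 H2]]; [left; exact H|right].
  split; [|exact H2]. split; [lia|].
  destruct (Nat.le_gt_cases (olen (blk y)) L) as [H3|H3]; [exact H3|].
  assert (beta ^ L <= beta ^ (olen (blk y) - 1)) by (apply Nat.pow_le_mono_r; lia). lia.
Qed.

(** The number [yt] of the division: the top [Dd] of [t] digits, filled up with zeros if there are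
    fewer. *)
Definition otop (Y : nat -> nat) (t : nat) : nat :=
  lp (fun i x => if i <? Dd then tadd D (tmul D x beta) (if i <? t then Y (t - 1 - i) else 0) else x).

Lemma d_otop : forall k Y t, Do k Y -> Df D (lv k l1) t -> Df D (lv (680 + k) l1) (fun e => otop (Y e) (t e)).
Proof.
  intros k Y t HY Ht.
  apply (dlp (30 + k) (fun e i x => if i <? Dd then tadd D (tmul D x beta) (if i <? t e then Y e (t e - 1 - i) else 0) else x)).
  dgo; dnums.
Qed.

Lemma otop_spec : forall y t, 1 <= t -> y < beta ^ t -> otop (blk y) t = y * beta ^ Dd / beta ^ t.
Proof.
  intros y t Ht Hy. pose proof beta_pos as Hbp.
  assert (HDN : Dd <= N).
  { pose proof (Nat.mul_le_mono_r 1 r (L + 2 + (Dd + L)) r_pos). lia. }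
  assert (H : (Dd <= N -> otop (blk y) t = y * beta ^ Dd / beta ^ t) /\ (N <= Dd -> otop (blk y) t = y * beta ^ N / beta ^ t) /\ otop (blk y) t < beta ^ Dd).
  { unfold otop. apply (lp_inv (fun i x => (Dd <= i -> x = y * beta ^ Dd / beta ^ t) /\ (i <= Dd -> x = y * beta ^ i / beta ^ t) /\ x < beta ^ Dd)).
    - split; [lia|]. split.
      + intros _. cbn [Nat.pow]. rewrite Nat.mul_1_r. symmetry. now apply Nat.div_small.
      + pose proof (bpos Dd). lia.
    - intros i x Hi (H1 & H2 & H3).
      assert (HDK : beta ^ S Dd <= 2 ^ K) by (apply beta_pow_K; lia).
      pose proof pK2 as HpK. pose proof (Nat.pow_nonzero 2 K ltac:(lia)) as HKz. pose proof (Nat.pow_nonzero 2 K ltac:(lia)) as HK0.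
      assert (HDs : beta ^ S Dd = beta ^ Dd * beta) by (cbn; lia).
      destruct (Nat.ltb_spec i Dd) as [Hid|Hid].
      2: { split; [clear - H3 HDK HDs HpK Hbp HKz; nia|]. split; [auto|split; [lia|auto]]. }
      assert (Hxb : x * beta < 2 ^ K) by (clear - H3 HDK HDs Hbp; nia).
      set (d := if i <? t then blk y (t - 1 - i) else 0).
      assert (Hd : d < beta) by (unfold d; destruct (i <? t); [apply blk_lt|lia]).
      assert (Hbk : beta <= 2 ^ K) by (rewrite <- (Nat.pow_1_r beta); apply beta_pow_K; lia).
      rewrite tmul_small by (apply (bd_pw K); lia).
      rewrite tadd_small by (apply (bd_pw KK); [unfold KK; lia|lia]).
      assert (E : x * beta + d = y * beta ^ S i / beta ^ t).
      { rewrite H2 by lia. unfold d. destruct (Nat.ltb_spec i t) as [Hit|Hit].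
        - assert (E1 : y * beta ^ i / beta ^ t = y / beta ^ (t - i)).
          { replace t with (t - i + i) at 1 by lia. rewrite Nat.pow_add_r. apply Nat.Div0.div_mul_cancel_r. apply bpos. }
          assert (E2 : y * beta ^ S i / beta ^ t = y / beta ^ (t - 1 - i)).
          { replace t with (t - 1 - i + S i) at 1 by lia. rewrite (Nat.pow_add_r _ (t - 1 - i)). apply Nat.Div0.div_mul_cancel_r. apply bpos. }
          rewrite E1, E2. unfold blk. replace (t - i) with (t - 1 - i + 1) by lia.
          rewrite Nat.pow_add_r, Nat.pow_1_r, <- Nat.Div0.div_div.
          rewrite (Nat.div_mod_eq (y / beta ^ (t - 1 - i)) beta) at 3. lia.
        - assert (E1 : forall j, t <= j -> y * beta ^ j / beta ^ t = y * beta ^ (j - t)).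
          { intros j Hj. replace j with (j - t + t) at 1 by lia. rewrite Nat.pow_add_r, Nat.mul_assoc. apply Nat.div_mul. apply bpos. }
          rewrite !E1 by lia. replace (S i - t) with (S (i - t)) by lia. cbn [Nat.pow]. lia. }
      assert (Hlt : x * beta + d < beta ^ Dd).
      { rewrite E. apply Nat.Div0.div_lt_upper_bound.
        assert (beta ^ S i <= beta ^ Dd) by (apply Nat.pow_le_mono_r; lia).
        pose proof (bpos Dd) as Hz. clear - H Hz Hy. nia. }
      split; [lia|]. split; [|split; auto].
      intros H4. replace Dd with (S i) at 1 by lia. exact E. }
  apply H. exact HDN.
Qed.

Definition ou (Y : nat -> nat) : nat := B2D / tadd D (otop Y (olen Y)) 1.

Lemma d_ou : forall k Y, Do k Y -> Df D (lv (10 + (680 + (660 + k))) l1) (fun e => ou (Y e)).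
Proof.
  intros k Y HY. pose proof (d_olen k Y HY) as Ht.
  pose proof (d_otop (660 + k) Y (fun e => olen (Y e)) (Do_mono k (660 + k) Y ltac:(lia) HY) Ht) as H.
  unfold ou. dgo; dnums.
Qed.

(** The digits of [u * yc + u] from [complement_spec] before carrying; [oF] carries and cuts them
    off to get the digits of [f]. *)
Definition ocw (Y : nat -> nat) (u i : nat) : nat :=
  tadd D (tmul D u (beta - 1 - Y i)) (if i =? 0 then u else 0).
Definition oF (Y : nat -> nat) (u t i : nat) : nat := if i <? tadd D t 2 then ocb (ocw Y u) i else 0.

Lemma d_oF : forall k Y u t, Do k Y -> Df D (lv k l1) u -> Df D (lv k l1) t ->
  Do (720 + k) (fun e i => oF (Y e) (u e) (t e) i).
Proof.
  intros k Y u t HY Hu Ht.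
  assert (Hc : Do (20 + k) (fun e i => ocw (Y e) (u e) i)).
  { unfold Do, ocw. dgo; dnums. }
  apply d_ocb in Hc. remember (fun e j => ocb (ocw (Y e) (u e)) j) as ob.
  unfold Do, oF.
  apply (Df_ext D _ (fun e => if e 0 <? tadd D (t (sh 1 e)) 2 then ob (sh 1 e) (e 0) else 0)); [intros e _; now rewrite Heqob|].
  dgo; dnums.
Qed.

(** Horner's rule of [geom], applied to values at the [j]-th power of the root of unity. *)
Definition oG (fv t j : nat) : nat :=
  lp (fun i x => if i <? r then tadd D (tmul D fv x) (owr j (tmul D (tadd D Dd t) i)) mod Mo else x).

Lemma d_oG : forall k fv t, Do k fv -> Df D (lv k l1) t -> Do (720 + k) (fun e j => oG (fv e j) (t e) j).
Proof.
  intros k fv t Hf Ht.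
  apply (dlp1 (70 + k) (fun e j i x => if i <? r then tadd D (tmul D (fv e j) x) (owr j (tmul D (tadd D Dd (t e)) i)) mod Mo else x)).
  unfold owr. dgo; dnums.
Qed.

Definition oA (X : nat -> nat) (i : nat) : nat := tadd D (tmul D beta (X i)) (if i =? 0 then beta / 2 else 0).

(** The numerator of [division_spec] with the root of unity in place of [beta]. A product of many
    long numbers is not a single loop over blocks, but the values of its factors multiply
    pointwise. *)
Definition oV (X Y : nat -> nat) (u t j : nat) : nat :=
  tmul D (tmul D (oev L (oA X) j) u mod Mo) (oG (oev (L + 2) (oF Y u t) j) t j) mod Mo.

Lemma d_oV : forall k X Y u t, Do k X -> Do k Y -> Df D (lv k l1) u -> Df D (lv k l1) t ->
  Do (20 + (720 + (720 + (720 + k)))) (fun e j => oV (X e) (Y e) (u e) (t e) j).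
Proof.
  intros k X Y u t HX HY Hu Ht.
  assert (HA : Do (20 + k) (fun e i => oA (X e) i)).
  { unfold Do, oA. dgo; dnums. }
  pose proof (d_oev (20 + k) L (fun e i => oA (X e) i) CL HA) as H1.
  pose proof (d_oF k Y u t HY Hu Ht) as HF.
  pose proof (d_oev (720 + k) (L + 2) _ CL2 HF) as H2.
  pose proof (d_oG (720 + (720 + k)) _ t H2 ltac:(eapply Df_mono; [|exact Ht]; unfold lv; lia)) as H3.
  remember (fun e j => oev L (fun i => oA (X e) i) j) as oa.
  remember (fun e j => oG (oev (L + 2) (fun i => oF (Y e) (u e) (t e) i) j) (t e) j) as og.
  unfold Do, oV.
  apply (Df_ext D _ (fun e => tmul D (tmul D (oa (sh 1 e) (e 0)) (u (sh 1 e)) mod Mo) (og (sh 1 e) (e 0)) mod Mo));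
    [intros e _; now rewrite Heqoa, Heqog|].
  dgo.
Qed.

(** The inverse transform as in [dft_inverse]; [cinv] is the inverse of [N]. *)
Definition oC (V : nat -> nat) (k : nat) : nat :=
  tmul D cinv (osum N (fun j => tmul D (V j) (owr j (N - k)))) mod Mo.

Lemma d_oC : forall k V, Do k V -> Do (740 + k) (fun e i => oC (V e) i).
Proof.
  intros k V HV.
  assert (H : Do (50 + k) (fun e j => tmul D (V (sh 1 e) j) (owr j (N - e 0)))).
  { unfold Do, owr.
    change (Df D (lv (50 + k) l1) (fun e => tmul D (V (sh 2 e) (e 0)) (texp D (tmul D g0 (tmul D (e 0) (N - e 1) mod N))))).
    dgo. }
  apply (d_osum _ N _ CN) in H. unfold Do, oC.
  dgo.
Qed.

(** Dividing by [beta ^ (1 + (Dd + t) * r)] amounts to reading the block that many places higher.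
    The divisor 0 is the one of length 0 and gives quotient 0. *)
Definition oD (X Y : nat -> nat) (i : nat) : nat :=
  if olen Y =? 0 then 0 else
  ocb (oC (oV X Y (ou Y) (olen Y))) (tadd D (tadd D i 1) (tmul D (tadd D Dd (olen Y)) r)).

Definition cD : nat := 30 + (680 + (740 + (20 + (720 + (720 + (720 + (10 + (680 + 660)))))))).

Lemma d_oD : forall k X Y, Do k X -> Do k Y -> Do (cD + k) (fun e i => oD (X e) (Y e) i).
Proof.
  intros k X Y HX HY. set (k' := 10 + (680 + (660 + k))).
  pose proof (d_ou k Y HY) as Hu. fold k' in Hu.
  assert (Ht : Df D (lv k' l1) (fun e => olen (Y e))).
  { eapply Df_mono; [|apply d_olen; exact HY]. unfold lv, k'; lia. }
  pose proof (d_oV k' X Y (fun e => ou (Y e)) (fun e => olen (Y e)) (Do_mono k k' X ltac:(unfold k'; lia) HX)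
    (Do_mono k k' Y ltac:(unfold k'; lia) HY) Hu Ht) as HV.
  apply d_oC, d_ocb in HV.
  remember (fun e j => ocb (fun i => oC (fun j => oV (X e) (Y e) (ou (Y e)) (olen (Y e)) j) i) j) as ob.
  remember (fun e => olen (Y e)) as tt.
  apply (Do_mono (30 + (680 + (740 + (20 + (720 + (720 + (720 + k')))))))); [unfold cD, k'; lia|].
  unfold Do, oD.
  apply (Df_ext D _ (fun e => if tt (sh 1 e) =? 0 then 0 else
    ob (sh 1 e) (tadd D (tadd D (e 0) 1) (tmul D (tadd D Dd (tt (sh 1 e))) r)))); [intros e _; now rewrite Heqob, Heqtt|].
  clear Heqob Heqtt Hu HX HY. dgo; dnums.
Qed.

Lemma oev_le : forall c cf j, oev c cf j <= 2 ^ K.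
Proof.
  intros c cf j. unfold oev, osum. apply (lp_inv (fun _ x => x <= 2 ^ K)); [lia|].
  intros i x _ _. split; apply Mo_lt.
Qed.

Lemma oG_spec : forall fv t j, fv <= 2 ^ K -> j < N -> t <= L ->
  eqm Mo (oG fv t j) (geom fv ((2 ^ (g0 * j)) ^ (Dd + t)) r) /\ oG fv t j <= 2 ^ K.
Proof.
  intros fv t j Hf Hj Ht. pose proof (Nat.pow_nonzero 2 K ltac:(lia)) as HKz. pose proof pK2 as HpK.
  set (Z := (2 ^ (g0 * j)) ^ (Dd + t)).
  assert (Hrt : (Dd + t) * r <= N).
  { transitivity (r * (L + 2 + (Dd + L))); [rewrite Nat.mul_comm; apply Nat.mul_le_mono_l|]; lia. }
  assert (HrN : r <= N).
  { transitivity (r * (L + 2 + (Dd + L))); [|lia]. transitivity (r * 1); [lia|]. apply Nat.mul_le_mono_l. lia. }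
  assert (H : (r <= N -> eqm Mo (oG fv t j) (geom fv Z r)) /\ (N <= r -> eqm Mo (oG fv t j) (geom fv Z N)) /\ oG fv t j <= 2 ^ K).
  { unfold oG. apply (lp_inv (fun i x => (r <= i -> eqm Mo x (geom fv Z r)) /\ (i <= r -> eqm Mo x (geom fv Z i)) /\ x <= 2 ^ K)).
    - split; [|split]; [intros H; replace r with 0 by lia| |lia]; intros; reflexivity.
    - intros i x Hi (H1 & H2 & H3). destruct (Nat.ltb_spec i r) as [Hir|Hir].
      2: { split; [lia|]. split; [auto|split; [lia|auto]]. }
      split; [apply Mo_lt|].
      assert (Hti : (Dd + t) * i <= N).
      { transitivity ((Dd + t) * r); [apply Nat.mul_le_mono_l; lia|exact Hrt]. }
      pose proof N_K as HNK.
      assert (HDt : Dd + t <= N).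
      { transitivity ((Dd + t) * r); [|exact Hrt]. transitivity ((Dd + t) * 1); [lia|]. apply Nat.mul_le_mono_l. lia. }
      rewrite (tadd_small D Dd t) by (apply (bd_pw KK); [unfold KK; lia|lia]).
      rewrite (tmul_small D (Dd + t) i) by (apply (bd_pw KK); [unfold KK; lia|lia]).
      assert (Hfx : fv * x < 2 ^ (K + S K)) by (apply lt_mul_pw; [exact Hf|cbn; lia]).
      destruct (owr_val j ((Dd + t) * i) (NN_bd _ _ Hj Hti)) as [_ Ho].
      rewrite (tmul_small D fv x) by (apply (bd_pw (K + S K)); lia).
      assert (E : eqm Mo ((fv * x + owr j ((Dd + t) * i)) mod Mo) (geom fv Z (S i))).
      { unfold eqm. rewrite Nat.Div0.mod_mod. cbn [geom]. apply eqm_add.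
        - apply eqm_mul; [reflexivity|]. apply H2. lia.
        - unfold Z. rewrite <- !Nat.pow_mul_r. unfold eqm. rewrite (owr_eqm j ((Dd + t) * i) (NN_bd _ _ Hj Hti)). do 2 f_equal. ring. }
      rewrite tadd_small.
      + split; [|split]; [intros H4; replace r with (S i) by lia; exact E|intros _; exact E|apply Mo_lt].
      + apply (bd_pw (S (K + S K))); [lia|]. rewrite two_pow_S.
        pose proof (pw (K + K) (K + S K) ltac:(lia)). lia. }
  split; apply H. exact HrN.
Qed.

Lemma dig1_le : forall n c B, (forall i, i < n -> c i <= B) -> dig 1 n c <= n * B.
Proof.
  induction n as [|n IH]; intros c B H; [cbn; lia|]. cbn [dig]. rewrite Nat.pow_1_l, Nat.mul_1_r.
  specialize (IH c B ltac:(intros; apply H; lia)). specialize (H n ltac:(lia)). lia.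
Qed.

Lemma dig_first : forall B n u, dig B (S n) (fun i => if i =? 0 then u else 0) = u.
Proof.
  intros B n u. rewrite dig_cons. cbn [Nat.eqb].
  replace (dig B n (fun _ => 0)) with 0; [lia|]. induction n as [|n IH]; [reflexivity|]. cbn [dig]. lia.
Qed.

Lemma dig_full : forall n, dig beta n (fun _ => beta - 1) + 1 = beta ^ n.
Proof.
  intros n. pose proof beta_pos as Hb. clear - Hb. induction n as [|n IH]; [reflexivity|]. cbn [dig Nat.pow].
  assert (beta * beta ^ n = (beta - 1) * beta ^ n + beta ^ n) by nia. lia.
Qed.

Lemma oD_spec : forall x y i, x < beta ^ L -> y < beta ^ L -> i < L -> oD (blk x) (blk y) i = blk (x / y) i.
Proof.
  intros x y i Hx Hy Hi. unfold oD.
  destruct (olen_spec y Hy) as [[E0 ->]|[Ht Hyt]].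
  { rewrite E0. cbn [Nat.eqb]. cbn [Nat.div]. symmetry. apply (blk_high 0 0); [cbn|]; lia. }
  remember (olen (blk y)) as t eqn:Et.
  destruct (Nat.eqb_spec t 0) as [Z|_]; [lia|].
  pose proof beta_pos as Hbp. pose proof N_K as HNK. pose proof (Nat.pow_nonzero 2 K ltac:(lia)) as HKz. pose proof pK2 as HpK.
  set (u := beta ^ (2 * Dd) / (y * beta ^ Dd / beta ^ t + 1)).
  destruct (reciprocal_spec beta Dd t y ltac:(lia) ltac:(lia) ltac:(lia) (proj1 Hyt) (proj2 Hyt)) as (f & Ef & Hf & Hu & Hyl).
  fold u in Ef, Hu.
  assert (HDK : forall k, k <= Dd + Dd + 2 * r + 8 -> beta ^ k < bd D).
  { intros k Hk. pose proof (beta_pow_K k Hk). apply (bd_pw KK); [unfold KK; lia|lia]. }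
  assert (Eu : ou (blk y) = u).
  { unfold ou. rewrite <- Et, otop_spec by (try apply Hyt; lia). rewrite tadd_small; [reflexivity|].
    specialize (HDK Dd ltac:(lia)). lia. }
  rewrite Eu.
  assert (Hu1 : u <= beta ^ (Dd + 1)) by lia.
  assert (HuK : u <= 2 ^ K) by (pose proof (beta_pow_K (Dd + 1) ltac:(lia)); lia).
  assert (Hocw : forall j, ocw (blk y) u j = u * (beta - 1 - blk y j) + (if j =? 0 then u else 0) /\ ocw (blk y) u j <= 2 ^ K).
  { intros j. assert (H1 : u * (beta - 1 - blk y j) + u <= 2 ^ K).
    { transitivity (beta ^ (Dd + 1) * beta ^ 1).
      - rewrite Nat.pow_1_r. transitivity (u * beta); [|now apply Nat.mul_le_mono_r].
        assert (u * (beta - 1 - blk y j) <= u * (beta - 1)) by (apply Nat.mul_le_mono_l; lia).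
        assert (u * beta = u * (beta - 1) + u) by (clear - Hbp; nia). lia.
      - rewrite <- Nat.pow_add_r. apply beta_pow_K. lia. }
    unfold ocw. rewrite tmul_small by (apply (bd_pw KK); [unfold KK; lia|lia]).
    rewrite tadd_small; [split; [reflexivity|]|apply (bd_pw KK); [unfold KK; lia|]]; destruct (j =? 0); lia. }
  set (yc := dig beta (L + 2) (fun j => beta - 1 - blk y j)).
  assert (Hyc : y + yc + 1 = beta ^ (L + 2)).
  { rewrite <- dig_full. unfold yc. rewrite <- (Nat.mod_small y (beta ^ (L + 2))) at 1.
    - rewrite <- dig_blk, dig_add. f_equal. apply dig_ext. intros j _. pose proof (blk_lt y j). lia.
    - eapply Nat.lt_le_trans; [exact Hy|]. apply Nat.pow_le_mono_r; lia. }
  assert (Hw : dig beta (L + 2) (ocw (blk y) u) = u * yc + u).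
  { unfold yc. rewrite dig_scale. replace (L + 2) with (S (L + 1)) by lia.
    transitivity (dig beta (S (L + 1)) (fun j => u * (beta - 1 - blk y j)) + dig beta (S (L + 1)) (fun j => if j =? 0 then u else 0));
      [|now rewrite dig_first].
    rewrite dig_add. apply dig_ext. intros j _. apply Hocw. }
  pose proof (complement_spec beta Dd t y ltac:(lia) ltac:(lia) ltac:(lia) (proj1 Hyt) (proj2 Hyt) f (L + 2) yc Ef Hf ltac:(lia) Hyc) as Hcf. fold u in Hcf.
  set (F := oF (blk y) u t).
  assert (HF : forall j, F j = if j <? t + 2 then blk (u * yc + u) j else 0).
  { intros j. unfold F, oF. rewrite (tadd_small D t 2) by (apply (bd_pw KK); [unfold KK; lia|pose proof LN; lia]).
    destruct (Nat.ltb_spec j (t + 2)); [|reflexivity]. rewrite <- Hw.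
    apply ocb_spec; [lia|apply LN|]. intros j' _. apply Hocw. }
  assert (HFb : forall j, F j < beta).
  { intros j. rewrite HF. destruct (j <? t + 2); [apply blk_lt|lia]. }
  assert (HFd : dig beta (L + 2) F = f).
  { rewrite (dig_zero_tail beta (t + 2) (L + 2) F); [|lia|].
    - rewrite <- Hcf, <- dig_blk. apply dig_ext. intros j Hj. rewrite HF. destruct (Nat.ltb_spec j (t + 2)); [reflexivity|lia].
    - intros j Hj. rewrite HF. destruct (Nat.ltb_spec j (t + 2)); [lia|reflexivity]. }
  set (A := oA (blk x)).
  assert (Hb2K : beta * beta <= 2 ^ K) by (rewrite <- Nat.pow_2_r; apply beta_pow_K; lia).
  assert (HA : forall j, A j = beta * blk x j + (if j =? 0 then beta / 2 else 0) /\ A j <= beta * beta).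
  { intros j. assert (H1 : beta * blk x j + beta / 2 <= beta * beta).
    { pose proof (blk_lt x j). assert (beta / 2 <= beta) by (apply Nat.Div0.div_le_upper_bound; lia). clear - H H0 Hbp. nia. }
    unfold A, oA. rewrite tmul_small by (apply (bd_pw KK); [unfold KK; lia|lia]).
    rewrite tadd_small; [split; [reflexivity|]|apply (bd_pw KK); [unfold KK; lia|]]; destruct (j =? 0); lia. }
  assert (HAd : dig beta L A = beta * x + beta / 2).
  { rewrite <- (Nat.mod_small x (beta ^ L)) at 1 by exact Hx. rewrite <- dig_blk, dig_scale.
    transitivity (dig beta L (fun j => beta * blk x j) + dig beta L (fun j => if j =? 0 then beta / 2 else 0)).
    - rewrite dig_add. apply dig_ext. intros j _. apply HA.
    - f_equal. replace L with (S (L - 1)) by lia. apply dig_first. }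
  set (n' := L + (r * ((L + 2) + (Dd + t)) + 1)).
  assert (Hn' : n' <= N).
  { unfold n'. pose proof (Nat.mul_le_mono_l (L + 2 + (Dd + t)) (L + 2 + (Dd + L)) r ltac:(lia)). lia. }
  set (Pp := fun X => dig X L A * (u * geom (dig X (L + 2) F) (X ^ (Dd + t)) r)).
  assert (HP : poly Pp n').
  { unfold Pp, n'. apply poly_mul; [apply poly_dig|]. apply poly_scale. apply poly_geom. apply poly_dig. }
  destruct HP as [c0 Hc0].
  set (c := fun j => if j <? n' then c0 j else 0).
  assert (Hc : forall X, Pp X = dig X n' c).
  { intros X. rewrite Hc0. apply dig_ext. intros j Hj. unfold c. destruct (Nat.ltb_spec j n'); [reflexivity|lia]. }
  (* The value at 1 bounds all coefficients; as it is at most [2 ^ K], they survive the reduction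
     modulo [2 ^ K + 1]. *)
  assert (HP1 : Pp 1 <= 2 ^ K).
  { unfold Pp. rewrite Nat.pow_1_l.
    assert (B1 : dig 1 L A <= beta * (beta * beta)).
    { transitivity (L * (beta * beta)); [apply dig1_le; intros; apply HA|apply Nat.mul_le_mono_r; lia]. }
    assert (B2 : dig 1 (L + 2) F <= beta * beta).
    { transitivity ((L + 2) * beta); [apply dig1_le; intros j _; specialize (HFb j); lia|apply Nat.mul_le_mono_r; lia]. }
    assert (B3 : geom (dig 1 (L + 2) F) 1 r <= beta * (beta * beta) ^ r).
    { etransitivity; [apply (geom_le _ (beta * beta) r B2)|apply Nat.mul_le_mono_r; lia]. clear - Hbp. nia. }
    transitivity (beta * (beta * beta) * (beta ^ (Dd + 1) * (beta * (beta * beta) ^ r))).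
    - apply Nat.mul_le_mono; [exact B1|]. apply Nat.mul_le_mono; [exact Hu1|exact B3].
    - rewrite <- (Nat.pow_2_r beta), <- Nat.pow_mul_r.
      replace (beta * beta ^ 2 * (beta ^ (Dd + 1) * (beta * beta ^ (2 * r)))) with (beta ^ (3 + (Dd + 1 + (1 + 2 * r)))).
      + apply beta_pow_K. lia.
      + rewrite !Nat.pow_add_r, Nat.pow_1_r. cbn [Nat.pow]. ring. }
  assert (HcM : forall j, c j < Mo).
  { intros j. unfold c. destruct (Nat.ltb_spec j n') as [Hj|Hj]; [|unfold Mo; lia].
    pose proof (coef_le n' c0 j Hj) as H1. rewrite <- Hc0 in H1. unfold Mo. lia. }
  set (V := oV (blk x) (blk y) u t).
  assert (HV : forall j, j < N -> eqm Mo (V j) (dig (2 ^ (g0 * j)) n' c) /\ V j <= 2 ^ K).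
  { intros j Hj. unfold V, oV. split; [|apply Mo_lt].
    fold A. fold F.
    pose proof (oev_le L A j) as L1. pose proof (oev_le (L + 2) F j) as L2.
    destruct (oG_spec (oev (L + 2) F j) t j L2 Hj ltac:(lia)) as [G1 G2].
    assert (M1 : oev L A j * u < 2 ^ (K + S K)) by (apply lt_mul_pw; [exact L1|cbn; lia]).
    rewrite (tmul_small D (oev L A j) u) by (apply (bd_pw (K + S K)); lia).
    assert (M2 : (oev L A j * u) mod Mo * oG (oev (L + 2) F j) t j < 2 ^ (K + S K)) by (apply lt_mul_pw; [apply Mo_lt|cbn; lia]).
    rewrite tmul_small by (apply (bd_pw (K + S K)); lia).
    rewrite <- Hc. unfold Pp, eqm. rewrite Nat.Div0.mod_mod. rewrite Nat.mul_assoc.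
    apply eqm_mul.
    - unfold eqm. rewrite Nat.Div0.mod_mod. apply eqm_mul; [|reflexivity].
      apply oev_spec; [pose proof LN; lia|exact Hj|]. intros j' _. destruct (HA j') as [_ H1].
      eapply Nat.le_lt_trans; [exact H1|]. eapply Nat.le_lt_trans; [exact Hb2K|]. apply Nat.pow_lt_mono_r; pose proof K_pos; lia.
    - unfold eqm. rewrite G1. apply geom_eqm; [|reflexivity].
      apply oev_spec; [apply LN|exact Hj|]. intros j' _. specialize (HFb j').
      eapply Nat.lt_le_trans; [exact HFb|]. transitivity (2 ^ K); [|apply pw; lia]. clear - Hb2K Hbp. nia. }
  assert (HC : forall k, k < N -> oC V k = c k).
  { intros k Hk. unfold oC.
    assert (W : forall j, j < N -> tmul D (V j) (owr j (N - k)) = V j * 2 ^ (g0 * ((j * (N - k)) mod N)) /\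
       V j * 2 ^ (g0 * ((j * (N - k)) mod N)) < 2 ^ (4 * K + 16)).
    { intros j Hj. destruct (HV j Hj) as [_ HVj]. destruct (owr_val j (N - k) (NN_bd j (N - k) Hj ltac:(lia))) as [O1 O2].
      rewrite <- O1. assert (M1 : V j * owr j (N - k) < 2 ^ (K + S (K + K))).
      { apply lt_mul_pw; [exact HVj|]. rewrite two_pow_S. pose proof (Nat.pow_nonzero 2 (K + K)). lia. }
      split; [apply tmul_small; apply (bd_pw (K + S (K + K))); lia|].
      pose proof (pw (K + S (K + K)) (4 * K + 16) ltac:(lia)). lia. }
    rewrite osum_spec; [|lia|intros j Hj; destruct (W j Hj) as [-> H1]; exact H1].
    rewrite (dig_ext 1 N _ (fun j => V j * 2 ^ (g0 * ((j * (N - k)) mod N)))) by (intros j Hj; apply W; exact Hj).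
    rewrite tmul_small.
    2: { apply (bd_pw (K + K + S K)); [lia|]. apply lt_mul_pw; [unfold cinv; apply pw; lia|].
         rewrite two_pow_S. pose proof (Mo_lt (dig 1 N (fun j => V j * 2 ^ (g0 * ((j * (N - k)) mod N))))). lia. }
    pose proof (dft_inverse K u0 g0 H_g n' c k V) as DI. rewrite <- H_N2 in DI.
    unfold cinv, Mo. rewrite DI; auto.
    - unfold c. destruct (k <? n'); reflexivity.
    - pose proof u0_K. lia.
    - intros j Hj. apply HV. exact Hj. }
  assert (Hkk : i + 1 + (Dd + t) * r < N).
  { pose proof (Nat.mul_le_mono_r (Dd + t) (L + 2 + (Dd + L)) r ltac:(lia)) as H1.
    lia. }
  assert (HNb : forall z, z <= N -> z < bd D) by (intros z Hz; apply (bd_pw KK); [unfold KK; lia|lia]).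
  assert (HDt : Dd + t <= N).
  { pose proof (Nat.mul_le_mono_r 1 r (L + 2 + (Dd + L)) r_pos). lia. }
  rewrite (tadd_small D Dd t), (tmul_small D (Dd + t) r), (tadd_small D i 1), (tadd_small D (i + 1)) by (apply HNb; lia).
  fold V. rewrite (ocb_spec (oC V) _ N Hkk (le_n N)).
  2: { intros j Hj. rewrite HC by exact Hj. specialize (HcM j). unfold Mo in HcM. lia. }
  rewrite (dig_ext beta N (oC V) c HC).
  rewrite (dig_zero_tail beta n' N c Hn') by (intros j Hj; unfold c; destruct (Nat.ltb_spec j n'); [lia|reflexivity]).
  rewrite <- Hc. unfold Pp. rewrite HFd, HAd.
  pose proof (division_spec beta Dd t y ltac:(lia) ltac:(lia) ltac:(lia) (proj1 Hyt) (proj2 Hyt) f x r Ef Hf) as DS. fold u in DS.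
  unfold blk at 1. replace (i + 1 + (Dd + t) * r) with ((1 + (Dd + t) * r) + i) by lia.
  rewrite (Nat.pow_add_r beta (1 + (Dd + t) * r) i), <- Nat.Div0.div_div. rewrite Nat.mul_assoc, DS; [reflexivity| |].
  - transitivity (beta ^ (L + 1)); [|apply Nat.pow_le_mono_r; lia]. rewrite Nat.pow_add_r, Nat.pow_1_r.
    clear - Hx Hbp. nia.
  - exists (2 ^ (b - 1)). unfold beta. replace b with (S (b - 1)) at 1 by lia. reflexivity.
Qed.

Hypothesis H_n : b * L < beta.
Hypothesis Cn : Df D l1 (fun _ => b * L).

Local Notation nn := (b * L).

Lemma pow_nn : beta ^ L = 2 ^ nn.
Proof. apply beta_pow. Qed.

(** Second instance of the symbolic run: the values are long words, definable block by block. *)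
Definition Dv (k : nat) (f : env -> nat) : Prop :=
  (forall e, bde (bd D) e -> f e < 2 ^ nn) /\ Do k (fun e i => blk (f e) i).

Lemma Dv_mono : forall k k' f, k <= k' -> Dv k f -> Dv k' f.
Proof. intros k k' f H [H1 H2]. split; auto. eapply Do_mono; eauto. Qed.

Lemma Dv_intro : forall k f G, (forall e, bde (bd D) e -> f e < 2 ^ nn) -> Do k G ->
  (forall e i, bde (bd D) e -> i < L -> G e i = blk (f e) i) -> Dv (3 + k) f.
Proof.
  intros k f G Hf HG E. split; auto.
  apply (Df_ext D _ (fun e => if e 0 <? L then G (sh 1 e) (e 0) else 0)).
  - intros e He. destruct (Nat.ltb_spec (e 0) L) as [H|H].
    + apply E; auto. now apply bde_sh.
    + symmetry. apply (blk_high _ L); auto. rewrite pow_nn. apply Hf. now apply bde_sh.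
  - dgo; dnums.
Qed.

Lemma blk_of_dig : forall d c i, (forall p, d p < beta) -> i < c -> blk (dig beta c d) i = d i.
Proof. intros d c i Hd Hi. apply (dig_digit b c d i b); auto. Qed.

Lemma blk_small : forall v i, v < beta -> blk v i = if i =? 0 then v else 0.
Proof.
  intros v i Hv. destruct (Nat.eqb_spec i 0) as [->|H].
  - unfold blk. cbn [Nat.pow]. rewrite Nat.div_1_r. now apply Nat.mod_small.
  - apply (blk_high v 1); [now rewrite Nat.pow_1_r|lia].
Qed.

Lemma blk_not : forall x i, x < beta ^ L -> i < L -> blk (beta ^ L - 1 - x) i = beta - 1 - blk x i.
Proof.
  intros x i Hx Hi. pose proof beta_pos as Hbp.
  rewrite <- (blk_of_dig (fun i => beta - 1 - blk x i) L i); [|intros p; lia|exact Hi].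
  f_equal. pose proof (dig_full L) as E1.
  pose proof (dig_sub beta L (fun _ => beta - 1) (blk x)) as E2.
  rewrite dig_blk, Nat.mod_small in E2 by exact Hx. cbv beta in E2. rewrite <- E2.
  - lia.
  - intros p _. pose proof (blk_lt x p). lia.
Qed.

Lemma blk_testbit : forall x i j, Nat.testbit (blk x i) j = (j <? b) && Nat.testbit x (j + b * i).
Proof.
  intros x i j. unfold blk. rewrite beta_pow. unfold beta. rewrite <- Nat.shiftr_div_pow2.
  destruct (Nat.ltb_spec j b).
  - rewrite Nat.mod_pow2_bits_low by auto. apply Nat.shiftr_spec'.
  - now rewrite Nat.mod_pow2_bits_high by auto.
Qed.

Lemma blk_land : forall x y i, blk (Nat.land x y) i = Nat.land (blk x i) (blk y i).
Proof.
  intros x y i. apply Nat.bits_inj. intros j. rewrite Nat.land_spec, !blk_testbit, Nat.land_spec.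
  destruct (j <? b); [reflexivity|reflexivity].
Qed.

Lemma blk_pow2 : forall x i, blk (2 ^ x) i = if i =? x / b then 2 ^ (x mod b) else 0.
Proof.
  intros x i. pose proof (Nat.div_mod_eq x b) as E. pose proof (Nat.mod_upper_bound x b ltac:(lia)) as Hm.
  apply Nat.bits_inj. intros j. rewrite blk_testbit.
  destruct (Nat.eqb_spec i (x / b)) as [->|Hne].
  - rewrite !Nat.pow2_bits_eqb. destruct (Nat.ltb_spec j b); cbn [andb].
    + apply eq_true_iff_eq. rewrite !Nat.eqb_eq. lia.
    + symmetry. apply Nat.eqb_neq. lia.
  - rewrite Nat.bits_0, Nat.pow2_bits_eqb. destruct (Nat.ltb_spec j b); [|reflexivity]. cbn [andb].
    apply Nat.eqb_neq. intros H1. apply Hne.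
    apply (Nat.div_unique x b i j); lia.
Qed.

Definition conv (a c : nat -> nat) (k : nat) : nat := dig 1 (S k) (fun i => a i * c (k - i)).

Lemma conv_S : forall a c k, conv a c (S k) = a 0 * c (S k) + conv (fun i => a (S i)) c k.
Proof.
  intros a c k. unfold conv. rewrite dig_cons, Nat.mul_1_l. f_equal.
Qed.

(** [R] collects what lies beyond position [n], the part that multiplication of machine words
    discards. *)
Lemma conv_spec : forall X n a c, exists R, dig X n a * dig X n c = dig X n (conv a c) + R * X ^ n.
Proof.
  intros X n. induction n as [|n IH]; intros a c; [exists 0; reflexivity|].
  destruct (IH (fun i => a (S i)) c) as [R HR].
  exists (R + c n * dig X n (fun i => a (S i))).
  assert (E : dig X (S n) (conv a c) = a 0 * dig X (S n) c + X * dig X n (conv (fun i => a (S i)) c)).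
  { rewrite !dig_cons. unfold conv at 1. cbn [dig]. rewrite !Nat.sub_0_r.
    rewrite (dig_ext X n (fun i => conv a c (S i)) (fun i => a 0 * c (S i) + conv (fun i => a (S i)) c i))
      by (intros i _; apply conv_S).
    rewrite <- dig_add, <- dig_scale. cbn [Nat.pow]. ring. }
  rewrite E, (dig_cons X n a), Nat.mul_add_distr_r.
  replace (X * dig X n (fun i => a (S i)) * dig X (S n) c) with
    (X * (dig X n (fun i => a (S i)) * dig X n c) + c n * dig X n (fun i => a (S i)) * (X * X ^ n)) by (cbn [dig]; ring).
  rewrite HR. cbn [Nat.pow]. ring.
Qed.

Definition omul (X Y : nat -> nat) (k : nat) : nat := osum L (fun i => if k <? i then 0 else tmul D (X i) (Y (k - i))).

Lemma d_omul : forall k X Y, Do k X -> Do k Y -> Do (700 + k) (fun e j => omul (X e) (Y e) j).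
Proof.
  intros k X Y HX HY.
  assert (H : Do (30 + k) (fun e i => if e 0 <? i then 0 else tmul D (X (sh 1 e) i) (Y (sh 1 e) (e 0 - i)))).
  { unfold Do.
    change (Df D (lv (30 + k) l1) (fun e => if e 1 <? e 0 then 0 else tmul D (X (sh 2 e) (e 0)) (Y (sh 2 e) (e 1 - e 0)))).
    dgo; dnums. }
  exact (d_osum (30 + k) L _ CL H).
Qed.

Lemma omul_spec : forall x y k, k < L -> omul (blk x) (blk y) k = conv (blk x) (blk y) k /\ conv (blk x) (blk y) k <= 2 ^ K.
Proof.
  intros x y k Hk. unfold omul. pose proof beta_pos as Hbp.
  assert (Hxy : forall i j, blk x i * blk y j <= beta * beta).
  { intros i j. apply Nat.mul_le_mono; apply Nat.lt_le_incl, blk_lt. }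
  assert (Hb3 : beta ^ 3 <= 2 ^ K) by (apply beta_pow_K; lia).
  assert (Hb2 : beta * beta <= 2 ^ K).
  { transitivity (beta ^ 2); [rewrite Nat.pow_2_r; lia|apply beta_pow_K; lia]. }
  assert (Hc : conv (blk x) (blk y) k <= 2 ^ K).
  { unfold conv. transitivity (S k * (beta * beta)); [apply dig1_le; intros; apply Hxy|].
    transitivity (beta * (beta * beta)); [apply Nat.mul_le_mono_r; lia|]. cbn [Nat.pow] in Hb3. lia. }
  split; [|exact Hc]. pose proof (Nat.pow_nonzero 2 K ltac:(lia)) as HKz. pose proof pK2 as HpK.
  assert (Ht : forall i j, tmul D (blk x i) (blk y j) = blk x i * blk y j).
  { intros i j. apply tmul_small. specialize (Hxy i j). apply (bd_pw KK); [unfold KK; lia|lia]. }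
  rewrite osum_spec.
  - rewrite (dig_zero_tail 1 (S k) L); [|lia|].
    + rewrite (dig_ext 1 (S k) _ (fun i => blk x i * blk y (k - i))).
      * apply Nat.mod_small. fold (conv (blk x) (blk y) k). unfold Mo. lia.
      * intros i Hi. destruct (Nat.ltb_spec k i); [lia|apply Ht].
    + intros i Hi. destruct (Nat.ltb_spec k i); [reflexivity|lia].
  - pose proof LN. lia.
  - intros i _. pose proof (pw KK (4 * K + 16) ltac:(unfold KK; lia)).
    destruct (k <? i); [lia|]. rewrite Ht. specialize (Hxy i (k - i)). lia.
Qed.

(** An exponent below [nn] fits into block 0, and the power has a single nonzero block; any larger
    exponent saturates to the maximal word, all of whose blocks are [beta - 1]. *)
Definition oexp (X : nat -> nat) (i : nat) : nat :=
  if ocmp X (fun i => if i =? 0 then nn else 0) =? 1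
  then (if i =? X 0 / b then texp D (X 0 mod b) else 0) else beta - 1.

Lemma d_oexp : forall k X, Do k X -> Do (690 + k) (fun e i => oexp (X e) i).
Proof.
  intros k X HX.
  assert (H0 : Do (10 + k) (fun (e : env) i => if i =? 0 then nn else 0)) by (unfold Do; dgo; dnums).
  pose proof (d_ocmp (10 + k) X _ (Do_mono k (10 + k) X ltac:(lia) HX) H0) as H.
  remember (fun e => ocmp (X e) (fun i => if i =? 0 then nn else 0)) as c.
  unfold Do, oexp.
  apply (Df_ext D _ (fun e => if c (sh 1 e) =? 1 then (if e 0 =? X (sh 1 e) 0 / b then texp D (X (sh 1 e) 0 mod b) else 0) else beta - 1));
    [intros e _; now rewrite Heqc|].
  clear Heqc H0. dgo; dnums.
Qed.

Definition cA : nat := cD + 100.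

Lemma Dv_ifeq : forall k f g h h', Dv k f -> Dv k g -> Dv k h -> Dv k h' ->
  Dv (cA + k) (fun e => if f e =? g e then h e else h' e).
Proof.
  intros k f g h h' [Bf Df0] [Bg Dg] [Bh Dh] [Bh' Dh'].
  pose proof (d_ocmp k _ _ Df0 Dg) as Hc.
  remember (fun e => ocmp (fun i => blk (f e) i) (fun i => blk (g e) i)) as c.
  remember (fun e i => blk (h e) i) as H1. remember (fun e i => blk (h' e) i) as H2.
  apply (Dv_mono (3 + (20 + (660 + k)))); [unfold cA, cD; lia|].
  apply (Dv_intro _ _ (fun e i => if c e =? 0 then H1 e i else H2 e i)).
  - intros e He. destruct (f e =? g e); auto.
  - clear HeqH1 HeqH2 Heqc Df0 Dg. unfold Do. dgo; dnums.
  - intros e i He Hi. rewrite Heqc, HeqH1, HeqH2.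
    change (fun i => blk (f e) i) with (blk (f e)). change (fun i => blk (g e) i) with (blk (g e)).
    rewrite ocmp_spec by (rewrite pow_nn; auto). unfold cmp.
    destruct (Nat.eqb_spec (f e) (g e)) as [E|E].
    + rewrite E, Nat.ltb_irrefl. reflexivity.
    + destruct (Nat.ltb_spec (f e) (g e)); [reflexivity|]. destruct (Nat.ltb_spec (g e) (f e)); [reflexivity|lia].
Qed.

Lemma Dv_not : forall k f, Dv k f -> Dv (13 + k) (fun e => Nat.lnot (f e) nn).
Proof.
  intros k f [Bf Hf]. remember (fun e i => blk (f e) i) as X.
  apply (Dv_intro (10 + k) _ (fun e i => beta - 1 - X e i)).
  - intros e He. rewrite lnot_low by auto. specialize (Bf e He). lia.
  - clear HeqX. unfold Do. dgo; dnums.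
  - intros e i He Hi. rewrite HeqX, lnot_low by auto. rewrite <- pow_nn. symmetry. apply blk_not; auto.
    rewrite pow_nn. auto.
Qed.

Lemma Dv_and : forall k f g, Dv k f -> Dv k g -> Dv (13 + k) (fun e => Nat.land (f e) (g e)).
Proof.
  intros k f g [Bf Hf] [Bg Hg]. remember (fun e i => blk (f e) i) as X. remember (fun e i => blk (g e) i) as Y.
  apply (Dv_intro (10 + k) _ (fun e i => Nat.land (X e i) (Y e i))).
  - intros e He. eapply Nat.le_lt_trans; [apply land_le_l|auto].
  - clear HeqX HeqY. unfold Do. dgo; dnums.
  - intros e i He Hi. rewrite HeqX, HeqY. symmetry. apply blk_land.
Qed.

Lemma Dv_const_small : forall k v, Df D (lv k l1) (fun _ => v) -> v < beta -> v < 2 ^ nn -> Dv (13 + k) (fun _ => v).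
Proof.
  intros k v Hv Hb Hn. apply (Dv_intro (10 + k) _ (fun _ i => if i =? 0 then v else 0)); auto.
  - unfold Do. dgo; dnums.
  - intros e i _ _. symmetry. now apply blk_small.
Qed.

Lemma Dv_arith : forall o k f g, Dv k f -> Dv k g -> Dv (cA + k) (fun e => arith_eval nn o (f e) (g e)).
Proof.
  intros o k f g HF HG. pose proof beta_pos as Hbp.
  assert (Hnn : 0 < nn) by (apply Nat.mul_pos_pos; lia).
  assert (HnL : nn < 2 ^ nn) by (apply Nat.pow_gt_lin_r; lia).
  assert (Hlt : forall e, bde (bd D) e -> arith_eval nn o (f e) (g e) < 2 ^ nn).
  { intros e He. apply arith_lt; [exact Hnn|apply HF; auto|apply HG; auto]. }
  assert (Hsm : forall v, v < beta -> Df D (lv 4 l1) (fun _ => v) -> v < 2 ^ nn -> Dv (cA + k) (fun _ => v)).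
  { intros v Hv Hd Hn. apply (Dv_mono (13 + 4)); [unfold cA, cD; lia|]. now apply Dv_const_small. }
  pose proof HF as [Bf Hf]. pose proof HG as [Bg Hg].
  remember (fun e i => blk (f e) i) as X eqn:EX. remember (fun e i => blk (g e) i) as Y eqn:EY.
  assert (EXe : forall e, X e = blk (f e)) by (intros e; rewrite EX; reflexivity).
  assert (EYe : forall e, Y e = blk (g e)) by (intros e; rewrite EY; reflexivity).
  assert (Bf' : forall e, bde (bd D) e -> f e < beta ^ L) by (intros e He; rewrite pow_nn; auto).
  assert (Bg' : forall e, bde (bd D) e -> g e < beta ^ L) by (intros e He; rewrite pow_nn; auto).
  clear EX EY.
  assert (Intro : forall k' G, 3 + k' <= cA + k -> Do k' G ->
    (forall e i, bde (bd D) e -> i < L -> G e i = blk (arith_eval nn o (f e) (g e)) i) ->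
    Dv (cA + k) (fun e => arith_eval nn o (f e) (g e))).
  { intros k' G Hk HG' HE. apply (Dv_mono (3 + k')); [exact Hk|]. now apply (Dv_intro k' _ G). }
  destruct o; cbn [arith_eval] in *.
  - apply Hsm; [lia|dgo; dnums|lia].
  - apply Hsm; [lia|dgo; dnums|lia].
  - apply Hsm; [exact H_n|dgo|exact HnL].
  - apply (Intro 4 (fun _ _ => beta - 1)); [unfold cA, cD; lia|unfold Do; dgo; dnums|].
    intros e i He Hi. rewrite <- pow_nn, <- (Nat.sub_0_r (beta ^ L - 1)), blk_not; auto.
    + rewrite (blk_high 0 0); [lia|cbn; lia|lia].
    + pose proof (bpos L). lia.
  - apply (Intro (690 + k) (fun e i => oexp (X e) i)); [unfold cA, cD; lia|now apply d_oexp|].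
    intros e i He Hi. unfold oexp. rewrite EXe.
    assert (E : ocmp (blk (f e)) (fun i => if i =? 0 then nn else 0) = cmp (f e) nn).
    { rewrite <- ocmp_spec; [|auto|rewrite pow_nn; lia]. f_equal. apply functional_extensionality. intros j.
      symmetry. now apply blk_small. }
    rewrite E. unfold cmp. destruct (Nat.ltb_spec (f e) nn) as [H|H].
    + cbn [Nat.eqb]. rewrite (blk_small (f e)) by lia. cbn [Nat.eqb].
      rewrite Nat.min_l by (pose proof (Nat.pow_lt_mono_r 2 (f e) nn ltac:(lia) H); lia).
      rewrite blk_pow2. destruct (i =? f e / b); [|reflexivity]. apply texp_small.
      pose proof (Nat.mod_upper_bound (f e) b ltac:(lia)).
      apply (bd_pw b); [|apply Nat.pow_lt_mono_r; lia].
      pose proof (Nat.mul_le_mono_l 1 (Dd + Dd + 2 * r + 8) b ltac:(lia)). lia.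
    + replace ((if nn <? f e then 2 else 0) =? 1) with false by (destruct (nn <? f e); reflexivity).
      rewrite Nat.min_r.
      * rewrite <- pow_nn, <- (Nat.sub_0_r (beta ^ L - 1)), blk_not; auto.
        -- rewrite (blk_high 0 0); [lia|cbn; lia|lia].
        -- pose proof (bpos L). lia.
      * pose proof (pw nn (f e) H). lia.
  - apply (Dv_mono (13 + k)); [unfold cA, cD; lia|]. now apply Dv_not.
  - assert (Hc : Do (10 + k) (fun e i => tadd D (X e i) (Y e i))) by (unfold Do; dgo).
    apply d_ocb in Hc. eapply (Intro _ _); [|exact Hc|]; [unfold cA, cD; lia|].
    intros e i He Hi. rewrite <- pow_nn, blk_mod by auto. cbv beta.
    assert (Hb2 : beta ^ 2 <= 2 ^ K) by (apply beta_pow_K; lia).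
    assert (Hxy : forall j, X e j + Y e j <= 2 ^ K).
    { intros j. rewrite EXe, EYe. pose proof (blk_lt (f e) j). pose proof (blk_lt (g e) j). cbn [Nat.pow] in Hb2. clear - Hb2 H H0 Hbp. nia. }
    assert (Hta : forall j, tadd D (X e j) (Y e j) = X e j + Y e j).
    { intros j. apply tadd_small. specialize (Hxy j). pose proof pK2. pose proof (Nat.pow_nonzero 2 K ltac:(lia)).
      apply (bd_pw KK); [unfold KK; lia|lia]. }
    rewrite (ocb_spec _ i L Hi); [|pose proof LN; lia|intros j _; rewrite Hta; apply Hxy].
    f_equal. rewrite (dig_ext beta L _ (fun j => X e j + Y e j)) by (intros j _; apply Hta).
    rewrite <- dig_add, EXe, EYe, !dig_blk, !Nat.mod_small; auto.
  - pose proof (d_ocb _ _ (d_omul k X Y Hf Hg)) as Hc. eapply (Intro _ _); [|exact Hc|]; [unfold cA, cD; lia|].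
    intros e i He Hi. cbv beta. rewrite EXe, EYe.
    change (fun j => omul (blk (f e)) (blk (g e)) j) with (omul (blk (f e)) (blk (g e))).
    rewrite (ocb_spec _ i L Hi); [|pose proof LN; lia|].
    2: { intros j Hj. destruct (omul_spec (f e) (g e) j Hj) as [-> H]. exact H. }
    rewrite (dig_ext beta L _ (conv (blk (f e)) (blk (g e)))) by (intros j Hj; apply omul_spec; exact Hj).
    rewrite <- pow_nn. destruct (conv_spec beta L (blk (f e)) (blk (g e))) as [R HR].
    rewrite !dig_blk, !Nat.mod_small in HR by auto. rewrite HR, Nat.Div0.mod_add. symmetry. now apply blk_mod.
  - apply (Intro (cD + k) (fun e i => oD (X e) (Y e) i)); [unfold cA; lia|now apply d_oD|].
    intros e i He Hi. rewrite EXe, EYe. apply oD_spec; auto.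
  - pose proof (d_ocmp k X Y Hf Hg) as Hc. remember (fun e => ocmp (X e) (Y e)) as c eqn:Ec.
    apply (Intro (10 + (660 + k)) (fun e i => if c e =? 1 then Y e i else X e i)); [unfold cA, cD; lia|clear Ec; unfold Do; dgo; dnums|].
    intros e i He Hi. rewrite Ec, EXe, EYe, ocmp_spec by auto. unfold cmp.
    destruct (Nat.ltb_spec (f e) (g e)).
    + rewrite Nat.max_r by lia. reflexivity.
    + rewrite Nat.max_l by lia. destruct (g e <? f e); reflexivity.
  - pose proof (d_ocmp k X Y Hf Hg) as Hc. remember (fun e => ocmp (X e) (Y e)) as c eqn:Ec.
    apply (Intro (10 + (660 + k)) (fun e i => if c e =? 1 then X e i else Y e i)); [unfold cA, cD; lia|clear Ec; unfold Do; dgo; dnums|].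
    intros e i He Hi. rewrite Ec, EXe, EYe, ocmp_spec by auto. unfold cmp.
    destruct (Nat.ltb_spec (f e) (g e)).
    + rewrite Nat.min_l by lia. reflexivity.
    + rewrite Nat.min_r by lia. destruct (g e <? f e); reflexivity.
  - apply (Dv_mono (13 + k)); [unfold cA, cD; lia|]. now apply Dv_and.
  - pose proof (Dv_not _ _ (Dv_and _ _ _ (Dv_not k f HF) (Dv_not k g HG))) as H.
    apply (Dv_mono (13 + (13 + (13 + k)))); [unfold cA, cD; lia|].
    destruct H as [H1 H2]. split; auto.
    eapply Df_ext; [|exact H2]. intros e He. cbv beta. f_equal.
    assert (F1 : f (sh 1 e) < 2 ^ nn) by (apply Bf; now apply bde_sh).
    assert (G1 : g (sh 1 e) < 2 ^ nn) by (apply Bg; now apply bde_sh).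
    rewrite (lor_low nn _ _ Hnn F1 G1), (lnot_low nn (f _) F1), (lnot_low nn (g _) G1).
    apply lnot_low. eapply Nat.le_lt_trans; [apply land_le_l|lia].
Qed.

Lemma Dv_ext : forall k f g, (forall e, bde (bd D) e -> f e = g e) -> Dv k f -> Dv k g.
Proof.
  intros k f g E [H1 H2]. split.
  - intros e He. rewrite <- E by auto. auto.
  - eapply Df_ext; [|exact H2]. intros e He. cbv beta. rewrite E; [reflexivity|now apply bde_sh].
Qed.

Lemma blk_shift : forall v p i, blk (v * 2 ^ p) i =
  if p <? b * i then (v / 2 ^ (b * i - p)) mod beta else if p - b * i <? b then (v mod beta * 2 ^ (p - b * i)) mod beta else 0.
Proof.
  intros v p i. unfold blk. rewrite beta_pow. destruct (Nat.ltb_spec p (b * i)) as [H|H].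
  - replace (b * i) with (b * i - p + p) at 1 by lia. rewrite Nat.pow_add_r.
    rewrite Nat.Div0.div_mul_cancel_r by (apply Nat.pow_nonzero; lia). reflexivity.
  - replace p with (p - b * i + b * i) at 1 by lia. rewrite Nat.pow_add_r, Nat.mul_assoc, Nat.div_mul by (apply Nat.pow_nonzero; lia).
    destruct (Nat.ltb_spec (p - b * i) b).
    + symmetry. apply Nat.Div0.mul_mod_idemp_l.
    + unfold beta. replace (p - b * i) with (p - b * i - b + b) by lia. rewrite Nat.pow_add_r, Nat.mul_assoc. apply Nat.Div0.mod_mul.
Qed.

Lemma b_K : b + b <= K.
Proof.
  transitivity (b * (Dd + Dd + 2 * r + 8)); [|exact H_K]. transitivity (b * 2); [lia|]. apply Nat.mul_le_mono_l. lia.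
Qed.

Lemma Dv_shift : forall k v p, Df D (lv k l1) v -> Df D l1 (fun _ => p) ->
  (forall e, bde (bd D) e -> v e * 2 ^ p < 2 ^ nn) -> Dv (63 + k) (fun e => v e * 2 ^ p).
Proof.
  intros k v p Hv Hp Hlt.
  apply (Dv_intro (60 + k) _ (fun e i => if p <? tmul D b i then (v e / texp D (tmul D b i - p)) mod beta else
    if p - tmul D b i <? b then tmul D (v e mod beta) (texp D (p - tmul D b i)) mod beta else 0)); auto.
  - unfold Do. dgo; dnums.
  - intros e i He Hi. pose proof beta_pos as Hbp. pose proof b_K as HbK.
    assert (Hbi : b * i <= nn) by (apply Nat.mul_le_mono_l; lia).
    rewrite tmul_small by (apply (bd_pw b); [lia|fold beta; lia]).
    rewrite blk_shift. destruct (Nat.ltb_spec p (b * i)) as [H|H].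
    + unfold texp. destruct (Nat.ltb_spec (2 ^ (b * i - p)) (bd D)) as [H1|H1]; [reflexivity|].
      rewrite (Nat.div_small (v e) (2 ^ (b * i - p))); [reflexivity|]. pose proof (Df_lt D _ _ _ Hv He). lia.
    + destruct (Nat.ltb_spec (p - b * i) b) as [H1|H1]; [|reflexivity].
      assert (H2 : 2 ^ (p - b * i) < 2 ^ b) by (apply Nat.pow_lt_mono_r; lia).
      rewrite texp_small by (apply (bd_pw b); [lia|exact H2]).
      rewrite tmul_small; [reflexivity|]. apply (bd_pw (b + b)); [lia|]. apply lt_mul_pw; [|exact H2].
      apply Nat.lt_le_incl, Nat.mod_upper_bound. fold beta. lia.
Qed.

(** The shape of the diagonal parameter: short words placed at fixed bit positions of a long one. *)
Definition tsum (ts : list ((env -> nat) * nat)) (e : env) : nat :=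
  fold_right (fun t s => fst t e * 2 ^ snd t + s) 0 ts.

Lemma Dv_tsum : forall ts, Forall (fun t => Df D (lv 1 l1) (fst t) /\ Df D l1 (fun _ => snd t)) ts ->
  (forall e, bde (bd D) e -> tsum ts e < 2 ^ nn) -> Dv (cA * S (length ts)) (tsum ts).
Proof.
  intros ts HF. induction HF as [|t ts [H1 H2] HF IH]; intros Hlt.
  - apply (Dv_mono (13 + 1)); [unfold cA, cD; lia|]. apply Dv_const_small.
    + dgo; dnums.
    + pose proof beta_pos. lia.
    + pose proof (Nat.pow_nonzero 2 nn). lia.
  - cbn [length]. replace (cA * S (S (length ts))) with (cA + cA * S (length ts)) by lia.
    apply (Dv_ext _ (fun e => arith_eval nn Defs.Add (fst t e * 2 ^ snd t) (tsum ts e))).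
    + intros e He. specialize (Hlt e He). cbn [arith_eval]. apply Nat.mod_small. exact Hlt.
    + apply (Dv_arith Defs.Add _ (fun e => fst t e * 2 ^ snd t) (tsum ts)).
      * apply (Dv_mono (63 + 1)); [unfold cA, cD; lia|]. apply Dv_shift; auto.
        intros e He. specialize (Hlt e He). cbn [tsum fold_right] in Hlt. lia.
      * apply IH. intros e He. specialize (Hlt e He). cbn [tsum fold_right] in Hlt. unfold tsum. lia.
Qed.

Lemma Dv_diag : forall Q T ts, is_program Q -> length Q <= T -> T + 32 <= 2 ^ nn ->
  Forall (fun t => Df D (lv 1 l1) (fst t) /\ Df D l1 (fun _ => snd t)) ts ->
  (forall e, bde (bd D) e -> tsum ts e < 2 ^ nn) ->
  cls D (lv (cA * (S (length ts) + T * (4 * T + 160) + 5) + 5) l1) (fun e => result nn Q (tsum ts e) T <> 0).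
Proof.
  intros Q T ts HQ1 HQ2 HT HF Hlt.
  assert (Hn5 : 5 <= nn).
  { pose proof (Nat.pow_le_mono_r 2 5 nn). destruct (Nat.le_gt_cases 5 nn); [assumption|].
    exfalso. assert (2 ^ nn <= 2 ^ 4) by (apply pw; lia). cbn in H1. lia. }
  assert (HR : Dv (cA * (S (length ts) + T * (4 * T + 160) + 5)) (fun e => result nn Q (tsum ts e) T)).
  { apply (Dv_result env nn (fun d f => Dv (cA * d) f)); auto.
    - intros d d' f Hd. apply Dv_mono. apply Nat.mul_le_mono_l. exact Hd.
    - intros o d f g Hf Hg. replace (cA * S d) with (cA + cA * d) by lia. now apply Dv_arith.
    - intros d f g h h' Hf Hg Hh Hh'. replace (cA * S d) with (cA + cA * d) by lia. now apply Dv_ifeq.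
    - now apply Dv_tsum. }
  set (k := cA * (S (length ts) + T * (4 * T + 160) + 5)) in *. clearbody k.
  destruct HR as [_ HR].
  remember (fun e i => blk (result nn Q (tsum ts e) T) i) as X eqn:EX.
  assert (H0 : Dp D (lv (5 + k) l1) (fun e => (X (sh 0 e) 0 =? 0) = true)).
  { clear EX. dgo; dnums. }
  rewrite (Nat.add_comm k 5). eapply d_ext; [apply (d_prf D)| |exact (proj2 H0)].
  intros e _. cbv beta. rewrite EX. change (sh 0 e) with e.
  assert (Hr : result nn Q (tsum ts e) T <= 1).
  { unfold result. destruct (outputs _) as [|v vs]; [lia|]. destruct (v =? 0); lia. }
  rewrite blk_small by (pose proof beta_pos; lia). cbn [Nat.eqb]. rewrite Nat.eqb_eq. tauto.
Qed.

End Blocks.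

(** * Choice of sizes and the diagonal argument *)

(** The number of levels that must collapse: the depth of a run of [Q] on long words, started on a
    parameter with seven fields, hence the 8. *)
Definition depth (T : nat) : nat := lv (cA * (8 + T * (4 * T + 160) + 5) + 5) (lv 100 0).

Lemma pow2_linear : forall x, 5 <= x -> 2 * x + 12 <= 2 ^ x.
Proof. intros x H. induction H as [|x H IH]; [cbn; lia|]. cbn [Nat.pow]. lia. Qed.

Lemma dig_two : forall B n u v, 3 <= n ->
  dig B n (fun i => if i =? 1 then u else if i =? 2 then v else 0) = B * (u + B * v).
Proof.
  intros B n u v Hn. rewrite (dig_zero_tail B 3 n); [cbn; ring|exact Hn|].
  intros i Hi. destruct (Nat.eqb_spec i 1); [lia|]. destruct (Nat.eqb_spec i 2); [lia|reflexivity].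
Qed.

Lemma Lmax_ge : forall T k, k + T + 100 <= Lmax T k.
Proof.
  intros T k. unfold Lmax, K1, lv, S0. assert (T <= T * (4 * T + 160)) by (destruct T; lia). lia.
Qed.

Section Diagonal.

Variables T kmax Lx V E a q : nat.
Variable Q : nat -> program.
Hypothesis Ek : kmax = depth T.
Hypothesis ELx : Lx = Lmax T kmax.
(** [cube V] is [2 ^ (3 * Lx + 24)]. [E] exceeds this exponent by enough to keep below [q] both the
    number of table bits ([a_cube]) and the accumulated growth of the word length over all levels
    ([a_mul]). *)
Hypothesis EV : V = 2 ^ (Lx + 7).
Hypothesis EE : E = 3 * Lx + 40.
Hypothesis Ea : a = 2 ^ (E - 4).
Hypothesis Eq : q = 2 ^ a.

Let m0 := 8 * q ^ 15.
Let n := q ^ 16.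
Let w := 2 ^ (E + 1).
Let s0 := 2 ^ (3 * cube V) + w + 1.

Lemma Lx_big : kmax + T + 100 <= Lx.
Proof. rewrite ELx. apply Lmax_ge. Qed.

Lemma a_cube : 3 * cube V <= a.
Proof.
  assert (Hc : cube V = 2 ^ (3 * Lx + 24)).
  { unfold cube. replace (V + V) with (2 ^ (Lx + 8)).
    - rewrite <- !Nat.pow_add_r. f_equal. lia.
    - rewrite EV. replace (Lx + 8) with (S (Lx + 7)) by lia. apply two_pow_S. }
  rewrite Hc. transitivity (2 ^ (3 * Lx + 26)).
  - replace (3 * Lx + 26) with (S (S (3 * Lx + 24))) by lia. rewrite !two_pow_S. lia.
  - rewrite Ea. apply Nat.pow_le_mono_r; lia.
Qed.

Lemma cube_eq : 128 * cube V = 2 ^ (3 * Lx + 31).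
Proof.
  unfold cube. replace (V + V) with (2 ^ (Lx + 8)).
  - change 128 with (2 ^ 7). rewrite <- !Nat.pow_add_r. f_equal. lia.
  - rewrite EV. replace (Lx + 8) with (S (Lx + 7)) by lia. symmetry. symmetry. apply two_pow_S.
Qed.

Lemma a_mul : 3 + (3 * Lx + 31) * (kmax + 1) <= a.
Proof.
  pose proof Lx_big. pose proof (Nat.pow_gt_lin_r 2 Lx ltac:(lia)) as H1.
  assert (H2 : 3 * Lx + 31 <= 2 ^ 6 * 2 ^ Lx) by (change (2 ^ 6) with 64; lia).
  assert (H3 : (3 * Lx + 31) * (kmax + 1) <= 2 ^ 6 * 2 ^ Lx * 2 ^ Lx) by (apply Nat.mul_le_mono; lia).
  rewrite <- !Nat.pow_add_r in H3.
  assert (H4 : 2 ^ (6 + Lx + Lx) + 3 <= 2 ^ (E - 4)).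
  { transitivity (2 ^ (S (6 + Lx + Lx))); [|apply Nat.pow_le_mono_r; lia]. rewrite two_pow_S.
    pose proof (Nat.pow_le_mono_r 2 2 (6 + Lx + Lx) ltac:(lia) ltac:(lia)) as H5. change (2 ^ 2) with 4 in H5. lia. }
  lia.
Qed.

Lemma q_big : 64 <= q.
Proof.
  rewrite Eq. change 64 with (2 ^ 6). apply Nat.pow_le_mono_r; [lia|]. pose proof a_mul. nia.
Qed.

Lemma q_up : forall k, 64 * q ^ k <= q ^ S k.
Proof. intros k. cbn [Nat.pow]. apply Nat.mul_le_mono_r. apply q_big. Qed.

Lemma q_ge : forall k, q <= q ^ S k.
Proof.
  induction k as [|k IH]; [rewrite Nat.pow_1_r; lia|]. pose proof (q_up (S k)). lia.
Qed.

Lemma q_m0 : q <= m0 /\ 8 * m0 <= n.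
Proof. unfold m0, n. pose proof (q_ge 14). pose proof (q_up 15). lia. Qed.

Lemma T3q : 2 ^ (3 * cube V) <= q.
Proof. rewrite Eq. apply Nat.pow_le_mono_r; [lia|apply a_cube]. Qed.

Lemma n_eq : n = 2 ^ (2 ^ E).
Proof.
  unfold n. rewrite Eq, <- Nat.pow_mul_r. f_equal. rewrite Ea. change 16 with (2 ^ 4). rewrite <- Nat.pow_add_r. f_equal. lia.
Qed.

Lemma n_w : n < 2 ^ w.
Proof. rewrite n_eq. apply Nat.pow_lt_mono_r; [lia|]. unfold w. apply Nat.pow_lt_mono_r; lia. Qed.

Lemma ww_q : w * w + 4 * w <= q /\ w + 1 <= q.
Proof.
  assert (H : w * w + 4 * w <= q).
  { unfold w. rewrite <- Nat.pow_add_r. change 4 with (2 ^ 2). rewrite <- Nat.pow_add_r.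
    transitivity (2 ^ (E + 1 + (E + 1)) + 2 ^ (E + 1 + (E + 1))).
    - apply Nat.add_le_mono_l. apply Nat.pow_le_mono_r; lia.
    - rewrite <- two_pow_S, Eq. apply Nat.pow_le_mono_r; [lia|]. rewrite Ea.
      pose proof (pow2_linear (E - 4) ltac:(lia)). lia. }
  split; [exact H|]. assert (1 <= w) by (unfold w; pose proof (Nat.pow_nonzero 2 (E + 1)); lia). nia.
Qed.

Lemma V_ok : 2 ^ Lmax T kmax + Lmax T kmax + 100 <= V.
Proof.
  rewrite <- ELx, EV, Nat.pow_add_r. change (2 ^ 7) with 128.
  pose proof (Nat.pow_gt_lin_r 2 Lx ltac:(lia)). lia.
Qed.

Lemma cube_pos : 1 <= cube V.
Proof.
  assert (1 <= V) by (rewrite EV; pose proof (Nat.pow_nonzero 2 (Lx + 7)); lia). unfold cube. nia.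
Qed.

Lemma be_bound : forall l, 1 <= be m0 V l <= m0 * (128 * cube V) ^ l.
Proof.
  pose proof cube_pos as Hc. pose proof q_big. pose proof q_m0.
  induction l as [|l IH]; [cbn [be Nat.pow]; lia|].
  assert (E0 : be m0 V (S l) = 16 * (be m0 V l + be m0 V l + 2) * cube V + 2) by (cbn [be]; unfold cube; ring).
  cbn [Nat.pow]. rewrite E0. split; [lia|].
  transitivity (be m0 V l * (128 * cube V)).
  - clear - Hc IH. nia.
  - transitivity (m0 * (128 * cube V) ^ l * (128 * cube V)); [apply Nat.mul_le_mono_r; lia|].
    apply Nat.eq_le_incl. ring.
Qed.

(** The ratio [q / 8] of [n] to [m0] absorbs the growth of all levels, so every machine that is
    consulted has word length at most [n]. *)
Lemma be_n : forall l, l <= kmax + 1 -> be m0 V l <= n.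
Proof.
  intros l Hl. destruct (be_bound l) as [_ H]. eapply Nat.le_trans; [exact H|].
  rewrite cube_eq, <- Nat.pow_mul_r. unfold m0, n.
  assert (H1 : 8 * 2 ^ ((3 * Lx + 31) * l) <= q).
  { replace (8 * 2 ^ ((3 * Lx + 31) * l)) with (2 ^ (3 + (3 * Lx + 31) * l)) by (rewrite Nat.pow_add_r; reflexivity).
    rewrite Eq. apply Nat.pow_le_mono_r; [lia|].
    pose proof a_mul. pose proof (Nat.mul_le_mono_l l (kmax + 1) (3 * Lx + 31) Hl). lia. }
  change (q ^ 16) with (q * q ^ 15). 
  transitivity (8 * 2 ^ ((3 * Lx + 31) * l) * q ^ 15); [apply Nat.eq_le_incl; ring|now apply Nat.mul_le_mono_r].
Qed.

Lemma be_m0_le : forall l, m0 <= be m0 V l.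
Proof.
  induction l as [|l IH]; [cbn [be]; lia|]. pose proof cube_pos as Hc.
  assert (E0 : be m0 V (S l) = 16 * (be m0 V l + be m0 V l + 2) * cube V + 2) by (cbn [be]; unfold cube; ring).
  rewrite E0. clear - IH Hc. nia.
Qed.

Lemma M_n : forall l, l <= kmax -> q <= M m0 V l /\ M m0 V l + M m0 V l + 2 <= n.
Proof.
  intros l Hl. pose proof (be_n (S l) ltac:(lia)) as H1.
  replace (be m0 V (S l)) with (M m0 V l + M m0 V l + 2) in H1 by (unfold M; cbn [be]; lia). split; [|exact H1].
  destruct (be_bound l) as [Hb _]. pose proof q_m0.
  pose proof (be_m0_le l) as Hm.
  pose proof cube_pos as Hc. unfold M. fold (cube V) in *.
  assert (E1 : 8 * ((be m0 V l + be m0 V l + 2) * (V + V) * (V + V) * (V + V)) = 8 * ((be m0 V l + be m0 V l + 2) * cube V)) by (unfold cube; ring).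
  rewrite E1. clear - Hm Hc H. nia.
Qed.

Lemma adm : admissible n (be m0 V kmax) V.
Proof.
  pose proof cube_pos as Hc. pose proof T3q as H3. pose proof q_big. pose proof q_m0. destruct (be_bound kmax) as [Hb _].
  destruct (M_n kmax (le_n _)) as [M1 M2]. pose proof (be_m0_le) as Hm.
  assert (H8 : 8 * ((be m0 V kmax + be m0 V kmax + 2) * (V + V) * (V + V) * (V + V)) <= n) by (unfold M in M2; lia).
  split.
  - rewrite EV. pose proof (Nat.pow_nonzero 2 (Lx + 7)). lia.
  - pose proof a_cube. pose proof (Nat.pow_gt_lin_r 2 a ltac:(lia)). rewrite <- Eq in H2. specialize (Hm kmax). lia.
  - apply Nat.div_le_lower_bound; [lia|exact H8].
  - apply Nat.div_le_lower_bound; [lia|]. unfold n. pose proof (q_ge 14). pose proof (q_up 15). lia.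
  - unfold n. pose proof (q_ge 15). lia.
Qed.

Lemma sz_ok : sz s0 (S kmax) <= m0.
Proof.
  unfold sz. pose proof a_mul as H1. pose proof T3q. destruct ww_q as [_ H2]. pose proof q_big.
  assert (H3 : 13 ^ S kmax <= q).
  { transitivity (16 ^ S kmax); [apply Nat.pow_le_mono_l; lia|]. change 16 with (2 ^ 4). rewrite <- Nat.pow_mul_r, Eq.
    apply Nat.pow_le_mono_r; [lia|]. nia. }
  transitivity (q * (2 * q)); [apply Nat.mul_le_mono; [exact H3|unfold s0; lia]|].
  unfold m0. pose proof (q_up 2). pose proof (q_ge 12). 
  replace (q * (2 * q)) with (2 * q ^ 2) by (cbn [Nat.pow]; ring).
  assert (q ^ 2 <= q ^ 15) by (apply Nat.pow_le_mono_r; lia). lia.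
Qed.

Hypothesis HQ : forall m, q <= m -> m <= n -> is_program (Q m) /\ length (Q m) <= T /\
  forall x, x < 2 ^ m -> (Win m x <-> result m (Q m) x T = 0).

(** The predicate says that [Q n] rejects the parameter with table [e 1], advice [e 2] and these
    same two words as environment. After the collapse it is itself given by a table [Tb] and an
    advice [adv]; for [e 1 = Tb] and [e 2 = adv] the parameter asks about its own rejection. *)
Lemma no_collapse : False.
Proof.
  pose proof q_big as Hq. pose proof q_m0 as [Hqm Hmn]. pose proof Lx_big as HLx. pose proof T3q as H3.
  destruct ww_q as [Hww Hwq]. pose proof n_w as Hnw.
  assert (Hw1 : 3 <= w).
  { unfold w. change 3 with (2 ^ 2 - 1). pose proof (Nat.pow_le_mono_r 2 2 (E + 1) ltac:(lia) ltac:(lia)). lia. }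
  assert (HwE : 3 * cube V <= q) by (pose proof (Nat.pow_gt_lin_r 2 (3 * cube V) ltac:(lia)); lia).
  assert (B3 : 2 ^ (3 * cube V) <= m0) by lia.
  assert (B4 : w * w + 4 * w <= m0) by lia.
  assert (B5 : forall l, l <= kmax -> be m0 V (S l) <= 2 ^ w - 1) by (intros l Hl; pose proof (be_n (S l) ltac:(lia)); lia).
  pose proof sz_ok as B6.
  assert (B7 : w + 1 <= s0) by (unfold s0; lia).
  assert (B8 : 2 ^ (3 * cube V) <= s0) by (unfold s0; lia).
  assert (HTq : T + 100 <= q).
  { pose proof a_mul. pose proof (Nat.pow_gt_lin_r 2 a ltac:(lia)). rewrite <- Eq in H0. nia. }
  assert (B9 : T + 32 <= m0) by lia.
  assert (B10 : forall l, l <= kmax -> is_program (Q (M m0 V l)) /\ length (Q (M m0 V l)) <= T /\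
    forall x, x < 2 ^ M m0 V l -> (Win (M m0 V l) x <-> result (M m0 V l) (Q (M m0 V l)) x T = 0)).
  { intros l Hl. destruct (M_n l Hl). apply HQ; lia. }
  assert (HD0 : exists D : dclass, bd D = 2 ^ m0 /\ cls D = Def kmax m0 V s0 /\ csts D = (fun c => c < 2 ^ s0)).
  { exists (Level T kmax m0 V w s0 Q V_ok B3 Hw1 B4 B5 B6 B7 B8 B9 B10). auto. }
  destruct HD0 as (D & Hbd & Hcls & Hcst).
  assert (Hs0 : forall c, c <= n -> c < 2 ^ s0).
  { intros c Hc. pose proof (Nat.pow_le_mono_r 2 w s0 ltac:(lia) ltac:(lia)). lia. }
  assert (Hwm : w <= m0) by lia.
  assert (Hcm : forall c, c <= n -> c < bd D).
  { intros c Hc. rewrite Hbd. pose proof (Nat.pow_le_mono_r 2 w m0 ltac:(lia) Hwm). lia. }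
  assert (C0 : forall c, c < 2 ^ s0 -> c < bd D -> Df D 0 (fun _ => c)).
  { intros c H1 H2. apply Df_cst; [rewrite Hcst; exact H1|exact H2]. }
  assert (Cn : forall c, c <= n -> Df D 0 (fun _ => c)) by (intros c Hc; apply C0; auto).
  assert (Dw : Df D 0 (fun _ => w)) by (apply Cn; lia).
  assert (Du : Df D 0 (fun _ => 2 ^ w)).
  { apply C0; [apply Nat.pow_lt_mono_r; lia|]. rewrite Hbd. apply Nat.pow_lt_mono_r; lia. }
  assert (HB1 : bd D <= 2 ^ (w * (2 ^ w - 1))).
  { rewrite Hbd. apply Nat.pow_le_mono_r; [lia|]. transitivity (1 * (2 ^ w - 1)); [lia|]. apply Nat.mul_le_mono_r. lia. }
  assert (HB2 : 2 ^ (w * w + 4 * w) <= bd D) by (rewrite Hbd; apply Nat.pow_le_mono_r; lia).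
  assert (Cx : forall c, c < m0 -> Df D (lv 14 0) (fun _ => 2 ^ c)).
  { intros c Hc. apply (dexp D w Hw1 HB1 HB2 0 Dw Du 0 0 (fun _ => c)); [lia|apply Cn; lia|].
    intros e _. rewrite Hbd. apply Nat.pow_lt_mono_r; lia. }
  set (l1 := lv 100 0).
  assert (U0 : forall f, Df D 0 f -> Df D l1 f) by (intros f H; eapply Df_mono; [|exact H]; lia).
  assert (U14 : forall f, Df D (lv 14 0) f -> Df D l1 f) by (intros f H; eapply Df_mono; [|exact H]; unfold l1, lv; lia).
  assert (Cp1 : forall c d, c < m0 -> d <= n -> 2 ^ c + d < 2 ^ m0 -> Df D l1 (fun _ => 2 ^ c + d)).
  { intros c d Hc Hd Hcd. eapply Df_mono; [|apply (dadd D 14 0 (fun _ => 2 ^ c) (fun _ => d))].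
    - unfold l1, lv; lia.
    - now apply Cx.
    - eapply dleaf; [apply Cn; exact Hd|lia].
    - intros e _. rewrite Hbd. exact Hcd. }
  assert (HDc : counting D w m0 l1).
  { split; auto.
    - intros l P HP. rewrite Hcls in HP |- *. exact (Def_not T kmax m0 V w s0 Q V_ok B3 Hw1 B4 B5 B6 B7 B8 B9 B10 l P HP).
    - apply U0, Cn. lia.
    - rewrite Hbd.
      assert (Em : 2 ^ m0 - 1 = 2 ^ (m0 - 1) + (2 ^ (m0 - 1) - 1)).
      { replace m0 with (S (m0 - 1)) at 1 by lia. rewrite two_pow_S. pose proof (Nat.pow_nonzero 2 (m0 - 1)). lia. }
      rewrite Em. eapply Df_mono; [|apply (dadd D 15 0 (fun _ => 2 ^ (m0 - 1)) (fun _ => 2 ^ (m0 - 1) - 1))].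
      + unfold l1, lv; lia.
      + eapply Df_mono; [|apply Cx; lia]. unfold lv; lia.
      + apply (dsub D 14 0 (fun _ => 2 ^ (m0 - 1)) (fun _ => 1)); [apply Cx; lia|].
        eapply dleaf; [apply Cn; lia|lia].
      + intros e _. rewrite <- Em, Hbd. pose proof (Nat.pow_nonzero 2 m0). lia. }
  pose proof (q_up 0) as U_0. pose proof (q_up 1) as U_1. pose proof (q_up 2) as U_2. pose proof (q_up 3) as U_3.
  pose proof (q_up 4) as U_4. pose proof (q_up 5) as U_5. pose proof (q_up 6) as U_6. pose proof (q_up 7) as U_7.
  pose proof (q_up 8) as U_8. pose proof (q_up 9) as U_9. pose proof (q_up 10) as U_10. pose proof (q_up 11) as U_11.
  pose proof (q_up 12) as U_12. pose proof (q_up 13) as U_13. pose proof (q_up 14) as U_14. pose proof (q_up 15) as U_15.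
  rewrite Nat.pow_0_r, Nat.pow_1_r in U_0. rewrite Nat.pow_1_r in U_1.
  assert (Hn16 : n = q ^ 16) by reflexivity. assert (Hm15 : m0 = 8 * q ^ 15) by reflexivity.
  assert (Ebl : q ^ 10 * q ^ 6 = n) by (unfold n; rewrite <- Nat.pow_add_r; reflexivity).
  set (fp := n / 8). set (st := stride (be m0 V kmax) V).
  set (bk := be m0 V kmax). set (pb := Pb s0 kmax).
  pose proof adm as Hadm. fold bk in Hadm.
  assert (Hst : st * V <= fp).
  { destruct Hadm as [_ _ Han _ _]. fold fp in Han. unfold st, stride. fold bk.
    eapply Nat.le_trans; [|exact Han]. transitivity ((bk + bk + 2) * (V + V) * (V + V) * (V + V)); [|lia].
    apply Nat.mul_le_mono_l. lia. }
  assert (HV1 : 100 <= V) by (pose proof V_ok; lia).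
  assert (Hfp : 8 * fp <= n) by (unfold fp; apply Nat.Div0.mul_div_le).
  assert (Hst5 : 5 * st <= fp).
  { eapply Nat.le_trans; [|exact Hst]. rewrite Nat.mul_comm. apply Nat.mul_le_mono_l. lia. }
  assert (Hbkm : m0 <= bk) by (apply be_m0_le).
  assert (Hstm : m0 <= st).
  { unfold st, stride. fold bk. transitivity ((bk + bk + 2) * 1 * 1); [lia|].
    apply Nat.mul_le_mono; [apply Nat.mul_le_mono_l|]; lia. }
  assert (Hpb : Df D l1 (fun _ => pb) /\ pb < 2 ^ m0).
  { unfold pb. destruct kmax as [|k'] eqn:Ekk.
    - unfold Pb. split; [apply U0, Cn; lia|]. pose proof (Nat.pow_nonzero 2 m0). lia.
    - unfold Pb. assert (Hz : sz s0 k' < m0).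
      { eapply Nat.lt_le_trans; [|exact B6]. unfold sz. rewrite !Nat.pow_succ_r'. pose proof (Nat.pow_nonzero 13 k' ltac:(lia)).
        assert (1 <= s0) by lia. clear - H H0. nia. }
      split; [apply U14, Cx; exact Hz|apply Nat.pow_lt_mono_r; lia]. }
  destruct Hpb as [Dpb Hpb].
  (* The fields of [encode] by bit position. [e 1] and [e 2] occur twice: as table and advice, and
     in slots 1 and 2 of the encoded environment, which follow the two constants and the empty slot
     0. *)
  set (ts := [((fun _ : env => bk), 0); ((fun _ : env => V), fp); ((fun e : env => e 1), 2 * fp); ((fun e : env => e 2), 3 * fp);
    ((fun _ : env => pb), 3 * fp + st); ((fun e : env => e 1), 3 * fp + 3 * st); ((fun e : env => e 2), 3 * fp + 4 * st)]).
  set (star := fun (e : env) (i : nat) => if i =? 1 then e 1 else if i =? 2 then e 2 else 0).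
  assert (Hk3 : 3 <= S0 + kmax) by (unfold S0; lia).
  assert (Hk2 : 2 + (S0 + kmax) <= V).
  { pose proof V_ok as HV0. rewrite <- ELx in HV0. unfold S0. lia. }
  assert (Ets : forall e, tsum ts e = encode n bk V (e 1) (dig (2 ^ st) V (inputs_of [e 2; pb] (S0 + kmax) (star e)))).
  { intros e. rewrite inputs_dig by exact Hk2. unfold star. rewrite dig_two by exact Hk3.
    unfold encode, tsum, ts. cbv zeta. fold fp. cbn [fold_right fst snd].
    replace (2 ^ (2 * fp)) with (2 ^ fp * 2 ^ fp) by (rewrite <- Nat.pow_add_r; f_equal; lia).
    replace (2 ^ (3 * fp)) with (2 ^ fp * 2 ^ fp * 2 ^ fp) by (rewrite <- !Nat.pow_add_r; f_equal; lia).
    replace (2 ^ (3 * fp + st)) with (2 ^ fp * 2 ^ fp * 2 ^ fp * 2 ^ st) by (rewrite <- !Nat.pow_add_r; f_equal; lia).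
    replace (2 ^ (3 * fp + 3 * st)) with (2 ^ fp * 2 ^ fp * 2 ^ fp * 2 ^ st * 2 ^ st * 2 ^ st) by (rewrite <- !Nat.pow_add_r; f_equal; lia).
    replace (2 ^ (3 * fp + 4 * st)) with (2 ^ fp * 2 ^ fp * 2 ^ fp * 2 ^ st * 2 ^ st * 2 ^ st * 2 ^ st) by (rewrite <- !Nat.pow_add_r; f_equal; lia).
    rewrite Nat.pow_0_r. generalize (2 ^ fp) as F, (2 ^ st) as W. intros F W. ring. }
  assert (Hstar : forall e, bde (2 ^ m0) e -> bde (2 ^ m0) (star e)).
  { intros e He i. unfold star. destruct (i =? 1); [apply He|]. destruct (i =? 2); [apply He|].
    pose proof (Nat.pow_nonzero 2 m0). lia. }
  assert (Hfm : m0 <= fp) by (unfold fp; apply Nat.div_le_lower_bound; lia).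
  assert (Hlt : forall e, bde (bd D) e -> tsum ts e < 2 ^ n).
  { intros e He. rewrite Hbd in He. rewrite Ets. apply encode_lt; [exact Hadm| |].
    - fold fp. eapply Nat.lt_le_trans; [apply He|]. apply Nat.pow_le_mono_r; lia.
    - fold fp. eapply Nat.lt_le_trans; [apply dig_bound|rewrite <- Nat.pow_mul_r; apply Nat.pow_le_mono_r; [lia|exact Hst]].
      intros p _. eapply Nat.lt_le_trans; [|apply (Nat.pow_le_mono_r 2 m0 st); lia].
      apply inputs_of_lt; [pose proof (Nat.pow_nonzero 2 m0); lia|repeat constructor; [apply He|exact Hpb]|auto]. }
  assert (Hbkn : bk <= n) by (apply be_n; lia).
  assert (HVn : V <= n) by (clear - Hst Hfp Hstm Hqm Hq; nia).
  destruct (HQ n ltac:(lia) (le_n n)) as (Q1 & Q2 & Q3).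
  assert (HTn : T + 32 <= 2 ^ n) by (pose proof (Nat.pow_gt_lin_r 2 n ltac:(lia)); lia).
  assert (Hu0 : q ^ 10 = 2 ^ S (10 * a - 1)).
  { rewrite Eq, <- Nat.pow_mul_r. f_equal. pose proof a_mul. lia. }
  assert (Hbig : q ^ 10 < 2 ^ (q ^ 10)) by (apply Nat.pow_gt_lin_r; lia).
  assert (Hna : n < 2 ^ (q ^ 10)).
  { unfold n. rewrite Eq at 1. rewrite <- Nat.pow_mul_r. apply Nat.pow_lt_mono_r; [lia|].
    pose proof (Nat.pow_gt_lin_r 2 a ltac:(lia)) as Hl. rewrite <- Eq in Hl. lia. }
  (* Sizes: [q ^ 6] blocks of [q ^ 10] bits; precision [q ^ 3] and [2 * q ^ 3] terms give about
     [2 * q ^ 6] correct digits; the numerator has degree about [4 * q ^ 9], below the transform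
     length [q ^ 10]; its coefficients take at most about [6 * q ^ 13] bits, below [K = q ^ 14]. *)
  pose proof (fun _ : True => Dv_diag D w m0 l1 q (q ^ 14) (q ^ 10) (q ^ 6) (q ^ 10) (q ^ 3) (2 * q ^ 3) (2 * q ^ 4) (10 * a - 1) HDc
    (U0 _ (Cn q ltac:(lia))) (U0 _ (Cn (q ^ 10) ltac:(lia))) (U0 _ (Cn (q ^ 6) ltac:(lia))) (U0 _ (Cn (q ^ 6 + 2) ltac:(lia)))
    (U0 _ (Cn (q ^ 10) ltac:(lia))) (U14 _ (Cx (q ^ 10) ltac:(lia)))) as DD.
  assert (R1 : 2 ^ (q ^ 14) + 1 < 2 ^ m0).
  { transitivity (2 ^ S (q ^ 14)); [|apply Nat.pow_lt_mono_r; lia]. rewrite two_pow_S.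
    pose proof (Nat.pow_gt_lin_r 2 (q ^ 14) ltac:(lia)). lia. }
  assert (P103 : q ^ 10 * q ^ 3 = q ^ 13) by (rewrite <- Nat.pow_add_r; reflexivity).
  assert (P36 : q ^ 3 * q ^ 6 = q ^ 9) by (rewrite <- Nat.pow_add_r; reflexivity).
  assert (P33 : q ^ 3 * q ^ 3 = q ^ 6) by (rewrite <- Nat.pow_add_r; reflexivity).
  assert (P410 : q ^ 4 * q ^ 10 = q ^ 14) by (rewrite <- Nat.pow_add_r; reflexivity).
  assert (P141 : q ^ 14 * q = q ^ 15) by (rewrite Nat.mul_comm; reflexivity).
  assert (R2 : Df D l1 (fun _ => (2 ^ (q ^ 10)) ^ (2 * q ^ 3))).
  { rewrite <- Nat.pow_mul_r. apply U14, Cx. replace (q ^ 10 * (2 * q ^ 3)) with (2 * q ^ 13) by lia. lia. }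
  assert (R3 : 2 * q ^ 4 * 2 ^ (10 * a - 1) = q ^ 14).
  { transitivity (q ^ 4 * q ^ 10); [|lia]. rewrite Hu0, two_pow_S. generalize (q ^ 4) as x, (2 ^ (10 * a - 1)) as y. clear. intros x y. lia. }
  assert (R4 : (q ^ 14 + 2) * (q + 1) < m0).
  { replace ((q ^ 14 + 2) * (q + 1)) with (q ^ 15 + q ^ 14 + 2 * q + 2) by lia. lia. }
  assert (R5 : q ^ 6 + (2 * q ^ 3 * (q ^ 6 + 2 + (q ^ 3 + q ^ 6)) + 1) + 2 <= q ^ 10).
  { replace (2 * q ^ 3 * (q ^ 6 + 2 + (q ^ 3 + q ^ 6))) with (4 * q ^ 9 + 4 * q ^ 3 + 2 * q ^ 6) by lia. lia. }
  assert (R6 : q ^ 10 * (q ^ 3 + q ^ 3 + 2 * (2 * q ^ 3) + 8) <= q ^ 14).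
  { replace (q ^ 10 * (q ^ 3 + q ^ 3 + 2 * (2 * q ^ 3) + 8)) with (6 * q ^ 13 + 8 * q ^ 10) by lia. lia. }
  assert (R7 : q ^ 6 + 1 <= (q ^ 3 - 2) * (2 * q ^ 3)).
  { rewrite Nat.mul_sub_distr_r. replace (q ^ 3 * (2 * q ^ 3)) with (2 * q ^ 6) by lia. lia. }
  pose proof (fun t : True => DD t (Cp1 (q ^ 14) 1 ltac:(lia) ltac:(lia) R1)) as DD1.
  pose proof (fun t : True => DD1 t (U0 _ (Cn (q ^ 14 + 2) ltac:(lia))) (U0 _ (Cn (q ^ 3) ltac:(lia))) (U0 _ (Cn (2 * q ^ 3) ltac:(lia)))
    (U0 _ (Cn (2 * q ^ 4) ltac:(lia))) R2 (U14 _ (Cx (2 * q ^ 14 - S (10 * a - 1)) ltac:(lia))) eq_refl Hu0 R3 R4 ltac:(lia) ltac:(lia) ltac:(lia) R5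
    ltac:(lia) ltac:(lia) R6 ltac:(lia) R7) as DD2.
  rewrite Ebl in DD2.
  pose proof (DD2 I Hna (U0 _ (Cn n (le_n n))) (Q n) T ts Q1 Q2 HTn) as DD3.
  assert (HF : Forall (fun t => Df D (lv 1 l1) (fst t) /\ Df D l1 (fun _ => snd t)) ts).
  { assert (Lf : forall f, Df D l1 f -> Df D (lv 1 l1) f) by (intros f H; eapply dleaf; [exact H|lia]).
    unfold ts.
    repeat (apply Forall_cons; [split; cbn [fst snd]|]); [..|apply Forall_nil];
      first [apply U0, Cn; lia | apply Lf, U0, Cn; lia | apply Lf; exact Dpb | apply dvar; lia]. }
  specialize (DD3 HF Hlt). rewrite Hcls in DD3. change (S (length ts)) with 8 in DD3.
  replace (lv (cA * (8 + T * (4 * T + 160) + 5) + 5) l1) with kmax in DD3 by (rewrite Ek; reflexivity).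
  destruct (Def_Win T kmax m0 V w s0 V_ok B3 Hw1 B4 B6 B7 B8 B9 kmax _ n DD3 (le_n _) Hadm) as (Tb & adv & HTb & Hadv & HW).
  set (e := fun i => if i =? 1 then Tb else if i =? 2 then adv else 0).
  assert (He : bde (2 ^ m0) e).
  { intros i. unfold e. pose proof (Nat.pow_le_mono_r 2 _ _ ltac:(lia) B3) as P1.
    assert (P2 : sz s0 kmax <= m0).
    { eapply Nat.le_trans; [|exact B6]. unfold sz. apply Nat.mul_le_mono_r. apply Nat.pow_le_mono_r; lia. }
    pose proof (Nat.pow_le_mono_r 2 _ _ ltac:(lia) P2) as P3. pose proof (Nat.pow_nonzero 2 m0 ltac:(lia)).
    destruct (i =? 1); [lia|]. destruct (i =? 2); lia. }
  specialize (HW e He).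
  pose proof (Ets e) as Ee. change (e 1) with Tb in Ee. change (e 2) with adv in Ee.
  replace (star e) with e in Ee by (extensionality i; unfold star, e; destruct (Nat.eqb_spec i 1) as [->|]; [reflexivity|];
    destruct (Nat.eqb_spec i 2) as [->|]; reflexivity).
  assert (HW' : result n (Q n) (tsum ts e) T <> 0 <-> Win n (tsum ts e)) by (rewrite Ee at 2; exact HW). clear HW.
  specialize (Hlt e ltac:(rewrite Hbd; exact He)). specialize (Q3 _ Hlt). tauto.
Qed.

End Diagonal.

(** * From the sizes to iterated logarithms *)

(** The exponent [E] in [n = 2 ^ (2 ^ E)] of the diagonal argument. *)
Definition tower (T : nat) : nat := 3 * Lmax T (depth T) + 40.

Lemma tower_quadratic : exists C, 1 <= C /\ forall T, 1 <= T -> tower T <= C * (T * T).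
Proof.
  (* The depth is affine in [X = T * (4 * T + 160)]. [cA] is generalised to a variable so that the
     arithmetic stays symbolic. *)
  assert (H : forall c, exists A B, forall X, 3 * (30 * (22 * (3 * (20 + (30 * (c * (8 + X + 5) + 5) + (30 * 100 + 0))) +
     (20 + (30 * (c * (8 + X + 5) + 5) + (30 * 100 + 0)) + 10) + 20 + X + 5) + 2) + (30 * 60 + 0) + 2) + 40 = A * X + B).
  { intros c. exists (3 * (30 * (22 * (3 * (30 * c) + 30 * c + 1)))).
    exists (3 * (30 * (22 * (3 * (20 + (30 * (c * (8 + 0 + 5) + 5) + (30 * 100 + 0))) +
     (20 + (30 * (c * (8 + 0 + 5) + 5) + (30 * 100 + 0)) + 10) + 20 + 0 + 5) + 2) + (30 * 60 + 0) + 2) + 40).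
    intros X. lia. }
  destruct (H cA) as (A & B & HAB). exists (164 * A + B + 1). split; [lia|]. intros T HT.
  assert (E : tower T = A * (T * (4 * T + 160)) + B).
  { rewrite <- HAB. reflexivity. }
  rewrite E. assert (H1 : T * (4 * T + 160) <= 164 * (T * T)) by nia.
  assert (H2 : A * (T * (4 * T + 160)) <= A * (164 * (T * T))) by now apply Nat.mul_le_mono_l.
  assert (H3 : B * 1 <= B * (T * T)) by (apply Nat.mul_le_mono_l; nia). lia.
Qed.

Lemma ln2_pos : (0 < ln 2)%R.
Proof. rewrite <- ln_1. apply ln_increasing; lra. Qed.

Lemma lg_mono : forall x y, (0 < x <= y)%R -> (lg x <= lg y)%R.
Proof.
  intros x y [Hx Hy]. unfold lg, Rdiv. apply Rmult_le_compat_r; [left; apply Rinv_0_lt_compat, ln2_pos|].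
  destruct Hy as [Hy|Hy]; [left; now apply ln_increasing|right; now rewrite Hy].
Qed.

Lemma lg_pow2 : forall k, lg (INR (2 ^ k)) = INR k.
Proof.
  intros k. rewrite pow_INR. unfold lg. change (INR 2) with 2%R. rewrite ln_pow by lra. pose proof ln2_pos. field. lra.
Qed.

(** From 16 on the triple logarithm is at least 1, and the square root of [E] is at most [C * T], so
    the factor [1 / C] brings the bound down to [T]. *)
Lemma growth_le : forall C T E m, 1 <= C -> E <= C * (T * T) -> 16 <= m -> m <= 2 ^ (2 ^ E) ->
  (growth (/ INR C) m <= INR T)%R.
Proof.
  intros C T E m HC HE Hm1 Hm2. unfold growth.
  assert (HC' : (1 <= INR C)%R) by (change 1%R with (INR 1); now apply le_INR).
  assert (G1 : (4 <= lg (INR m))%R).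
  { replace 4%R with (lg (INR (2 ^ 4))) by (rewrite lg_pow2; cbn; lra). apply lg_mono. split; [apply lt_0_INR; cbn; lia|now apply le_INR]. }
  assert (G2 : (2 <= lg (lg (INR m)))%R).
  { replace 2%R with (lg (INR (2 ^ 2))) by (rewrite lg_pow2; cbn; lra). apply lg_mono. cbn [Nat.pow]. cbn [Nat.mul Nat.add].
    split; [apply lt_0_INR; lia|]. replace (INR 4) with 4%R by (cbn; lra). exact G1. }
  assert (G3 : (1 <= lg (lg (lg (INR m))))%R).
  { replace 1%R with (lg (INR (2 ^ 1))) by (rewrite lg_pow2; cbn; lra). apply lg_mono.
    split; [apply lt_0_INR; cbn; lia|]. replace (INR (2 ^ 1)) with 2%R by (cbn; lra). exact G2. }
  assert (G4 : (lg (lg (INR m)) <= INR E)%R).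
  { rewrite <- (lg_pow2 E). apply lg_mono. split; [lra|]. rewrite <- (lg_pow2 (2 ^ E)). apply lg_mono.
    split; [apply lt_0_INR; lia|now apply le_INR]. }
  assert (G5 : (sqrt (lg (lg (INR m))) <= INR C * INR T)%R).
  { rewrite <- (sqrt_square (INR C * INR T)) by (apply Rmult_le_pos; apply pos_INR).
    apply sqrt_le_1_alt. eapply Rle_trans; [exact G4|]. eapply Rle_trans; [apply le_INR; exact HE|].
    rewrite !mult_INR. pose proof (pos_INR T). nra. }
  pose proof (sqrt_pos (lg (lg (INR m)))) as G6.
  assert (G7 : (/ lg (lg (lg (INR m))) <= 1)%R) by (rewrite <- Rinv_1; apply Rinv_le_contravar; lra).
  assert (G8 : (0 < / lg (lg (lg (INR m))))%R) by (apply Rinv_0_lt_compat; lra).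
  assert (G9 : (/ INR C * sqrt (lg (lg (INR m))) <= INR T)%R).
  { apply (Rmult_le_reg_l (INR C)); [lra|]. rewrite <- Rmult_assoc, Rinv_r by lra. lra. }
  assert (G10 : (0 <= / INR C * sqrt (lg (lg (INR m))))%R).
  { apply Rmult_le_pos; [left; apply Rinv_0_lt_compat; lra|exact G6]. }
  nra.
Qed.

Lemma result_spec : forall m Qm x v t T, (v = 0 \/ v = 1) -> outputs_within m Qm [x] v t -> t <= T ->
  (has_output m Qm [x] 0 <-> result m Qm x T = 0).
Proof.
  intros m Qm x v t T Hv Ht HtT. pose proof (outputs_within_mono _ _ _ _ _ _ HtT Ht) as HT.
  unfold result. unfold outputs_within in HT. destruct (outputs (run m Qm [x] T)) as [|v' vs] eqn:E; [discriminate|].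
  cbn in HT. injection HT as ->. split.
  - intros [t' H']. rewrite <- (outputs_within_fun _ _ _ _ _ _ _ H' Ht). reflexivity.
  - intros H. destruct (Nat.eqb_spec v 0) as [->|]; [|discriminate]. now exists t.
Qed.

Theorem theorem2 :
  exists (eps : R) (c : nat) (P : program),
    (0 < eps)%R /\ 0 < c /\ is_test c 2 P /\
    (forall n, 10 < n -> exists t, is_time_requirement n 2 P t /\ t <= c) /\
    forall Q : nat -> program,
      unary_test_family Q (growth eps) (growth eps) ->
      forall m, exists n, m < n /\
        exists a, a < 2 ^ n /\
          ~ ((exists x, x < 2 ^ n /\ has_output n P [x; a] 0)
             <-> has_output n (Q n) [a] 0).
Proof.
  destruct tower_quadratic as (C & HC & HCT).
  exists (/ INR C)%R, (lim verifier), P.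
  assert (Htest : is_test (lim verifier) 2 P) by (apply prog_is_test; [apply verifier_wf|apply verifier_len|apply pval_le]).
  split; [apply Rinv_0_lt_compat; apply lt_0_INR; lia|].
  split; [destruct Htest as (_ & _ & H & _); lia|]. split; [exact Htest|].
  split; [apply prog_time; [apply verifier_wf|apply verifier_len]|].
  intros Q [n0 HQ] m. apply NNPP. intros HN.
  (* If the claim fails, [Q n] decides [Win n] for all [n > m]. [T] is chosen so that every word
     length from [q] on exceeds [m], [n0] and 16. *)
  set (T := m + n0 + 16). set (q := 2 ^ 2 ^ (tower T - 4)).
  assert (Hq : m + n0 + 16 < q).
  { unfold q. apply (Nat.lt_trans _ (2 ^ (tower T - 4))); [|apply Nat.pow_gt_lin_r; lia].
    apply (Nat.le_lt_trans _ (tower T - 4)); [|apply Nat.pow_gt_lin_r; lia].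
    pose proof (Lmax_ge T (depth T)) as HL. assert (ET : T = m + n0 + 16) by reflexivity. unfold tower. lia. }
  assert (HT : 1 <= T) by (unfold T; lia).
  refine (no_collapse T (depth T) (Lmax T (depth T)) (2 ^ (Lmax T (depth T) + 7)) (tower T) (2 ^ (tower T - 4)) q Q
    eq_refl eq_refl eq_refl eq_refl eq_refl eq_refl _).
  assert (En : q ^ 16 = 2 ^ (2 ^ tower T)).
  { unfold q. rewrite <- Nat.pow_mul_r. f_equal. replace (tower T) with (tower T - 4 + 4) at 2 by (unfold tower; lia).
    rewrite Nat.pow_add_r. reflexivity. }
  intros k Hk1 Hk2. rewrite En in Hk2.
  assert (HG : (growth (/ INR C) k <= INR T)%R) by (apply (growth_le C T (tower T)); auto; lia).
  destruct (HQ k ltac:(lia)) as (P1 & P2 & P3).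
  split; [exact P1|]. split; [apply INR_le; eapply Rle_trans; eassumption|].
  intros x Hx. destruct (P3 x Hx) as (v & t & Hv & Ht & Htg).
  rewrite <- (result_spec k (Q k) x v t T Hv Ht) by (apply INR_le; eapply Rle_trans; eassumption).
  apply NNPP. intros H. apply HN. exists k. split; [lia|]. exists x. split; [exact Hx|exact H].
Qed.
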